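(* Let $d=4$ (so $W$ is of type $B_2$, $\mathbb{C}[\mathcal{C}]=\mathbb{C}[A,B]$). The $\mathbb{C}[A,B]$-algebra $\mathbb{C}[\mathcal{Z}^{\mu_4}]$ admits the following presentation: generators $r,R,\mathbf{eu},\mathbf{a}_2$; relations $$\begin{aligned} &\mathbf{eu}\,(\mathbf{a}_2+2(A^2-B^2))=0,\qquad r\,(\mathbf{a}_2+2(A^2-B^2))=0,\qquad R\,(\mathbf{a}_2+2(A^2-B^2))=0,\\ &(\mathbf{a}_2-2(A^2-B^2))(\mathbf{a}_2+2(A^2-B^2))=0,\\ &(\mathbf{eu}-2(A+B))(\mathbf{eu}+2(A+B))(\mathbf{eu}-2(A-B))(\mathbf{eu}+2(A-B))=rR+4(A^2-B^2)(\mathbf{a}_2+2(A^2-B^2)). \end{aligned}$$ In particular, for $c\in\mathcal{C}$ with $a=c_s$, $b=c_t$: (a) If $a^2=b^2$, then $\mathcal{Z}_c^{\mu_4}$ is irreducible and is equal to $\{(e,u,v)\in\mathbb{C}^3\mid(e-4a)(e+4a)e^2=uv\}$. (b) If $a^2\ne b^2$, then $\mathcal{Z}_c^{\mu_4}$ has two irreducible components: (b1) the one of maximal dimension, which is equal to $$\{(e,u,v)\in\mathbb{C}^3\mid(e-2(a+b))(e+2(a+b))(e-2(a-b))(e+2(a-b))=uv\},$$ and which contains $z_{\mathbf 1}$, $z_\varepsilon$, $z_{\varepsilon_s}$ and $z_{\varepsilon_t}$; (b2) an isolated point (corresponding to the maximal ideal $\langle r,R,\mathbf{eu},\mathbf{a}_2-2(a^2-b^2)\rangle$),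 which is equal to $z_{\chi_1}$.
   Context: Let $d=4$ and let $\zeta$ be a primitive $d$-th root of unity. $V=\mathbb{C}^2$ has canonical basis $(x,y)$, $V^*$ dual basis $(X,Y)$; $\mathbb{C}[V]=\mathbb{C}[X,Y]$, $\mathbb{C}[V^*]=\mathbb{C}[x,y]$. For $i\in\mathbb{Z}/d\mathbb{Z}$, $s_i=\begin{pmatrix}0&\zeta^i\\ \zeta^{-i}&0\end{pmatrix}$, $\alpha_i^\vee=\zeta^ix-y$, $\alpha_i=X-\zeta^iY$; $s=s_0$, $t=s_1$, $W=\langle s,t\rangle$, $\mathrm{Ref}(W)=\{s_i\}$. $\mathcal{C}$ is the space of functions $\mathrm{Ref}(W)\to\mathbb{C}$ constant on conjugacy classes, $C_i\in\mathcal{C}^*$ is evaluation at $s_i$; $C_i=C_{i+2}$, $A=C_0$, $B=C_1$. The irreducible characters of $W$ are $\mathbf 1$ (trivial), $\varepsilon=\det$, $\varepsilon_s,\varepsilon_t$ (linear, $\varepsilon_s(s)=\varepsilon_t(t)=-1$, $\varepsilon_s(t)=\varepsilon_t(s)=1$) and $\chi_1$, the character of $W\subset\mathrm{GL}_2(\mathbb{C})$. $\mathbf{H}$ (generic rational Cherednik algebra at $t=0$) is the quotient of $\mathbb{C}[\mathcal{C}]\otimes(T(V\oplus V^* )\rtimes W)$ by $[u,u']=[U,U']=0$, $[u,U]=-2\sum_iC_i\frac{\langle u,\alpha_i\rangle\langle\alpha_i^\vee,U\rangle}{\langle\alpha_i^\vee,\alpha_i\rangle}s_i$ ($u,u'\in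 V$, $U,U'\in V^*$); $Z$ is its centre. For $c\in\mathcal{C}$, $\mathbf{H}_c=\mathbf{H}/(C_i-c_{s_i})_i\mathbf{H}$, with centre $Z_c=Z/(C_i-c_{s_i})_iZ$. $\mathcal{Z}$ and $\mathcal{Z}_c$ are the affine varieties with algebras of regular functions $Z$ and $Z_c$. Multiplication gives $\mathbb{C}[\mathcal{C}]\otimes\mathbb{C}[V]\otimes\mathbb{C}W\otimes\mathbb{C}[V^*]\cong\mathbf{H}$; $\mathrm{Trunc}$ takes the coefficient of $1\in W$ and restricts to a bijection $Z\cong\mathbb{C}[\mathcal{C}\times V\times V^*]^W$. $r=x^4+y^4$, $R=X^4+Y^4$, $\mathbf{eu}=\mathrm{Trunc}^{-1}(xX+yY)$, $\mathbf{a}_2=\mathrm{Trunc}^{-1}(x^{2}Y^2+y^{2}X^2)$ are elements of $Z$; the same symbols denote their images in quotients. $\xi\in\mathbb{C}^\times$ acts on $\mathbf{H}$ by $\xi^{-1}$ on $V$, $\xi$ on $V^*$, trivially on $W$ and $\mathcal{C}^*$; this induces actions on $\mathcal{Z}$ and $\mathcal{Z}_c$. $\mu_m$ is the group of $m$-th roots of unity, and fixed point varieties carry their reduced structure. ''Equal'' for varieties means identified via the coordinates $e=\mathbf{eu}$, $u=r$, $v=R$. For $\chi\in\mathrm{Irr}(W)$, $z_\chi\in\mathcal{Z}_c$ is the point corresponding to the character by which $Z_c$ acts on $\mathcal{L}_c(\chi)$, the unique simple quotient of the baby Verma module $\overline{\mathbf{H}}_c\otimes_{\overline{\mathbf H}_c^-}E_\chi$,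 where $\overline{\mathbf{H}}_c$ is the quotient of $\mathbf{H}_c$ by the ideal generated by the elements of $\mathbb{C}[V]^W$ and $\mathbb{C}[V^*]^W$ with zero constant term, $\overline{\mathbf H}_c^-$ is its subalgebra generated by $V$ and $W$, and $V$ acts by $0$ on the representation $E_\chi$ of character $\chi$. *)

(* Defs.v *)
From HB Require Import structures.
From mathcomp Require Import all_boot all_order all_algebra.
(* The notations of monalg clash with those of mpoly. *)
From mathcomp Require Import -(notations) monalg.
From mathcomp Require Import mpoly.
From mathcomp Require Import boolp classical_sets.

Set Implicit Arguments.
Unset Strict Implicit.
Unset Printing Implicit Defensive.

Import GRing.Theory.
Local Open Scope ring_scope.
Local Open Scope quotient_scope.
Local Open Scope classical_set_scope.

Section TwoSidedIdeal.
Variable R : pzRingType.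

Definition two_sided (J : set R) : Prop :=
  [/\ J 0, (forall a b, J a -> J b -> J (a + b)) &
      forall u a v, J a -> J (u * a * v)].

Definition ideal2 (S : set R) : set R :=
  [set a | forall J, two_sided J -> S `<=` J -> J a].

Lemma ideal2P S : two_sided (ideal2 S).
Proof.
split=> [J [] //|a b Ja Jb J HJ SJ|u a v Ja J HJ SJ].
- by case: (HJ) => _ + _; apply; [exact: Ja|exact: Jb].
- by case: (HJ) => _ _; apply; exact: Ja.
Qed.

Lemma ideal2_sub S : S `<=` ideal2 S.
Proof. by move=> a Sa J _; apply. Qed.

End TwoSidedIdeal.

Section QuotientRing.
Variables (R : pzRingType) (S : set R).
Local Notation I := (ideal2 S).

Let I0 : I 0. Proof. by case: (ideal2P S). Qed.
Let ID a b : I a -> I b -> I (a + b).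
Proof. by case: (ideal2P S) => _ + _; apply. Qed.
Let IM u a v : I a -> I (u * a * v).
Proof. by case: (ideal2P S) => _ _; apply. Qed.
Let IMl u a : I a -> I (u * a).
Proof. by move=> /(IM u 1); rewrite mulr1. Qed.
Let IMr u a : I a -> I (a * u).
Proof. by move=> /(IM 1 u); rewrite mul1r. Qed.
Let IN a : I a -> I (- a).
Proof. by move=> /(IMl (-1)); rewrite mulN1r. Qed.

Definition quot_rel : rel R := fun a b => `[< I (a - b) >].

Lemma quot_rel_equiv : equiv_class_of quot_rel.
Proof.
split=> [a|a b|b a c].
- by apply/asboolP; rewrite subrr.
- by apply/asboolP/asboolP => /IN; rewrite opprB.
- by move=> /asboolP ab /asboolP bc; apply/asboolP;
    rewrite -(subrK b a) -addrA; apply: ID.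
Qed.

Canonical quot_rel_equivrel := EquivRelPack quot_rel_equiv.
Canonical quot_rel_encModRel := defaultEncModRel quot_rel.

Definition quot := {eq_quot quot_rel}.

HB.instance Definition _ := Choice.on quot.
HB.instance Definition _ := EqQuotient.on quot.

Definition qpi (a : R) : quot := \pi_quot a.
Definition qrepr (q : quot) : R := repr q.

Lemma qreprK : cancel qrepr qpi. Proof. exact: reprK. Qed.

Lemma qpiE a b : qpi a = qpi b <-> I (a - b).
Proof.
by split=> [/eqP|ab]; rewrite ?piE; [move/asboolP|apply/eqP; rewrite piE; apply/asboolP].
Qed.

Lemma qrepr_pi a : I (qrepr (qpi a) - a).
Proof. by apply/qpiE; rewrite qreprK. Qed.

Definition qzero := qpi 0.
Definition qone := qpi 1.
Definition qopp q := qpi (- qrepr q).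
Definition qadd p q := qpi (qrepr p + qrepr q).
Definition qmul p q := qpi (qrepr p * qrepr q).

Let qpi_opp a : qopp (qpi a) = qpi (- a).
Proof. by apply/qpiE; rewrite -opprD; apply: IN; exact: qrepr_pi. Qed.
Let qpi_add a b : qadd (qpi a) (qpi b) = qpi (a + b).
Proof.
by apply/qpiE; rewrite opprD addrACA; apply: ID; exact: qrepr_pi.
Qed.
Let qpi_mul a b : qmul (qpi a) (qpi b) = qpi (a * b).
Proof.
apply/qpiE; set a' := qrepr _; set b' := qrepr _.
have -> : a' * b' - a * b = (a' - a) * b' + a * (b' - b).
  by rewrite mulrBl mulrBr addrA subrK.
by apply: ID; [apply: IMr|apply: IMl]; exact: qrepr_pi.
Qed.

Let qaddA : associative qadd.
Proof.
move=> p q r; rewrite -(qreprK p) -(qreprK q) -(qreprK r).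
by rewrite !qpi_add addrA.
Qed.
Let qaddC : commutative qadd.
Proof. by move=> p q; rewrite -(qreprK p) -(qreprK q) !qpi_add addrC. Qed.
Let qadd0 : left_id qzero qadd.
Proof. by move=> p; rewrite -(qreprK p) qpi_add add0r. Qed.
Let qaddN : left_inverse qzero qopp qadd.
Proof. by move=> p; rewrite -(qreprK p) qpi_opp qpi_add addNr. Qed.

HB.instance Definition _ := GRing.isZmodule.Build quot qaddA qaddC qadd0 qaddN.

Let qmulA : associative qmul.
Proof.
move=> p q r; rewrite -(qreprK p) -(qreprK q) -(qreprK r).
by rewrite !qpi_mul mulrA.
Qed.
Let qmul1 : left_id qone qmul.
Proof. by move=> p; rewrite -(qreprK p) qpi_mul mul1r. Qed.
Let qmulr1 : right_id qone qmul.
Proof. by move=> p; rewrite -(qreprK p) qpi_mul mulr1. Qed.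
Let qmulDl : left_distributive qmul qadd.
Proof.
move=> p q r; rewrite -(qreprK p) -(qreprK q) -(qreprK r).
by rewrite !(qpi_mul, qpi_add) mulrDl.
Qed.
Let qmulDr : right_distributive qmul qadd.
Proof.
move=> p q r; rewrite -(qreprK p) -(qreprK q) -(qreprK r).
by rewrite !(qpi_mul, qpi_add) mulrDr.
Qed.

HB.instance Definition _ := GRing.Zmodule_isPzRing.Build quot
  qmulA qmul1 qmulr1 qmulDl qmulDr.

Lemma qpi_is_zmod_morphism : zmod_morphism qpi.
Proof. by move=> a b; rewrite -qpi_add -qpi_opp. Qed.
HB.instance Definition _ :=
  GRing.isZmodMorphism.Build R quot qpi qpi_is_zmod_morphism.

Lemma qpi_is_monoid_morphism : monoid_morphism qpi.
Proof. by split=> // a b; rewrite -qpi_mul. Qed.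
HB.instance Definition _ :=
  GRing.isMonoidMorphism.Build R quot qpi qpi_is_monoid_morphism.

Lemma qpi_eq0 a : S a -> qpi a = 0.
Proof.
by move=> Sa; rewrite -[RHS](rmorph0 qpi); apply/qpiE; rewrite subr0; exact: ideal2_sub.
Qed.

(* Meaningful when f is a ring morphism killing S, see qliftE. *)
Definition qlift (B : pzRingType) (f : R -> B) (q : quot) : B := f (qrepr q).

Lemma qliftE (B : pzRingType) (f : {rmorphism R -> B}) a :
  (forall s, S s -> f s = 0) -> qlift f (qpi a) = f a.
Proof.
move=> fS; apply/eqP; rewrite -subr_eq0 -rmorphB; apply/eqP.
apply: (@qrepr_pi a [set b | f b = 0]) => //; split => /=.
- exact: rmorph0.
- by move=> b c /= fb fc; rewrite rmorphD fb fc addr0.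
- by move=> u b v /= fb; rewrite !rmorphM fb mulr0 mul0r.
Qed.

End QuotientRing.

Section Centre.
Variable R : pzRingType.

Definition central : {pred R} := [pred z : R | `[< forall h, z * h = h * z >]].

Lemma centralP z : reflect (forall h, z * h = h * z) (z \in central).
Proof. exact: asboolP. Qed.

Lemma central_subring : subring_closed central.
Proof.
split=> [|y z /centralP yC /centralP zC|y z /centralP yC /centralP zC];
  apply/centralP => h.
- by rewrite mul1r mulr1.
- by rewrite mulrBl mulrBr yC zC.
- by rewrite -mulrA zC mulrA yC mulrA.
Qed.

Record centre := Centre { centre_val : R; _ : centre_val \in central }.
HB.instance Definition _ := [isSub for centre_val].
HB.instance Definition _ := [Choice of centre by <:].
HB.instance Definition _ :=
  GRing.SubChoice_isSubPzRing.Build R central centre central_subring.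

Lemma centre_mulC : commutative (@GRing.mul centre).
Proof. by case=> y yC z; apply: val_inj => /=; move/centralP: yC. Qed.
HB.instance Definition _ :=
  GRing.PzRing_hasCommutativeMul.Build centre centre_mulC.

(* The element z seen in the centre; the junk value 0 if z is not central. *)
Definition toZ (z : R) : centre := insubd 0 z.

End Centre.

(* k : C -> A gives the scalars of the C-algebra A; the points of the variety
   Spec A are the C-algebra morphisms A -> C.                                *)

Section Varieties.
Variables (C : fieldType) (A : pzRingType) (k : C -> A).
Local Notation pt := {rmorphism A -> C}.
Implicit Types (Y X F : set pt).

Definition points : set pt := [set p : pt | forall c, p (k c) = c].

Definition zclosed F : Prop :=
  exists E : set A, F = [set p | points p /\ forall f, E f -> p f = 0].

Definition closed_in Y F : Prop := exists2 F', zclosed F' & F = Y `&` F'.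

Definition irreducible_set Y : Prop :=
  Y !=set0 /\ forall F1 F2, zclosed F1 -> zclosed F2 ->
    Y `<=` F1 `|` F2 -> Y `<=` F1 \/ Y `<=` F2.

Definition irr_component Y X : Prop :=
  [/\ X `<=` Y, irreducible_set X &
      forall X', X' `<=` Y -> irreducible_set X' -> X `<=` X' -> X' = X].

Definition dim_ge Y (n : nat) : Prop :=
  exists F : nat -> set pt,
    (forall i, (i <= n)%N -> closed_in Y (F i) /\ irreducible_set (F i)) /\
    (forall i, (i < n)%N -> F i `<` F i.+1).

(* dim Y < dim X in the extended naturals *)
Definition dim_lt Y X : Prop := exists2 n, dim_ge X n & ~ dim_ge Y n.

Definition isolated_in Y (p : pt) : Prop := Y p /\ closed_in Y (Y `\` [set p]).

Definition coords n (g : n.-tuple A) (p : pt) : n.-tuple C := map_tuple p g.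

(* The coordinates g embed Y as the subset T of the affine n-space: they map Y
   onto T and every regular function on Y is a polynomial in them. *)
Definition identified_via n (g : n.-tuple A) Y (T : set (n.-tuple C)) : Prop :=
  coords g @` Y = T /\
  forall f : A, exists P : {mpoly C[n]},
    forall p, Y p -> p f = P.@[tnth (coords g p)].

(* The C-algebra of regular functions on (the reduced variety) Y, that is, A
   modulo the functions vanishing on Y, is presented by the generators g and
   the relations rels. *)
Definition presents n (g : n.-tuple A) (rels : seq {mpoly C[n]}) Y : Prop :=
  (forall f : A, exists P : {mpoly C[n]},
     forall p, Y p -> p f = P.@[tnth (coords g p)]) /\
  (forall P : {mpoly C[n]},
     (forall p, Y p -> P.@[tnth (coords g p)] = 0) <->
     exists Q : nat -> {mpoly C[n]},
       P = \sum_(i < size rels) Q i * rels`_i).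

(* The maximal ideal of the point p0 of Y, in the algebra of regular functions
   on Y, is generated by the restrictions of the elements of gs. *)
Definition maxideal_gen Y (p0 : pt) (gs : seq A) : Prop :=
  forall f : A, p0 f = 0 <->
    exists h : nat -> A,
      forall p, Y p -> p f = p (\sum_(i < size gs) h i * gs`_i).

End Varieties.

(* Used for torusE below; stated in an abstract algebra because comparing terms
   of a monoid algebra by conversion is very slow. *)
Section Scaling.
Variables (C : fieldType) (A : lalgType C) (T : {rmorphism A -> A}).
Hypothesis TZ : forall c f, T (c *: f) = c *: T f.
Hypothesis scAr : forall c (f g : A), f * (c *: g) = c *: (f * g).

Lemma scaling_comb (T' : A -> A) (c a b : C) (f g : A) :
  (forall f g, T' (f + g) = T' f + T' g) ->
  (forall c f, T' (c *: f) = c *: T' f) ->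
  T' f = c *: f -> T' g = c *: g -> T' (a *: f + b *: g) = c *: (a *: f + b *: g).
Proof.
by move=> D Z fE gE; rewrite D !Z fE gE scalerDr !scalerA (mulrC a) (mulrC b).
Qed.

Lemma scaling_central (B : pzRingType) (p : {rmorphism A -> B}) (x f : A) :
  T x = x -> (forall g, p (x * g - g * x) = 0) -> p (T (x * f - f * x)) = 0.
Proof. by move=> xE x0; rewrite [T _]rmorphB /= !(rmorphM T) /= xE. Qed.

Lemma scaling_rel (B : pzRingType) (p : {rmorphism A -> B}) c d (x y z w : A) :
  T x = c *: x -> T y = d *: y -> T z = d *: z -> T w = c *: w ->
  p (x * y - z * w) = 0 -> p (T (x * y - z * w)) = 0.
Proof.
move=> xE yE zE wE E0.
have -> : T (x * y - z * w) = (c * d)%:A * (x * y - z * w).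
  rewrite rmorphB !rmorphM /= xE yE zE wE -!scalerAl !scAr !scalerA mul1r.
  by rewrite (mulrC d) -scalerBr.
by rewrite rmorphM /= E0 mulr0.
Qed.

Lemma scaling_comm c d (x y : A) n m (a : 'I_m -> C) (u v : 'I_m -> A) :
  T x = c *: x -> T y = d *: y -> c * d = 1 ->
  (forall i, T (u i) = u i /\ T (v i) = v i) ->
  T (x * y - y * x + n%:R * \sum_(i < m) a i *: (u i * v i)) =
  x * y - y * x + n%:R * \sum_(i < m) a i *: (u i * v i).
Proof.
move=> xE yE cd uv; rewrite rmorphD rmorphB !rmorphM rmorph_nat rmorph_sum /=.
rewrite xE yE -!scalerAl !scAr !scalerA (mulrC d) cd !scale1r.
congr (_ + _ * _); apply: eq_bigr => i _; rewrite TZ rmorphM /=.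
by have [-> ->] := uv i.
Qed.

End Scaling.

(* Names of the generators of C[A, B], V^* and V, in the order of the
   triangular decomposition; they also number the variables of the polynomial
   algebra of functions on (parameters) x V x V^*. *)
Definition iA : 'I_6 := @Ordinal 6 0 isT.
Definition iB : 'I_6 := @Ordinal 6 1 isT.
Definition iX : 'I_6 := @Ordinal 6 2 isT.
Definition iY : 'I_6 := @Ordinal 6 3 isT.
Definition ix : 'I_6 := @Ordinal 6 4 isT.
Definition iy : 'I_6 := @Ordinal 6 5 isT.

(* The 8 elements of W: (i, true) is the reflection s_i and (i, false) the
   rotation diag(zeta^i, zeta^-i); see wmat and wmat_gen below. *)
Definition W : finType := ('I_4 * bool)%type.
Definition w1 : W := (ord0, false).
Definition reflW (i : 'I_4) : W := (i, true).

Definition gen : choiceType := ('I_6 + W)%type.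

Section Cherednik.
Variables (C : fieldType) (zeta : C).

Definition smat (i : nat) : 'M[C]_2 :=
  \matrix_(j, k) (if j == k then 0 else if j == 0 then zeta ^+ i else zeta ^- i).
Definition rmat (i : nat) : 'M[C]_2 :=
  \matrix_(j, k) (if j != k then 0 else if j == 0 then zeta ^+ i else zeta ^- i).
Definition wmat (w : W) : 'M[C]_2 := if w.2 then smat w.1 else rmat w.1.

(* V is the space of columns, V^* the space of rows. *)
Definition pairing (u : 'cV[C]_2) (U : 'rV[C]_2) : C := (U *m u) 0 0.
Definition corootV (i : nat) : 'cV[C]_2 :=
  \col_j (if j == 0 then zeta ^+ i else -1).
Definition rootV (i : nat) : 'rV[C]_2 :=
  \row_j (if j == 0 then 1 else - zeta ^+ i).

(* C[A, B] (x) (T(V + V^* ) >| W) is the quotient of the free algebra on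
   A, B, X, Y, x, y and the elements of W by the first six families of
   relations below. *)
Definition freealg : Type := monalg.malg (monalg.fmonom gen) C.
HB.instance Definition _ := GRing.Lalgebra.on freealg.

(* Locked, to keep conversion out of the monoid algebra. *)
Fact fgen_key : unit. Proof. exact: tt. Qed.
Definition fgen (g : gen) : freealg :=
  locked_with fgen_key (monalg.mkmalgU (monalg.fmu g) 1).
Lemma fgenE g : fgen g = monalg.mkmalgU (monalg.fmu g) 1.
Proof. exact: unlock. Qed.
Definition fi (i : 'I_6) : freealg := fgen (inl i).
Definition fT (w : W) : freealg := fgen (inr w).
Definition fV (u : 'cV[C]_2) : freealg := u 0 0 *: fi ix + u 1 0 *: fi iy.
Definition fVd (U : 'rV[C]_2) : freealg := U 0 0 *: fi iX + U 0 1 *: fi iY.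
Definition fC (i : 'I_4) : freealg := if odd i then fi iB else fi iA.

Inductive cherednik_rel : freealg -> Prop :=
| rel_A f : cherednik_rel (fi iA * f - f * fi iA)
| rel_B f : cherednik_rel (fi iB * f - f * fi iB)
| rel_W1 w : wmat w = 1%:M -> cherednik_rel (fT w - 1)
| rel_WM w1 w2 w3 : wmat w1 *m wmat w2 = wmat w3 ->
    cherednik_rel (fT w1 * fT w2 - fT w3)
| rel_WV w u : cherednik_rel (fT w * fV u - fV (wmat w *m u) * fT w)
| rel_WVd w U :
    cherednik_rel (fT w * fVd U - fVd (U *m invmx (wmat w)) * fT w)
| rel_VV u u' : cherednik_rel (fV u * fV u' - fV u' * fV u)
| rel_VdVd U U' : cherednik_rel (fVd U * fVd U' - fVd U' * fVd U)
| rel_VVd u U : cherednik_rel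
    (fV u * fVd U - fVd U * fV u
     + 2%:R * \sum_(i < 4) (pairing u (rootV i) * pairing (corootV i) U
                            / pairing (corootV i) (rootV i))
                *: (fC i * fT (reflW i))).

Definition cherednik : Type := quot cherednik_rel.
HB.instance Definition _ := GRing.PzRing.on cherednik.

Definition piH (f : freealg) : cherednik := qpi cherednik_rel f.
HB.instance Definition _ := GRing.RMorphism.copy piH (qpi cherednik_rel).
Definition scalH (c : C) : cherednik := piH (c *: 1).
Definition h_ (i : 'I_6) : cherednik := piH (fi i).
Definition T_ (w : W) : cherednik := piH (fT w).

(* The multiplication map C[A,B] (x) C[V] (x) C W (x) C[V^*] -> H; an element of
   the source is given by its coefficient at each w in W. *)
Definition pbw (q : {ffun W -> {mpoly C[6]}}) : cherednik :=
  \sum_w \sum_(m <- mpoly.msupp (q w))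
    scalH (q w)@_m *
      (h_ iA ^+ m iA * h_ iB ^+ m iB * (h_ iX ^+ m iX * h_ iY ^+ m iY)
       * T_ w * (h_ ix ^+ m ix * h_ iy ^+ m iy)).

(* By the PBW theorem pbw is bijective: q is the preimage of h. *)
Definition Trunc (h : cherednik) : {mpoly C[6]} :=
  (xget [ffun => 0] [set q | pbw q = h]) w1.

Local Notation Z := (centre cherednik).

Definition TruncInv (p : {mpoly C[6]}) : Z :=
  xget 0 [set z : Z | Trunc (val z) = p].

Definition scalZ (c : C) : Z := toZ (scalH c).
Definition zA : Z := toZ (h_ iA).
Definition zB : Z := toZ (h_ iB).
Definition zr : Z := toZ (h_ ix ^+ 4 + h_ iy ^+ 4).
Definition zR : Z := toZ (h_ iX ^+ 4 + h_ iY ^+ 4).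
Definition eu : Z := TruncInv ('X_ix * 'X_iX + 'X_iy * 'X_iY).
Definition a2 : Z :=
  TruncInv ('X_ix ^+ 2 * 'X_iY ^+ 2 + 'X_iy ^+ 2 * 'X_iX ^+ 2).

(* xi in C^* acts by xi^-1 on V (generators x, y) and by xi on V^*. *)
Definition weight (xi : C) (g : gen) : C :=
  match g with
  | inl i => if (i < 2)%N then 1 else if (i < 4)%N then xi else xi^-1
  | inr _ => 1
  end.
Definition torus_mon (xi : C) (m : monalg.fmonom gen) : freealg :=
  \prod_(g <- m) (weight xi g *: fgen g).
Definition torusF (xi : C) : freealg -> freealg :=
  monalg.mmap (monalg.malgC : C -> freealg) (torus_mon xi).
(* For xi != 0, the endomorphism induced by torusF xi, see torusE. *)
Definition torus (xi : C) : cherednik -> cherednik :=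
  qlift (S := cherednik_rel) (piH \o torusF xi).
Definition torusZ (xi : C) (z : Z) : Z := toZ (torus xi (val z)).

Definition muFix (m : nat) : set {rmorphism Z -> C} :=
  [set p | points scalZ p /\
    forall xi : C, xi ^+ m = 1 -> forall z, p (torusZ xi z) = p z].

(* The variables of p are X, Y in invV and x, y in invVd; w^-1 acts on V^*, a
   space of rows, by right multiplication by w. *)
Definition invV (p : {mpoly C[2]}) : Prop :=
  forall w (v : 'cV[C]_2), p.@[fun i => (wmat w *m v) i 0] = p.@[fun i => v i 0].
Definition invVd (p : {mpoly C[2]}) : Prop :=
  forall w (U : 'rV[C]_2), p.@[fun i => (U *m wmat w) 0 i] = p.@[fun i => U 0 i].

Definition inclV (p : {mpoly C[2]}) : cherednik :=
  \sum_(m <- mpoly.msupp p) scalH p@_m * (h_ iX ^+ m ord0 * h_ iY ^+ m ord_max).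
Definition inclVd (p : {mpoly C[2]}) : cherednik :=
  \sum_(m <- mpoly.msupp p) scalH p@_m * (h_ ix ^+ m ord0 * h_ iy ^+ m ord_max).

Section Specialization.
(* The parameter c, given by a = c_s and b = c_t *)
Variables a b : C.

Definition Hc_rel : set cherednik := [set h_ iA - scalH a; h_ iB - scalH b].
Definition Hc : Type := quot Hc_rel.
HB.instance Definition _ := GRing.PzRing.on Hc.
Definition piHc (h : cherednik) : Hc := qpi Hc_rel h.

(* Zc is Z / (A - a, B - b) Z. It acts on Hc-modules through Z -> Hc, and C^*
   acts on it through torusZ. *)
Definition Zc_rel : set Z := [set zA - scalZ a; zB - scalZ b].
Definition Zc : Type := quot Zc_rel.
HB.instance Definition _ := GRing.PzRing.on Zc.
Definition piZc (z : Z) : Zc := qpi Zc_rel z.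
Definition scalZc (c : C) : Zc := piZc (scalZ c).

Definition muFixc (m : nat) : set {rmorphism Zc -> C} :=
  [set p | points scalZc p /\
    forall xi : C, xi ^+ m = 1 -> forall z, p (piZc (torusZ xi z)) = p (piZc z)].

Definition Hbar_rel : set Hc :=
  [set h | exists2 p : {mpoly C[2]}, p@_0%MM = 0 &
     (invV p /\ h = piHc (inclV p)) \/ (invVd p /\ h = piHc (inclVd p))].
Definition Hbar : Type := quot Hbar_rel.
HB.instance Definition _ := GRing.PzRing.on Hbar.
Definition piHbar (h : cherednik) : Hbar := qpi Hbar_rel (piHc h).

Section BabyVerma.
Variables (n : nat) (rho : W -> 'M[C]_n).

Definition submodule (N : set 'rV[Hbar]_n) : Prop :=
  [/\ N 0, (forall u v, N u -> N v -> N (u + v)) &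
      forall h u, N u -> N (h *: u)].

(* The baby Verma module, induced from the representation rho of W on the space
   of columns C^n (with V acting by 0), is Hbar (x) C^n, seen as the free module
   of rows over Hbar with basis the e_j, modulo the submodule generated by these
   elements: (h g) (x) e - h (x) (g e), for the generators g of the subalgebra
   generated by V and W.                                                     *)
Definition verma_rel : set 'rV[Hbar]_n :=
  [set u | exists j, let e i := delta_mx 0 i : 'rV[Hbar]_n in
     [\/ u = piHbar (h_ ix) *: e j, u = piHbar (h_ iy) *: e j |
         exists w, u = piHbar (T_ w) *: e j
                       - \sum_i piHbar (scalH (rho w i j)) *: e i]].

(* N / <verma_rel> is a maximal proper submodule of the baby Verma module *)
Definition simple_quotient (N : set 'rV[Hbar]_n) : Prop :=
  [/\ submodule N, verma_rel `<=` N, N <> setT &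
      forall N', submodule N' -> N `<=` N' -> N' = N \/ N' = setT].

(* p is the point z_chi for the character chi of rho. *)
Definition is_zchi (p : {rmorphism Zc -> C}) : Prop :=
  points scalZc p /\
  exists N, [/\ simple_quotient N, (forall N', simple_quotient N' -> N' = N) &
    forall (z : Z) u,
      N (piHbar (val z) *: u - piHbar (scalH (p (piZc z))) *: u)].

End BabyVerma.
End Specialization.

Definition char1 (w : W) : C := 1.
Definition eps (w : W) : C := \det (wmat w).
(* See eps_sE and eps_tE. *)
Definition eps_s (w : W) : C := (-1) ^+ (w.1 + w.2).
Definition eps_t (w : W) : C := (-1) ^+ w.1.

Definition linrep (chi : W -> C) (w : W) : 'M[C]_1 := (chi w)%:M.

Section Checks.
Hypothesis zetaP : 4.-primitive_root zeta.

Definition mulW (g h : W) : W :=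
  (if g.2 then g.1 - h.1 else g.1 + h.1, g.2 (+) h.2).

Let z4 : zeta ^+ 4 = 1. Proof. exact: prim_expr_order. Qed.
Let z0 : zeta != 0.
Proof. by apply/eqP => z0; move/eqP: z4; rewrite z0 expr0n /= eq_sym oner_eq0. Qed.

Let zD (i j : 'I_4) : zeta ^+ (i + j)%R = zeta ^+ i * zeta ^+ j.
Proof. by rewrite -exprD -[RHS](expr_mod _ z4). Qed.
Let zB' (i j : 'I_4) : zeta ^+ (i - j)%R = zeta ^+ i * zeta ^- j.
Proof. by apply: (canRL (mulfK (expf_neq0 j z0))); rewrite -zD subrK. Qed.

Lemma wmatM g h : wmat (mulW g h) = wmat g *m wmat h.
Proof.
case: g h => [i []] [j []]; apply/matrixP => k l; rewrite !mxE big_ord_recl big_ord1;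
  case: k l => [[|[|//]] ?] [[|[|//]] ?];
  rewrite !mxE /= ?(mul0r, mulr0, addr0, add0r) //= ?zD ?zB' ?invfM ?invrK //.
all: by rewrite mulrC.
Qed.

Lemma wmat_inj : injective wmat.
Proof.
case=> [i []] [j []] /matrixP E.
- have := E 0 1; rewrite !mxE /= => /eqP; rewrite (eq_prim_root_expr zetaP).
  by rewrite !modn_small ?ltn_ord // => /eqP/val_inj ->.
- by have /eqP := E 0 1; rewrite !mxE /= expf_eq0 (negPf z0) andbF.
- by have /eqP := E 0 1; rewrite !mxE /= eq_sym expf_eq0 (negPf z0) andbF.
- have := E 0 0; rewrite !mxE /= => /eqP; rewrite (eq_prim_root_expr zetaP).
  by rewrite !modn_small ?ltn_ord // => /eqP/val_inj ->.
Qed.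

Lemma wmat1 : wmat w1 = 1%:M.
Proof.
apply/matrixP => k l; case: k l => [[|[|//]] ?] [[|[|//]] ?];
  by rewrite !mxE /= ?expr0 ?invr1.
Qed.

(* The matrices wmat w form the group generated by s = s_0 and t = s_1. *)
Lemma wmat_gen (M : 'M[C]_2) :
  (exists w, wmat w = M) <->
  (forall G : set 'M[C]_2, G 1%:M -> G (smat 0) -> G (smat 1) ->
     (forall A B, G A -> G B -> G (A *m B)) -> G M).
Proof.
split=> [[w <-] G G1 Gs Gt GM|]; last first.
  move=> /(_ [set A | exists w, wmat w = A]); apply=> /=.
  - by exists w1; exact: wmat1.
  - by exists (reflW 0).
  - by exists (reflW 1).
  - by move=> _ _ [g <-] [h <-]; exists (mulW g h); exact: wmatM.
pose s := reflW 0; pose t := reflW 1.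
have {}Gs : G (wmat s) by [].
have {}Gt : G (wmat t) by [].
have GW g h : G (wmat g) -> G (wmat h) -> G (wmat (mulW g h)).
  by rewrite wmatM; exact: GM.
have Gr : G (wmat (mulW t s)) by exact: GW.
have Gi k c : (k < 4)%N -> c = s \/ c = w1 ->
    G (wmat (mulW (iter k (mulW (mulW t s)) w1) c)).
  move=> _ cE; apply: (GW); last by case: cE => ->; rewrite // wmat1.
  by elim: k => [|k IH] /=; [rewrite wmat1|exact: GW].
have -> : w = mulW (iter w.1 (mulW (mulW t s)) w1) (if w.2 then s else w1).
  case: w => [[[|[|[|[|//]]]] ?] []];
  by congr pair; exact: val_inj.
by apply: Gi => //; case: w.2; [left|right].
Qed.

Lemma eps_sE :
  [/\ eps_s (reflW 0) = -1, eps_s (reflW 1) = 1 &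
      forall g h, eps_s (mulW g h) = eps_s g * eps_s h].
Proof.
rewrite /eps_s; split=> [||g h] /=; rewrite ?expr1 ?sqrrN ?expr1n // -exprD.
rewrite -[LHS]signr_odd -[RHS]signr_odd; congr (_ ^+ nat_of_bool _).
by case: g h => [[[|[|[|[|//]]]] ?] []] [[[|[|[|[|//]]]] ?] []].
Qed.

Lemma eps_tE :
  [/\ eps_t (reflW 0) = 1, eps_t (reflW 1) = -1 &
      forall g h, eps_t (mulW g h) = eps_t g * eps_t h].
Proof.
rewrite /eps_t; split=> [||g h] /=; rewrite ?expr1 // -exprD.
rewrite -[LHS]signr_odd -[RHS]signr_odd; congr (_ ^+ nat_of_bool _).
by case: g h => [[[|[|[|[|//]]]] ?] []] [[[|[|[|[|//]]]] ?] []].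
Qed.

(* torus xi is an algebra endomorphism of the Cherednik algebra, which multiplies
   the generators by their weights. *)
Lemma malgC_comm c (f : freealg) : GRing.comm (monalg.malgC c : freealg) f.
Proof.
rewrite /GRing.comm !monalg.malgM_def /monalg.malgC monalg.fgmulUg monalg.fgmulgU.
by apply: eq_bigr => m _; rewrite mulrC monalg.mul1m monalg.mulm1.
Qed.

Lemma scale_malgC c (f : freealg) : c *: f = (monalg.malgC c : freealg) * f.
Proof. by rewrite monalg.mul_malgC. Qed.

Lemma scale_freealgAr c (f g : freealg) : f * (c *: g) = c *: (f * g).
Proof. by rewrite !scale_malgC !mulrA -malgC_comm. Qed.

Lemma torus_mon_mmorph xi : monalg.mmorphism (torus_mon xi).
Proof.
split=> [m n|]; rewrite /torus_mon ?monalg.fmM ?big_cat //.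
by rewrite monalg.fm1 big_nil.
Qed.

HB.instance Definition _ xi :=
  monalg.isMultiplicative.Build _ _ (torus_mon xi) (torus_mon_mmorph xi).

Lemma torusF_zmod_morph xi : zmod_morphism (torusF xi).
Proof. by move=> f g; exact: (raddfB (monalg.mmap _ _)). Qed.
HB.instance Definition _ xi := GRing.isZmodMorphism.Build freealg freealg
  (torusF xi) (torusF_zmod_morph xi).

Lemma torusF_monoid_morph xi : monoid_morphism (torusF xi).
Proof.
have [] := @monalg.commr_mmap_is_multiplicative _ C freealg
  (monalg.malgC : C -> freealg) (torus_mon xi).
  by move=> g m m'; exact: malgC_comm.
by split.
Qed.
HB.instance Definition _ xi := GRing.isMonoidMorphism.Build freealg freealg
  (torusF xi) (torusF_monoid_morph xi).

Lemma torusF_Z xi c f : torusF xi (c *: f) = c *: torusF xi f.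
Proof.
by rewrite scale_malgC rmorphM /= {1}/torusF monalg.mmapC -scale_malgC.
Qed.

Lemma torusF_gen xi g : torusF xi (fgen g) = weight xi g *: fgen g.
Proof.
rewrite /torusF {1}fgenE monalg.mmapU /torus_mon monalg.fmU big_seq1.
by rewrite -scale_malgC scale1r.
Qed.

Lemma torusF_D xi f g : torusF xi (f + g) = torusF xi f + torusF xi g.
Proof. exact: rmorphD. Qed.

Lemma torusF_V xi u : torusF xi (fV u) = xi^-1 *: fV u.
Proof.
by rewrite /fV /fVd; apply: (@scaling_comb C freealg (torusF xi) _ _ _ _ _ (torusF_D xi) (torusF_Z xi));
   [exact: (torusF_gen xi (inl ix))
   |exact: (torusF_gen xi (inl iy))].
Qed.

Lemma torusF_Vd xi U : torusF xi (fVd U) = xi *: fVd U.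
Proof.
by rewrite /fV /fVd; apply: (@scaling_comb C freealg (torusF xi) _ _ _ _ _ (torusF_D xi) (torusF_Z xi));
   [exact: (torusF_gen xi (inl iX))
   |exact: (torusF_gen xi (inl iY))].
Qed.

Lemma torusF_T xi w : torusF xi (fT w) = fT w.
Proof. by rewrite torusF_gen scale1r. Qed.

Lemma torusF_C xi i : torusF xi (fC i) = fC i.
Proof. by rewrite /fC; case: ifP => _; rewrite torusF_gen /= scale1r. Qed.

Lemma piH_scale0 c f : piH f = 0 -> piH (c *: f) = 0.
Proof. by move=> f0; rewrite scale_malgC rmorphM /= f0 mulr0. Qed.

Lemma piH_rel0 f : cherednik_rel f -> piH f = 0.
Proof. exact: qpi_eq0. Qed.

Lemma torusF_rel xi f : xi != 0 -> cherednik_rel f -> piH (torusF xi f) = 0.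
Proof.
move=> xi0 fr; case: (fr) => [g|g|w wE|w w' w'' wE|w u|w U|u u'|U U'|u U].
- have T1 : torusF xi (fi iA) = fi iA.
    by apply: etrans (torusF_gen xi (inl iA)) _; rewrite scale1r.
  by apply: (@scaling_central C freealg (torusF xi) cherednik piH _ _ T1) => g'; exact/piH_rel0/rel_A.
- have T1 : torusF xi (fi iB) = fi iB.
    by apply: etrans (torusF_gen xi (inl iB)) _; rewrite scale1r.
  by apply: (@scaling_central C freealg (torusF xi) cherednik piH _ _ T1) => g'; exact/piH_rel0/rel_B.
- by rewrite rmorphB rmorph1 /= torusF_T; exact/piH_rel0/rel_W1.
- rewrite rmorphB rmorphM /= (torusF_T xi w) (torusF_T xi w') (torusF_T xi w'').
  exact/piH_rel0/rel_WM.
- have T1 : torusF xi (fT w) = 1 *: fT w by rewrite torusF_T scale1r.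
  apply: (@scaling_rel C freealg (torusF xi) scale_freealgAr cherednik piH _ _ _ _ _ _ T1 (torusF_V xi u)
            (torusF_V xi (wmat w *m u)) T1).
  exact/piH_rel0/rel_WV.
- have T1 : torusF xi (fT w) = 1 *: fT w by rewrite torusF_T scale1r.
  apply: (@scaling_rel C freealg (torusF xi) scale_freealgAr cherednik piH _ _ _ _ _ _ T1 (torusF_Vd xi U)
            (torusF_Vd xi (U *m invmx (wmat w))) T1).
  exact/piH_rel0/rel_WVd.
- apply: (@scaling_rel C freealg (torusF xi) scale_freealgAr
            cherednik piH _ _ _ _ _ _ (torusF_V xi u)
            (torusF_V xi u') (torusF_V xi u') (torusF_V xi u)).
  exact/piH_rel0/rel_VV.
- apply: (@scaling_rel C freealg (torusF xi) scale_freealgAr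
            cherednik piH _ _ _ _ _ _ (torusF_Vd xi U)
            (torusF_Vd xi U') (torusF_Vd xi U') (torusF_Vd xi U)).
  exact/piH_rel0/rel_VdVd.
- rewrite (@scaling_comm C freealg (torusF xi) (torusF_Z xi) scale_freealgAr
            _ _ _ _ _ _ _ _ _ (torusF_V xi u)
            (torusF_Vd xi U) (mulVf xi0)); first exact/piH_rel0/rel_VVd.
  by move=> i; split; [exact: torusF_C|exact: torusF_T].
Qed.

Lemma torusE xi f : xi != 0 -> torus xi (piH f) = piH (torusF xi f).
Proof.
by move=> xi0; apply: (@qliftE _ _ _ (piH \o torusF xi)) => g; exact: torusF_rel.
Qed.

End Checks.

End Cherednik.

Arguments muFix {C} zeta m.
Arguments muFixc {C} zeta a b m.
Arguments piZc {C zeta} a b z.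
Arguments scalZc {C} zeta a b c.
Arguments is_zchi {C} zeta a b {n} rho p.
Arguments char1 {C} w.
Arguments eps_s {C} w.
Arguments eps_t {C} w.

(* Main.v *)
(* Proof idea. The Cherednik algebra H acts by Dunkl operators on functions on W,
   for every point v of (parameters) x V x V^*. Filtering by the degree in x, y,
   where the leading part of an operator is polynomial multiplication, gives the
   PBW theorem, and for generic v an element of the centre Z acts by a scalar
   ev v z; these scalars separate the elements of Z, so that identities in Z are
   polynomial identities. Lifting leading parts one degree at a time shows that
   Z is generated by A, B, eu, a2, r, R, q = xy, Q = XY and two elements a1, a3.
   The last four are multiplied by -1 by zeta in C^*, so the fixed locus of mu_4
   is q = Q = a1 = a3 = 0, where the relations of Z become the five relations of
   the theorem. They generate the whole ideal: modulo them a polynomial is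
   f(r) + R g(R) + (a2 + 2(A^2 - B^2)) m, with f, g over C[A, B, eu] and m in
   C[A, B], and it vanishes only if f = g = m = 0. This needs enough points: those
   with R <> 0 come from v with x = (x0, 0), X = (X0, 0), those with R = 0 are
   limits of the former along polynomial curves, and the isolated point is the
   central character of a baby Verma module. In the latter the map that sends u
   to its component of degree 0 determines the unique maximal submodule, and its
   value on the centre is read off the PBW form of eu and a2. *)
From HB Require Import structures.
Require Import Defs.
From mathcomp Require Import all_boot all_order all_algebra.
(* The notations of monalg clash with those of mpoly. *)
From mathcomp Require Import -(notations) monalg.
From mathcomp Require Import ssrcomplements mpoly.
From mathcomp Require Import boolp classical_sets reals complex.
From mathcomp Require Import ring zify.

Set Implicit Arguments.
Unset Strict Implicit.
Unset Printing Implicit Defensive.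

Import GRing.Theory Num.Theory.
Local Open Scope ring_scope.
Local Open Scope classical_set_scope.

(** * The Cherednik algebra and its universal property *)

(** The Dunkl operators have coefficients C_i / α_i, with poles where α_i = X - ζ^i Y vanishes. The
    product of the four α_i is X^4 - Y^4 = (X^2 - Y^2)(X^2 + Y^2), so with A = a (X^2 - Y^2) and B =
    b (X^2 + Y^2) these quotients become a (X + ζ^i Y) for even i and b (X + ζ^i Y) for odd i. A
    point of type [pt] stores a and b instead of A and B: all coefficients are then polynomials, and
    identities of operators are left to [ring] modulo ζ^2 = -1. The price is that A and B can be
    prescribed freely only at points with X^4 <> Y^4, called [regular]; these are dense, which is
    enough for polynomial identities.

    The degree in x, y is measured by scaling these two coordinates by t and looking at the result
    as a polynomial in t.

    The elements [eu] and [a2] are defined by inverting [Trunc]. They are identified by exhibiting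
    central elements in PBW form with the right coefficient at 1, and by the injectivity of [Trunc]
    on the centre. *)

Section MkRMorphism.
Variables (A B : pzRingType).

Definition mk_rmorph (f : A -> B) (fZ : zmod_morphism f) (fM : monoid_morphism f) :
    {rmorphism A -> B} :=
  HB.pack f (GRing.isZmodMorphism.Build A B f fZ)
            (GRing.isMonoidMorphism.Build A B f fM).

Lemma rmorph_ext (p q : {rmorphism A -> B}) : p =1 q -> p = q.
Proof.
case: p q => [f [[f1] [f2]]] [g [[g1] [g2]]] /= /funext E.
move: f1 f2 g1 g2; rewrite E => f1 f2 g1 g2.
by rewrite (Prop_irrelevance f1 g1) (Prop_irrelevance f2 g2).
Qed.

End MkRMorphism.

Section QuotientMorphism.
Variables (R : pzRingType) (S : set R) (B : pzRingType) (f : {rmorphism R -> B}).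
Hypothesis fS : forall s, S s -> f s = 0.

Lemma qlift_zmod : zmod_morphism (qlift (S := S) f).
Proof.
move=> p q; rewrite -(qreprK p) -(qreprK q) -[qpi _ _ - _]rmorphB.
by rewrite !qliftE // rmorphB.
Qed.

Lemma qlift_monoid : monoid_morphism (qlift (S := S) f).
Proof.
split=> [|p q]; first by rewrite -[1](rmorph1 (qpi S)) qliftE // rmorph1.
by rewrite -(qreprK p) -(qreprK q) -[qpi _ _ * _]rmorphM !qliftE // rmorphM.
Qed.

Definition qliftR : {rmorphism quot S -> B} := mk_rmorph qlift_zmod qlift_monoid.

Lemma qliftRE a : qliftR (qpi S a) = f a.
Proof. exact: qliftE. Qed.

End QuotientMorphism.

Section Interface.
Variables (C : fieldType) (zeta : C).
Local Notation H := (cherednik zeta).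
Local Notation sc := (scalH zeta).

Lemma scalH_zmod : zmod_morphism sc.
Proof. by move=> c d; rewrite /scalH scalerBl rmorphB. Qed.
Lemma scalH_monoid : monoid_morphism sc.
Proof.
split=> [|c d]; rewrite /scalH ?scale1r ?rmorph1 //.
by rewrite -rmorphM -scalerAl mul1r scalerA.
Qed.
HB.instance Definition _ := GRing.isZmodMorphism.Build C H sc scalH_zmod.
HB.instance Definition _ := GRing.isMonoidMorphism.Build C H sc scalH_monoid.

Lemma piHD (f g : freealg C) : piH zeta (f + g) = piH zeta f + piH zeta g.
Proof. exact: rmorphD. Qed.
Lemma piHB (f g : freealg C) : piH zeta (f - g) = piH zeta f - piH zeta g.
Proof. exact: rmorphB. Qed.
Lemma piHM (f g : freealg C) : piH zeta (f * g) = piH zeta f * piH zeta g.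
Proof. exact: rmorphM. Qed.

Lemma piHZ c (f : freealg C) : piH zeta (c *: f) = sc c * piH zeta f.
Proof. by rewrite /scalH -rmorphM -scalerAl mul1r. Qed.

Lemma scalHC c h : sc c * h = h * sc c.
Proof.
rewrite -(qreprK h) -/(piH zeta _) -piHZ /scalH -rmorphM /=.
by rewrite scale_freealgAr mulr1.
Qed.

Definition genH (g : gen) : H := piH zeta (fgen C g).

Lemma fmonom_prod (m : monalg.fmonom gen) :
  (monalg.mkmalgU m 1 : freealg C) = \prod_(g <- m) fgen C g.
Proof.
case: m => s /=; elim: s => [|g s IH].
  by rewrite big_nil -monalg.fmE -/(monalg.fmone gen).
rewrite big_cons -IH fgenE monalg.malgM_def monalg.fgmulUU mulr1.
congr (monalg.mkmalgU _ _); apply/eqP; rewrite -val_eqE /=.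
by rewrite monalg.fmM monalg.fmuE.
Qed.

(** Words in the generators span the free algebra, so sums, scalars and left multiplication by
    single generators reach every element. *)
Lemma cherednik_ind (P : H -> Prop) :
  P 1 -> (forall h h', P h -> P h' -> P (h + h')) ->
  (forall c h, P h -> P (sc c * h)) -> (forall g h, P h -> P (genH g * h)) ->
  forall h, P h.
Proof.
move=> P1 PD PZ PM h; rewrite -(qreprK h) -/(piH zeta _).
rewrite [qrepr h]monalg.monalgE rmorph_sum /=.
have P0 : P 0 by rewrite -(mul0r 1) -(rmorph0 sc); exact: PZ.
apply: big_ind => // m _.
have -> : (monalg.mkmalgU m (monalg.mcoeff m (qrepr h)) : freealg C)
    = monalg.mcoeff m (qrepr h) *: (monalg.mkmalgU m 1 : freealg C).
  rewrite scale_malgC monalg.malgM_def /monalg.malgC monalg.fgmulUU.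
  by rewrite mulr1 monalg.mul1m.
rewrite piHZ; apply: (PZ); rewrite fmonom_prod rmorph_prod.
by elim: (monalg.fmonom_val m) => [|g s IH]; rewrite ?big_nil // big_cons; apply: PM.
Qed.

Section Universal.
Variables (B : nzRingType) (k : {rmorphism C -> B}) (phi : gen -> B).
Hypothesis kC : forall c b, GRing.comm (k c) b.

Definition univ_mon (m : monalg.fmonom gen) : B := \prod_(g <- m) phi g.
Lemma univ_mon_mmorph : monalg.mmorphism univ_mon.
Proof.
split=> [m n|]; rewrite /univ_mon ?monalg.fmM ?big_cat //.
by rewrite monalg.fm1 big_nil.
Qed.
HB.instance Definition _ :=
  monalg.isMultiplicative.Build _ _ univ_mon univ_mon_mmorph.

Definition univF (f : freealg C) : B := monalg.mmap k univ_mon f.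
Lemma univF_zmod : zmod_morphism univF.
Proof. by move=> f g; exact: (raddfB (monalg.mmap _ _)). Qed.
Lemma univF_monoid : monoid_morphism univF.
Proof.
have [] := @monalg.commr_mmap_is_multiplicative _ C B k univ_mon.
  by move=> g m m'; exact: kC.
by split.
Qed.
HB.instance Definition _ := GRing.isZmodMorphism.Build (freealg C) B univF univF_zmod.
HB.instance Definition _ := GRing.isMonoidMorphism.Build (freealg C) B univF univF_monoid.

Definition univF_rm : {rmorphism freealg C -> B} := univF.
Lemma univF_D f g : univF (f + g) = univF f + univF g. Proof. exact: rmorphD. Qed.
Lemma univF_B f g : univF (f - g) = univF f - univF g. Proof. exact: rmorphB. Qed.
Lemma univF_M f g : univF (f * g) = univF f * univF g. Proof. exact: rmorphM. Qed.

Lemma univF_Z c f : univF (c *: f) = k c * univF f.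
Proof. by rewrite scale_malgC rmorphM /= {1}/univF monalg.mmapC. Qed.

Lemma univF_gen g : univF (fgen C g) = phi g.
Proof.
rewrite /univF fgenE monalg.mmapU /univ_mon monalg.fmU big_seq1.
by rewrite -[RHS]mul1r -(rmorph1 k).
Qed.

Hypothesis univ0 : forall f, cherednik_rel zeta f -> univF f = 0.

Definition univH : {rmorphism H -> B} := qliftR (f := univF) univ0.

Lemma univHE f : univH (piH zeta f) = univF f. Proof. exact: qliftRE. Qed.
Lemma univH_gen g : univH (genH g) = phi g.
Proof. by rewrite univHE univF_gen. Qed.
Lemma univH_scal c : univH (sc c) = k c.
Proof. by rewrite univHE univF_Z rmorph1 mulr1. Qed.

End Universal.
End Interface.

(** * Computing in the group W and with fourth roots of unity *)

Definition invW (g : W) : W := (if g.2 then g.1 else - g.1, g.2).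
Definition rotW (i : 'I_4) : W := (i, false).

Lemma WP (P : W -> Prop) : P (rotW (inZp 0)) -> P (rotW (inZp 1)) ->
  P (rotW (inZp 2)) -> P (rotW (inZp 3)) -> P (reflW (inZp 0)) ->
  P (reflW (inZp 1)) -> P (reflW (inZp 2)) -> P (reflW (inZp 3)) -> forall g, P g.
Proof.
move=> a0 a1 a2 a3 b0 b1 b2 b3 [i e].
have : [\/ i = inZp 0, i = inZp 1, i = inZp 2 | i = inZp 3].
  by case: i => [[|[|[|[|//]]]] ?]; [constructor 1|constructor 2|constructor 3|
    constructor 4]; apply: val_inj.
by case=> ->; case: e.
Qed.

Lemma mulWA : associative mulW.
Proof.
case=> [i []] [j []] [k []]; rewrite /mulW /=; congr pair;
  by rewrite ?addrA ?subrA ?opprD ?opprB ?opprK ?addrA //.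
Qed.
Lemma mul1W : left_id w1 mulW.
Proof. by case=> i e; rewrite /mulW /= add0r. Qed.
Lemma mulW1 : right_id w1 mulW.
Proof. by case=> i []; rewrite /mulW /= ?addr0 ?subr0. Qed.
Lemma mulVW : left_inverse w1 invW mulW.
Proof. by case=> i []; rewrite /mulW /invW /= ?subrr ?addNr. Qed.
Lemma mulWV : right_inverse w1 invW mulW.
Proof. by case=> i []; rewrite /mulW /invW /= ?subrr ?addrN. Qed.
Lemma mulKW g : cancel (mulW g) (mulW (invW g)).
Proof. by move=> h; rewrite mulWA mulVW mul1W. Qed.
Lemma mulVKW g : cancel (mulW (invW g)) (mulW g).
Proof. by move=> h; rewrite mulWA mulWV mul1W. Qed.

Lemma big_ord4 (R : nmodType) (F : 'I_4 -> R) :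
  \sum_(i < 4) F i = F (inZp 0) + F (inZp 1) + F (inZp 2) + F (inZp 3).
Proof.
rewrite !big_ord_recl big_ord0 addr0 !addrA.
by congr (F _ + F _ + F _ + F _); apply: val_inj.
Qed.

Lemma commutator_eq (V : zmodType) (a b c : V) : a - b + c = 0 -> a = b - c.
Proof. by move/(canRL (addrK c)) => /(canRL (subrK b)) ->; rewrite sub0r addrC. Qed.

Section RootOfUnity.
Variables (C : fieldType) (zeta : C).
Hypothesis zetaP : 4.-primitive_root zeta.

Lemma zeta4 : zeta ^+ 4 = 1. Proof. exact: prim_expr_order. Qed.
Lemma zeta_neq0 : zeta != 0.
Proof. by apply/eqP => z0; move/eqP: zeta4; rewrite z0 expr0n /= eq_sym oner_eq0. Qed.
Lemma zeta2 : zeta ^+ 2 = -1.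
Proof.
have /eqP : (zeta ^+ 2 - 1) * (zeta ^+ 2 + 1) = 0 by ring: zeta4.
rewrite mulf_eq0 subr_eq0 addr_eq0 -(expr0 zeta) (eq_prim_root_expr zetaP) //=.
by move=> /eqP ->; rewrite expr0.
Qed.
Lemma zetaV : zeta^-1 = - zeta.
Proof. by apply: (mulfI zeta_neq0); rewrite divff ?zeta_neq0 // mulrN -expr2 zeta2 opprK. Qed.
(** If 2 were 0, then ζ^2 = -1 = 1 would contradict the order of ζ. *)
Lemma two_neq0 : 2 != 0 :> C.
Proof.
apply/eqP => E; have : zeta ^+ 2 = zeta ^+ 0.
  by rewrite zeta2 expr0; apply/eqP; rewrite eq_sym -addr_eq0 -[1 + 1]/(2%:R) E.
by move/eqP; rewrite (eq_prim_root_expr zetaP).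
Qed.

Lemma zeta_add (i j : 'I_4) : zeta ^+ (i + j)%R = zeta ^+ i * zeta ^+ j.
Proof. by rewrite -exprD -[RHS](expr_mod _ zeta4). Qed.

Lemma zeta_opp (i : 'I_4) : zeta ^+ (- i)%R = zeta ^- i.
Proof.
apply: (mulfI (expf_neq0 i zeta_neq0)); rewrite -zeta_add subrr expr0 divff //.
exact/expf_neq0/zeta_neq0.
Qed.

Lemma wmatV g : invmx (wmat zeta g) = wmat zeta (invW g).
Proof.
have E : wmat zeta (invW g) *m wmat zeta g = 1%:M.
  by rewrite -wmatM // mulVW wmat1.
have /andP[_ U] : (wmat zeta (invW g) \in unitmx) && (wmat zeta g \in unitmx).
  by rewrite -unitmx_mul E unitmx1.
by apply: (can_inj (mulmxK U)); rewrite mulVmx.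
Qed.

(** Inverse powers are traded for positive ones, which [ring] can reduce modulo ζ^2 = -1. *)
Lemma zeta_expV i : zeta ^- i = zeta ^+ (3 * i).
Proof.
apply: (mulfI (expf_neq0 i zeta_neq0)).
by rewrite divff ?expf_neq0 ?zeta_neq0 // -exprD -mulSn exprM zeta4 expr1n.
Qed.

Lemma wmatE g : wmat zeta g = \matrix_(j, k)
  if g.2 then (if j == k then 0 else if j == 0 then zeta ^+ g.1 else zeta ^+ (3 * g.1))
  else (if j != k then 0 else if j == 0 then zeta ^+ g.1 else zeta ^+ (3 * g.1)).
Proof. by apply/matrixP => j k; case: g => i [] /=; rewrite !mxE /= ?zeta_expV. Qed.

Lemma wmat_invE g : wmat zeta (invW g) = \matrix_(j, k)
  if g.2 then (if j == k then 0 else if j == 0 then zeta ^+ g.1 else zeta ^+ (3 * g.1))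
  else (if j != k then 0 else if j == 0 then zeta ^+ (3 * g.1) else zeta ^+ g.1).
Proof.
by apply/matrixP => j k; case: g => i [] /=; rewrite !mxE /= -?zeta_expV // zeta_opp invrK.
Qed.

End RootOfUnity.

Definition cV2 (C : fieldType) (a b : C) : 'cV[C]_2 := \col_i (if i == 0 then a else b).
Definition rV2 (C : fieldType) (a b : C) : 'rV[C]_2 := \row_i (if i == 0 then a else b).

Lemma pairingE (C : fieldType) u U : pairing u U = U 0 0 * u 0 0 + U 0 1 * u 1 0 :> C.
Proof.
rewrite /pairing mxE big_ord_recl big_ord1.
by congr (_ + U 0 _ * u _ 0); apply: val_inj.
Qed.

Section Spec.
Variables (C : fieldType) (zeta : C) (H : pzRingType) (sc : {rmorphism C -> H}).
Variables (h : 'I_6 -> H) (T : W -> H).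

Definition hvec (u : 'cV[C]_2) : H := sc (u 0 0) * h ix + sc (u 1 0) * h iy.
Definition hcovec (U : 'rV[C]_2) : H := sc (U 0 0) * h iX + sc (U 0 1) * h iY.
Definition hpar (i : 'I_4) : H := if odd i then h iB else h iA.

(* Everything but the universal property of the Cherednik algebra. Arguing in an
   abstract ring with these properties keeps conversion out of the free algebra. *)
Record cherednik_spec : Prop := CherednikSpec {
  spec_sc : forall c z, sc c * z = z * sc c;
  spec_A : forall z, h iA * z = z * h iA;
  spec_B : forall z, h iB * z = z * h iB;
  spec_T1 : T w1 = 1;
  spec_TM : forall g g', T g * T g' = T (mulW g g');
  spec_TV : forall g u, T g * hvec u = hvec (wmat zeta g *m u) * T g;
  spec_TVd : forall g U, T g * hcovec U = hcovec (U *m wmat zeta (invW g)) * T g;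
  spec_VV : forall u u', hvec u * hvec u' = hvec u' * hvec u;
  spec_VdVd : forall U U', hcovec U * hcovec U' = hcovec U' * hcovec U;
  spec_VVd : forall u U, hvec u * hcovec U - hcovec U * hvec u + 2%:R * \sum_(i < 4)
    sc (pairing u (rootV zeta i) * pairing (corootV zeta i) U
        / pairing (corootV zeta i) (rootV zeta i)) * (hpar i * T (reflW i)) = 0;
  spec_ind : forall P : H -> Prop,
    P 1 -> (forall a b, P a -> P b -> P (a + b)) ->
    (forall c a, P a -> P (sc c * a)) -> (forall i a, P a -> P (h i * a)) ->
    (forall g a, P a -> P (T g * a)) -> forall a, P a }.
End Spec.

Section Relations.
Variables (C : fieldType) (zeta : C).
Hypothesis zetaP : 4.-primitive_root zeta.
Local Notation H := (cherednik zeta).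
Local Notation A := (h_ zeta iA).
Local Notation B := (h_ zeta iB).
Local Notation tw := (T_ zeta).
Definition scR : {rmorphism C -> H} := scalH zeta.
Local Notation sc := scR.
Local Notation hV := (hvec sc (h_ zeta)).
Local Notation hVd := (hcovec sc (h_ zeta)).
Local Notation hC := (hpar (h_ zeta)).

Lemma piH_fV u : piH zeta (fV u) = hV u.
Proof. exact: etrans (piHD zeta _ _) (congr2 +%R (piHZ zeta _ _) (piHZ zeta _ _)). Qed.
Lemma piH_fVd U : piH zeta (fVd U) = hVd U.
Proof. exact: etrans (piHD zeta _ _) (congr2 +%R (piHZ zeta _ _) (piHZ zeta _ _)). Qed.

Lemma piH_fC i : piH zeta (fC C i) = hC i.
Proof. by rewrite /fC /hC; case: ifP. Qed.

Let rel0 f g : cherednik_rel zeta (f - g) -> piH zeta f = piH zeta g.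
Proof. by move/piH_rel0 => E; apply/eqP; rewrite -subr_eq0 -piHB; apply/eqP. Qed.

Let rel0M f g f' g' : cherednik_rel zeta (f * g - f' * g') ->
  piH zeta f * piH zeta g = piH zeta f' * piH zeta g'.
Proof. by move=> /rel0 E; exact: etrans (esym (piHM _ _ _)) (etrans E (piHM _ _ _)). Qed.

Lemma h_A_central h : A * h = h * A.
Proof.
by rewrite -(qreprK h); apply/rel0M/rel_A.
Qed.
Lemma h_B_central h : B * h = h * B.
Proof.
by rewrite -(qreprK h); apply/rel0M/rel_B.
Qed.

Lemma T_1 : tw w1 = 1.
Proof. by rewrite /T_ -[RHS](rmorph1 (piH zeta)); apply/rel0/rel_W1/wmat1. Qed.
Lemma T_M g h : tw g * tw h = tw (mulW g h).
Proof. by rewrite /T_ -rmorphM; apply/rel0/rel_WM; rewrite -wmatM. Qed.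
Lemma T_hV g u : tw g * hV u = hV (wmat zeta g *m u) * tw g.
Proof. by rewrite /T_ -!piH_fV; apply/rel0M/rel_WV. Qed.
Lemma T_hVd g U : tw g * hVd U = hVd (U *m wmat zeta (invW g)) * tw g.
Proof. by rewrite /T_ -(wmatV zetaP) -!piH_fVd; apply/rel0M/rel_WVd. Qed.
Lemma hV_comm u u' : hV u * hV u' = hV u' * hV u.
Proof. by rewrite -!piH_fV; apply/rel0M/rel_VV. Qed.
Lemma hVd_comm u u' : hVd u * hVd u' = hVd u' * hVd u.
Proof. by rewrite -!piH_fVd; apply/rel0M/rel_VdVd. Qed.

Lemma hV_hVd_rel u U : hV u * hVd U - hVd U * hV u + 2%:R * \sum_(i < 4)
    sc (pairing u (rootV zeta i) * pairing (corootV zeta i) U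
        / pairing (corootV zeta i) (rootV zeta i)) * (hC i * tw (reflW i)) = 0.
Proof.
pose p (i : 'I_4) := pairing u (rootV zeta i) * pairing (corootV zeta i) U
  / pairing (corootV zeta i) (rootV zeta i).
have e1 : piH zeta (fV u * fVd U - fVd U * fV u) = hV u * hVd U - hVd U * hV u.
  rewrite -piH_fV -piH_fVd.
  exact: etrans (piHB zeta _ _) (congr2 (fun a b => a - b) (piHM zeta _ _) (piHM zeta _ _)).
have e3 i : piH zeta (p i *: (fC C i * fT C (reflW i))) = sc (p i) * (hC i * tw (reflW i)).
  apply: etrans (piHZ _ _ _) _; rewrite -piH_fC.
  exact: (congr1 (fun z => sc (p i) * z) (piHM zeta (fC C i) (fT C (reflW i)))).
have e2 : piH zeta (2%:R * \sum_(i < 4) p i *: (fC C i * fT C (reflW i)))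
    = 2%:R * \sum_(i < 4) sc (p i) * (hC i * tw (reflW i)).
  rewrite -(eq_bigr _ (fun (i : 'I_4) _ => e3 i)).
  exact: etrans (piHM zeta _ _) (congr2 (fun a b => a * b) (rmorph_nat (piH zeta) 2) (rmorph_sum (piH zeta) _ _ _)).
exact: etrans (esym (etrans (piHD zeta _ _) (congr2 (fun a b => a + b) e1 e2))) (piH_rel0 (rel_VVd zeta u U)).
Qed.

Lemma cherednikP : cherednik_spec zeta sc (h_ zeta) tw.
Proof.
split; [exact: scalHC|exact: h_A_central|exact: h_B_central|exact: T_1|exact: T_M
  |exact: T_hV|exact: T_hVd|exact: hV_comm|exact: hVd_comm|exact: hV_hVd_rel|].
move=> P P1 PD PZ Ph PT; apply: (cherednik_ind P1 PD PZ) => -[i|g] a.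
  exact: Ph.
exact: PT.
Qed.

End Relations.

(** * Dunkl operators *)

Section Operators.
Variable C : fieldType.

Lemma card_W : #|{: W}| = 8. Proof. by rewrite card_prod card_ord card_bool. Qed.
Definition rankW (g : W) : 'I_8 := cast_ord card_W (enum_rank g).
Definition valW (i : 'I_8) : W := enum_val (cast_ord (esym card_W) i).
Lemma rankWK : cancel rankW valW.
Proof. by move=> g; rewrite /rankW /valW cast_ordK enum_rankK. Qed.
Lemma valWK : cancel valW rankW.
Proof. by move=> i; rewrite /rankW /valW enum_valK cast_ordKV. Qed.

Definition app (M : 'M[C]_8) (f : W -> C) (g : W) : C :=
  \sum_h M (rankW g) (rankW h) * f h.

Definition opM (F : W -> W -> C) : 'M[C]_8 :=
  \matrix_(i, j) \sum_w F w (valW i) *+ (mulW w (valW i) == valW j).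

Lemma app_opM F f g : app (opM F) f g = \sum_w F w g * f (mulW w g).
Proof.
rewrite /app; under eq_bigr => h _ do rewrite mxE !rankWK mulr_suml.
rewrite exchange_big; apply: eq_bigr => w _ /=.
rewrite (bigD1 (mulW w g)) //= eqxx big1 ?addr0 // => h.
by rewrite eq_sym => /negPf ->; rewrite mul0r.
Qed.

Lemma appM M N f : app (M * N) f = app M (app N f).
Proof.
apply/funext => g; rewrite /app; under eq_bigr => h _.
  rewrite mxE mulr_suml; over.
rewrite exchange_big /= (reindex rankW) /=; last by exists valW => ? _; rewrite ?rankWK ?valWK.
by apply: eq_bigr => h _; rewrite mulr_sumr; apply: eq_bigr => k _; rewrite mulrA.
Qed.
Lemma appD M N f g : app (M + N) f g = app M f g + app N f g.
Proof. by rewrite -big_split; apply: eq_bigr => h _; rewrite mxE mulrDl. Qed.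
Lemma appZ c M f g : app (c *: M) f g = c * app M f g.
Proof. by rewrite mulr_sumr; apply: eq_bigr => h _; rewrite mxE mulrA. Qed.
Lemma app_scalar c f g : app c%:M f g = c * f g.
Proof.
rewrite /app (bigD1 g) //= big1 ?addr0 ?mxE ?eqxx // => h hg.
by rewrite mxE (can_eq rankWK) eq_sym (negPf hg) mul0r.
Qed.

Lemma app0 f g : app 0 f g = 0.
Proof. by rewrite /app big1 // => h _; rewrite mxE mul0r. Qed.

Lemma app_inj M N : (forall f g, app M f g = app N f g) -> M = N.
Proof.
have E P k g : app P (fun h => (h == k)%:R) g = P (rankW g) (rankW k).
  rewrite /app (bigD1 k) //= eqxx mulr1 big1 ?addr0 // => h /negPf ->.
  by rewrite mulr0.
by move=> MN; apply/matrixP => i j; rewrite -(valWK i) -(valWK j) -!E MN.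
Qed.

Lemma app_scaler c M f g : app M (fun h => c * f h) g = c * app M f g.
Proof. by rewrite mulr_sumr; apply: eq_bigr => h _; rewrite mulrCA. Qed.

End Operators.

(** The fields [pa] and [pb] are not the values of A and B; those are [parA] and [parB] below. *)
Record pt (C : fieldType) := Pt { pa : C; pb : C; pX : C; pY : C; px : C; py : C }.

(** Natural exponents in place of ordinals let products of explicit group elements be computed by
    arithmetic and reduced modulo 4 by [norm_el]. *)
Definition el (n : nat) (b : bool) : W := (inZp n, b).
Lemma el_mul m b n c : mulW (el m b) (el n c) = el (m + (if b then 3 * n else n)) (b (+) c).
Proof.
by rewrite /mulW /el /=; congr pair; case: b; apply: val_inj => /=; lia.
Qed.
Lemma el_inv m b : invW (el m b) = el (if b then m else 3 * m) b.
Proof.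
by rewrite /invW /el; congr pair; case: b => //; apply: val_inj => /=; lia.
Qed.
Lemma el_mod n b : el n b = el (n %% 4) b.
Proof. by congr pair; apply: val_inj; rewrite /= modn_mod. Qed.

Lemma el0 : el 0 false = w1. Proof. by congr pair; apply: val_inj. Qed.

Lemma elP (P : W -> Prop) : P (el 0 false) -> P (el 1 false) ->
  P (el 2 false) -> P (el 3 false) -> P (el 0 true) ->
  P (el 1 true) -> P (el 2 true) -> P (el 3 true) -> forall g, P g.
Proof. exact: WP. Qed.

Lemma sumW (V : nmodType) (F : W -> V) : \sum_w F w =
  F (el 0 false) + F (el 1 false) + F (el 2 false) + F (el 3 false) +
  (F (el 0 true) + F (el 1 true) + F (el 2 true) + F (el 3 true)).
Proof.
rewrite (eq_bigr (fun w => F (w.1, w.2))); last by case.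
rewrite -(pair_bigA _ (fun i b => F (i, b))) /= big_ord4.
have E i : \sum_b F (i, b) = F (i, true) + F (i, false).
  by rewrite (bigD1 true) //= (bigD1 false) //= big1 ?addr0 // => -[].
by rewrite !E (AC (2*2*2*2) ((2*4*6*8)*(1*3*5*7))).
Qed.

Ltac norm_el := repeat match goal with
  | |- context [el ?n ?b] =>
    lazymatch n with
    | O => fail | 1%N => fail | 2%N => fail | 3%N => fail | _ =>
    let n' := eval vm_compute in (n %% 4)%N in
    rewrite (el_mod n b : el n b = el n' b) end
  end.

Section Coordinates.
Variables (C : fieldType) (zeta : C).
Hypothesis zetaP : 4.-primitive_root zeta.
Local Notation pt := (pt C).

(** The signs on [pa] and [pb] cancel those that X^2 - Y^2 and X^2 + Y^2 acquire under W, so that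
    the parameters A and B are constant along an orbit. *)
Definition W_act (g : W) (v : pt) : pt :=
  let n := val g.1 in let: Pt a b X Y x y := v in
  if g.2 then Pt ((-1) ^+ n.+1 * a) ((-1) ^+ n * b) (zeta ^+ n * Y) (zeta ^+ (3 * n) * X)
    (zeta ^+ (3 * n) * y) (zeta ^+ n * x)
  else Pt ((-1) ^+ n * a) ((-1) ^+ n * b) (zeta ^+ n * X) (zeta ^+ (3 * n) * Y)
    (zeta ^+ (3 * n) * x) (zeta ^+ n * y).

Lemma gactM g h v : W_act (mulW g h) v = W_act g (W_act h v).
Proof.
have z2 := zeta2 zetaP.
case: v => a b X Y x y; move: g h.
by elim/elP; elim/elP; rewrite /W_act /mulW /=; congr Pt; ring: z2.
Qed.

Variable v : pt.
Local Notation vg g := (W_act g v).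

(** The quotient C_i / α_i, because (X - ζ^i Y)(X + ζ^i Y) = X^2 - (-1)^i Y^2. *)
Definition dcoef (i : nat) (u : pt) : C :=
  (if odd i then pb u else pa u) * (pX u + zeta ^+ i * pY u).

Definition parA : C := pa v * (pX v ^+ 2 - pY v ^+ 2).
Definition parB : C := pb v * (pX v ^+ 2 + pY v ^+ 2).

Lemma parA_gact g : pa (vg g) * (pX (vg g) ^+ 2 - pY (vg g) ^+ 2) = parA.
Proof.
have z2 := zeta2 zetaP; rewrite /parA; case: v => a b X Y x y /=.
by elim/elP: g; rewrite /=; ring: z2.
Qed.
Lemma parB_gact g : pb (vg g) * (pX (vg g) ^+ 2 + pY (vg g) ^+ 2) = parB.
Proof.
have z2 := zeta2 zetaP; rewrite /parB; case: v => a b X Y x y /=.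
by elim/elP: g; rewrite /=; ring: z2.
Qed.

Definition diagM (F : pt -> C) : 'M[C]_8 :=
  opM (fun w g => if w == w1 then F (vg g) else 0).
(** The Dunkl operator at t = 0, which has no derivative term: multiplication by x plus the sum of
    the <x, α_i> C_i / α_i times s_i. Here <x, α_i> = 1, whereas <y, α_i> = -ζ^i accounts for the
    sign and the powers of ζ in [My]. *)
Definition Mx : 'M[C]_8 :=
  diagM (@px C) + opM (fun w g => if w.2 then dcoef w.1 (vg g) else 0).
Definition My : 'M[C]_8 :=
  diagM (@py C) - opM (fun w g => if w.2 then zeta ^+ w.1 * dcoef w.1 (vg g) else 0).
Definition MT (w : W) : 'M[C]_8 := opM (fun w' _ => (w' == invW w)%:R).

Definition genM (g : gen) : 'M[C]_8 :=
  match g with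
  | inl i => match val i with
    | 0 => parA%:M | 1 => parB%:M | 2 => diagM (@pX C) | 3 => diagM (@pY C)
    | 4 => Mx | _ => My end
  | inr w => MT w
  end.

Lemma app_diagM F f g : app (diagM F) f g = F (vg g) * f g.
Proof.
rewrite app_opM (bigD1 w1) // eqxx mul1W big1 /= ?addr0 // => w /negPf ->.
by rewrite mul0r.
Qed.

Lemma app_MT w f g : app (MT w) f g = f (mulW (invW w) g).
Proof.
rewrite app_opM (bigD1 (invW w)) // eqxx mul1r big1 /= ?addr0 // => w' /negPf ->.
by rewrite mul0r.
Qed.

Let fr f g n := f (mulW (el n true) g) : C.

Lemma app_Mx f g : app Mx f g = px (vg g) * f g + dcoef 0 (vg g) * fr f g 0 +
  dcoef 1 (vg g) * fr f g 1 + dcoef 2 (vg g) * fr f g 2 + dcoef 3 (vg g) * fr f g 3.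
Proof. by rewrite appD app_diagM app_opM sumW /= /fr; ring. Qed.

Lemma app_My f g : app My f g = py (vg g) * f g - (dcoef 0 (vg g) * fr f g 0 +
  zeta * dcoef 1 (vg g) * fr f g 1 - dcoef 2 (vg g) * fr f g 2
  - zeta * dcoef 3 (vg g) * fr f g 3).
Proof.
have z2 := zeta2 zetaP.
by rewrite appD app_diagM -scaleN1r appZ app_opM sumW /= /fr; ring: z2.
Qed.

Let z2 := zeta2 zetaP.

(** Both sides, applied to f at g, are combinations of values of f at translates of g. Once the
    products in W are normalised, the coefficients agree as polynomials modulo ζ^2 = -1. *)
Lemma Mxy_comm : Mx * My = My * Mx.
Proof.
apply: app_inj => f g; rewrite !appM [LHS]app_Mx [RHS]app_My /fr !app_Mx !app_My /fr.
rewrite /dcoef !gactM; case: (W_act g v) => a b X Y x y /=.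
rewrite !mulWA !el_mul /=; norm_el; rewrite el0 !mul1W.
ring: z2.
Qed.

Definition kM : {rmorphism C -> 'M[C]_8} := scalar_mx.
Lemma kM_comm c b : GRing.comm (kM c) b. Proof. exact/esym/scalar_mxC. Qed.

Local Notation uF := (univF kM genM).

Definition MV (u0 u1 : C) : 'M[C]_8 := u0 *: Mx + u1 *: My.
Definition MVd (u0 u1 : C) : 'M[C]_8 := u0 *: diagM (@pX C) + u1 *: diagM (@pY C).

Lemma uF_Zgen c g : uF (c *: fgen C g) = c *: genM g.
Proof.
apply: etrans (univF_Z _ kM_comm _ _) _; rewrite univF_gen.
exact: mul_scalar_mx.
Qed.

Lemma uF_V u : uF (fV u) = MV (u 0 0) (u 1 0).
Proof.
exact: etrans (univF_D _ kM_comm _ _) (congr2 (fun a b => a + b) (uF_Zgen _ _) (uF_Zgen _ _)).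
Qed.
Lemma uF_Vd U : uF (fVd U) = MVd (U 0 0) (U 0 1).
Proof.
exact: etrans (univF_D _ kM_comm _ _) (congr2 (fun a b => a + b) (uF_Zgen _ _) (uF_Zgen _ _)).
Qed.
Lemma uF_T w : uF (fT C w) = MT w. Proof. exact: univF_gen. Qed.
Lemma uF_C (i : 'I_4) : uF (fC C i) = (if odd i then parB else parA)%:M.
Proof. by rewrite /fC; case: ifP => _; exact: univF_gen. Qed.

Lemma MV_comm a b c d : MV a b * MV c d = MV c d * MV a b.
Proof.
rewrite /MV !mulrDl !mulrDr -!scalerAl -!scalerAr !scalerA Mxy_comm.
rewrite -!addrA mulrC; congr (_ + _); rewrite addrCA (mulrC b c); congr (_ + _).
by rewrite (mulrC d) (mulrC d).
Qed.

Lemma MVd_comm a b c d : MVd a b * MVd c d = MVd c d * MVd a b.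
Proof.
apply: app_inj => f g; rewrite !appM !appD !appZ !app_diagM !appD !appZ !app_diagM.
by ring.
Qed.

Lemma MT1 : MT w1 = 1.
Proof. by apply: app_inj => f g; rewrite app_MT app_scalar mul1r -{1}[g]mul1W mulKW. Qed.
Lemma MT_mul w w' : MT w * MT w' = MT (mulW w w').
Proof.
apply: app_inj => f g; rewrite appM !app_MT mulWA; congr (f (mulW _ _)).
by elim/elP: w; elim/elP: w'; apply/eqP.
Qed.

Lemma MT_MV w (u : 'cV[C]_2) (u' := wmat zeta w *m u) :
  MT w * MV (u 0 0) (u 1 0) = MV (u' 0 0) (u' 1 0) * MT w.
Proof.
apply: app_inj => f g; rewrite -[g](mulVKW w); move: (mulW (invW w) g) => {}g.
rewrite /MV !appM app_MT mulKW !appD !appZ.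
rewrite !app_Mx !app_My /fr !app_MT {}/u' !gactM.
rewrite /dcoef; case: (W_act g v) => a b X Y x y.
rewrite !mxE !big_ord_recl !big_ord0 [lift _ _](_ : _ = 1); last exact: val_inj.
move: (u 0 0) (u 1 0) => u0 u1; rewrite (wmatE zetaP).
elim/elP: w; rewrite !mxE /=; rewrite !mulWA !el_inv !el_mul /=; norm_el; rewrite ?el0 ?mul1W.
all: by ring: z2.
Qed.
Lemma MT_MVd w (U : 'rV[C]_2) (U' := U *m wmat zeta (invW w)) :
  MT w * MVd (U 0 0) (U 0 1) = MVd (U' 0 0) (U' 0 1) * MT w.
Proof.
apply: app_inj => f g; rewrite -[g](mulVKW w); move: (mulW (invW w) g) => {}g.
rewrite /MVd !appM app_MT mulKW !appD !appZ !app_diagM !app_MT mulKW {}/U' !gactM.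
case: (W_act g v) => a b X Y x y.
rewrite !mxE !big_ord_recl !big_ord0 [lift _ _](_ : _ = 1); last exact: val_inj.
move: (U 0 0) (U 0 1) => u0 u1; rewrite (wmat_invE zetaP).
elim/elP: w; rewrite !mxE /=; by ring: z2.
Qed.

Lemma MV_MVd (u : 'cV[C]_2) (U : 'rV[C]_2) (u0 := u 0 0) (u1 := u 1 0)
    (U0 := U 0 0) (U1 := U 0 1) :
  MV u0 u1 * MVd U0 U1 - MVd U0 U1 * MV u0 u1 + 2%:R * \sum_(i < 4)
    (pairing u (rootV zeta i) * pairing (corootV zeta i) U
        / pairing (corootV zeta i) (rootV zeta i)) *:
    ((if odd i then parB else parA)%:M * MT (reflW i)) = 0.
Proof.
have zi i : zeta ^+ i != 0 by exact/expf_neq0/(zeta_neq0 zetaP).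
have C2 := two_neq0 zetaP.
(* Since <α_i^∨, α_i> = 2 ζ^i, the factor 2 cancels and of the denominator only ζ^{-i} = ζ^{3i}
   remains. *)
pose e i := (u0 - zeta ^+ i * u1) * (U0 - zeta ^+ (3 * i) * U1).
rewrite mulr_sumr; under eq_bigr => i _.
  rewrite mulr_natl scalerMnl -mulr_natl.
  have -> : 2 * (pairing u (rootV zeta i) * pairing (corootV zeta i) U /
    pairing (corootV zeta i) (rootV zeta i)) = e i.
    rewrite /e -(zeta_expV zetaP) !pairingE !mxE /= -/u0 -/u1 -/U0 -/U1.
    by field; rewrite zi mulrN1 opprK -mulr2n -mulr_natr mulf_neq0 ?zi ?C2.
  over.
apply: app_inj => f g; rewrite big_ord4 !appD -scaleN1r appZ.
rewrite /MV /MVd !(appM, appD, appZ, app_diagM, app_scalar, app_Mx, app_My, app_MT).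
rewrite /fr !(appD, appZ, app_diagM) !gactM -(parA_gact g) -(parB_gact g) /e /dcoef.
case: (W_act g v) => a b X Y x y; rewrite app0.
rewrite -[reflW (inZp 0)]/(el 0 true) -[reflW (inZp 1)]/(el 1 true).
rewrite -[reflW (inZp 2)]/(el 2 true) -[reflW (inZp 3)]/(el 3 true) !el_inv /=.
by ring: z2.
Qed.

Let uF_eq f g f' g' : uF f * uF g = uF f' * uF g' -> uF (f * g - f' * g') = 0.
Proof.
move=> E; apply: etrans (univF_B _ kM_comm _ _) _.
apply: etrans (congr2 (fun a b => a - b) (univF_M _ kM_comm f g) (univF_M _ kM_comm f' g')) _.
by rewrite E; exact: subrr.
Qed.

Let uF_prod f g f' g' a b a' b' : uF f = a -> uF g = b -> uF f' = a' -> uF g' = b' ->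
  a * b = a' * b' -> uF f * uF g = uF f' * uF g'.
Proof. by move=> -> -> -> ->. Qed.

Lemma uF_rel0 f : cherednik_rel zeta f -> uF f = 0.
Proof.
case=> [g|g|w wE|w w' w'' wE|w u|w U|u u'|U U'|u U].
- apply: uF_eq; rewrite (univF_gen _ _ (inl iA)); exact: kM_comm.
- apply: uF_eq; rewrite (univF_gen _ _ (inl iB)); exact: kM_comm.
- have -> : w = w1 by apply: (wmat_inj zetaP); rewrite wE wmat1.
  apply: etrans (univF_B _ kM_comm _ _) _;   by apply: etrans (congr1 (fun a => uF (fT C w1) - a) (rmorph1 (univF_rm _ kM_comm))) _; rewrite uF_T MT1; exact: subrr.
- apply: etrans (univF_B _ kM_comm _ _) _; 
  apply: etrans (congr2 (fun a b => a - b) (univF_M _ kM_comm _ _) (uF_T w'')) _.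
  rewrite (uF_T w) (uF_T w') MT_mul.
  by rewrite (wmat_inj zetaP (etrans (wmatM zetaP w w') wE)); exact: subrr.
- exact: uF_eq (uF_prod (uF_T w) (uF_V u) (uF_V _) (uF_T w) (MT_MV w u)).
- rewrite (wmatV zetaP).
  exact: uF_eq (uF_prod (uF_T w) (uF_Vd U) (uF_Vd _) (uF_T w) (MT_MVd w U)).
- exact: uF_eq (uF_prod (uF_V u) (uF_V u') (uF_V u') (uF_V u) (MV_comm _ _ _ _)).
- exact: uF_eq (uF_prod (uF_Vd U) (uF_Vd U') (uF_Vd U') (uF_Vd U) (MVd_comm _ _ _ _)).
- rewrite -(MV_MVd u U); apply: etrans (univF_D _ kM_comm _ _) _.
  apply: (congr2 (fun a b => a + b)).
    apply: etrans (univF_B _ kM_comm _ _) _.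
    rewrite -uF_V -uF_Vd; apply: (congr2 (fun a b => a - b)); exact: (univF_M _ kM_comm).
  apply: etrans (univF_M _ kM_comm _ _) _.
  apply: (congr2 (fun a b => a * b)); first exact: (rmorph_nat (univF_rm _ kM_comm)).
  apply: etrans (rmorph_sum (univF_rm _ kM_comm) _ _ _) _; apply: eq_bigr => i _.
  apply: etrans (univF_Z _ kM_comm _ _) _; 
  apply: etrans (congr1 (fun a => _ * a) (univF_M _ kM_comm _ _)) _; rewrite uF_T uF_C.
  exact: mul_scalar_mx.
Qed.

Definition Phi : {rmorphism cherednik zeta -> 'M[C]_8} := univH kM_comm uF_rel0.

Lemma Phi_gen g : Phi (genH zeta g) = genM g. Proof. exact: univH_gen. Qed.
Lemma Phi_scal c : Phi (scalH zeta c) = c%:M. Proof. exact: univH_scal. Qed.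

End Coordinates.

(* The action of a ring H on functions on W through 8 x 8 matrices, given on the
   generators of the Cherednik algebra by Dunkl operators. *)
Record dunkl_spec (C : fieldType) (zeta : C) (H : pzRingType) (sc : {rmorphism C -> H})
    (h : 'I_6 -> H) (T : W -> H) (v : pt C) (P : H -> 'M[C]_8) : Prop := DunklSpec {
  dunkl_A : P (h iA) = (parA v)%:M;
  dunkl_B : P (h iB) = (parB v)%:M;
  dunkl_X : P (h iX) = diagM zeta v (@pX C);
  dunkl_Y : P (h iY) = diagM zeta v (@pY C);
  dunkl_x : P (h ix) = Mx zeta v;
  dunkl_y : P (h iy) = My zeta v;
  dunkl_T : forall w, P (T w) = MT C w;
  dunkl_sc : forall c, P (sc c) = c%:M }.

Lemma PhiP (C : fieldType) (zeta : C) (zetaP : 4.-primitive_root zeta) v :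
  dunkl_spec zeta (scR zeta) (h_ zeta) (T_ zeta) v (Phi zetaP v).
Proof.
split; do ?[exact: (Phi_gen zetaP v (inl _))].
  by move=> w; exact: (Phi_gen zetaP v (inr w)).
exact: Phi_scal.
Qed.

(** * Polynomials determined by their values, and top coefficients *)

Section PolyVanish.
Variable C : numFieldType.

Lemma poly_vanish (P : {poly C}) : (forall t, P.[t] = 0) -> P = 0.
Proof.
move=> P0; apply: (@roots_geq_poly_eq0 _ P [seq i%:R | i <- iota 0 (size P)]).
- by apply/allP => t _; apply/eqP.
- by rewrite map_inj_uniq ?iota_uniq // => i j /eqP; rewrite eqr_nat => /eqP.
- by rewrite size_map size_iota.
Qed.

Lemma poly_vanish_dense (P S : {poly C}) : S != 0 ->
  (forall t, S.[t] != 0 -> P.[t] = 0) -> P = 0.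
Proof.
move=> S0 P0; apply/eqP; rewrite -[P == 0]orbF -(negPf S0) -mulf_eq0.
apply/eqP/poly_vanish => t; rewrite hornerM.
by have [->|/P0 ->] := eqVneq S.[t] 0; rewrite ?mulr0 ?mul0r.
Qed.

(** The number whose base-[N] digits are the exponents of a monomial; exponents below [N] can be
    recovered from it. *)
Definition kcode N n (m : 'I_n -> nat) : nat := \sum_i m i * N ^ i.

Lemma kcode_inj N n (m m' : 'I_n -> nat) : (forall i, m i < N)%N ->
  (forall i, m' i < N)%N -> kcode N m = kcode N m' -> m =1 m'.
Proof.
elim: n m m' => [|n IH] m m' mN mN'; first by move=> _ [].
have E (f : 'I_n.+1 -> nat) : kcode N f = (kcode N (fun i => f (lift ord0 i)) * N + f ord0)%N.
  rewrite /kcode big_ord_recl expn0 muln1 addnC; congr (_ + _)%N.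
  by rewrite big_distrl; apply: eq_bigr => i _; rewrite /= /bump leq0n expnS mulnCA mulnC.
have N0 : (0 < N)%N by apply: leq_ltn_trans (mN ord0).
rewrite !E => e.
have e0 : m ord0 = m' ord0.
  by move/(congr1 (modn^~ N)): e; rewrite !modnMDl !modn_small.
have e1 : kcode N (fun i => m (lift ord0 i)) = kcode N (fun i => m' (lift ord0 i)).
  by move/(congr1 (divn^~ N)): e; rewrite !divnMDl // !divn_small // !addn0.
move=> i; have [j ->|->] := unliftP ord0 i => //.
exact: (IH (fun i => m (lift ord0 i)) (fun i => m' (lift ord0 i))).
Qed.

(* Kronecker's substitution u_i = t ^ (N ^ i). *)
Lemma mpoly_vanish n (P : {mpoly C[n]}) : (forall u, P.@[u] = 0) -> P = 0.
Proof.
move=> P0; set N := (msize P).+1.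
pose Q : {poly C} := \sum_(m <- msupp P) P@_m *: 'X^(kcode N m).
have Q0 : Q = 0.
  apply: poly_vanish => t; rewrite -(P0 (fun i => t ^+ (N ^ i))) mevalE horner_sum.
  apply: eq_bigr => m _; rewrite hornerZ hornerXn; congr (_ * _).
  by rewrite /kcode -prodrXr; apply: eq_bigr => i _; rewrite -exprM mulnC.
apply/eqP; rewrite -msupp_eq0; apply/eqP; case E : (msupp P) => [//|m s].
have mP : m \in msupp P by rewrite E mem_head.
have lt_N m' : m' \in msupp P -> forall i, (m' i < N)%N.
  move=> m'P i; rewrite ltnS; apply: leq_trans (ltnW (msize_mdeg_lt m'P)).
  by rewrite mdegE (bigD1 i) //= leq_addr.
have : Q`_(kcode N m) = P@_m.
  rewrite coef_sum (bigD1_seq m) ?msupp_uniq //= coefZ coefXn eqxx mulr1.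
  rewrite big_seq_cond big1 ?addr0 // => m' /andP[m'P ne].
  rewrite coefZ coefXn; case: eqP => [k|]; last by rewrite mulr0.
  case/eqP: ne; apply/mnmP => i.
  exact: (esym (kcode_inj (lt_N _ mP) (lt_N _ m'P) k i)).
by rewrite Q0 coef0 => /esym/eqP; rewrite mcoeff_eq0 mP.
Qed.

Lemma mpoly_vanish_dense n (P S : {mpoly C[n]}) : S != 0 ->
  (forall u, S.@[u] != 0 -> P.@[u] = 0) -> P = 0.
Proof.
move=> S0 P0; apply/eqP; rewrite -[P == 0]orbF -(negPf S0) -mulf_eq0.
apply/eqP/mpoly_vanish => u; rewrite mevalM.
by have [->|/P0 ->] := eqVneq S.@[u] 0; rewrite ?mulr0 ?mul0r.
Qed.

(** The value e may be 0, and then phi has degree below d. Along the points [vscale t v], e plays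
    the part of the symbol of an operator of order d. *)
Definition topP (d : nat) (phi : C -> C) (e : C) : Prop :=
  exists P : {poly C}, [/\ (size P <= d.+1)%N, P`_d = e & forall t, phi t = P.[t]].

Lemma topP_cst c : topP 0 (fun _ => c) c.
Proof.
exists c%:P; split=> [||t]; rewrite ?coefC ?hornerC //.
by rewrite (leq_trans (size_polyC_leq1 _)).
Qed.
Lemma topP_id : topP 1 (fun t => t) 1.
Proof. by exists 'X; split=> [||t]; rewrite ?size_polyX ?coefX ?hornerX. Qed.
Lemma topP_ext d phi psi e : phi =1 psi -> topP d phi e -> topP d psi e.
Proof. by move=> E [P [? ? Pt]]; exists P; split=> // t; rewrite -E. Qed.
Lemma topP_D d phi psi e f :
  topP d phi e -> topP d psi f -> topP d (fun t => phi t + psi t) (e + f).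
Proof.
move=> [P [sP <- Pt]] [Q [sQ <- Qt]]; exists (P + Q); split.
- by rewrite (leq_trans (size_polyD _ _)) // geq_max sP.
- by rewrite coefD.
- by move=> t; rewrite hornerD Pt Qt.
Qed.
Lemma topP_M d d' phi psi e f :
  topP d phi e -> topP d' psi f -> topP (d + d') (fun t => phi t * psi t) (e * f).
Proof.
move=> [P [sP <- Pt]] [Q [sQ <- Qt]]; exists (P * Q); split.
- by apply: leq_trans (size_polyMleq _ _) _; move: sP sQ; lia.
- rewrite coefM (bigD1 (inord d)) //= inordK ?ltnS ?leq_addr // addKn.
  rewrite big1 ?addr0 // => i ni; have : val i != d.
    by apply: contra ni => /eqP E; rewrite -val_eqE /= inordK ?ltnS ?leq_addr ?E.
  rewrite neq_ltn => /orP[lt|lt].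
    rewrite [Q`__]nth_default ?mulr0 //; apply: leq_trans sQ _.
    by rewrite ltn_subRL ltn_add2r.
  by rewrite [P`__]nth_default ?mul0r // (leq_trans sP).
- by move=> t; rewrite hornerM Pt Qt.
Qed.
Lemma topP_Z d phi e c : topP d phi e -> topP d (fun t => c * phi t) (c * e).
Proof. by move=> /(topP_M (topP_cst c)). Qed.
Lemma topP_lift d d' phi e : (d < d')%N -> topP d phi e -> topP d' phi 0.
Proof.
move=> lt [P [sP _ Pt]]; exists P; split=> //; first by rewrite (leq_trans sP) // ltnW.
by rewrite nth_default // (leq_trans sP).
Qed.
Lemma topP_0 d : topP d (fun _ => 0) 0.
Proof. by case: d => [|d]; [exact: topP_cst|apply: topP_lift (topP_cst 0)]. Qed.
Lemma topP_sum d (I : eqType) (r : seq I) (phi : I -> C -> C) e :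
  (forall i, i \in r -> topP d (phi i) (e i)) ->
  topP d (fun t => \sum_(i <- r) phi i t) (\sum_(i <- r) e i).
Proof.
elim: r => [|i r IH] H.
  by rewrite big_nil; apply: topP_ext (topP_0 d) => t; rewrite big_nil.
have Hr j : j \in r -> topP d (phi j) (e j) by move=> jr; apply: H; rewrite inE jr orbT.
rewrite big_cons; apply: topP_ext (topP_D (H i (mem_head _ _)) (IH Hr)) => t.
by rewrite big_cons.
Qed.
Lemma topP_uniq d phi e f : topP d phi e -> topP d phi f -> e = f.
Proof.
move=> [P [_ <- Pt]] [Q [_ <- Qt]]; suff -> : P = Q by [].
by apply/eqP; rewrite -subr_eq0; apply/eqP/poly_vanish => t; rewrite hornerD hornerN -Pt -Qt subrr.
Qed.

End PolyVanish.

(** * The PBW theorem *)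

Section AlgebraH.
Variables (C : fieldType) (zeta : C).
Hypothesis zetaP : 4.-primitive_root zeta.
Variables (H : pzRingType) (sc : {rmorphism C -> H}) (h : 'I_6 -> H) (T : W -> H).
Hypothesis spec : cherednik_spec zeta sc h T.

Local Notation A := (h iA).
Local Notation B := (h iB).
Local Notation X := (h iX).
Local Notation Y := (h iY).
Local Notation x := (h ix).
Local Notation y := (h iy).
Local Notation hV := (hvec sc h).
Local Notation hVd := (hcovec sc h).
Local Notation hC := (hpar h).

Let zi i : zeta ^+ i != 0. Proof. exact/expf_neq0/(zeta_neq0 zetaP). Qed.
Let z4 : zeta ^+ 4 = 1 := zeta4 zetaP.

Lemma hC_central i z : hC i * z = z * hC i.
Proof. by rewrite /Defs.fC /hpar; case: ifP => _; [apply: (spec_B spec)|apply: (spec_A spec)]. Qed.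

Lemma hV_hVd u U : hV u * hVd U = hVd U * hV u - \sum_(i < 4)
  sc ((u 0 0 - zeta ^+ i * u 1 0) * (U 0 0 - zeta ^- i * U 0 1)) * (hC i * T (reflW i)).
Proof.
rewrite (commutator_eq (spec_VVd spec u U)); congr (_ - _).
rewrite mulr_sumr; apply: eq_bigr => i _; rewrite mulrA -(rmorph_nat sc) -rmorphM.
congr (sc _ * _); rewrite !pairingE !mxE /=.
by field; rewrite zi mulrN1 opprK -mulr2n -mulr_natr mulf_neq0 ?zi ?(two_neq0 zetaP).
Qed.

Lemma hV_x : hV (cV2 1 0) = x.
Proof. by rewrite /hvec !mxE /= rmorph1 rmorph0 mul1r mul0r addr0. Qed.
Lemma hV_y : hV (cV2 0 1) = y.
Proof. by rewrite /hvec !mxE /= rmorph1 rmorph0 mul1r mul0r add0r. Qed.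
Lemma hVd_X : hVd (rV2 1 0) = X.
Proof. by rewrite /hcovec !mxE /= rmorph1 rmorph0 mul1r mul0r addr0. Qed.
Lemma hVd_Y : hVd (rV2 0 1) = Y.
Proof. by rewrite /hcovec !mxE /= rmorph1 rmorph0 mul1r mul0r add0r. Qed.

Lemma xyC : x * y = y * x. Proof. by rewrite -hV_x -hV_y (spec_VV spec). Qed.
Lemma XYC : X * Y = Y * X. Proof. by rewrite -hVd_X -hVd_Y (spec_VdVd spec). Qed.

(** A Fourier transform of the weighted reflections. Up to sign, the commutators of x, y with X, Y
    are the cases k = 0, 1 and 3. *)
Definition refl_sum (k : nat) : H := \sum_(i < 4) sc (zeta ^- (k * i)) * (hC i * T (reflW i)).

Lemma comm_xX : x * X = X * x - refl_sum 0.
Proof.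
rewrite -{1}hV_x -{1}hVd_X hV_hVd hV_x hVd_X; congr (_ - _); apply: eq_bigr => i _.
by rewrite !mxE /= !mulr0 !subr0 mulr1 mul0n expr0 invr1.
Qed.
Lemma comm_xY : x * Y = Y * x + refl_sum 1.
Proof.
rewrite -{1}hV_x -{1}hVd_Y hV_hVd hV_x hVd_Y -sumrN; congr (_ + _).
apply: eq_bigr => i _.
by rewrite !mxE /= !mulr0 !subr0 mulr1 mul1r sub0r mul1n rmorphN mulNr opprK.
Qed.
Lemma comm_yX : y * X = X * y + refl_sum 3.
Proof.
rewrite -{1}hV_y -{1}hVd_X hV_hVd hV_y hVd_X -sumrN; congr (_ + _).
apply: eq_bigr => i _.
rewrite !mxE /= !mulr0 !subr0 mulr1 mulr1 sub0r rmorphN mulNr opprK; congr (sc _ * _).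
rewrite (zeta_expV zetaP) (_ : 3 * (3 * i) = i + 4 * (2 * i))%N; last by lia.
by rewrite exprD exprM z4 expr1n mulr1.
Qed.
Lemma comm_yY : y * Y = Y * y - refl_sum 0.
Proof.
rewrite -{1}hV_y -{1}hVd_Y hV_hVd hV_y hVd_Y; congr (_ - _).
apply: eq_bigr => i _; congr (sc _ * _).
by rewrite !mxE /= mul0n expr0 invr1 !sub0r !mulr1 mulrNN divff ?zi.
Qed.

Lemma hV_wmat g u : hV (wmat zeta g *m u) =
  if g.2 then sc (zeta ^- g.1 * u 0 0) * y + sc (zeta ^+ g.1 * u 1 0) * x
  else sc (zeta ^+ g.1 * u 0 0) * x + sc (zeta ^- g.1 * u 1 0) * y.
Proof.
rewrite /hvec !mxE !big_ord_recl !big_ord0 !addr0 (_ : lift ord0 ord0 = 1); last exact: val_inj.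
case: g => i []; rewrite /wmat /= /smat /rmat !mxE /= ?mul0r ?addr0 ?add0r //.
by rewrite addrC.
Qed.
Lemma hVd_wmat g U : hVd (U *m wmat zeta g) =
  if g.2 then sc (zeta ^- g.1 * U 0 1) * X + sc (zeta ^+ g.1 * U 0 0) * Y
  else sc (zeta ^+ g.1 * U 0 0) * X + sc (zeta ^- g.1 * U 0 1) * Y.
Proof.
rewrite /hcovec !mxE !big_ord_recl !big_ord0 !addr0 (_ : lift ord0 ord0 = 1); last exact: val_inj.
case: g => i []; rewrite /wmat /= /smat /rmat !mxE /= ?mulr0 ?addr0 ?add0r //.
all: by rewrite ![U _ _ * _]mulrC.
Qed.

Lemma T_x g : T g * x = (if g.2 then sc (zeta ^- g.1) * y else sc (zeta ^+ g.1) * x) * T g.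
Proof.
rewrite -{1}hV_x (spec_TV spec) hV_wmat !mxE /= !mulr1 !mulr0 rmorph0 !mul0r.
by case: ifP; rewrite addr0.
Qed.
Lemma T_y g : T g * y = (if g.2 then sc (zeta ^+ g.1) * x else sc (zeta ^- g.1) * y) * T g.
Proof.
rewrite -{1}hV_y (spec_TV spec) hV_wmat !mxE /= !mulr1 !mulr0 rmorph0 !mul0r.
by case: ifP; rewrite add0r.
Qed.
Lemma T_X g : T g * X = (if g.2 then sc (zeta ^+ g.1) * Y else sc (zeta ^- g.1) * X) * T g.
Proof.
rewrite -{1}hVd_X (spec_TVd spec) hVd_wmat !mxE /= !mulr1 !mulr0 rmorph0 !mul0r.
by case: g => i [] /=; rewrite ?add0r ?addr0 // (zeta_opp zetaP).
Qed.
Lemma T_Y g : T g * Y = (if g.2 then sc (zeta ^- g.1) * X else sc (zeta ^+ g.1) * Y) * T g.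
Proof.
rewrite -{1}hVd_Y (spec_TVd spec) hVd_wmat !mxE /= !mulr1 !mulr0 rmorph0 !mul0r.
by case: g => i [] /=; rewrite ?add0r ?addr0 // (zeta_opp zetaP) invrK.
Qed.

Definition mono (m : 'X_{1..6}) (w : W) : H :=
  A ^+ m iA * B ^+ m iB * (X ^+ m iX * Y ^+ m iY) * T w * (x ^+ m ix * y ^+ m iy).

Definition pbw_sum (q : {ffun W -> {mpoly C[6]}}) : H :=
  \sum_w \sum_(m <- mpoly.msupp (q w)) sc (q w)@_m * mono m w.

Definition mn (a b i j k l : nat) : 'X_{1..6} := [multinom nth 0%N [:: a; b; i; j; k; l] n | n < 6].

Lemma mono_mn a b i j k l w :
  mono (mn a b i j k l) w = A ^+ a * B ^+ b * (X ^+ i * Y ^+ j) * T w * (x ^+ k * y ^+ l).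
Proof. by rewrite /mono !mnmE. Qed.

Lemma mn_eta (m : 'X_{1..6}) : m = mn (m iA) (m iB) (m iX) (m iY) (m ix) (m iy).
Proof.
apply/mnmP => n; rewrite mnmE.
by case: n => [[|[|[|[|[|[|//]]]]]] ?] /=; congr (m _); apply: val_inj.
Qed.

Lemma pbw_additive q q' : pbw_sum (q + q') = pbw_sum q + pbw_sum q'.
Proof.
rewrite /pbw_sum -big_split; apply: eq_bigr => w _; rewrite ffunE.
move: (q w) (q' w) => p p' {q q'}.
(* A common bound lets the three sums run over the same finite set of monomials; outside the
   supports the coefficients are 0. *)
pose K := maxn (msize p) (maxn (msize p') (msize (p + p'))).
have E (r : {mpoly C[6]}) : (msize r <= K)%N ->
  \sum_(m <- mpoly.msupp r) sc r@_m * mono m w = \sum_(m : 'X_{1..6 < K}) sc r@_m * mono m w.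
  move=> le_rK; pose I : subFinType _ := 'X_{1..6 < K}.
  rewrite (big_mksub I) ?mpoly.msupp_uniq //=; first last.
    by move=> m /msize_mdeg_lt /leq_trans; apply.
  rewrite big_rmcond //= => j /memN_msupp_eq0 ->.
  by rewrite rmorph0 mul0r.
rewrite !E ?leq_max ?leqnn ?orbT // -big_split; apply: eq_bigr => m _.
by rewrite /= mcoeffD rmorphD mulrDl.
Qed.

Lemma pbw0 : pbw_sum 0 = 0.
Proof. by rewrite /pbw_sum big1 // => w _; rewrite ffunE msupp0 big_nil. Qed.

Definition ffm (w : W) (p : {mpoly C[6]}) : {ffun W -> {mpoly C[6]}} :=
  [ffun w' => if w' == w then p else 0].

Lemma pbw_mono c m w : pbw_sum (ffm w (c *: 'X_[m])) = sc c * mono m w.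
Proof.
have [->|c0] := eqVneq c 0.
  rewrite rmorph0 mul0r scale0r -[RHS]pbw0; congr pbw_sum.
  by apply/ffunP => w'; rewrite !ffunE; case: ifP.
rewrite /pbw_sum (bigD1 w) //= ffunE eqxx msuppMCX // big_seq1 mcoeffZ mcoeffX eqxx mulr1.
by rewrite big1 ?addr0 // => w' ne; rewrite ffunE (negPf ne) msupp0 big_nil.
Qed.

Lemma spec_scZ c z z' : z * (sc c * z') = sc c * (z * z').
Proof. by rewrite mulrA -(spec_sc spec) mulrA. Qed.

Definition pbw_span (z : H) : Prop := exists q, z = pbw_sum q.

Lemma pbw_span0 : pbw_span 0. Proof. by exists 0; rewrite pbw0. Qed.
Lemma pbw_spanD z z' : pbw_span z -> pbw_span z' -> pbw_span (z + z').
Proof. by move=> [q ->] [q' ->]; exists (q + q'); rewrite pbw_additive. Qed.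
Lemma pbw_span_sum I (r : seq I) (F : I -> H) : (forall i, pbw_span (F i)) -> pbw_span (\sum_(i <- r) F i).
Proof. by move=> SF; apply: big_ind => //; [exact: pbw_span0|exact: pbw_spanD]. Qed.
Lemma pbw_span_mono c m w : pbw_span (sc c * mono m w).
Proof. by exists (ffm w (c *: 'X_[m])); rewrite pbw_mono. Qed.
Lemma pbw_span_mn a b i j k l w : pbw_span (A ^+ a * B ^+ b * (X ^+ i * Y ^+ j) * T w * (x ^+ k * y ^+ l)).
Proof. by rewrite -mono_mn -[mono _ _]mul1r -(rmorph1 sc); apply: pbw_span_mono. Qed.

Lemma pbw_span_mull z : (forall m w, pbw_span (z * mono m w)) -> (forall c u, pbw_span u -> pbw_span (sc c * u)) ->
  forall u, pbw_span u -> pbw_span (z * u).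
Proof.
move=> Sz Sc _ [q ->]; rewrite mulr_sumr; apply: pbw_span_sum => w; rewrite mulr_sumr.
by apply: pbw_span_sum => m; rewrite spec_scZ; apply/Sc/Sz.
Qed.

Lemma pbw_spanZ c u : pbw_span u -> pbw_span (sc c * u).
Proof.
move=> [q ->]; rewrite mulr_sumr; apply: pbw_span_sum => w; rewrite mulr_sumr.
by apply: pbw_span_sum => m; rewrite mulrA -rmorphM; apply: pbw_span_mono.
Qed.
Lemma pbw_spanB z z' : pbw_span z -> pbw_span z' -> pbw_span (z - z').
Proof.
by move=> Sz Sz'; apply: pbw_spanD => //; rewrite -mulN1r -(rmorph1 sc) -rmorphN; apply: pbw_spanZ.
Qed.

Let AX k z : A ^+ k * z = z * A ^+ k.
Proof. by elim: k => [|k IH]; rewrite ?mul1r ?mulr1 // exprS -mulrA IH mulrA (spec_A spec) mulrA. Qed.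
Let BX k z : B ^+ k * z = z * B ^+ k.
Proof. by elim: k => [|k IH]; rewrite ?mul1r ?mulr1 // exprS -mulrA IH mulrA (spec_B spec) mulrA. Qed.
Let commX (u v : H) k : u * v = v * u -> u * v ^+ k = v ^+ k * u.
Proof. by move=> uv; apply: commrX. Qed.

Lemma pbw_span_A u : pbw_span u -> pbw_span (A * u).
Proof.
apply: pbw_span_mull pbw_spanZ u => m w.
have := pbw_span_mn (m iA).+1 (m iB) (m iX) (m iY) (m ix) (m iy) w.
by rewrite /mono exprS !mulrA.
Qed.
Lemma pbw_span_B u : pbw_span u -> pbw_span (B * u).
Proof.
apply: pbw_span_mull pbw_spanZ u => m w.
have := pbw_span_mn (m iA) (m iB).+1 (m iX) (m iY) (m ix) (m iy) w.
by rewrite /mono exprS !mulrA AX.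
Qed.
Lemma mono_mull z a b p t v : z * (A ^+ a * B ^+ b * p * t * v) = A ^+ a * B ^+ b * (z * p) * t * v.
Proof. by rewrite !mulrA -AX -(mulrA (A ^+ a) z) -BX !mulrA. Qed.

Lemma pbw_span_X u : pbw_span u -> pbw_span (X * u).
Proof.
apply: pbw_span_mull pbw_spanZ u => m w; rewrite /mono mono_mull (mulrA X) -exprS; exact: pbw_span_mn.
Qed.
Lemma pbw_span_Y u : pbw_span u -> pbw_span (Y * u).
Proof.
apply: pbw_span_mull pbw_spanZ u => m w; rewrite /mono mono_mull (mulrA Y) (commX _ (esym XYC)) -(mulrA (X ^+ _)) -exprS.
exact: pbw_span_mn.
Qed.

Lemma T_XY g i j : exists c i' j', T g * (X ^+ i * Y ^+ j) = sc c * (X ^+ i' * Y ^+ j') * T g.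
Proof.
have pw (u v : H) (c : C) k : T g * u = sc c * v * T g ->
    T g * u ^+ k = sc (c ^+ k) * v ^+ k * T g.
  move=> E; elim: k => [|k IH]; first by rewrite !expr0 rmorph1 !mulr1 mul1r.
  rewrite exprSr mulrA IH -mulrA E !exprSr rmorphM !mulrA; congr (_ * _ * _).
  by rewrite -!mulrA; congr (_ * _); rewrite (spec_sc spec).
have [] : (exists c d, T g * X = sc c * X * T g /\ T g * Y = sc d * Y * T g) \/
         (exists c d, T g * X = sc c * Y * T g /\ T g * Y = sc d * X * T g).
- by rewrite T_X T_Y; case: g.2; [right|left]; do 2!eexists; split.
- move=> [c [d [/pw EX /pw EY]]]; exists (c ^+ i * d ^+ j), i, j.
  rewrite mulrA EX -mulrA EY rmorphM !mulrA; congr (_ * _ * _).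
  by rewrite -!mulrA; congr (_ * _); rewrite (spec_sc spec).
- move=> [c [d [/pw EX /pw EY]]]; exists (c ^+ i * d ^+ j), j, i.
  rewrite mulrA EX -mulrA EY rmorphM !mulrA; congr (_ * _).
  rewrite -!mulrA; congr (_ * _); rewrite spec_scZ; congr (_ * _).
  by apply: commX; apply/esym/commX; exact: XYC.
Qed.

Lemma pbw_span_T g u : pbw_span u -> pbw_span (T g * u).
Proof.
apply: pbw_span_mull pbw_spanZ u => m w; rewrite /mono.
have [c [i [j E]]] := T_XY g (m iX) (m iY).
have -> : T g * (A ^+ m iA * B ^+ m iB * (X ^+ m iX * Y ^+ m iY) * T w * (x ^+ m ix * y ^+ m iy))
  = sc c * (A ^+ m iA * B ^+ m iB * (X ^+ i * Y ^+ j) * T (mulW g w) * (x ^+ m ix * y ^+ m iy)).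
  by rewrite mono_mull E mono_mull -(spec_TM spec) !mulrA.
exact/pbw_spanZ/pbw_span_mn.
Qed.

Lemma pbw_span_hC i u : pbw_span u -> pbw_span (hC i * u).
Proof. by move=> Su; rewrite /hpar; case: ifP => _; [exact: pbw_span_B|exact: pbw_span_A]. Qed.
Lemma pbw_span_S k u : pbw_span u -> pbw_span (refl_sum k * u).
Proof.
by move=> Su; rewrite mulr_suml; apply: pbw_span_sum => i; rewrite -!mulrA; apply/pbw_spanZ/pbw_span_hC/pbw_span_T.
Qed.

Lemma x_T w : x * T w = T w * (if w.2 then sc (zeta ^- w.1) * y else sc (zeta ^- w.1) * x).
Proof.
have E z z' : T (invW w) * z = z' * T (invW w) -> z * T w = T w * z'.
  move=> E; rewrite -[z in LHS]mul1r -(spec_T1 spec) -(mulWV w) -(spec_TM spec).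
  by rewrite -(mulrA (T w)) E -!mulrA (spec_TM spec) mulVW (spec_T1 spec) mulr1.
apply: E; rewrite T_x; case: w => i [] //=; by rewrite (zeta_opp zetaP).
Qed.
Lemma y_T w : y * T w = T w * (if w.2 then sc (zeta ^+ w.1) * x else sc (zeta ^+ w.1) * y).
Proof.
have E z z' : T (invW w) * z = z' * T (invW w) -> z * T w = T w * z'.
  move=> E; rewrite -[z in LHS]mul1r -(spec_T1 spec) -(mulWV w) -(spec_TM spec).
  by rewrite -(mulrA (T w)) E -!mulrA (spec_TM spec) mulVW (spec_T1 spec) mulr1.
apply: E; rewrite T_y; case: w => i [] //=; by rewrite (zeta_opp zetaP) invrK.
Qed.

(** Each time z crosses an X or a Y on its way to T w it leaves a term with [refl_sum]; these stay
    in the span by its stability under A, B, X, Y and T, already known at this point. *)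
Lemma pbw_span_xy z : (forall w k l, pbw_span (z * (T w * (x ^+ k * y ^+ l)))) ->
  (exists s s' : nat * bool, z * X = X * z + (-1) ^+ s.2 * refl_sum s.1 /\
    z * Y = Y * z + (-1) ^+ s'.2 * refl_sum s'.1) -> forall u, pbw_span u -> pbw_span (z * u).
Proof.
move=> zT [[s e] [[s' e'] /= [zX zY]]]; apply: pbw_span_mull pbw_spanZ => m w; rewrite /mono.
set v := x ^+ _ * _; rewrite -!mulrA mulrA -AX -mulrA (mulrA z) -BX -mulrA.
have sgn (b : bool) u : pbw_span u -> pbw_span ((-1) ^+ b * u).
  by case: b => Su; rewrite ?mul1r // mulN1r -sub0r; apply: pbw_spanB => //; exact: pbw_span0.
have SAX k u : pbw_span u -> pbw_span (A ^+ k * u).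
  by move=> Su; elim: k => [|k IH]; rewrite ?mul1r // exprS -mulrA; apply: pbw_span_A.
have SBX k u : pbw_span u -> pbw_span (B ^+ k * u).
  by move=> Su; elim: k => [|k IH]; rewrite ?mul1r // exprS -mulrA; apply: pbw_span_B.
have SXX k u : pbw_span u -> pbw_span (X ^+ k * u).
  by move=> Su; elim: k => [|k IH]; rewrite ?mul1r // exprS -mulrA; apply: pbw_span_X.
have SYX k u : pbw_span u -> pbw_span (Y ^+ k * u).
  by move=> Su; elim: k => [|k IH]; rewrite ?mul1r // exprS -mulrA; apply: pbw_span_Y.
have Sv : pbw_span (T w * v) by have := pbw_span_mn 0 0 0 0 (m ix) (m iy) w; rewrite !mul1r.
apply/SAX/SBX; elim: (m iX) => [|i IH]; last first.
  rewrite exprS -(mulrA X) mulrA zX mulrDl -!mulrA; apply: pbw_spanD; first exact: pbw_span_X.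
  exact/sgn/pbw_span_S/SXX/SYX.
rewrite mul1r; elim: (m iY) => [|j IH]; first by rewrite mul1r; apply: zT.
rewrite exprS -(mulrA Y) mulrA zY mulrDl -!mulrA; apply: pbw_spanD; first exact: pbw_span_Y.
exact/sgn/pbw_span_S/SYX.
Qed.

Lemma pbw_span_x u : pbw_span u -> pbw_span (x * u).
Proof.
apply: pbw_span_xy => [w k l|]; last first.
  by exists (0%N, true), (1%N, false); rewrite /= mulN1r mul1r comm_xX comm_xY.
rewrite mulrA x_T; case: ifP => _.
  rewrite -!mulrA spec_scZ; apply: pbw_spanZ; have := pbw_span_mn 0 0 0 0 k l.+1 w.
  by rewrite !mul1r exprS (mulrA (x ^+ k)) -(commX _ (esym xyC)) -mulrA.
rewrite -!mulrA spec_scZ; apply: pbw_spanZ; have := pbw_span_mn 0 0 0 0 k.+1 l w.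
by rewrite !mul1r exprS -mulrA.
Qed.
Lemma pbw_span_y u : pbw_span u -> pbw_span (y * u).
Proof.
apply: pbw_span_xy => [w k l|]; last first.
  by exists (3, false), (0%N, true); rewrite /= mulN1r mul1r comm_yX comm_yY.
rewrite mulrA y_T; case: ifP => _; last first.
  rewrite -!mulrA spec_scZ; apply: pbw_spanZ; have := pbw_span_mn 0 0 0 0 k l.+1 w.
  by rewrite !mul1r exprS (mulrA (x ^+ k)) -(commX _ (esym xyC)) -mulrA.
rewrite -!mulrA spec_scZ; apply: pbw_spanZ; have := pbw_span_mn 0 0 0 0 k.+1 l w.
by rewrite !mul1r exprS -mulrA.
Qed.

(** The span of the ordered monomials contains 1 and is stable under left multiplication by every
    generator. *)
Lemma pbw_surj z : exists q, z = pbw_sum q.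
Proof.
apply: (spec_ind spec (P := pbw_span)) => [||c u|i u|g u]; [|exact: pbw_spanD|exact: pbw_spanZ| |exact: pbw_span_T].
  by have := pbw_span_mn 0 0 0 0 0 0 w1; rewrite !mul1r !mulr1 (spec_T1 spec).
case: i => [[|[|[|[|[|[|//]]]]]] lt_i] Su.
- by rewrite (_ : Ordinal _ = iA); [exact: pbw_span_A|exact: val_inj].
- by rewrite (_ : Ordinal _ = iB); [exact: pbw_span_B|exact: val_inj].
- by rewrite (_ : Ordinal _ = iX); [exact: pbw_span_X|exact: val_inj].
- by rewrite (_ : Ordinal _ = iY); [exact: pbw_span_Y|exact: val_inj].
- by rewrite (_ : Ordinal _ = ix); [exact: pbw_span_x|exact: val_inj].
- by rewrite (_ : Ordinal _ = iy); [exact: pbw_span_y|exact: val_inj].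
Qed.

End AlgebraH.

Definition vscale (C : fieldType) (t : C) (v : pt C) : pt C :=
  Pt (pa v) (pb v) (pX v) (pY v) (t * px v) (t * py v).
Definition setxy (C : fieldType) (v : pt C) (a b : C) : pt C :=
  Pt (pa v) (pb v) (pX v) (pY v) a b.

Definition regular (C : fieldType) (v : pt C) : bool := pX v ^+ 4 != pY v ^+ 4.

Definition xyd (m : 'X_{1..6}) : nat := m ix + m iy.

Section TopCoefficient.
Variable C : numFieldType.
Implicit Type p : {mpoly C[6]}.

Definition topc (d : nat) p : {mpoly C[6]} :=
  \sum_(m <- mpoly.msupp p | xyd m == d) p@_m *: 'X_[m].

Lemma mcoeff_topc d p m : (topc d p)@_m = if xyd m == d then p@_m else 0.
Proof.
rewrite /topc raddf_sum /=.
have [mp|mp] := boolP (m \in mpoly.msupp p); last first.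
  rewrite (memN_msupp_eq0 mp) if_same big1_seq // => m' /andP[_ m'p].
  rewrite mcoeffZ mcoeffX; case: eqP => [E|]; last by rewrite mulr0.
  by rewrite -E m'p in mp.
rewrite big_mkcond (bigD1_seq m) ?mpoly.msupp_uniq //= big1 ?addr0 => [|m' ne]; last first.
  by case: ifP => // _; rewrite mcoeffZ mcoeffX (negPf ne) mulr0.
by case: ifP => // _; rewrite mcoeffZ mcoeffX eqxx mulr1.
Qed.

End TopCoefficient.

Section Faithful.
Variables (C : numFieldType) (zeta : C).
Hypothesis zetaP : 4.-primitive_root zeta.
Variables (H : pzRingType) (sc : {rmorphism C -> H}) (h : 'I_6 -> H) (T : W -> H).
Hypothesis spec : cherednik_spec zeta sc h T.
Variable P : pt C -> {rmorphism H -> 'M[C]_8}.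
Hypothesis PP : forall v, dunkl_spec zeta sc h T v (P v).

Local Notation A := (h iA).
Local Notation B := (h iB).
Local Notation X := (h iX).
Local Notation Y := (h iY).
Local Notation x := (h ix).
Local Notation y := (h iy).
Local Notation gact := (W_act zeta).
Local Notation pbwA := (pbw_sum sc h T).
Local Notation mono := (mono h T).

Definition dunkl_act v z f := app (P v z) f.

Lemma act_M v z z' f : dunkl_act v (z * z') f = dunkl_act v z (dunkl_act v z' f).
Proof. by rewrite /dunkl_act rmorphM appM. Qed.
Lemma act_D v z z' f g : dunkl_act v (z + z') f g = dunkl_act v z f g + dunkl_act v z' f g.
Proof. by rewrite /dunkl_act rmorphD appD. Qed.
Lemma act_N v z f g : dunkl_act v (- z) f g = - dunkl_act v z f g.
Proof. by rewrite /dunkl_act rmorphN -scaleN1r appZ mulN1r. Qed.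
Lemma act_0 v f g : dunkl_act v 0 f g = 0.
Proof. by rewrite /dunkl_act rmorph0 app0. Qed.
Lemma act_1 v f g : dunkl_act v 1 f g = f g.
Proof. by rewrite /dunkl_act rmorph1 app_scalar mul1r. Qed.
Lemma act_sc v c f g : dunkl_act v (sc c) f g = c * f g.
Proof. by rewrite /dunkl_act (dunkl_sc (PP v)) app_scalar. Qed.
Lemma act_A v f g : dunkl_act v A f g = parA v * f g.
Proof. by rewrite /dunkl_act (dunkl_A (PP v)) app_scalar. Qed.
Lemma act_B v f g : dunkl_act v B f g = parB v * f g.
Proof. by rewrite /dunkl_act (dunkl_B (PP v)) app_scalar. Qed.
Lemma act_X v f g : dunkl_act v X f g = pX (gact g v) * f g.
Proof. by rewrite /dunkl_act (dunkl_X (PP v)) app_diagM. Qed.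
Lemma act_Y v f g : dunkl_act v Y f g = pY (gact g v) * f g.
Proof. by rewrite /dunkl_act (dunkl_Y (PP v)) app_diagM. Qed.
Lemma act_x v f g : dunkl_act v x f g = px (gact g v) * f g +
  dcoef zeta 0 (gact g v) * f (mulW (el 0 true) g) + dcoef zeta 1 (gact g v) * f (mulW (el 1 true) g) +
  dcoef zeta 2 (gact g v) * f (mulW (el 2 true) g) + dcoef zeta 3 (gact g v) * f (mulW (el 3 true) g).
Proof. by rewrite /dunkl_act (dunkl_x (PP v)) app_Mx. Qed.
Lemma act_y v f g : dunkl_act v y f g = py (gact g v) * f g - (dcoef zeta 0 (gact g v) * f (mulW (el 0 true) g) +
  zeta * dcoef zeta 1 (gact g v) * f (mulW (el 1 true) g) - dcoef zeta 2 (gact g v) * f (mulW (el 2 true) g)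
  - zeta * dcoef zeta 3 (gact g v) * f (mulW (el 3 true) g)).
Proof. by rewrite /dunkl_act (dunkl_y (PP v)) (app_My zetaP). Qed.
Lemma act_T v w f g : dunkl_act v (T w) f g = f (mulW (invW w) g).
Proof. by rewrite /dunkl_act (dunkl_T (PP v)) app_MT. Qed.
Lemma act_sum v I (r : seq I) (F : I -> H) f g :
  dunkl_act v (\sum_(i <- r) F i) f g = \sum_(i <- r) dunkl_act v (F i) f g.
Proof. by elim: r => [|i r IH]; rewrite ?big_nil ?act_0 // !big_cons act_D IH. Qed.
Lemma act_Mg v z z' f g : dunkl_act v (z * z') f g = dunkl_act v z (dunkl_act v z' f) g.
Proof. by rewrite act_M. Qed.

Lemma act_exp v z k f g c : (forall f g, dunkl_act v z f g = c g * f g) ->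
  dunkl_act v (z ^+ k) f g = c g ^+ k * f g.
Proof.
move=> E; elim: k f => [|k IH] f; first by rewrite expr0 act_1 mul1r.
by rewrite exprS act_Mg E IH exprS mulrA.
Qed.

Lemma gact1 v : gact w1 v = v.
Proof. by case: v => *; rewrite /W_act /= !expr0 !mul1r. Qed.

Lemma vscaleE t v g : gact g (vscale t v) =
  Pt (pa (gact g v)) (pb (gact g v)) (pX (gact g v)) (pY (gact g v))
     (t * px (gact g v)) (t * py (gact g v)).
Proof. by case: v => a b X0 Y0 x0 y0; case: g => i []; rewrite /gact /vscale /=; congr Pt; rewrite mulrCA. Qed.

(** The coefficients [dcoef] do not involve x and y, so the reflection terms stay in degree d, and
    only multiplication by x contributes in degree d + 1. *)
Lemma topP_x v d (F : C -> W -> C) e : (forall g, topP d (F^~ g) (e g)) ->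
  forall g, topP d.+1 (fun t => dunkl_act (vscale t v) x (F t) g) (px (gact g v) * e g).
Proof.
move=> Fe g; have L n : topP d.+1 (fun t => dcoef zeta n (gact g v) * F t (mulW (el n true) g)) 0.
  exact: topP_lift (ltnSn d) (topP_Z _ (Fe _)).
have := topP_Z (px (gact g v)) (topP_M (@topP_id C) (Fe g)).
move=> /topP_D/(_ (L 0%N)) /topP_D/(_ (L 1%N)) /topP_D/(_ (L 2)) /topP_D/(_ (L 3)).
by rewrite mul1r !addr0; apply: topP_ext => t; rewrite act_x vscaleE /= mulrA (mulrC t).
Qed.

Lemma topP_y v d (F : C -> W -> C) e : (forall g, topP d (F^~ g) (e g)) ->
  forall g, topP d.+1 (fun t => dunkl_act (vscale t v) y (F t) g) (py (gact g v) * e g).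
Proof.
move=> Fe g; have L n c : topP d.+1 (fun t => c * dcoef zeta n (gact g v) * F t (mulW (el n true) g)) 0.
  exact: topP_lift (ltnSn d) (topP_Z _ (Fe _)).
have := topP_Z (py (gact g v)) (topP_M (@topP_id C) (Fe g)).
move=> /topP_D/(_ (L 0%N (-1))) /topP_D/(_ (L 1%N (- zeta))) /topP_D/(_ (L 2 1)) /topP_D/(_ (L 3 zeta)).
rewrite (mul1r (e g)) !addr0; apply: topP_ext => t; rewrite act_y vscaleE /=.
by rewrite /dcoef /=; ring.
Qed.

(** A monomial of the triangular decomposition acts on [delta_w1] in the order x, y, then T g, then
    X, Y. Hence x and y are evaluated at v, but X and Y at its translate by g. *)
Definition vec (g : W) (v : pt C) (n : 'I_6) : C :=
  nth 0 [:: parA v; parB v; pX (gact g v); pY (gact g v); px v; py v] n.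

Definition delta_w1 (g : W) : C := (g == w1)%:R.

(** To leading order x and y act diagonally, so they multiply [delta_w1] by their values at v; T w
    then carries the support from 1 to w, where X, Y and the parameters act diagonally. *)
Lemma topP_mono v m w g :
  topP (xyd m) (fun t => dunkl_act (vscale t v) (mono m w) delta_w1 g)
    (('X_[m] : {mpoly C[6]}).@[vec g v] *+ (w == g)).
Proof.
have Ty l g' : topP l (fun t => dunkl_act (vscale t v) (y ^+ l) delta_w1 g') (py (gact g' v) ^+ l * delta_w1 g').
  elim: l g' => [|l IH] g'.
    by apply: topP_ext (topP_cst _) => t; rewrite /= expr0 act_1 mul1r.
  by have := topP_y v IH g'; rewrite mulrA -exprS; apply: topP_ext => t; rewrite exprS act_Mg.
have Tx k l g' : topP (k + l) (fun t => dunkl_act (vscale t v) (x ^+ k * y ^+ l) delta_w1 g')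
    (px (gact g' v) ^+ k * (py (gact g' v) ^+ l * delta_w1 g')).
  elim: k g' => [|k IH] g'; first by rewrite !mul1r.
  by have := topP_x v IH g'; rewrite mulrA -exprS; apply: topP_ext => t;
    rewrite exprS -mulrA act_Mg.
have := topP_Z (parA v ^+ m iA * parB v ^+ m iB * (pX (gact g v) ^+ m iX * pY (gact g v) ^+ m iY))
  (Tx (m ix) (m iy) (mulW (invW w) g)).
set e := (X in topP _ _ X) => H1; set e' := (X in topP _ _ X).
have -> : e' = e.
  rewrite /e /e' /delta_w1 mevalX; have [->|ne] := eqVneq w g.
    rewrite mulVW eqxx mulr1 gact1 !big_ord_recl big_ord0 /vec /= mulr1 !mulrA.
    by congr (_ ^+ m _ * _ ^+ m _ * _ ^+ m _ * _ ^+ m _ * _ ^+ m _ * _ ^+ m _); apply: val_inj.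
  rewrite (_ : _ == w1 = false) ?mulr0 //.
  by apply: contraNF ne => /eqP E; rewrite -[w]mulW1 -E mulWA mulWV mul1W.
apply: topP_ext H1 => t; rewrite /mono !act_Mg.
have vsX u : pX (gact u (vscale t v)) = pX (gact u v) by rewrite vscaleE.
have vsY u : pY (gact u (vscale t v)) = pY (gact u v) by rewrite vscaleE.
rewrite (@act_exp _ A _ _ _ (fun _ => parA v)) => [|*]; last by rewrite act_A.
rewrite (@act_exp _ B _ _ _ (fun _ => parB v)) => [|*]; last by rewrite act_B.
rewrite act_Mg (@act_exp _ X _ _ _ (fun g => pX (gact g v))) => [|*]; last by rewrite act_X vsX.
rewrite (@act_exp _ Y _ _ _ (fun g => pY (gact g v))) => [|*]; last by rewrite act_Y vsY.
by rewrite act_T !mulrA -act_M.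
Qed.

Lemma topP_pbw v (q : {ffun W -> {mpoly C[6]}}) d g : (forall w m, m \in mpoly.msupp (q w) -> xyd m <= d)%N ->
  topP d (fun t => dunkl_act (vscale t v) (pbwA q) delta_w1 g) ((topc d (q g)).@[vec g v]).
Proof.
move=> qd.
have K w : topP d (fun t => dunkl_act (vscale t v) (\sum_(m <- mpoly.msupp (q w)) sc (q w)@_m * mono m w) delta_w1 g)
    ((topc d (q w)).@[vec g v] *+ (w == g)).
  rewrite /topc raddf_sum -sumrMnl [X in topP _ _ X]big_mkcond /=.
  pose F m t := (q w)@_m * dunkl_act (vscale t v) (mono m w) delta_w1 g.
  apply: (@topP_ext _ _ (fun t => \sum_(m <- mpoly.msupp (q w)) F m t)) => [t|].
    by rewrite act_sum; apply: eq_bigr => m _; rewrite act_Mg act_sc.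
  apply: (@topP_sum _ _ _ _ F) => m /qd; rewrite leq_eqVlt mevalZ => /orP[/eqP E|lt].
    by rewrite E eqxx -mulrnAr; apply: topP_Z; rewrite -E; exact: topP_mono.
  by rewrite (ltn_eqF lt); apply: topP_lift lt _; apply: topP_Z; exact: topP_mono.
have -> : (topc d (q g)).@[vec g v] = \sum_w (topc d (q w)).@[vec g v] *+ (w == g).
  by rewrite (bigD1 g) //= eqxx big1 ?addr0 // => w /negPf ->.
apply: topP_ext (topP_sum (fun w _ => K w)) => t.
by rewrite /pbw_sum act_sum.
Qed.

Lemma gact_setxy v a b g : pX (gact g (setxy v a b)) = pX (gact g v) /\
  pY (gact g (setxy v a b)) = pY (gact g v).
Proof. by case: v => *; rewrite /W_act /setxy /=; case: ifP. Qed.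

Lemma regular_gact g (v : pt C) : regular (gact g v) = regular v.
Proof.
have z4 n : zeta ^+ n ^+ 4 = 1 by rewrite exprAC (zeta4 zetaP) expr1n.
rewrite /regular; case: v => a b X0 Y0 x0 y0; case: g => i [];
  by rewrite /W_act /= !exprMn !z4 !mul1r // eq_sym.
Qed.

Lemma regular_sqr (v : pt C) : regular v -> (pX v ^+ 2 - pY v ^+ 2 != 0) /\ (pX v ^+ 2 + pY v ^+ 2 != 0).
Proof.
rewrite /regular -subr_eq0 (_ : _ - _ = (pX v ^+ 2 - pY v ^+ 2) * (pX v ^+ 2 + pY v ^+ 2)).
  by rewrite mulf_eq0 negb_or => /andP.
by ring.
Qed.

(** Regularity allows the parameters to be divided by X^2 - Y^2 and X^2 + Y^2. The point is moved by
    the inverse of g to give its translate the prescribed X and Y; the coordinates x and y, which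
    [vec] does not translate, are then reset. *)
Lemma vec_surj g (u : 'I_6 -> C) : u iX ^+ 4 != u iY ^+ 4 ->
  exists2 v, regular v & vec g v =1 u.
Proof.
move=> ru; pose v0 := Pt (u iA / (u iX ^+ 2 - u iY ^+ 2)) (u iB / (u iX ^+ 2 + u iY ^+ 2))
  (u iX) (u iY) 0 0.
pose v1 := gact (invW g) v0; pose v := setxy v1 (u ix) (u iy).
have gv : gact g v1 = v0 by rewrite /v1 -(gactM zetaP) mulWV gact1.
have r1 : regular v1 by rewrite /v1 regular_gact.
have [s1 s2] := @regular_sqr v0 ru; rewrite /= in s1 s2.
exists v => //; have [vX vY] := gact_setxy v1 (u ix) (u iy) g.
have vA : parA v = u iA.
  by rewrite -[LHS]/(parA v1) -(parA_gact zetaP v1 g) gv /= divfK.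
have vB : parB v = u iB.
  by rewrite -[LHS]/(parB v1) -(parB_gact zetaP v1 g) gv /= divfK.
move=> n; rewrite /vec vA vB vX vY gv /=.
by case: n => [[|[|[|[|[|[|//]]]]]] ?] /=; congr u; apply: val_inj.
Qed.

Lemma mpoly_regular (p : {mpoly C[6]}) g : (forall v, regular v -> p.@[vec g v] = 0) -> p = 0.
Proof.
move=> p0; apply: (@mpoly_vanish_dense _ _ _ ('X_iX ^+ 4 - 'X_iY ^+ 4)).
  apply/eqP => /(congr1 (meval (fun n => (n == iX)%:R))).
  rewrite rmorphB !rmorphXn /= !mevalXU meval0 expr0n expr1n subr0.
  by move/eqP; rewrite oner_eq0.
move=> u; rewrite rmorphB !rmorphXn /= !mevalXU subr_eq0 => /(vec_surj g)[v rv E].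
by rewrite -(meval_eq _ E); exact: p0.
Qed.

(** If some coefficient had degree above e, its part of highest degree would be a nonzero polynomial
    with value 0 at all regular points. The excess over e is thus removed one degree at a time. *)
Lemma pbw_degree (q : {ffun W -> {mpoly C[6]}}) e E :
  (forall v g, regular v -> topP e (fun t => dunkl_act (vscale t v) (pbwA q) delta_w1 g) (E v g)) ->
  (forall w m, m \in mpoly.msupp (q w) -> xyd m <= e)%N /\
  (forall v g, regular v -> (topc e (q g)).@[vec g v] = E v g).
Proof.
move=> qE.
have claim k : (forall w m, m \in mpoly.msupp (q w) -> xyd m <= e + k)%N ->
               (forall w m, m \in mpoly.msupp (q w) -> xyd m <= e)%N.
  elim: k => [|k IH] qk; first by rewrite addn0 in qk.
  apply: IH => w m mq; have := qk w m mq; rewrite leq_eqVlt addnS => /orP[/eqP Em|//].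
  suff /(congr1 (mcoeff m)) : topc (e + k).+1 (q w) = 0.
    by rewrite mcoeff_topc Em eqxx mcoeff0 => /eqP; rewrite mcoeff_eq0 mq.
  apply: (@mpoly_regular _ w) => v rv; rewrite addnS in qk.
  apply: topP_uniq (topP_pbw v w qk) _; apply: topP_lift (qE v w rv).
  by rewrite ltnS leq_addr.
have qe : (forall w m, m \in mpoly.msupp (q w) -> xyd m <= e)%N.
  (* Any bound on the degrees starts the descent; the total size of the coefficients is one. *)
  apply: (claim (\sum_w msize (q w))%N) => w m /mpoly.msize_mdeg_lt lt.
  apply: leq_trans (leq_addl _ _); rewrite (bigD1 w) //=; apply: leq_trans (leq_addr _ _).
  apply: leq_trans (ltnW lt); rewrite /xyd mdegE (bigD1 ix) //= (bigD1 iy) //=.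
  by rewrite addnA leq_addr.
split=> // v g rv; exact: topP_uniq (topP_pbw v g qe) (qE v g rv).
Qed.

Lemma faithful z : (forall v f g, regular v -> dunkl_act v z f g = 0) -> z = 0.
Proof.
have [q ->] := pbw_surj zetaP spec z => z0.
have [|qe q0] := @pbw_degree q 0 (fun _ _ => 0).
  by move=> v g rv; apply: topP_ext (topP_0 _ _) => t; rewrite z0.
suff -> : q = 0 by rewrite pbw0.
apply/ffunP => w; rewrite ffunE; apply/mpolyP => m; rewrite mcoeff0; apply/eqP.
rewrite mcoeff_eq0; apply/negP => mq.
have /(congr1 (mcoeff m)) : topc 0 (q w) = 0 by apply: (@mpoly_regular _ w) => v /q0.
have /eqP xm : xyd m == 0%N by rewrite -leqn0 (qe w).
by rewrite mcoeff_topc xm mcoeff0 => /eqP; rewrite mcoeff_eq0 mq.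
Qed.

Lemma pbw_inj : injective pbwA.
Proof.
move=> q q' E; have [|qe q0] := @pbw_degree (q - q') 0 (fun _ _ => 0).
  have pN : pbwA (- q') = - pbwA q'.
    by apply/eqP; rewrite -addr_eq0 -pbw_additive addNr pbw0.
  move=> v g rv; apply: topP_ext (topP_0 _ _) => t.
  by rewrite pbw_additive pN E subrr act_0.
apply/eqP; rewrite -subr_eq0; apply/eqP/ffunP => w; rewrite [RHS]ffunE.
apply/mpolyP => m; rewrite mcoeff0; apply/eqP; rewrite mcoeff_eq0; apply/negP => mq.
have /(congr1 (mcoeff m)) : topc 0 ((q - q') w) = 0 by apply: (@mpoly_regular _ w) => v /q0.
have /eqP xm : xyd m == 0%N by rewrite -leqn0 (qe w).
by rewrite mcoeff_topc xm mcoeff0 => /eqP; rewrite mcoeff_eq0 mq.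
Qed.

End Faithful.

(** * The centre *)

Section Centre.
Variables (C : numFieldType) (zeta : C).
Hypothesis zetaP : 4.-primitive_root zeta.
Variables (H : pzRingType) (sc : {rmorphism C -> H}) (h : 'I_6 -> H) (T : W -> H).
Hypothesis spec : cherednik_spec zeta sc h T.
Variable P : pt C -> {rmorphism H -> 'M[C]_8}.
Hypothesis PP : forall v, dunkl_spec zeta sc h T v (P v).

Local Notation A := (h iA).
Local Notation B := (h iB).
Local Notation X := (h iX).
Local Notation Y := (h iY).
Local Notation x := (h ix).
Local Notation y := (h iy).
Local Notation gact := (W_act zeta).
Local Notation pbwA := (pbw_sum sc h T).
Local Notation act := (dunkl_act P).
Local Notation dl := (delta_w1 C).
Local Notation Z := (centre H).

Lemma act_scale v z c f g : act v z (fun g => c * f g) g = c * act v z f g.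
Proof. exact: app_scaler. Qed.

Lemma centreP (z : Z) u : val z * u = u * val z.
Proof. by case: z => z zC /=; move/centralP: zC. Qed.

(** A reflection s_i that fixes the pair (X, Y) gives X = ζ^i Y, hence X^4 = Y^4. A rotation that
    fixes it is trivial, because X or Y is nonzero. *)
Lemma regular_free v g k : regular v -> pX (gact g v) = pX (gact k v) ->
  pY (gact g v) = pY (gact k v) -> g = k.
Proof.
have E w u : regular u -> pX (gact w u) = pX u -> pY (gact w u) = pY u -> w = w1.
  have zn n : zeta ^+ n ^+ 4 = 1 by rewrite exprAC (zeta4 zetaP) expr1n.
  have z1 (n : 'I_4) : zeta ^+ n = 1 -> n = 0.
    move=> /eqP; rewrite -(expr0 zeta) (eq_prim_root_expr zetaP) mod0n modn_small //.
    by move=> /eqP n0; apply: val_inj.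
  case: u => a b X0 Y0 x0 y0; case: w => n []; rewrite /W_act /regular /= => r EX EY.
    by rewrite -EX exprMn zn mul1r eqxx in r.
  suff -> : n = 0 by congr pair; apply: val_inj.
  have [X00|X0n] := eqVneq X0 0; last first.
    by apply: z1; apply: (mulIf X0n); rewrite EX mul1r.
  have Y0n : Y0 != 0 by apply: contraNneq r => ->; rewrite X00.
  have : zeta ^+ (3 * n) = 1 by apply: (mulIf Y0n); rewrite EY mul1r.
  rewrite -(zeta_expV zetaP) => /(congr1 GRing.inv); rewrite invrK invr1; exact: z1.
move=> rv; rewrite -[g]mulW1 -(mulVW k) mulWA (gactM zetaP) => EX EY.
by rewrite (E _ _ _ EX EY) ?(regular_gact zetaP) // mul1W.
Qed.

Definition delta (k g : W) : C := (g == k)%:R.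

Lemma act_delta v z f g : act v z f g = \sum_k act v z (delta k) g * f k.
Proof.
apply: eq_bigr => k _; congr (_ * _); rewrite /dunkl_act /app (bigD1 k) //= /delta eqxx mulr1.
by rewrite big1 ?addr0 // => j /negPf ->; rewrite mulr0.
Qed.

Definition ev v (z : Z) : C := act v (val z) dl w1.

(** Commutation with X and Y makes z diagonal, since these two coordinates separate the points of a
    regular orbit. Commutation with T g makes all the diagonal entries equal. *)
Lemma ev_act v z f g : regular v -> act v (val z) f g = ev v z * f g.
Proof.
move=> rv; have D k j : j != k -> act v (val z) (delta k) j = 0.
  move=> jk.
  have EX : (pX (gact j v) - pX (gact k v)) * act v (val z) (delta k) j = 0.
    apply/eqP; rewrite mulrBl subr_eq0 -(act_X PP) -!act_Mg -centreP act_Mg.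
    rewrite (_ : act v X _ = fun g => pX (gact k v) * delta k g) ?act_scale //.
    apply/funext => i; rewrite (act_X PP) /delta; case: eqP => [->|] //.
    by rewrite !mulr0.
  have EY : (pY (gact j v) - pY (gact k v)) * act v (val z) (delta k) j = 0.
    apply/eqP; rewrite mulrBl subr_eq0 -(act_Y PP) -!act_Mg -centreP act_Mg.
    rewrite (_ : act v Y _ = fun g => pY (gact k v) * delta k g) ?act_scale //.
    apply/funext => i; rewrite (act_Y PP) /delta; case: eqP => [->|] //.
    by rewrite !mulr0.
  apply/eqP; apply: contraNT jk => ne0; apply/eqP; apply: (regular_free rv).
    by apply/eqP; rewrite -subr_eq0; apply/eqP; apply: (mulIf ne0); rewrite EX mul0r.
  by apply/eqP; rewrite -subr_eq0; apply/eqP; apply: (mulIf ne0); rewrite EY mul0r.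
rewrite act_delta (bigD1 g) //= big1 ?addr0 => [|k]; last first.
  by rewrite eq_sym => /D ->; rewrite mul0r.
congr (_ * _); transitivity (act v (T g) (act v (val z) dl) g); last first.
  by rewrite (act_T PP) mulVW.
rewrite -act_Mg -centreP act_Mg; congr (act v (val z) _ g); apply/funext => k.
by rewrite (act_T PP) /delta /delta_w1 (can2_eq (mulVKW g) (mulKW g)) mulW1.
Qed.

Lemma cvalB (z z' : Z) : val (z - z') = val z - val z'. Proof. exact: rmorphB. Qed.
Lemma cvalM (z z' : Z) : val (z * z') = val z * val z'. Proof. exact: rmorphM. Qed.
Lemma cval1 : val (1 : Z) = 1. Proof. exact: rmorph1. Qed.

Lemma ev_zmod v : zmod_morphism (ev v).
Proof. by move=> z z'; rewrite /ev cvalB act_D act_N. Qed.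

Lemma ev_monoid v : regular v -> monoid_morphism (ev v).
Proof.
move=> rv; split=> [|z z']; first by rewrite /ev cval1 act_1 /delta_w1 eqxx.
by rewrite /ev cvalM act_Mg (ev_act _ _ _ rv).
Qed.

Definition evR v (rv : regular v) : {rmorphism Z -> C} := mk_rmorph (ev_zmod v) (ev_monoid rv).

Lemma ev_inj z z' : (forall v, regular v -> ev v z = ev v z') -> z = z'.
Proof.
move=> E; apply/val_inj/eqP; rewrite -subr_eq0; apply/eqP.
apply: (faithful zetaP spec PP) => v f g rv.
by rewrite act_D act_N !ev_act // E // subrr.
Qed.

(** Scalars commute with every operator, and faithfulness carries this back to the algebra. *)
Lemma scalar_central z (k : pt C -> C) :
  (forall v f g, regular v -> act v z f g = k v * f g) -> z \in @central H.
Proof.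
move=> E; apply/centralP => u; apply/eqP; rewrite -subr_eq0; apply/eqP.
apply: (faithful zetaP spec PP) => v f g rv.
rewrite act_D act_N !act_Mg E // (_ : act v z f = fun g => k v * f g).
  by rewrite act_scale subrr.
by apply/funext => j; rewrite E.
Qed.

Lemma central_gens z : (forall i, z * h i = h i * z) -> (forall w, z * T w = T w * z) ->
  z \in @central H.
Proof.
move=> zh zT; apply/centralP; apply: (spec_ind spec) => [|u u' E E'|c u E|i u E|w u E].
- by rewrite mulr1 mul1r.
- by rewrite mulrDr mulrDl E E'.
- by rewrite (spec_scZ spec) E mulrA.
- by rewrite mulrA zh -mulrA E mulrA.
- by rewrite mulrA zT -mulrA E mulrA.
Qed.

Lemma toZE z : z \in @central H -> val (toZ z) = z.
Proof. by move=> zC; rewrite /toZ insubdK. Qed.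

End Centre.

(** The defect d0 of commuting u with z is turned by u into d1, d2, d3 in succession, and each time
    u becomes u'. In the application the defects are multiples of [refl_sum], and u, u' are the two
    members of a doublet. *)
Lemma pow4_comm (H : pzRingType) (u u' z d0 d1 d2 d3 : H) :
  u * z = z * u + d0 -> u * d0 = d1 * u' -> u * d1 = d2 * u' -> u * d2 = d3 * u' ->
  u ^+ 4 * z = z * u ^+ 4 +
    (d3 * u' ^+ 3 + d2 * u' ^+ 2 * u + d1 * u' * u ^+ 2 + d0 * u ^+ 3).
Proof.
move=> uz u0 u1 u2.
have step n E : u ^+ n * z = z * u ^+ n + E ->
    u ^+ n.+1 * z = z * u ^+ n.+1 + (u * E + d0 * u ^+ n).
  move=> Hn; rewrite exprS -mulrA Hn mulrDr mulrA uz mulrDl -!addrA.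
  by rewrite -mulrA [d0 * _ + _]addrC.
have E1 : u ^+ 1 * z = z * u ^+ 1 + d0 by rewrite expr1.
have := step _ _ E1; rewrite u0 expr1 => E2.
have := step _ _ E2.
rewrite mulrDr (mulrA u d1 u') (mulrA u d0 u) u1 u0 -(mulrA d2) -[u' * u']expr2 => E3.
rewrite (step _ _ E3) !mulrDr (mulrA u d2) u2 (mulrA u (d1 * u')) (mulrA u d1) u1.
by rewrite (mulrA u d0) u0 -(mulrA d3 u') -(exprS u' 2) -(mulrA d2 u' u') -[u' * u']expr2 !addrA.
Qed.

Section CentralElements.
Variables (C : fieldType) (zeta : C).
Hypothesis zetaP : 4.-primitive_root zeta.
Variables (H : pzRingType) (sc : {rmorphism C -> H}) (h : 'I_6 -> H) (T : W -> H).
Hypothesis spec : cherednik_spec zeta sc h T.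

Local Notation A := (h iA).
Local Notation B := (h iB).
Local Notation X := (h iX).
Local Notation Y := (h iY).
Local Notation x := (h ix).
Local Notation y := (h iy).
Local Notation S_ := (refl_sum zeta sc h T).
Local Notation hC := (hpar h).

Lemma S_mod k : S_ (k + 4) = S_ k.
Proof.
apply: eq_bigr => i _; congr (sc _ * _).
by rewrite mulnDl exprD (exprM zeta 4) (zeta4 zetaP) expr1n mulr1.
Qed.

(* The pairs (p, q) that W transforms like (x, y). *)
Definition doublet (p q : H) : Prop := p * q = q * p /\
  forall w, p * T w = sc (zeta ^- w.1) * (T w * (if w.2 then q else p)) /\
            q * T w = sc (zeta ^+ w.1) * (T w * (if w.2 then p else q)).

Lemma doublet_xy : doublet x y.
Proof.
split=> [|w]; first exact: (xyC spec).
rewrite (x_T zetaP spec) (y_T zetaP spec); split; case: ifP => _; exact: (spec_scZ spec).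
Qed.

Lemma doublet_YX : doublet Y X.
Proof.
have E (w : W) z z' c : c != 0 -> T w * z' = sc c * z * T w -> z * T w = sc c^-1 * (T w * z').
  by move=> c0 ->; rewrite !mulrA -rmorphM mulVf // rmorph1 mul1r.
have zi i : zeta ^+ i != 0 by exact/expf_neq0/(zeta_neq0 zetaP).
split=> [|w]; first exact/esym/(XYC spec).
split; case E2 : w.2.
- by apply: E => //; rewrite (T_X zetaP spec) E2.
- by apply: E => //; rewrite (T_Y zetaP spec) E2.
- rewrite -[zeta ^+ _]invrK; apply: E; first by rewrite invr_eq0.
  by rewrite (T_Y zetaP spec) E2.
- rewrite -[zeta ^+ _]invrK; apply: E; first by rewrite invr_eq0.
  by rewrite (T_X zetaP spec) E2.
Qed.

(** X and Y commute, so adding multiples of them to x and y leaves the commutators with X and Y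
    unchanged. *)
Lemma comm_xl l (p := x + sc l * Y) (q := y + sc l * X) :
  [/\ p * X = X * p - S_ 0, p * Y = Y * p + S_ 1, q * X = X * q + S_ 3 & q * Y = Y * q - S_ 0].
Proof.
have E u v : sc l * u * v = v * (sc l * u) + sc l * (u * v - v * u).
  by rewrite (spec_scZ spec) -mulrDr addrC subrK mulrA.
by rewrite /p /q !mulrDl !mulrDr !E (XYC spec) !subrr !mulr0 !addr0
  (comm_xX zetaP spec) (comm_xY zetaP spec) (comm_yX zetaP spec) (comm_yY zetaP spec);
  split; rewrite addrAC.
Qed.

(** W transforms (Y, X) like (x, y), hence also the combinations. The two new elements commute
    because [x, X] = [y, Y]. *)
Lemma doublet_xl l : doublet (x + sc l * Y) (y + sc l * X).
Proof.
have [xy dxy] := doublet_xy; have [YX dYX] := doublet_YX; split=> [|w].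
  rewrite !mulrDl !mulrDr xy -!mulrA !(spec_scZ spec) YX -!addrA; congr (_ + _).
  rewrite !addrA; congr (_ + _); rewrite -!mulrDr; congr (_ * _).
  rewrite (comm_xX zetaP spec) (comm_yY zetaP spec).
  by rewrite addrC [RHS]addrAC addrA.
have [E1 E2] := dxy w; have [F1 F2] := dYX w.
rewrite !mulrDl E1 E2 -!mulrA F1 F2; split; rewrite (spec_scZ spec) -mulrDr;
  congr (_ * _); rewrite -(spec_scZ spec) -mulrDr; by case: ifP.
Qed.

Section Doublet.
Variables p q : H.
Hypothesis dpq : doublet p q.

Let pq : p * q = q * p. Proof. by case: dpq. Qed.

Lemma doublet_S k : p * S_ k = S_ k.+1 * q /\ q * S_ k = S_ (k + 3) * p.
Proof.
have [_ d] := dpq; split; rewrite mulr_sumr mulr_suml; apply: eq_bigr => i _.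
  have [/= E _] := d (reflW i).
  rewrite (spec_scZ spec) (mulrA p) -(hC_central spec) -(mulrA (hC i)) E (spec_scZ spec) !mulrA -rmorphM.
  by congr (sc _ * _ * _ * _); rewrite -invfM -exprD mulSn addnC.
have [/= _ E] := d (reflW i).
rewrite (spec_scZ spec) (mulrA q) -(hC_central spec) -(mulrA (hC i)) E (spec_scZ spec) !mulrA -rmorphM.
congr (sc _ * _ * _ * _); rewrite !(zeta_expV zetaP) -exprD mulnDl.
rewrite (_ : 3 * (k * i + 3 * i) = (3 * (k * i) + i) + 4 * (2 * i))%N; last by lia.
by rewrite [in RHS]exprD (exprM zeta 4) (zeta4 zetaP) expr1n mulr1.
Qed.

Let pS k : p * S_ k = S_ k.+1 * q. Proof. by case: (doublet_S k). Qed.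
Let qS k : q * S_ k = S_ (k + 3) * p. Proof. by case: (doublet_S k). Qed.

Variables (z : H) (e : C) (k : nat).
Hypothesis pz : p * z = z * p + sc e * S_ k.
Hypothesis qz : q * z = z * q - sc e * S_ (k + 3).

(** Moving p through S_(k+3) produces S_(k+4) = S_k followed by q, and this cancels the defect of
    p. *)
Lemma doublet_mul_comm : p * q * z = z * (p * q).
Proof.
rewrite -mulrA qz mulrBr mulrA pz mulrDl (spec_scZ spec) pS -addnS S_mod.
by rewrite !mulrA addrK.
Qed.

(** By the periodicity of S, the expansions of [p^4, z] and [q^4, z] from [pow4_comm] consist of the
    same four terms, in reverse order and with opposite signs. *)
Lemma doublet_pow4_comm : (p ^+ 4 + q ^+ 4) * z = z * (p ^+ 4 + q ^+ 4).
Proof.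
pose s j := sc e * S_ j.
have s4 j : s (j + 4)%N = s j by rewrite /s S_mod.
have ps j : p * s j = s j.+1 * q by rewrite /s (spec_scZ spec) pS mulrA.
have qs j : q * - s j.+1 = - s j * p by rewrite mulrN mulNr /s (spec_scZ spec) qS addSnnS S_mod mulrA.
have q0 : q * z = z * q + - s (k + 3)%N by [].
have s3 : s (k + 3)%N = s k.+3 by rewrite addn3.
rewrite s3 in q0.
rewrite mulrDl mulrDr (pow4_comm pz (ps k) (ps k.+1) (ps k.+2)).
rewrite (pow4_comm q0 (qs k.+2) (qs k.+1) (qs k)) addrACA.
rewrite [X in _ + X](_ : _ = 0) ?addr0 // !mulNr -!opprD.
have c1 : q ^+ 2 * p = p * q ^+ 2 by apply/esym/commrX.
have c2 : p ^+ 2 * q = q * p ^+ 2 by apply/esym/commrX/esym.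
rewrite -!(mulrA (s _)) c1 c2 -/(s k).
apply/eqP; rewrite subr_eq0; apply/eqP.
by rewrite (AC (1*1*1*1) (4*3*2*1)).
Qed.

End Doublet.

End CentralElements.

Section MoreCentralElements.
Variables (C : numFieldType) (zeta : C).
Hypothesis zetaP : 4.-primitive_root zeta.
Variables (H : pzRingType) (sc : {rmorphism C -> H}) (h : 'I_6 -> H) (T : W -> H).
Hypothesis spec : cherednik_spec zeta sc h T.

Local Notation A := (h iA).
Local Notation B := (h iB).
Local Notation X := (h iX).
Local Notation Y := (h iY).
Local Notation x := (h ix).
Local Notation y := (h iy).
Local Notation S_ := (refl_sum zeta sc h T).
Local Notation doublet := (doublet zeta sc T).

Lemma doublet_T p q w : doublet p q ->
  (p * q) * T w = T w * (p * q) /\ (p ^+ 4 + q ^+ 4) * T w = T w * (p ^+ 4 + q ^+ 4).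
Proof.
move=> [pq d]; have [E1 E2] := d w.
have pw (u u' : H) c n : u * T w = sc c * (T w * u') -> u ^+ n * T w = sc (c ^+ n) * (T w * u' ^+ n).
  move=> E; elim: n => [|n IH]; first by rewrite !expr0 rmorph1 !mul1r mulr1.
  rewrite exprSr -mulrA E (spec_scZ spec) (mulrA (u ^+ n)) IH.
  by rewrite !mulrA -rmorphM -exprS -!mulrA -exprSr.
have zi i : zeta ^+ i != 0 by exact/expf_neq0/(zeta_neq0 zetaP).
have z4 i : (zeta ^+ i) ^+ 4 = 1 by rewrite exprAC (zeta4 zetaP) expr1n.
split.
  rewrite -mulrA E2 (spec_scZ spec) (mulrA p) E1 -!mulrA (mulrA (sc _)) -rmorphM divff // rmorph1 mul1r.
  by case: ifP => _; rewrite ?pq.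
rewrite mulrDl (pw _ _ _ _ E1) (pw _ _ _ _ E2) exprVn z4 invr1 rmorph1 !mul1r mulrDr.
by case: ifP => _ //; rewrite addrC.
Qed.

(* Central for every l. Its expansion in l is
   r + 4 l a1 + l^2 (6 a2 + 4 (A^2 - B^2)) + 4 l^3 a3 + l^4 R, hence a1 and a3 (ca1
   and ca3 below) by interpolation at l = 1, -1, 2, -2. *)
Definition rl l : H := (x + sc l * Y) ^+ 4 + (y + sc l * X) ^+ 4.

Let AB_comm z : (z * A = A * z) * (z * B = B * z).
Proof. by rewrite (spec_A spec) (spec_B spec). Qed.

Lemma sum_pow4_comm (p q : H) : p * q = q * p -> (p ^+ 4 + q ^+ 4) * p = p * (p ^+ 4 + q ^+ 4).
Proof.
move=> pq; rewrite mulrDl mulrDr -exprSr -exprS; congr (_ + _).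
by apply/esym/commrX.
Qed.

Lemma gens_central z : z * X = X * z -> z * Y = Y * z -> z * x = x * z -> z * y = y * z ->
  (forall w, z * T w = T w * z) -> z \in @central H.
Proof.
move=> zX zY zx zy zT; apply: (central_gens spec) => // i.
case: i => [[|[|[|[|[|[|//]]]]]] lt_i].
- by rewrite (_ : Ordinal _ = iA) ?AB_comm //; exact: val_inj.
- by rewrite (_ : Ordinal _ = iB) ?AB_comm //; exact: val_inj.
- by rewrite (_ : Ordinal _ = iX) //; exact: val_inj.
- by rewrite (_ : Ordinal _ = iY) //; exact: val_inj.
- by rewrite (_ : Ordinal _ = ix) //; exact: val_inj.
- by rewrite (_ : Ordinal _ = iy) //; exact: val_inj.
Qed.

Let NegOne k : - S_ k = sc (-1) * S_ k. Proof. by rewrite rmorphN rmorph1 mulN1r. Qed.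
Let One k : S_ k = sc 1 * S_ k. Proof. by rewrite rmorph1 mul1r. Qed.
Let NNegOne k : S_ k = - (sc (-1) * S_ k). Proof. by rewrite -NegOne opprK. Qed.
Let NOne k : - S_ k = - (sc 1 * S_ k). Proof. by rewrite -One. Qed.

(** The computation with doublets gives commutation with X, Y and W. As a sum of fourth powers of
    two commuting elements, [rl l] commutes with x + lY and y + lX, hence with x and y. *)
Lemma rl_central l : rl l \in @central H.
Proof.
have dp := doublet_xl zetaP spec l; have [pq _] := dp.
have [pX pY qX qY] := comm_xl zetaP spec l.
rewrite NegOne in pX; rewrite NNegOne in qX; rewrite One in pY; rewrite NOne in qY.
have rX : rl l * X = X * rl l by exact: (doublet_pow4_comm zetaP spec dp pX qX).
have rY : rl l * Y = Y * rl l.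
  by apply: (doublet_pow4_comm zetaP spec dp pY); rewrite (S_mod zetaP _ _ _ 0).
have rp : rl l * (x + sc l * Y) = (x + sc l * Y) * rl l.
  exact: sum_pow4_comm.
have rq : rl l * (y + sc l * X) = (y + sc l * X) * rl l.
  by rewrite /rl addrC; apply: sum_pow4_comm.
have rT w : rl l * T w = T w * rl l by case: (doublet_T w dp).
move: (rl l) rX rY rp rq rT => r rX rY rp rq rT; apply: gens_central => //.
  by move: rp; rewrite mulrDr mulrDl (spec_scZ spec) rY mulrA; apply: addIr.
by move: rq; rewrite mulrDr mulrDl (spec_scZ spec) rX mulrA; apply: addIr.
Qed.

Lemma xy_central : x * y \in @central H.
Proof.
have dp := doublet_xy zetaP spec; have xyC := xyC spec.
apply: gens_central => [||||w]; last by case: (doublet_T w dp).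
- have := comm_xX zetaP spec; rewrite NegOne => pX.
  have := comm_yX zetaP spec; rewrite NNegOne => qX.
  exact: (doublet_mul_comm zetaP spec dp pX qX).
- have := comm_xY zetaP spec; rewrite One => pX.
  have := comm_yY zetaP spec; rewrite NOne -(S_mod zetaP _ _ _ 0) => qX.
  exact: (doublet_mul_comm zetaP spec dp pX qX).
- by rewrite -mulrA -xyC.
- by rewrite mulrA -xyC.
Qed.

Lemma YX_comm (dp := doublet_YX zetaP spec) : Y * X \in @central H /\ (Y ^+ 4 + X ^+ 4) \in @central H.
Proof.
have XYC := XYC spec.
have Yx : Y * x = x * Y + sc (-1) * S_ 1.
  by rewrite -NegOne (comm_xY zetaP spec) addrK.
have Xx : X * x = x * X - sc (-1) * S_ (1 + 3).
  by rewrite -NNegOne (S_mod zetaP _ _ _ 0) (comm_xX zetaP spec) subrK.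
have Yy : Y * y = y * Y + sc 1 * S_ 0.
  by rewrite -One (comm_yY zetaP spec) subrK.
have Xy : X * y = y * X - sc 1 * S_ (0 + 3).
  by rewrite -One (comm_yX zetaP spec) addrK.
split; apply: gens_central => [||||w].
- by rewrite mulrA XYC.
- by rewrite -mulrA XYC.
- exact: (doublet_mul_comm zetaP spec dp Yx Xx).
- exact: (doublet_mul_comm zetaP spec dp Yy Xy).
- by case: (doublet_T w dp).
- by rewrite addrC; apply: sum_pow4_comm.
- exact: sum_pow4_comm.
- exact: (doublet_pow4_comm zetaP spec dp Yx Xx).
- exact: (doublet_pow4_comm zetaP spec dp Yy Xy).
- by case: (doublet_T w dp).
Qed.

(** The PBW form of [eu]. The reflections are the correction that makes Xx + Yy central; they have
    no component at 1 in W, so [Trunc] does not see them. *)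
Definition euH : H := X * x + Y * y - S_ 0.
(** The PBW form of [a2]. The last term sits at the element -1 of W, which is [el 2 false]; it is
    the only one without x, y, X and Y, and therefore decides the value of [a2] on a baby Verma
    module. *)
Definition a2H : H := Y ^+ 2 * x ^+ 2 + X ^+ 2 * y ^+ 2 + Y * S_ 1 * x + X * S_ 3 * y
  + X * S_ 2 * x + Y * S_ 2 * y - 2%:R * (A ^+ 2 - B ^+ 2) * T (el 2 false).

End MoreCentralElements.

(** * The scalars by which the central elements act *)

Section Values.
Variables (C : numFieldType) (zeta : C).
Hypothesis zetaP : 4.-primitive_root zeta.
Variables (H : pzRingType) (sc : {rmorphism C -> H}) (h : 'I_6 -> H) (T : W -> H).
Hypothesis spec : cherednik_spec zeta sc h T.
Variable P : pt C -> {rmorphism H -> 'M[C]_8}.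
Hypothesis PP : forall v, dunkl_spec zeta sc h T v (P v).

Local Notation A := (h iA).
Local Notation B := (h iB).
Local Notation X := (h iX).
Local Notation Y := (h iY).
Local Notation x := (h ix).
Local Notation y := (h iy).
Local Notation gact := (W_act zeta).
Local Notation act := (dunkl_act P).
Local Notation S_ := (refl_sum zeta sc h T).
Let z2 : zeta ^+ 2 = -1 := zeta2 zetaP.

Lemma act_S v k f g : act v (S_ k) f g =
  parA v * f (mulW (el 0 true) g) + (-1) ^+ k * parA v * f (mulW (el 2 true) g) +
  zeta ^+ (3 * k) * parB v * f (mulW (el 1 true) g) + zeta ^+ k * parB v * f (mulW (el 3 true) g).
Proof.
rewrite /refl_sum act_sum big_ord4 !act_Mg !(act_sc PP) /hpar /=.
rewrite !act_Mg !(act_A PP) !(act_B PP) !(act_T PP).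
rewrite -[reflW (inZp 0)]/(el 0 true) -[reflW (inZp 1)]/(el 1 true).
rewrite -[reflW (inZp 2)]/(el 2 true) -[reflW (inZp 3)]/(el 3 true) !el_inv /= ?modn_small //.
rewrite muln0 expr0 invr1 muln1 (mulnC k 2) (mulnC k 3) !(zeta_expV zetaP) (mulnA 3).
rewrite (_ : zeta ^+ (3 * 2 * k) = (-1) ^+ k); last first.
  by rewrite exprM; congr (_ ^+ k); ring: z2.
rewrite (_ : zeta ^+ (3 * (3 * k)) = zeta ^+ k); last first.
  by rewrite mulnA exprM; congr (_ ^+ k); ring: z2.
by ring.
Qed.

Lemma euH_act v f g : act v (euH zeta sc h T) f g = (px v * pX v + py v * pY v) * f g.
Proof.
have -> : px v * pX v + py v * pY v = px (gact g v) * pX (gact g v) + py (gact g v) * pY (gact g v).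
  case: v => a b X0 Y0 x0 y0; by elim/elP: g; rewrite /W_act /=; ring: z2.
rewrite /euH act_D act_N act_D !act_Mg act_S (act_X PP) (act_Y PP) (act_x PP) (act_y zetaP PP).
rewrite -(parA_gact zetaP v g) -(parB_gact zetaP v g) /dcoef.
case: (gact g v) => a b X0 Y0 x0 y0 /=; by ring: z2.
Qed.

(** The scalar of [a2H] at v. Its parameter terms are 2 b^2 (X^2 - Y^2)^2 - 2 a^2 (X^2 + Y^2)^2,
    which for Y = 0 is -2 (A^2 - B^2). *)
Definition kappa (v : pt C) : C := let: Pt a b X Y x y := v in
  Y ^+ 2 * x ^+ 2 + X ^+ 2 * y ^+ 2 + 2 * b ^+ 2 * (Y ^+ 4 + X ^+ 4 - 2 * X ^+ 2 * Y ^+ 2)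
  - 2 * a ^+ 2 * (Y ^+ 4 + X ^+ 4 + 2 * X ^+ 2 * Y ^+ 2).

Lemma a2H_act v f g : act v (a2H zeta sc h T) f g = kappa v * f g.
Proof.
have -> : kappa v = kappa (gact g v).
  case: v => a b X0 Y0 x0 y0; by elim/elP: g; rewrite /W_act /=; ring: z2.
rewrite /a2H -(rmorph_nat sc) !act_D act_N !act_Mg !(act_X PP) !(act_Y PP) !act_S.
rewrite (act_sc PP) act_D act_N !act_Mg !(act_A PP) !(act_B PP) (act_T PP).
rewrite [act v x (act v x f) g](act_x PP) [act v y (act v y f) g](act_y zetaP PP).
rewrite !(act_x PP) !(act_y zetaP PP) !(gactM zetaP) !mulWA.
rewrite -(parA_gact zetaP v g) -(parB_gact zetaP v g) /dcoef.
case: (gact g v) => a b X0 Y0 x0 y0; rewrite !el_mul !el_inv /=; norm_el.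
rewrite ?el0 ?mul1W; by ring: z2.
Qed.

(** At v, x + lY and y + lX act as x and y do at the shifted point; so the value of [rl l] at v is
    that of r = [rl 0] at the shifted point. *)
Definition shiftv (l : C) (v : pt C) : pt C :=
  Pt (pa v) (pb v) (pX v) (pY v) (px v + l * pY v) (py v + l * pX v).

Lemma gact_shiftv l v g : gact g (shiftv l v) = shiftv l (gact g v).
Proof.
case: v => a b X0 Y0 x0 y0; elim/elP: g; rewrite /W_act /shiftv /=; congr Pt; by ring: z2.
Qed.

Lemma act_xl l v f g : act v (x + sc l * Y) f g = act (shiftv l v) x f g.
Proof.
rewrite act_D act_Mg (act_sc PP) (act_Y PP) !(act_x PP) gact_shiftv /dcoef /=.
by ring.
Qed.
Lemma act_yl l v f g : act v (y + sc l * X) f g = act (shiftv l v) y f g.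
Proof.
rewrite act_D act_Mg (act_sc PP) (act_X PP) !(act_y zetaP PP) gact_shiftv /dcoef /=.
by ring.
Qed.

Lemma act_pow_shift v v' u u' k f g : (forall f g, act v u f g = act v' u' f g) ->
  act v (u ^+ k) f g = act v' (u' ^+ k) f g.
Proof.
move=> E; elim: k g => [|k IH] g; first by rewrite !expr0 !act_1.
by rewrite !exprS !act_Mg E; congr (act v' u' _ g); apply/funext.
Qed.

(** The scalar of x^4 + y^4 at v. *)
Definition rho (v : pt C) : C := let: Pt a b X Y x y := v in
  x ^+ 4 + y ^+ 4
  - 8 * a ^+ 2 * (Y ^+ 2 * y ^+ 2 + Y ^+ 2 * x ^+ 2 + 2 * X * Y * x * y + X ^+ 2 * y ^+ 2 + X ^+ 2 * x ^+ 2)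
  + 8 * b ^+ 2 * (Y ^+ 2 * x ^+ 2 - Y ^+ 2 * y ^+ 2 - 2 * X * Y * x * y + X ^+ 2 * y ^+ 2 - X ^+ 2 * x ^+ 2)
  + 16 * (a ^+ 2 - b ^+ 2) ^+ 2 * (X ^+ 4 + Y ^+ 4).

(** The scalar of a central element can be read off on the constant function. Since W fixes it,
    Dunkl operators produce from it functions of the point [gact g v] alone. *)
Let one : W -> C := fun _ => 1.

(* x maps the function g |-> F (gact g v) to g |-> dstep F (gact g v). *)
Definition dstep (F : pt C -> C) (u : pt C) : C := px u * F u +
  dcoef zeta 0 u * F (gact (el 0 true) u) + dcoef zeta 1 u * F (gact (el 1 true) u) +
  dcoef zeta 2 u * F (gact (el 2 true) u) + dcoef zeta 3 u * F (gact (el 3 true) u).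

(** The result of x^2 on the constant function 1, tabulated so that x^4 takes only two more Dunkl
    steps. *)
Let F2 (u : pt C) : C := let: Pt a b X Y x y := u in
  - 4 * a ^+ 2 * Y ^+ 2 + 2 * a * X * x + 2 * a * Y * y + 4 * b ^+ 2 * Y ^+ 2
  + 2 * b * X * x + 2 * b * Y * y + x ^+ 2.

Lemma act_dstep v f F g : (forall g, f g = F (gact g v)) -> act v x f g = dstep F (gact g v).
Proof. by move=> E; rewrite (act_x PP) !E !(gactM zetaP). Qed.

Lemma act_x4 v g : act v (x ^+ 4) one g = dstep (dstep F2) (gact g v).
Proof.
rewrite !exprS expr0 mulr1 !act_M; apply: act_dstep => {}g; apply: act_dstep => {}g.
rewrite (@act_dstep v _ (dstep (fun _ => 1))) => [|k]; last exact: act_dstep.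
case: (gact g v) => a b X0 Y0 x0 y0; rewrite /dstep /dcoef /W_act /F2 /=.
by ring: z2.
Qed.

(** The reflection s conjugates y into x and fixes the constant function, so y^4 is x^4 evaluated at
    the reflected point. *)
Lemma act_y4 v g : act v (y ^+ 4) one g = dstep (dstep F2) (gact (el 0 true) (gact g v)).
Proof.
rewrite -(gactM zetaP) -act_x4.
have E : y * T (el 0 true) = T (el 0 true) * x.
  by rewrite (T_x spec) /= expr0 invr1 rmorph1 mul1r.
have E4 k : y ^+ k * T (el 0 true) = T (el 0 true) * x ^+ k.
  by elim: k => [|k IH]; rewrite ?mul1r ?mulr1 // exprS -mulrA IH mulrA E -mulrA -exprS.
transitivity (act v (y ^+ 4 * T (el 0 true)) one g).
  by rewrite act_Mg; congr (act v _ _ g); apply/funext => k; rewrite (act_T PP).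
by rewrite E4 act_Mg (act_T PP) el_inv.
Qed.

Lemma rl_act l v : act v (rl sc h l) one w1 = rho (shiftv l v).
Proof.
rewrite /rl act_D (act_pow_shift _ _ _ (act_xl l v)) (act_pow_shift _ _ _ (act_yl l v)).
rewrite act_x4 act_y4 (gact1 zeta); case: (shiftv l v) => a b X0 Y0 x0 y0.
rewrite /dstep /dcoef /W_act /F2 /rho /=.
by ring: z2.
Qed.

Lemma xy_act v : act v (x * y) one w1 = px v * py v + 4 * (pa v ^+ 2 - pb v ^+ 2) * pX v * pY v.
Proof.
rewrite act_Mg (act_x PP) !(act_y zetaP PP) !(gactM zetaP) (gact1 zeta) /dcoef.
case: v => a b X0 Y0 x0 y0; rewrite /W_act /one /=; by ring: z2.
Qed.

Lemma YX_act v : act v (Y * X) one w1 = pX v * pY v.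
Proof. by rewrite act_Mg (act_Y PP) (act_X PP) (gact1 zeta) mulr1 mulrC. Qed.

Lemma Y4X4_act v : act v (Y ^+ 4 + X ^+ 4) one w1 = pX v ^+ 4 + pY v ^+ 4.
Proof.
rewrite act_D (act_exp _ _ _ (c := fun g => pY (gact g v))) => [|*]; last by rewrite (act_Y PP).
rewrite (act_exp _ _ _ (c := fun g => pX (gact g v))) => [|*]; last by rewrite (act_X PP).
by rewrite (gact1 zeta) !mulr1 addrC.
Qed.

End Values.

(** * The truncation map on the centre *)

Section TruncSection.
Variables (C : numFieldType) (zeta : C).
Hypothesis zetaP : 4.-primitive_root zeta.
Variables (H : pzRingType) (sc : {rmorphism C -> H}) (h : 'I_6 -> H) (T : W -> H).
Hypothesis spec : cherednik_spec zeta sc h T.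
Variable P : pt C -> {rmorphism H -> 'M[C]_8}.
Hypothesis PP : forall v, dunkl_spec zeta sc h T v (P v).

Local Notation A := (h iA).
Local Notation B := (h iB).
Local Notation X := (h iX).
Local Notation Y := (h iY).
Local Notation x := (h ix).
Local Notation y := (h iy).
Local Notation pbwA := (pbw_sum sc h T).
Local Notation Z := (centre H).
Local Notation S_ := (refl_sum zeta sc h T).

Definition TruncA (z : H) : {mpoly C[6]} := (xget [ffun => 0] [set q | pbwA q = z]) w1.
Definition TruncInvA (p : {mpoly C[6]}) : Z := xget 0 [set z : Z | TruncA (val z) = p].

Lemma TruncA_pbw q : TruncA (pbwA q) = q w1.
Proof.
rewrite /TruncA; case: xgetP => [q' _ /= /(pbw_inj zetaP PP) -> //|/(_ q)].
by case.
Qed.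

Lemma TruncA_D z z' : TruncA (z + z') = TruncA z + TruncA z'.
Proof.
have [q ->] := pbw_surj zetaP spec z; have [q' ->] := pbw_surj zetaP spec z'.
by rewrite -pbw_additive !TruncA_pbw ffunE.
Qed.

Lemma TruncA_0 : TruncA 0 = 0.
Proof. by rewrite -(pbw0 sc h T) TruncA_pbw ffunE. Qed.

Lemma TruncA_N z : TruncA (- z) = - TruncA z.
Proof. by apply/eqP; rewrite -addr_eq0 -TruncA_D addNr TruncA_0. Qed.

Lemma TruncA_sum I (r : seq I) (F : I -> H) :
  TruncA (\sum_(i <- r) F i) = \sum_(i <- r) TruncA (F i).
Proof. by elim: r => [|i r IH]; rewrite ?big_nil ?TruncA_0 // !big_cons TruncA_D IH. Qed.

Lemma TruncA_mono c a b i j k l w :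
  TruncA (sc c * (A ^+ a * B ^+ b * (X ^+ i * Y ^+ j) * T w * (x ^+ k * y ^+ l))) =
  (c *: 'X_[mn a b i j k l]) *+ (w == w1).
Proof. by rewrite -mono_mn -pbw_mono TruncA_pbw ffunE eq_sym; case: eqP. Qed.

Lemma TruncA_S i j k l n : TruncA (X ^+ i * Y ^+ j * S_ n * (x ^+ k * y ^+ l)) = 0.
Proof.
rewrite mulr_sumr mulr_suml TruncA_sum big1 // => m _.
rewrite (spec_scZ spec) -mulrA (mulrA (X ^+ i * _)) -(hC_central spec) /hpar.
have n1 : (reflW m == w1) = false by rewrite xpair_eqE andbF.
case: ifP => _.
  have := TruncA_mono (zeta ^- (n * m)) 0 1 i j k l (reflW m).
  by rewrite n1 expr0 mul1r expr1 !mulrA.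
have := TruncA_mono (zeta ^- (n * m)) 1 0 i j k l (reflW m).
by rewrite n1 expr0 mulr1 expr1 !mulrA.
Qed.

Lemma TruncA_id (i j k l : nat) : TruncA (X ^+ i * Y ^+ j * (x ^+ k * y ^+ l)) = 'X_[mn 0 0 i j k l].
Proof.
have := TruncA_mono 1 0 0 i j k l w1.
by rewrite eqxx !expr0 !mul1r rmorph1 mul1r (spec_T1 spec) mulr1 scale1r.
Qed.

Lemma mpolyX_mn (a b i j k l : nat) : 'X_[mn a b i j k l] =
  'X_iA ^+ a * 'X_iB ^+ b * ('X_iX ^+ i * 'X_iY ^+ j) * ('X_ix ^+ k * 'X_iy ^+ l) :> {mpoly C[6]}.
Proof.
rewrite !mpolyXn -!mpolyXD; congr 'X_[_]; apply/mnmP => n.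
rewrite !(mnmDE, mulmnE, mnm1E, mnmE).
by case: n => [[|[|[|[|[|[|//]]]]]] ?]; rewrite ?mul0n ?mul1n ?addn0 ?add0n.
Qed.

Lemma TruncA_euH : TruncA (euH zeta sc h T) = 'X_ix * 'X_iX + 'X_iy * 'X_iY.
Proof.
rewrite /euH TruncA_D TruncA_N TruncA_D.
have := TruncA_id 1 0 1 0; rewrite ?(expr0, expr1, mul1r, mulr1) mpolyX_mn => ->.
have := TruncA_id 0 1 0 1; rewrite ?(expr0, expr1, mul1r, mulr1) mpolyX_mn => ->.
have := TruncA_S 0 0 0 0 0; rewrite ?(expr0, expr1, mul1r, mulr1) => ->.
by rewrite subr0 ?(expr0, expr1, mul1r, mulr1) mulrC ['X_iY * _]mulrC.
Qed.

Lemma TruncA_a2H : TruncA (a2H zeta sc h T) = 'X_ix ^+ 2 * 'X_iY ^+ 2 + 'X_iy ^+ 2 * 'X_iX ^+ 2.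
Proof.
rewrite /a2H !TruncA_D TruncA_N.
have := TruncA_id 0 2 2 0; rewrite ?(expr0, expr1, mul1r, mulr1) mpolyX_mn => ->.
have := TruncA_id 2 0 0 2; rewrite ?(expr0, expr1, mul1r, mulr1) mpolyX_mn => ->.
have := TruncA_S 0 1 1 0 1; rewrite ?(expr0, expr1, mul1r, mulr1) => ->.
have := TruncA_S 1 0 0 1 3; rewrite ?(expr0, expr1, mul1r, mulr1) => ->.
have := TruncA_S 1 0 1 0 2; rewrite ?(expr0, expr1, mul1r, mulr1) => ->.
have := TruncA_S 0 1 0 1 2; rewrite ?(expr0, expr1, mul1r, mulr1) => ->.
have n1 : (el 2 false == w1) = false by [].
have -> : 2%:R * (A ^+ 2 - B ^+ 2) * T (el 2 false) =
  sc 2 * (A ^+ 2 * B ^+ 0 * (X ^+ 0 * Y ^+ 0) * T (el 2 false) * (x ^+ 0 * y ^+ 0)) +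
  sc (- 2) * (A ^+ 0 * B ^+ 2 * (X ^+ 0 * Y ^+ 0) * T (el 2 false) * (x ^+ 0 * y ^+ 0)).
  by rewrite !expr0 !mulr1 !mul1r rmorphN rmorph_nat mulNr -mulrBr -mulrA mulrBl.
rewrite TruncA_D !TruncA_mono n1 !mulr0n !addr0 subr0 ?(expr0, mul1r, mulr1).
by rewrite mulrC ['X_iX ^+ 2 * _]mulrC.
Qed.

(** A central element sends [delta_w1] to a multiple of itself, so away from 1 in W the part of
    highest degree of q has only zero values; at 1 it is zero by hypothesis. Descent on the degree
    follows. *)
Lemma trunc_inj0 q : pbwA q \in @central H -> q w1 = 0 -> q = 0.
Proof.
move=> qC q1; have claim d : (forall w m, m \in mpoly.msupp (q w) -> xyd m < d)%N -> q = 0.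
  elim: d => [|d IH] qd.
    apply/ffunP => w; rewrite ffunE; apply/mpolyP => m; rewrite mcoeff0; apply/eqP.
    by rewrite mcoeff_eq0; apply/negP => /qd.
  apply: IH => w m mq; have := qd w m mq; rewrite ltnS leq_eqVlt => /orP[/eqP md|//].
  have [w1E|wn1] := eqVneq w w1; first by move: mq; rewrite w1E q1 msupp0.
  suff /(congr1 (mcoeff m)) : topc d (q w) = 0.
    by rewrite mcoeff_topc md eqxx mcoeff0 => /eqP; rewrite mcoeff_eq0 mq.
  apply: (@mpoly_regular _ _ zetaP _ w) => v rv.
  apply: topP_uniq (topP_pbw zetaP PP v w qd) _; apply: topP_ext (topP_0 _ _) => t.
  rewrite -(toZE qC) (ev_act zetaP PP) // /delta_w1 (negPf wn1) mulr0 //.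
apply: (claim (\sum_w msize (q w)).+1%N) => w m /mpoly.msize_mdeg_lt lt; rewrite ltnS.
rewrite (bigD1 w) //=; apply: leq_trans (leq_addr _ _).
apply: leq_trans (ltnW lt); rewrite /xyd mdegE (bigD1 ix) //= (bigD1 iy) //=.
by rewrite addnA leq_addr.
Qed.

(** The choice made by [xget] is some central element with the same truncation as z, and
    [trunc_inj0] forces it to be z. *)
Lemma TruncInvAE z : z \in @central H -> TruncInvA (TruncA z) = toZ z.
Proof.
move=> zC; rewrite /TruncInvA; case: xgetP => [z' _ /= E|/(_ (toZ z))]; last first.
  by case; rewrite /= toZE.
apply/val_inj; rewrite toZE //; move: E zC; have [q qE] := pbw_surj zetaP spec (val z').
have [q' ->] := pbw_surj zetaP spec z; rewrite qE !TruncA_pbw => E zC.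
have N u : pbwA (- u) = - pbwA u.
  by apply/eqP; rewrite -addr_eq0 -pbw_additive addNr pbw0.
suff /subr0_eq E' : q - q' = 0 by apply: etrans qE _; rewrite E'.
apply: trunc_inj0; last by rewrite !ffunE E subrr.
rewrite pbw_additive N -qE -(toZE zC).
by apply/centralP => u; rewrite mulrBl mulrBr !centreP.
Qed.

End TruncSection.

Section ElementsOfZ.
Variables (C : numFieldType) (zeta : C).
Hypothesis zetaP : 4.-primitive_root zeta.
Variables (H : pzRingType) (sc : {rmorphism C -> H}) (h : 'I_6 -> H) (T : W -> H).
Hypothesis spec : cherednik_spec zeta sc h T.
Variable P : pt C -> {rmorphism H -> 'M[C]_8}.
Hypothesis PP : forall v, dunkl_spec zeta sc h T v (P v).

Local Notation A := (h iA).
Local Notation B := (h iB).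
Local Notation X := (h iX).
Local Notation Y := (h iY).
Local Notation x := (h ix).
Local Notation y := (h iy).
Local Notation Z := (centre H).
Local Notation ev := (ev P).
Local Notation act := (dunkl_act P).
Local Notation gact := (W_act zeta).
Let z2 : zeta ^+ 2 = -1 := zeta2 zetaP.

Definition cs (c : C) : Z := toZ (sc c).
Definition cA : Z := toZ A.
Definition cB : Z := toZ B.
Definition cq : Z := toZ (x * y).
Definition cQ : Z := toZ (Y * X).
Definition cR : Z := toZ (X ^+ 4 + Y ^+ 4).
Definition crl (l : C) : Z := toZ (rl sc h l).
Definition cr : Z := toZ (x ^+ 4 + y ^+ 4).
Definition ceu : Z := toZ (euH zeta sc h T).
Definition ca2 : Z := toZ (a2H zeta sc h T).
(** The differences at l = 1, -1 and at l = 2, -2 are 8 a1 + 8 a3 and 16 a1 + 64 a3; eliminating a3,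
    or a1 for the next definition, leaves the factor 48. *)
Definition ca1 : Z := cs 48^-1 * (cs 8 * (crl 1 - crl (-1)) - (crl 2 - crl (-2))).
Definition ca3 : Z := cs 48^-1 * ((crl 2 - crl (-2)) - cs 2 * (crl 1 - crl (-1))).

Lemma sc_central c : sc c \in @central H.
Proof. by apply/centralP => u; apply: (spec_sc spec). Qed.
Lemma A_central : A \in @central H.
Proof. by apply/centralP => u; apply: (spec_A spec). Qed.
Lemma B_central : B \in @central H.
Proof. by apply/centralP => u; apply: (spec_B spec). Qed.
Lemma euH_central : euH zeta sc h T \in @central H.
Proof. by apply: (scalar_central zetaP spec PP) => v f g _; rewrite (euH_act zetaP PP). Qed.
Lemma a2H_central : a2H zeta sc h T \in @central H.
Proof. by apply: (scalar_central zetaP spec PP) => v f g _; rewrite (a2H_act zetaP PP). Qed.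

Lemma cs_zmod : zmod_morphism cs.
Proof.
by move=> c d; apply: val_inj; rewrite cvalB !toZE ?sc_central // rmorphB.
Qed.
Lemma cs_monoid : monoid_morphism cs.
Proof.
split=> [|c d]; apply: val_inj.
  by rewrite cval1 toZE ?sc_central // rmorph1.
by rewrite cvalM !toZE ?sc_central // rmorphM.
Qed.
Definition csR : {rmorphism C -> Z} := mk_rmorph cs_zmod cs_monoid.

Lemma crl0 : crl 0 = cr.
Proof. by rewrite /crl /cr /rl rmorph0 !mul0r !addr0. Qed.

Lemma R_central : X ^+ 4 + Y ^+ 4 \in @central H.
Proof. by rewrite addrC; case: (YX_comm zetaP spec). Qed.

Section Evaluate.
Variable v : pt C.
Hypothesis rv : regular v.

Lemma ev_one z : z \in @central H -> ev v (toZ z) = act v z (fun _ => 1) w1.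
Proof. by move=> zC; rewrite -(toZE zC) (ev_act zetaP PP) // mulr1 toZE. Qed.

Lemma ev_cs c : ev v (cs c) = c.
Proof. by rewrite ev_one ?sc_central // (act_sc PP) mulr1. Qed.
Lemma ev_A : ev v cA = parA v.
Proof. by rewrite ev_one ?A_central // (act_A PP) mulr1. Qed.
Lemma ev_B : ev v cB = parB v.
Proof. by rewrite ev_one ?B_central // (act_B PP) mulr1. Qed.
Lemma ev_q : ev v cq = px v * py v + 4 * (pa v ^+ 2 - pb v ^+ 2) * pX v * pY v.
Proof. by rewrite ev_one ?(xy_central zetaP spec) // (xy_act zetaP PP). Qed.
Lemma ev_Q : ev v cQ = pX v * pY v.
Proof. by rewrite ev_one ?(YX_act PP) //; case: (YX_comm zetaP spec). Qed.
Lemma ev_R : ev v cR = pX v ^+ 4 + pY v ^+ 4.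
Proof. by rewrite ev_one ?R_central // addrC (Y4X4_act PP). Qed.
Lemma ev_rl l : ev v (crl l) = rho (shiftv l v).
Proof. by rewrite ev_one ?(rl_central zetaP spec) // (rl_act zetaP spec PP). Qed.
Lemma ev_r : ev v cr = rho v.
Proof. by rewrite -crl0 ev_rl; case: v => a b *; rewrite /shiftv /= !mul0r !addr0. Qed.
Lemma ev_eu : ev v ceu = px v * pX v + py v * pY v.
Proof. by rewrite ev_one ?euH_central // (euH_act zetaP PP) mulr1. Qed.
Lemma ev_a2 : ev v ca2 = kappa v.
Proof. by rewrite ev_one ?a2H_central // (a2H_act zetaP PP) mulr1. Qed.

Definition kappa1 (v : pt C) : C := let: Pt a b X Y x y := v in
  Y * x ^+ 3 + X * y ^+ 3
  + 4 * b ^+ 2 * (Y ^+ 3 * x + X ^+ 3 * y - 2 * X * Y * (Y * y + X * x))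
  - 4 * a ^+ 2 * (Y ^+ 3 * x + X ^+ 3 * y + 2 * X * Y * (Y * y + X * x)).

Lemma ev_a1 : ev v ca1 = kappa1 v.
Proof.
rewrite -[ev v _]/(evR zetaP PP rv _) !(rmorphM, rmorphB) /= !ev_cs !ev_rl.
case: v => a b X0 Y0 x0 y0; rewrite /rho /shiftv /=; by field.
Qed.
Lemma ev_a3 : ev v ca3 = pY v ^+ 3 * px v + pX v ^+ 3 * py v.
Proof.
rewrite -[ev v _]/(evR zetaP PP rv _) !(rmorphM, rmorphB) /= !ev_cs !ev_rl.
case: v => a b X0 Y0 x0 y0; rewrite /rho /shiftv /=; by field.
Qed.

End Evaluate.

Definition cD : Z := cA ^+ 2 - cB ^+ 2.
Definition cS : Z := cA ^+ 2 + cB ^+ 2.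

Let evRE v (rv : regular v) z : ev v z = evR zetaP PP rv z. Proof. by []. Qed.

(** Evaluation at regular points reduces each relation to a polynomial identity. The right-hand
    sides are arranged so that all their terms contain [cq], [cQ], [ca1] or [ca3], the elements that
    vanish on the fixed locus. *)
Lemma relations :
  [/\ ceu * (ca2 + 2%:R * cD) = cQ * ca1 + cq * ca3,
      cr * (ca2 + 2%:R * cD) =
        ca1 ^+ 2 + cq ^+ 2 * ceu ^+ 2 - 4%:R * cq ^+ 3 * cQ - 8%:R * cq ^+ 2 * cS,
      cR * (ca2 + 2%:R * cD) =
        ca3 ^+ 2 + cQ ^+ 2 * ceu ^+ 2 - 4%:R * cQ ^+ 3 * cq - 8%:R * cQ ^+ 2 * cS,
      (ca2 - 2%:R * cD) * (ca2 + 2%:R * cD) =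
        ca1 * ca3 - cq * cQ * ceu ^+ 2 + 4%:R * cq ^+ 2 * cQ ^+ 2 + 8%:R * cq * cQ * cS &
      (ceu - 2%:R * (cA + cB)) * (ceu + 2%:R * (cA + cB)) *
        (ceu - 2%:R * (cA - cB)) * (ceu + 2%:R * (cA - cB))
        - (cr * cR + 4%:R * cD * (ca2 + 2%:R * cD)) =
      - (ca1 * ca3) + 5%:R * cq * cQ * ceu ^+ 2 - 4%:R * cq ^+ 2 * cQ ^+ 2 - 8%:R * cq * cQ * cS].
Proof.
rewrite /cD /cS; split; apply: (ev_inj zetaP spec PP) => v rv;
  move: (ev_A rv) (ev_B rv) (ev_q rv) (ev_Q rv) (ev_R rv) (ev_r rv) (ev_eu rv);
  move: (ev_a2 rv) (ev_a1 rv) (ev_a3 rv); rewrite !(evRE rv);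
  move: cA cB cq cQ cR cr ceu ca2 ca1 ca3 => A B q Q R r e a2 a1 a3 Ea2 Ea1 Ea3 EA EB Eq EQ ER Er Ee;
  rewrite !(rmorphM, rmorphB, rmorphD, rmorphXn, rmorphN) ?rmorph1
    ?EA ?EB ?Eq ?EQ ?ER ?Er ?Ee ?Ea2 ?Ea1 ?Ea3;
  clear A B q Q R r e a2 a1 a3 Ea2 Ea1 Ea3 EA EB Eq EQ ER Er Ee rv;
  case: v => a b X0 Y0 x0 y0; rewrite /rho /kappa /kappa1 /parA /parB /=; ring.
Qed.

End ElementsOfZ.

(** * Generators of the centre *)

Section Generation.
Variables (C : numFieldType) (zeta : C).
Hypothesis zetaP : 4.-primitive_root zeta.
Variables (H : pzRingType) (sc : {rmorphism C -> H}) (h : 'I_6 -> H) (T : W -> H).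
Hypothesis spec : cherednik_spec zeta sc h T.
Variable P : pt C -> {rmorphism H -> 'M[C]_8}.
Hypothesis PP : forall v, dunkl_spec zeta sc h T v (P v).

Local Notation Z := (centre H).
Local Notation ev := (ev P).
Local Notation act := (dunkl_act P).
Local Notation gact := (W_act zeta).
Local Notation cs := (cs sc).
Local Notation cA := (cA h).
Local Notation cB := (cB h).
Local Notation cq := (cq h).
Local Notation cQ := (cQ h).
Local Notation cR := (cR h).
Local Notation cr := (cr h).
Local Notation ceu := (ceu zeta sc h T).
Local Notation ca2 := (ca2 zeta sc h T).
Local Notation ca1 := (ca1 sc h).
Local Notation ca3 := (ca3 sc h).

Inductive Gen : Z -> Prop :=
| Gen_cs c : Gen (cs c)
| Gen_A : Gen cA | Gen_B : Gen cB | Gen_q : Gen cq | Gen_Q : Gen cQ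
| Gen_r : Gen cr | Gen_R : Gen cR | Gen_eu : Gen ceu
| Gen_a1 : Gen ca1 | Gen_a2 : Gen ca2 | Gen_a3 : Gen ca3
| Gen_D z z' : Gen z -> Gen z' -> Gen (z + z')
| Gen_M z z' : Gen z -> Gen z' -> Gen (z * z').

(* phi is the part of degree d in x, y of an element of Gen. *)
Definition Lift (d : nat) (phi : pt C -> C) : Prop := exists2 z, Gen z &
  forall v, regular v -> topP d (fun t => ev (vscale t v) z) (phi v).

Lemma Lift_ext d phi psi : (forall v, regular v -> phi v = psi v) -> Lift d phi -> Lift d psi.
Proof. by move=> E [z Gz Hz]; exists z => // v rv; rewrite -E //; apply: Hz. Qed.

Lemma Lift_cst c : Lift 0 (fun _ => c).
Proof.
exists (cs c) => [|v rv]; first exact: Gen_cs.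
by apply: topP_ext (topP_cst c) => t; rewrite (ev_cs zetaP spec PP).
Qed.
Lemma Lift_D d phi psi : Lift d phi -> Lift d psi -> Lift d (fun v => phi v + psi v).
Proof.
move=> [z Gz Hz] [z' Gz' Hz']; exists (z + z') => [|v rv]; first exact: Gen_D.
apply: topP_ext (topP_D (Hz v rv) (Hz' v rv)) => t.
have rt : regular (vscale t v) by [].
by rewrite -![ev _ _]/(evR zetaP PP rt _) rmorphD.
Qed.
Lemma Lift_M d d' phi psi : Lift d phi -> Lift d' psi -> Lift (d + d') (fun v => phi v * psi v).
Proof.
move=> [z Gz Hz] [z' Gz' Hz']; exists (z * z') => [|v rv]; first exact: Gen_M.
apply: topP_ext (topP_M (Hz v rv) (Hz' v rv)) => t.
have rt : regular (vscale t v) by [].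
by rewrite -![ev _ _]/(evR zetaP PP rt _) rmorphM.
Qed.
Lemma Lift_Z d phi c : Lift d phi -> Lift d (fun v => c * phi v).
Proof. exact: Lift_M (Lift_cst c). Qed.
Lemma Lift_B d phi psi : Lift d phi -> Lift d psi -> Lift d (fun v => phi v - psi v).
Proof.
move=> L L'; apply: Lift_ext (Lift_D L (Lift_Z (-1) L')) => v _; by rewrite mulN1r.
Qed.
Lemma Lift_X d phi k : Lift d phi -> Lift (k * d) (fun v => phi v ^+ k).
Proof.
move=> L; elim: k => [|k IH].
  by apply: Lift_ext (Lift_cst 1) => v _; rewrite expr0.
by rewrite mulSn; apply: Lift_ext (Lift_M L IH) => v _; rewrite exprS.
Qed.
Lemma Lift_0 d : Lift d (fun _ => 0).
Proof.
exists (cs 0) => [|v rv]; first exact: Gen_cs.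
by apply: topP_ext (topP_0 C d) => t; rewrite (ev_cs zetaP spec PP).
Qed.
Lemma Lift_sum d (I : eqType) (r : seq I) (F : I -> pt C -> C) :
  (forall i, i \in r -> Lift d (F i)) -> Lift d (fun v => \sum_(i <- r) F i v).
Proof.
elim: r => [|i r IH] L.
  by apply: Lift_ext (Lift_0 d) => v _; rewrite big_nil.
apply: (@Lift_ext _ (fun v => F i v + \sum_(j <- r) F j v)) => [v _|]; first by rewrite big_cons.
by apply: Lift_D; [exact/L/mem_head|apply: IH => j jr; apply: L; rewrite inE jr orbT].
Qed.

Lemma topP_poly (p : seq C) phi : (forall t, phi t = \sum_(i < size p) p`_i * t ^+ i) ->
  topP (size p).-1 phi (last 0 p).
Proof.
move=> E; exists (Poly p); split.
- by apply: leq_trans (size_Poly _) _; case: (p).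
- by rewrite coef_Poly nth_last.
move=> t; rewrite E horner_Poly; elim: (p) => [|c s IH] /=; first by rewrite big_ord0.
by rewrite big_ord_recl expr0 mulr1 -IH mulr_suml addrC; congr (_ + _);
  apply: eq_bigr => i _; rewrite /= exprSr mulrA.
Qed.

Lemma Lift_parA : Lift 0 (@parA C).
Proof. by exists cA => [|v rv]; [constructor|]; apply: topP_ext (topP_cst _) => t; rewrite (ev_A zetaP spec PP). Qed.
Lemma Lift_parB : Lift 0 (@parB C).
Proof. by exists cB => [|v rv]; [constructor|]; apply: topP_ext (topP_cst _) => t; rewrite (ev_B zetaP spec PP). Qed.
Lemma Lift_Q : Lift 0 (fun v => pX v * pY v).
Proof. by exists cQ => [|v rv]; [constructor|]; apply: topP_ext (topP_cst _) => t; rewrite (ev_Q zetaP spec PP). Qed.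
Lemma Lift_R : Lift 0 (fun v => pX v ^+ 4 + pY v ^+ 4).
Proof. by exists cR => [|v rv]; [constructor|]; apply: topP_ext (topP_cst _) => t; rewrite (ev_R zetaP spec PP). Qed.

Lemma Lift_q : Lift 2 (fun v => px v * py v).
Proof.
exists cq => [|v rv]; first by constructor.
apply: (@topP_poly [:: 4 * (pa v ^+ 2 - pb v ^+ 2) * pX v * pY v; 0; px v * py v]) => t.
by rewrite (ev_q zetaP spec PP) //= !big_ord_recl big_ord0 /=; ring.
Qed.
Lemma Lift_eu : Lift 1 (fun v => px v * pX v + py v * pY v).
Proof.
exists ceu => [|v rv]; first by constructor.
apply: (@topP_poly [:: 0; px v * pX v + py v * pY v]) => t.
by rewrite (ev_eu zetaP spec PP) //= !big_ord_recl big_ord0 /=; ring.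
Qed.
Lemma Lift_a3 : Lift 1 (fun v => pY v ^+ 3 * px v + pX v ^+ 3 * py v).
Proof.
exists ca3 => [|v rv]; first by constructor.
apply: (@topP_poly [:: 0; pY v ^+ 3 * px v + pX v ^+ 3 * py v]) => t.
by rewrite (ev_a3 zetaP spec PP) //= !big_ord_recl big_ord0 /=; ring.
Qed.
Lemma Lift_a2 : Lift 2 (fun v => pY v ^+ 2 * px v ^+ 2 + pX v ^+ 2 * py v ^+ 2).
Proof.
exists ca2 => [|v rv]; first by constructor.
apply: (@topP_poly [:: kappa (vscale 0 v); 0; pY v ^+ 2 * px v ^+ 2 + pX v ^+ 2 * py v ^+ 2]) => t.
rewrite (ev_a2 zetaP spec PP) //= !big_ord_recl big_ord0 /=.
by case: v rv => a b X0 Y0 x0 y0 _; rewrite /kappa /vscale /=; ring.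
Qed.
Lemma Lift_a1 : Lift 3 (fun v => pY v * px v ^+ 3 + pX v * py v ^+ 3).
Proof.
exists ca1 => [|v rv]; first by constructor.
apply: (@topP_poly [:: 0; kappa1 v - (pY v * px v ^+ 3 + pX v * py v ^+ 3); 0;
  pY v * px v ^+ 3 + pX v * py v ^+ 3]) => t.
rewrite (ev_a1 zetaP spec PP) //= !big_ord_recl big_ord0 /=.
by case: v rv => a b X0 Y0 x0 y0 _; rewrite /kappa1 /vscale /=; ring.
Qed.
Lemma Lift_r : Lift 4 (fun v => px v ^+ 4 + py v ^+ 4).
Proof.
exists cr => [|v rv]; first by constructor.
pose r2 (v : pt C) : C := let: Pt a b X Y x y := v in
  - 8 * a ^+ 2 * (Y ^+ 2 * y ^+ 2 + Y ^+ 2 * x ^+ 2 + 2 * X * Y * x * y + X ^+ 2 * y ^+ 2 + X ^+ 2 * x ^+ 2)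
  + 8 * b ^+ 2 * (Y ^+ 2 * x ^+ 2 - Y ^+ 2 * y ^+ 2 - 2 * X * Y * x * y + X ^+ 2 * y ^+ 2 - X ^+ 2 * x ^+ 2).
apply: (@topP_poly [:: rho (vscale 0 v); 0; r2 v; 0; px v ^+ 4 + py v ^+ 4]) => t.
rewrite (ev_r zetaP spec PP) //= !big_ord_recl big_ord0 /=.
by case: v rv => a b X0 Y0 x0 y0 _; rewrite /r2 /rho /vscale /=; ring.
Qed.

Definition msym (i j k l : nat) (v : pt C) : C :=
  px v ^+ i * py v ^+ j * pX v ^+ k * pY v ^+ l + px v ^+ j * py v ^+ i * pX v ^+ l * pY v ^+ k.

(** The symmetrisation [msym] accounts for the reflection s, and the congruence says that rotations
    fix the monomial. By induction on the total degree, a factor xy or XY is taken out as [cq] or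
    [cQ]; what remains is obtained from products of the other generators, up to terms with such a
    factor. *)
Lemma Lift_msym i j k l : (i + l = j + k %[mod 4])%N -> Lift (i + j) (msym i j k l).
Proof.
have [n] := ubnP (i + j + k + l).
elim: n i j k l => // n IH i j k l lt_n cong.
have step_q i' j' k' l' : (i'.+1 + j'.+1 + k' + l' < n.+1)%N -> (i'.+1 + l' = j'.+1 + k' %[mod 4])%N ->
    Lift (i'.+1 + j'.+1) (msym i'.+1 j'.+1 k' l').
  move=> lt c; have := IH i' j' k' l' ltac:(lia) ltac:(lia).
  move=> /(Lift_M Lift_q); rewrite (_ : 2 + (i' + j') = i'.+1 + j'.+1)%N; last by lia.
  by apply: Lift_ext => v _; rewrite /msym !exprS; ring.
have step_Q i' j' k' l' : (i' + j' + k'.+1 + l'.+1 < n.+1)%N -> (i' + l'.+1 = j' + k'.+1 %[mod 4])%N ->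
    Lift (i' + j') (msym i' j' k'.+1 l'.+1).
  move=> lt c; have := IH i' j' k' l' ltac:(lia) ltac:(lia).
  by move=> /(Lift_M Lift_Q); apply: Lift_ext => v _; rewrite /msym !exprS; ring.
have swap i' j' k' l' : Lift (i' + j') (msym i' j' k' l') -> Lift (j' + i') (msym j' i' l' k').
  by rewrite addnC; apply: Lift_ext => v _; rewrite /msym addrC.
(* For i, k > 0 the sum x^i X^k + y^i Y^k is [ceu] times the case (i - 1, k - 1), and for k = 0 or i
   = 0 it is [cr] or [cR] times the case with the exponent lowered by 4, always up to mixed
   terms. *)
have same i' k' : (i' + k' < n.+1)%N -> (i' = k' %[mod 4])%N -> Lift i' (msym i' 0 k' 0).
  move=> lt c; case: i' k' lt c => [|i'] [|k'] lt c.
  - apply: Lift_ext (Lift_cst 2) => v _; rewrite /msym; ring.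
  - have [j' kE] : exists j', k'.+1 = j'.+4 by exists (k' - 3)%N; lia.
    have [j0|jp] := posnP j'.
      rewrite kE j0; apply: Lift_ext Lift_R => v _; rewrite /msym; ring.
    have [m jE] : exists m, j' = m.+1 by exists j'.-1; lia.
    have L1 := Lift_M Lift_R (IH 0%N 0%N j' 0%N ltac:(lia) ltac:(lia)).
    have L2 := step_Q 0%N 0%N m 3 ltac:(lia) ltac:(lia).
    apply: Lift_ext (Lift_B L1 L2) => v _; rewrite kE jE /msym !exprS; ring.
  - have [j' iE] : exists j', i'.+1 = j'.+4 by exists (i' - 3)%N; lia.
    have [j0|jp] := posnP j'.
      rewrite iE j0; apply: Lift_ext Lift_r => v _; rewrite /msym; ring.
    have [m jE] : exists m, j' = m.+1 by exists j'.-1; lia.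
    have := Lift_M Lift_r (IH j' 0%N 0%N 0%N ltac:(lia) ltac:(lia)).
    have := step_q m 3 0%N 0%N ltac:(lia) ltac:(lia).
    rewrite (_ : m.+1 + 4 = i'.+1)%N; last by lia.
    rewrite (_ : 4 + (j' + 0) = i'.+1)%N; last by lia.
    move=> L2 L1; rewrite iE in L1 L2 *.
    apply: Lift_ext (Lift_B L1 L2) => v _; rewrite jE /msym !exprS; ring.
  - have := Lift_M Lift_eu (IH i' 0%N k' 0%N ltac:(lia) ltac:(lia)).
    rewrite addn0 add1n => L1.
    case: i' k' lt c L1 => [|i'] k' lt c L1; last first.
      have := step_q i' 0%N k' 1%N ltac:(lia) ltac:(lia); rewrite addn1 => L2.
      by apply: Lift_ext (Lift_B L1 L2) => v _; rewrite /msym !exprS; ring.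
    case: k' lt c L1 => [|k'] lt c L1.
      by apply: Lift_ext Lift_eu => v _; rewrite /msym; ring.
    have L2 := step_Q 0%N 1%N k' 0%N ltac:(lia) ltac:(lia).
    by apply: Lift_ext (Lift_B L1 L2) => v _; rewrite /msym !exprS; ring.
(* For i, l > 0 and i + l = 4 the sum x^i Y^l + y^i X^l is the leading part of a3, a2 or a1; from i
   + l = 8 on, an exponent that is at least 4 is lowered with [cr] or [cR]. *)
have anti i' l' : (i' + l' < n.+1)%N -> (i' + l' = 0 %[mod 4])%N -> Lift i' (msym i' 0 0 l').
  move=> lt c; case: i' l' lt c => [|i'] [|l'] lt c.
  - apply: Lift_ext (Lift_cst 2) => v _; rewrite /msym; ring.
  - have := swap 0%N 0%N l'.+1 0%N (same 0%N l'.+1 ltac:(lia) ltac:(lia)); by [].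
  - have := same i'.+1 0%N ltac:(lia) ltac:(lia); by [].
  have [E|gt4] : (i'.+1 + l'.+1 = 4 \/ 8 <= i'.+1 + l'.+1)%N by lia.
    have [E1|[E1|E1]] : (i' = 0 \/ i' = 1 \/ i' = 2)%N by lia.
    + have -> : l' = 2 by lia.
      by rewrite E1; apply: Lift_ext Lift_a3 => v _; rewrite /msym; ring.
    + have -> : l' = 1%N by lia.
      by rewrite E1; apply: Lift_ext Lift_a2 => v _; rewrite /msym; ring.
    + have -> : l' = 0%N by lia.
      by rewrite E1; apply: Lift_ext Lift_a1 => v _; rewrite /msym; ring.
  have [lt4|ge4] := ltnP i'.+1 4.
    have [m lE] : exists m, l'.+1 = m.+1.+4 by exists (l' - 4)%N; lia.
    have L1 := Lift_M Lift_R (IH i'.+1 0%N 0%N m.+1 ltac:(lia) ltac:(lia)).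
    rewrite addn0 add0n in L1.
    have := step_Q i'.+1 0%N 3 m ltac:(lia) ltac:(lia); rewrite addn0 => L2.
    by rewrite lE; apply: Lift_ext (Lift_B L1 L2) => v _; rewrite /msym !exprS; ring.
  have [m iE] : exists m, i'.+1 = m.+4 by exists (i' - 3)%N; lia.
  case: m iE => [|m] iE.
    (* For i = 4 the product of r with X^l + Y^l also contains x^4 X^l + y^4 Y^l, which is supplied
       by [ceu]. *)
    have := Lift_M Lift_eu (IH 3 0%N l' 0%N ltac:(lia) ltac:(lia)); rewrite addn0 add1n => L1.
    have := step_q 2 0%N l' 1%N ltac:(lia) ltac:(lia); rewrite addn1 => L2.
    have L3 : Lift 4 (msym 4 0 l'.+1 0).
      by apply: Lift_ext (Lift_B L1 L2) => v _; rewrite /msym !exprS; ring.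
    have L4 := Lift_M Lift_r (IH 0%N 0%N 0%N l'.+1 ltac:(lia) ltac:(lia)).
    rewrite iE; apply: Lift_ext (Lift_B L4 L3) => v _; rewrite /msym !exprS; ring.
  have := Lift_M Lift_r (IH m.+1 0%N 0%N l'.+1 ltac:(lia) ltac:(lia)).
  have := step_q m 3 0%N l'.+1 ltac:(lia) ltac:(lia).
  rewrite (_ : m.+1 + 4 = i'.+1)%N; last by lia.
  rewrite (_ : 4 + (m.+1 + 0) = i'.+1)%N; last by lia.
  move=> L2 L1; rewrite iE in L1 L2 *.
  by apply: Lift_ext (Lift_B L1 L2) => v _; rewrite /msym !exprS; ring.
case: i j k l lt_n cong => [|i] [|j] k l lt_n cong; last exact: step_q.
- case: k l lt_n cong => [|k] [|l] lt_n cong; last exact: step_Q.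
  + by apply: same; lia.
  + by apply: anti; lia.
  + by apply: same; lia.
- case: k l lt_n cong => [|k] [|l] lt_n cong; last exact: step_Q.
  + by apply/swap; rewrite addn0; apply: same; lia.
  + by apply/swap; rewrite addn0; apply: same; lia.
  + by apply/swap; rewrite addn0; apply: anti; lia.
- case: k l lt_n cong => [|k] [|l] lt_n cong; last exact: step_Q.
  + by rewrite addn0; apply: same; lia.
  + by rewrite addn0; apply: anti; lia.
  + by rewrite addn0; apply: same; lia.
Qed.

(** Right translation by k intertwines the actions at v and at its translate, since left
    multiplications in W commute with it. Central elements therefore have the same value along an
    orbit. *)
Lemma act_gact k v z f g :
  act (gact k v) z f g = act v z (fun u => f (mulW u (invW k))) (mulW g k).
Proof.
have mK u : mulW (mulW u k) (invW k) = u by rewrite -mulWA mulWV mulW1.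
have E u : gact (mulW u k) v = gact u (gact k v) by rewrite (gactM zetaP).
move: z f g; apply: (spec_ind spec) => [|z z' IH IH'|c z IH|i z IH|w z IH] f g.
- by rewrite !act_1 mK.
- by rewrite !act_D IH IH'.
- by rewrite !act_Mg !(act_sc PP) IH.
- have F f' : act (gact k v) (h i) f' g = act v (h i) (fun u => f' (mulW u (invW k))) (mulW g k).
    have pA : parA (gact k v) = parA v by exact: (parA_gact zetaP).
    have pB : parB (gact k v) = parB v by exact: (parB_gact zetaP).
    case: i {IH} => [[|[|[|[|[|[|//]]]]]] lt_i].
    + by rewrite (_ : Ordinal _ = iA) ?(act_A PP) ?mK ?pA //; exact: val_inj.
    + by rewrite (_ : Ordinal _ = iB) ?(act_B PP) ?mK ?pB //; exact: val_inj.
    + by rewrite (_ : Ordinal _ = iX) ?(act_X PP) ?mK ?E //; exact: val_inj.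
    + by rewrite (_ : Ordinal _ = iY) ?(act_Y PP) ?mK ?E //; exact: val_inj.
    + by rewrite (_ : Ordinal _ = ix) ?(act_x PP) ?mulWA ?mK ?E //; exact: val_inj.
    + by rewrite (_ : Ordinal _ = iy) ?(act_y zetaP PP) ?mulWA ?mK ?E //; exact: val_inj.
  rewrite !act_Mg F; congr (act v (h i) _ _); apply/funext => u.
  by rewrite IH -mulWA mulVW mulW1.
- rewrite !act_Mg !(act_T PP) IH; congr (act v z _ _).
  by rewrite mulWA.
Qed.

Lemma ev_gact v z k : regular v -> ev (gact k v) z = ev v z.
Proof.
move=> rv; have rk : regular (gact k v) by rewrite (regular_gact zetaP).
have := ev_act zetaP PP z (fun _ => 1) w1 rk; rewrite mulr1 => <-.
by rewrite act_gact (ev_act zetaP PP) // mulr1.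
Qed.

Lemma vscale_gact t v k : vscale t (gact k v) = gact k (vscale t v).
Proof.
case: v => a b X0 Y0 x0 y0; case: k => i []; rewrite /W_act /vscale /=.
  by congr Pt; rewrite mulrCA.
by congr Pt; rewrite mulrCA.
Qed.

Lemma sum_zeta N : \sum_(i < 4) zeta ^+ (i * N) = if (4 %| N)%N then 4 else 0.
Proof.
have z2 := zeta2 zetaP; have z4 := zeta4 zetaP.
have E : zeta ^+ (1 * N) = zeta ^+ (N %% 4) by rewrite mul1n (expr_mod _ z4).
rewrite (eq_bigr (fun i : 'I_4 => (zeta ^+ (N %% 4)) ^+ i)); last first.
  by move=> i _; rewrite (expr_mod _ z4) -exprM mulnC.
rewrite /dvdn; have := ltn_pmod N (isT : 0 < 4)%N.
case: (N %% 4)%N => [|[|[|[|//]]]] _; rewrite big_ord4 /=; ring: z2.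
Qed.

(** The sum over the rotations is a sum of powers of ζ and vanishes unless the weight of the
    monomial is divisible by 4; the reflections contribute its mirror image. *)
Lemma vec_sum m v : \sum_g ('X_[m] : {mpoly C[6]}).@[vec zeta w1 (gact g v)] =
  if (4 %| m iX + 3 * m iY + 3 * m ix + m iy)%N then
    4 * (parA v ^+ m iA * parB v ^+ m iB) * msym (m ix) (m iy) (m iX) (m iY) v else 0.
Proof.
have E u : ('X_[m] : {mpoly C[6]}).@[vec zeta w1 u] = parA u ^+ m iA * parB u ^+ m iB *
    (px u ^+ m ix * py u ^+ m iy * pX u ^+ m iX * pY u ^+ m iY).
  transitivity (parA u ^+ m iA * parB u ^+ m iB * pX u ^+ m iX * pY u ^+ m iY *
    px u ^+ m ix * py u ^+ m iy); last by ring.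
  rewrite mevalX !big_ord_recl big_ord0 /vec (gact1 zeta) /= mulr1 !mulrA.
  by congr (_ ^+ m _ * _ ^+ m _ * _ ^+ m _ * _ ^+ m _ * _ ^+ m _ * _ ^+ m _); apply: val_inj.
rewrite (eq_bigr (fun g : W => parA v ^+ m iA * parB v ^+ m iB *
  (zeta ^+ (g.1 * (m iX + 3 * m iY + 3 * m ix + m iy)) *
   if g.2 then px v ^+ m iy * py v ^+ m ix * pX v ^+ m iY * pY v ^+ m iX
   else px v ^+ m ix * py v ^+ m iy * pX v ^+ m iX * pY v ^+ m iY))); last first.
  move=> g _; rewrite E.
  rewrite -[parA (gact g v)]/(pa _ * _) (parA_gact zetaP) -[parB (gact g v)]/(pb _ * _) (parB_gact zetaP).
  congr (_ * _); case: v => a b X0 Y0 x0 y0; case: g => i s; rewrite /W_act /=.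
  have -> : zeta ^+ (3 * i)%N = (zeta ^+ i) ^+ 3 by rewrite mulnC exprM.
  rewrite exprM; move: (zeta ^+ i) => om.
  rewrite 3!exprD (exprM om 3 (m iY)) (exprM om 3 (m ix)); move: (om ^+ 3) => om3.
  by case: s; rewrite !exprMn; ring.
rewrite -mulr_sumr sumW /=.
have := sum_zeta (m iX + 3 * m iY + 3 * m ix + m iy); rewrite big_ord4 /=.
set N := (m iX + _ + _ + _)%N => S0; rewrite -!mulrDl -mulrDr S0 /msym.
by case: ifP => _; ring.
Qed.

(** The top part of a central element in x, y is invariant under W, because [ev] is constant on
    orbits. It is thus a combination of the [msym], hence also the top part of an element of [Gen],
    and the difference of the two has lower degree. *)
Lemma Gen_all z : Gen z.
Proof.
have claim d z' : (exists E, forall v, regular v -> topP d (fun t => ev (vscale t v) z') (E v)) ->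
    (forall d' u, (d' < d)%N -> (exists E, forall v, regular v -> topP d' (fun t => ev (vscale t v) u) (E v)) -> Gen u) ->
    Gen z'.
  move=> [E HE] IH; have [q qE] := pbw_surj zetaP spec (val z').
  have [] := @pbw_degree _ _ zetaP _ _ _ _ _ PP q d (fun v g => E v * delta_w1 C g).
    move=> v g rv; have := topP_Z (delta_w1 C g) (HE v rv); rewrite mulrC.
    apply: topP_ext => t; rewrite -qE (ev_act zetaP PP) //; exact: mulrC.
  move=> _ qtop; pose f := topc d (q w1).
  have fE v : regular v -> f.@[vec zeta w1 v] = E v.
    by move=> rv; rewrite /f qtop // /delta_w1 eqxx mulr1.
  have Einv v k : regular v -> E (gact k v) = E v.
    move=> rv; have rk : regular (gact k v) by rewrite (regular_gact zetaP).
    apply: topP_uniq (HE _ rk) _; apply: topP_ext (HE v rv) => t.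
    by rewrite vscale_gact ev_gact.
  have LE : Lift d E.
    (* By invariance, averaging over the 8 elements of W does not change E, and it turns every
       monomial into 0 or a multiple of [msym]. *)
    pose F m v := f@_m * (8^-1 * \sum_g ('X_[m] : {mpoly C[6]}).@[vec zeta w1 (gact g v)]).
    apply: (@Lift_ext _ (fun v => \sum_(m <- mpoly.msupp f) F m v)) => [v rv|].
      rewrite /F; under eq_bigr do rewrite mulrCA mulr_sumr.
      rewrite -mulr_sumr exchange_big /=.
      rewrite (eq_bigr (fun _ => E v)) => [|g _].
        by rewrite sumr_const card_W -[E v *+ _]mulr_natl mulrA mulVf ?mul1r // pnatr_eq0.
      have rg : regular (gact g v) by rewrite (regular_gact zetaP).
      by rewrite -(Einv v g rv) -(fE _ rg) [in RHS](mpolyE f) raddf_sum;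
        apply: eq_bigr => m _; rewrite /= mevalZ.
    apply: Lift_sum => m mf; apply: Lift_Z; apply: Lift_Z.
    have md : xyd m = d.
      apply/eqP; apply: contraLR mf => ne; rewrite -mcoeff_eq0 mcoeff_topc (negPf ne) //.
    apply: Lift_ext => [v rv|]; first by rewrite vec_sum.
    case: (boolP (4 %| m iX + 3 * m iY + 3 * m ix + m iy)%N) => [c|_]; last exact: Lift_0.
    have L1 := Lift_X (m iA) Lift_parA; have L2 := Lift_X (m iB) Lift_parB.
    have c' : (m ix + m iY = m iy + m iX %[mod 4])%N by move: c; rewrite /dvdn; lia.
    have := Lift_M (Lift_Z 4 (Lift_M L1 L2)) (Lift_msym c').
    by rewrite !muln0 !add0n -md.
  have [u Gu Hu] := LE; rewrite -(subrK u z'); apply: Gen_D => //.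
  have D v : regular v -> topP d (fun t => ev (vscale t v) (z' - u)) 0.
    move=> rv; have := topP_D (HE v rv) (topP_Z (-1) (Hu v rv)); rewrite mulN1r subrr.
    apply: topP_ext => t; have rt : regular (vscale t v) by [].
    by rewrite -![ev _ _]/(evR zetaP PP rt _) rmorphB mulN1r.
  (* In degree 0 the difference is constant in t with constant term 0; at t = 1 this says that it
     vanishes at v. *)
  case: d IH D {HE qtop f fE LE Hu} => [|d] IH D.
    suff -> : z' - u = 0 by rewrite -(rmorph0 (csR spec)); exact: Gen_cs.
    apply: (ev_inj zetaP spec PP) => v rv; have [p [sp p0 pt]] := D v rv.
    have -> : v = vscale 1 v by case: v {rv D pt}=> *; rewrite /vscale /= !mul1r.
    have r1 : regular (vscale 1 v) by [].
    rewrite pt (size1_polyC sp) p0 hornerC.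
    by rewrite -[ev _ _]/(evR zetaP PP r1 _) rmorph0.
  apply: (IH d) => //.
  (* The new top coefficient is that of t^d; at points that are not regular it is set to 0. *)
  have /choice [E' HE'] : forall v, exists e, regular v -> topP d (fun t => ev (vscale t v) (z' - u)) e.
    move=> v; case rv : (regular v); last by exists 0.
    have [p [sp p0 pt]] := D v rv; exists p`_d => _; exists p; split=> //.
    rewrite leqNgt; apply/negP => lt; have sz : size p = d.+2 by apply/eqP; rewrite eqn_leq sp.
    have : lead_coef p == 0 by rewrite /lead_coef sz p0.
    by rewrite lead_coef_eq0 => /eqP pp; rewrite pp size_poly0 in lt.
  by exists E'.
have main d : forall z', (exists E, forall v, regular v -> topP d (fun t => ev (vscale t v) z') (E v)) -> Gen z'.
  elim/ltn_ind: d => d IH z' Hz; apply: (claim d z' Hz) => d' u lt Hu; exact: (IH d').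
have [q qE] := pbw_surj zetaP spec (val z).
apply: (main (\sum_w msize (q w))%N).
exists (fun v => (topc (\sum_w msize (q w)) (q w1)).@[vec zeta w1 v]) => v rv.
have qd : (forall w m, m \in mpoly.msupp (q w) -> xyd m <= \sum_w msize (q w))%N.
  move=> w m /mpoly.msize_mdeg_lt lt.
  rewrite (bigD1 w) //=; apply: leq_trans (leq_addr _ _).
  apply: leq_trans (ltnW lt); rewrite /xyd mdegE (bigD1 ix) //= (bigD1 iy) //=.
  by rewrite addnA leq_addr.
by apply: topP_ext (topP_pbw zetaP PP v w1 qd) => t; rewrite -qE.
Qed.

End Generation.

(** * The torus action *)

Section Torus.
Variables (C : numFieldType) (zeta : C).
Hypothesis zetaP : 4.-primitive_root zeta.
Variables (H : pzRingType) (sc : {rmorphism C -> H}) (h : 'I_6 -> H) (T : W -> H).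
Hypothesis spec : cherednik_spec zeta sc h T.
Variable P : pt C -> {rmorphism H -> 'M[C]_8}.
Hypothesis PP : forall v, dunkl_spec zeta sc h T v (P v).

Local Notation A := (h iA).
Local Notation B := (h iB).
Local Notation X := (h iX).
Local Notation Y := (h iY).
Local Notation x := (h ix).
Local Notation y := (h iy).
Local Notation Z := (centre H).

Record torus_spec (xi : C) (tau : {rmorphism H -> H}) : Prop := TorusSpec {
  tau_sc : forall c, tau (sc c) = sc c;
  tau_h : forall i, tau (h i) = sc (weight xi (inl i)) * h i;
  tau_T : forall w, tau (T w) = T w }.

(** Surjectivity of the torus action is what makes it preserve the centre. *)
Lemma torus_specK xi tau tau' : xi != 0 -> torus_spec xi tau ->
  torus_spec xi^-1 tau' -> cancel tau' tau.
Proof.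
move=> xi0 S S'; apply: (spec_ind spec) => [|a b IHa IHb|c a IH|i a IH|g a IH].
- by rewrite !rmorph1.
- by rewrite !rmorphD IHa IHb.
- by rewrite !rmorphM /= (tau_sc S') (tau_sc S) IH.
- rewrite !rmorphM /= (tau_h S') rmorphM /= (tau_sc S) (tau_h S) IH !mulrA -rmorphM.
  have -> : weight xi^-1 (inl i) * weight xi (inl i) = 1.
    by rewrite /weight; case: ifP => _; rewrite ?mul1r //; case: ifP => _;
      rewrite ?invrK ?mulVf ?mulfV.
  by rewrite rmorph1 mul1r.
- by rewrite !rmorphM /= (tau_T S') (tau_T S) IH.
Qed.

Section OneParameter.
Variables (xi : C) (tau tau' : {rmorphism H -> H}).
Hypotheses (xi0 : xi != 0) (S : torus_spec xi tau) (S' : torus_spec xi^-1 tau').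

Lemma tau_central z : z \in @central H -> tau z \in @central H.
Proof.
move=> /centralP zC; apply/centralP => u.
by rewrite -(torus_specK xi0 S S' u) -!rmorphM zC.
Qed.

Definition tauZ (z : Z) : Z := toZ (tau (val z)).

Lemma tauZE z : val (tauZ z) = tau (val z).
Proof. by rewrite toZE // tau_central //; exact: valP. Qed.

Lemma tauZ_zmod : zmod_morphism tauZ.
Proof. by move=> z z'; apply: val_inj; rewrite cvalB !tauZE cvalB rmorphB. Qed.
Lemma tauZ_monoid : monoid_morphism tauZ.
Proof.
split=> [|z z']; apply: val_inj; first by rewrite cval1 tauZE cval1 rmorph1.
by rewrite cvalM !tauZE cvalM rmorphM.
Qed.
Definition tauR : {rmorphism Z -> Z} := mk_rmorph tauZ_zmod tauZ_monoid.

Lemma tauZ_to z u : z \in @central H -> tau z = u -> tauZ (toZ z) = toZ u.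
Proof. by move=> zC <-; rewrite /tauZ toZE. Qed.

Lemma tauZ_toZ c z : z \in @central H -> tau z = sc c * z -> tauZ (toZ z) = cs sc c * toZ z.
Proof.
move=> zC E; apply: val_inj; rewrite tauZE cvalM !toZE //; exact: (sc_central spec c).
Qed.

Let th i : tau (h i) = sc (weight xi (inl i)) * h i := tau_h S i.
Let tx : tau x = sc xi^-1 * x. Proof. exact: th. Qed.
Let ty : tau y = sc xi^-1 * y. Proof. exact: th. Qed.
Let tX : tau X = sc xi * X. Proof. exact: th. Qed.
Let tY : tau Y = sc xi * Y. Proof. exact: th. Qed.
Let tA : tau A = A. Proof. by rewrite th rmorph1 mul1r. Qed.
Let tB : tau B = B. Proof. by rewrite th rmorph1 mul1r. Qed.

Let scM c d a b : sc c * a * (sc d * b) = sc (c * d) * (a * b).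
Proof. by rewrite rmorphM -!mulrA (mulrA a) -(spec_sc spec d a) !mulrA. Qed.
Let scX c a n : (sc c * a) ^+ n = sc (c ^+ n) * a ^+ n.
Proof. by rewrite exprMn_comm ?rmorphXn //; exact: (spec_sc spec c a). Qed.

Lemma tauZ_cs c : tauZ (cs sc c) = cs sc c.
Proof. by apply: tauZ_to; [exact: (sc_central spec c)|exact: (tau_sc S c)]. Qed.
Lemma tauZ_A : tauZ (cA h) = cA h.
Proof. by apply: tauZ_to tA; exact: (A_central spec). Qed.
Lemma tauZ_B : tauZ (cB h) = cB h.
Proof. by apply: tauZ_to tB; exact: (B_central spec). Qed.
Lemma tauZ_q : tauZ (cq h) = cs sc (xi ^- 2) * cq h.
Proof.
by apply: tauZ_toZ; [exact: (xy_central zetaP spec)|rewrite rmorphM /= tx ty scM -invfM].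
Qed.
Lemma tauZ_Q : tauZ (cQ h) = cs sc (xi ^+ 2) * cQ h.
Proof.
by apply: tauZ_toZ; [case: (YX_comm zetaP spec)|rewrite rmorphM /= tX tY scM].
Qed.

Hypothesis xi4 : xi ^+ 4 = 1.

Lemma tauZ_R : tauZ (cR h) = cR h.
Proof.
apply: tauZ_to; first exact: (R_central zetaP spec).
by rewrite rmorphD !rmorphXn /= tX tY !scX xi4 rmorph1 !mul1r.
Qed.
(** x + lY is sent to ξ^-1 (x + ξ^2 l Y), and similarly y + lX; the factor ξ^-1 disappears in the
    fourth power because ξ^4 = 1. *)
Lemma tauZ_rl l : tauZ (crl sc h l) = crl sc h (xi ^+ 2 * l).
Proof.
apply: tauZ_to; first exact: (rl_central zetaP spec _).
have E a b : sc xi^-1 * a + sc l * (sc xi * b) = sc xi^-1 * (a + sc (xi ^+ 2 * l) * b).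
  by rewrite mulrDr mulrA -rmorphM mulrA -rmorphM; congr (_ + sc _ * _); rewrite expr2 -mulrA mulKf // mulrC.
rewrite /rl rmorphD !rmorphXn !rmorphD !rmorphM /= tx ty tX tY (tau_sc S) !E !scX.
by rewrite exprVn xi4 invr1 rmorph1 !mul1r !rmorphM.
Qed.
Lemma tauZ_r : tauZ (cr h) = cr h.
Proof. by rewrite -(crl0 sc) tauZ_rl mulr0. Qed.

Let tS k : tau (refl_sum zeta sc h T k) = refl_sum zeta sc h T k.
Proof.
rewrite rmorph_sum; apply: eq_bigr => i _; rewrite !rmorphM /= (tau_sc S) (tau_T S).
by rewrite /hpar; case: ifP => _; rewrite ?tA ?tB.
Qed.

Let txy a b : tau (a * b) = tau a * tau b. Proof. exact: rmorphM. Qed.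
Let pair1 a b u : sc xi * a * u * (sc xi^-1 * b) = a * u * b.
Proof. by rewrite -(mulrA (sc xi)) scM mulfV // rmorph1 mul1r. Qed.

Lemma tauZ_eu : tauZ (ceu zeta sc h T) = ceu zeta sc h T.
Proof.
apply: tauZ_to; first exact: (euH_central zetaP spec PP).
rewrite /euH rmorphB rmorphD !txy tX tY tx ty tS.
by rewrite !scM mulfV // rmorph1 !mul1r.
Qed.

Lemma tauZ_a2 : tauZ (ca2 zeta sc h T) = ca2 zeta sc h T.
Proof.
apply: tauZ_to; first exact: (a2H_central zetaP spec PP).
have F : xi * xi * (xi^-1 * xi^-1) = 1 by rewrite mulrACA mulfV // mulr1.
rewrite /a2H !expr2 rmorphB !rmorphD !txy rmorphB !txy tX tY tx ty tA tB !tS (tau_T S) rmorph_nat.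
by rewrite !scM F rmorph1 !mul1r !pair1.
Qed.

(** For ξ^2 = -1 the action exchanges [crl l] and [crl (-l)], and [ca1] is made of differences of
    such pairs. *)
Lemma tauZ_a1 : xi ^+ 2 = 1 \/ xi ^+ 2 = -1 -> tauZ (ca1 sc h) = cs sc (xi ^+ 2) * ca1 sc h.
Proof.
move=> H2; rewrite -[tauZ _]/(tauR _) /ca1 !(rmorphM, rmorphB) /=.
rewrite !tauZ_cs !tauZ_rl !mulr1.
have csN1 : cs sc (-1) = -1 by rewrite -[LHS]/(csR spec (-1)) rmorphN rmorph1.
have cs1 : cs sc 1 = 1 by rewrite -[LHS]/(csR spec 1) rmorph1.
case: H2 => ->; rewrite ?mul1r ?mulrN ?mulN1r ?opprK ?csN1 ?cs1 ?mul1r //.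
move: (crl sc h 1) (crl sc h (-1)) (crl sc h 2) (crl sc h (-2)) => p1 p2 p3 p4; ring.
Qed.

Lemma tauZ_a3 : xi ^+ 2 = 1 \/ xi ^+ 2 = -1 -> tauZ (ca3 sc h) = cs sc (xi ^+ 2) * ca3 sc h.
Proof.
move=> H2; rewrite -[tauZ _]/(tauR _) /ca3 !(rmorphM, rmorphB) /=.
rewrite !tauZ_cs !tauZ_rl !mulr1.
have csN1 : cs sc (-1) = -1 by rewrite -[LHS]/(csR spec (-1)) rmorphN rmorph1.
have cs1 : cs sc 1 = 1 by rewrite -[LHS]/(csR spec 1) rmorph1.
case: H2 => ->; rewrite ?mul1r ?mulrN ?mulN1r ?opprK ?csN1 ?cs1 ?mul1r //.
move: (crl sc h 1) (crl sc h (-1)) (crl sc h 2) (crl sc h (-2)) => p1 p2 p3 p4; ring.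
Qed.

Variable p : {rmorphism Z -> C}.
Hypothesis pP : forall c, p (cs sc c) = c.

Let pM a b : p (a * b) = p a * p b. Proof. exact: rmorphM. Qed.

Lemma fixed_of_vanishing : p (cq h) = 0 -> p (cQ h) = 0 -> p (ca1 sc h) = 0 -> p (ca3 sc h) = 0 ->
  forall z, p (tauZ z) = p z.
Proof.
move=> q0 Q0 a10 a30.
have H2 : xi ^+ 2 = 1 \/ xi ^+ 2 = -1.
  have : (xi ^+ 2 - 1) * (xi ^+ 2 + 1) = 0 by rewrite -subr_sqr expr1n -exprM xi4 subrr.
  by move/eqP; rewrite mulf_eq0 subr_eq0 addr_eq0 => /orP[]/eqP->; [left|right].
have K c z : p z = 0 -> p (cs sc c * z) = p z by move=> z0; rewrite pM z0 mulr0.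
move=> z; have := Gen_all zetaP spec PP z.
elim=> [c||||||||||| z1 z2 _ IH1 _ IH2| z1 z2 _ IH1 _ IH2].
- by rewrite tauZ_cs.
- by rewrite tauZ_A.
- by rewrite tauZ_B.
- by rewrite tauZ_q K.
- by rewrite tauZ_Q K.
- by rewrite tauZ_r.
- by rewrite tauZ_R.
- by rewrite tauZ_eu.
- by rewrite (tauZ_a1 H2) (K _ _ a10).
- by rewrite tauZ_a2.
- by rewrite (tauZ_a3 H2) (K _ _ a30).
- by rewrite -[tauZ _]/(tauR _) !rmorphD IH1 IH2.
- by rewrite -[tauZ _]/(tauR _) !rmorphM IH1 IH2.
Qed.

Lemma vanishing_of_fixed : xi ^+ 2 = -1 -> (forall z, p (tauZ z) = p z) ->
  [/\ p (cq h) = 0, p (cQ h) = 0, p (ca1 sc h) = 0 & p (ca3 sc h) = 0].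
Proof.
move=> x2 pt; have N (c : C) : - c = c -> c = 0.
  by move/eqP; rewrite eq_sym -addr_eq0 -mulr2n mulrn_eq0 /= => /eqP.
split; apply: N.
- by rewrite -[RHS]pt tauZ_q pM pP x2 invrN1 mulN1r.
- by rewrite -[RHS]pt tauZ_Q pM pP x2 mulN1r.
- by rewrite -[RHS]pt tauZ_a1 ?(pM (cs sc _)) ?pP ?x2 ?mulN1r; [|right].
- by rewrite -[RHS]pt tauZ_a3 ?(pM (cs sc _)) ?pP ?x2 ?mulN1r; [|right].
Qed.

End OneParameter.
End Torus.

(** * Geometry of the fixed locus *)

Section PolynomialFunctions.
Variable C : numFieldType.

Lemma mpoly_ring_ind n (Q : {mpoly C[n]} -> Prop) :
  (forall c, Q c%:MP) -> (forall i, Q 'X_i) -> (forall p q, Q p -> Q q -> Q (p + q)) ->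
  (forall p q, Q p -> Q q -> Q (p * q)) -> forall p, Q p.
Proof.
move=> QC QX QD QM; apply: mpolyind => [|c m p _ _ Qp]; first by rewrite -mpolyC0.
apply: (QD) => //; rewrite -mul_mpolyC; apply: (QM) => //.
rewrite mpolyXE_id; elim/big_ind: _ => [||i _]; rewrite -?mpolyC1 //.
by elim: (m i) => [|k IH]; rewrite ?expr0 -?mpolyC1 // exprS; apply: QM.
Qed.

(** Rational functions of t whose denominator is a power of v, described by their values where v
    does not vanish. *)
Definition ratl (v : {poly C}) (phi : C -> C) : Prop :=
  exists N (q : {poly C}), forall t, v.[t] != 0 -> q.[t] = v.[t] ^+ N * phi t.

Lemma ratl_poly v (p : {poly C}) : ratl v (fun t => p.[t]).
Proof. by exists 0%N, p => t _; rewrite mul1r. Qed.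

Lemma ratl_div v (p : {poly C}) : ratl v (fun t => p.[t] / v.[t]).
Proof. by exists 1%N, p => t v0; rewrite expr1 mulrC divfK. Qed.

Lemma ratl_meval v n (c : 'I_n -> C -> C) (P : {mpoly C[n]}) : (forall i, ratl v (c i)) ->
  ratl v (fun t => P.@[fun i => c i t]).
Proof.
move=> cr; elim/mpoly_ring_ind: P => [k|i|p q [N [p' Ep]] [M [q' Eq]]|p q [N [p' Ep]] [M [q' Eq]]].
- by exists 0%N, k%:P => t _; rewrite mevalC hornerC mul1r.
- by have [N [q E]] := cr i; exists N, q => t v0; rewrite mevalXU E.
- exists (N + M)%N, (v ^+ M * p' + v ^+ N * q') => t v0.
  by rewrite !hornerE Ep // Eq // mevalD exprD; ring.
- exists (N + M)%N, (p' * q') => t v0.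
  by rewrite hornerM Ep // Eq // mevalM exprD; ring.
Qed.

Lemma meval_curve n (c : 'I_n -> {poly C}) (P : {mpoly C[n]}) :
  exists q : {poly C}, forall t, P.@[fun i => (c i).[t]] = q.[t].
Proof.
have [N [q E]] := @ratl_meval 1 n (fun i t => (c i).[t]) P (fun i => ratl_poly 1 (c i)).
by exists q => t; rewrite E ?hornerC ?oner_neq0 // expr1n mul1r.
Qed.

Lemma exists_nonroot (p : {poly C}) : p != 0 -> exists t, p.[t] != 0.
Proof.
move=> p0; apply: contrapT => E; case/eqP: p0; apply: poly_vanish => t.
by apply/eqP; apply: contrapT => /negP pt; apply: E; exists t.
Qed.

End PolynomialFunctions.

Section Geometry.
Variables (C : numFieldType) (A0 : pzRingType) (k : C -> A0) (Y : set {rmorphism A0 -> C}).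
Variables (E0 : set A0) (a b : C) (e u v w : A0).
Local Notation pt := {rmorphism A0 -> C}.
Local Notation D := (a ^+ 2 - b ^+ 2).
Definition quartic (x : C) : C :=
  (x - 2 * (a + b)) * (x + 2 * (a + b)) * (x - 2 * (a - b)) * (x + 2 * (a - b)).
Definition co (p : pt) : 'I_4 -> C := tnth [tuple p e; p u; p v; p w].
Definition c4 (x y z t : C) : 'I_4 -> C := tnth [tuple x; y; z; t].

Hypothesis YE : Y = [set p : pt | points k p /\ forall f, E0 f -> p f = 0].
Hypothesis Yfun : forall f : A0, exists P : {mpoly C[4]}, forall p : pt, Y p -> p f = P.@[co p].
Hypothesis Yrel : forall p : pt, Y p ->
  [/\ p e * (p w + 2 * D) = 0, p u * (p w + 2 * D) = 0, p v * (p w + 2 * D) = 0,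
      (p w - 2 * D) * (p w + 2 * D) = 0 &
      quartic (p e) = p u * p v + 4 * D * (p w + 2 * D)].
Hypothesis Ygen : forall x z, z != 0 -> exists p : pt,
  [/\ Y p, p e = x, p u = quartic x / z, p v = z & p w = - 2 * D].

Definition Y1 : set pt := [set p | Y p /\ p w = - 2 * D].

Let Ypt (p : pt) : Y p -> points k p. Proof. by rewrite YE => -[]. Qed.

Lemma Y1_quartic (p : pt) : Y1 p -> quartic (p e) = p u * p v.
Proof. by case=> /Yrel[_ _ _ _ ->] ->; ring. Qed.

Lemma Y_co_inj (p q : pt) : Y p -> Y q -> co p =1 co q -> p = q.
Proof.
move=> Yp Yq E; apply: rmorph_ext => f; have [P PE] := Yfun f.
by rewrite !PE //; apply: meval_eq.
Qed.

Definition quarticP : {poly C} := ('X - (2 * (a + b))%:P) * ('X + (2 * (a + b))%:P) *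
  ('X - (2 * (a - b))%:P) * ('X + (2 * (a - b))%:P).
Lemma quarticPE x : quarticP.[x] = quartic x.
Proof. by rewrite /quarticP !hornerE. Qed.
Lemma quarticP0 : quarticP != 0.
Proof.
have N c : 'X + c%:P != 0 :> {poly C} by rewrite -size_poly_eq0 size_XaddC.
by rewrite /quarticP !mulf_neq0 // ?polyXsubC_eq0.
Qed.

(** Through every point of the hypersurface [quartic] x = y z passes a polynomial curve in it that
    is not contained in z = 0. This makes the points of [Ygen], all with z nonzero, dense. *)
Lemma curve_through x0 y0 z0 : quartic x0 = y0 * z0 -> exists cx cy cz : {poly C},
  [/\ cx.[0] = x0, cy.[0] = y0, cz.[0] = z0, cz != 0 & forall t, quartic cx.[t] = cy.[t] * cz.[t]].
Proof.
move=> E; have [z00|z0N] := eqVneq z0 0; last first.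
  exists x0%:P, y0%:P, z0%:P; split=> [||||t]; rewrite ?hornerC ?polyC_eq0 //.
have [y00|y0N] := eqVneq y0 0; last first.
  (* As y0 is nonzero, y can stay constant while x moves, and z is solved from the equation. *)
  exists (x0%:P + 'X), y0%:P, (y0^-1 *: (quarticP \Po (x0%:P + 'X))).
  split=> [||||t]; rewrite ?(hornerZ, horner_comp, hornerD, hornerC, hornerX) ?addr0 ?quarticPE ?E ?z00 ?mulr0 //.
    have [t Et] := exists_nonroot quarticP0; apply/eqP => /(congr1 (fun p => p.[t - x0])).
    rewrite !(hornerZ, horner_comp, hornerD, hornerC, hornerX) addrC subrK => /eqP.
    by rewrite mulf_eq0 invr_eq0 (negPf y0N) (negPf Et).
  by rewrite mulVKf.
have /factor_theorem [G GE] : root quarticP x0 by rewrite /root quarticPE E z00 mulr0.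
(* Here x0 is a root of the quartic. Taking x = x0 + t^2 yields a factor t^2, of which y and z
   receive one t each, so that both vanish at t = 0. *)
exists (x0%:P + 'X ^+ 2), ('X * (G \Po (x0%:P + 'X ^+ 2))), 'X.
split=> [||||t]; rewrite ?hornerE ?polyX_eq0 ?y00 ?z00 ?expr0n ?addr0 //.
rewrite -quarticPE GE hornerM hornerXsubC horner_comp !hornerE; ring.
Qed.

(** Along a curve through the point, f and v restrict to nonzero polynomials in t; at a parameter
    where neither vanishes, [Ygen] provides the new point. *)
Lemma generic_nonzero (f : A0) (p : pt) : Y1 p -> p f != 0 ->
  exists p', [/\ Y1 p', p' v != 0 & p' f != 0].
Proof.
move=> Yp pf; have [P PE] := Yfun f.
have [cx [cy [cz [x0 y0 z0 cz0 F]]]] := curve_through (Y1_quartic Yp).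
pose c : 'I_4 -> {poly C} := tnth [tuple cx; cy; cz; (-2 * D)%:P].
have [q qE] := meval_curve c P.
have cE t i : (c i).[t] = c4 cx.[t] cy.[t] cz.[t] (- 2 * D) i.
  by case: i => [[|[|[|[|//]]]] ?]; rewrite /c /c4 !(tnth_nth 0) /= ?hornerC.
have q0 : q != 0.
  apply: contraNneq pf => q0; have [Yp' pw] := Yp; rewrite PE //.
  rewrite (@meval_eq _ _ _ (fun i => (c i).[0])) ?qE ?q0 ?horner0 // => i.
  rewrite cE x0 y0 z0 -pw.
  by case: i => [[|[|[|[|//]]]] ?].
have [t] := exists_nonroot (mulf_neq0 q0 cz0); rewrite hornerM mulf_eq0 negb_or => /andP[qt zt].
have [p' [Yp' pe pu pv pw]] := Ygen cx.[t] zt; exists p'; split=> //; first by rewrite pv.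
rewrite PE // (@meval_eq _ _ _ (fun i => (c i).[t])) ?qE // => i.
rewrite cE -pe -pv -pw.
have -> : cy.[t] = p' u by rewrite pu F mulfK.
by case: i => [[|[|[|[|//]]]] ?].
Qed.

(** If neither closed set contains [Y1], functions f1 and f2 witness this at points with v nonzero.
    There [Y1] is the graph of u = [quartic] e / v over the (e, v)-plane, so a line joins the two
    points; on it f1 and f2 are rational, and a parameter where both are nonzero gives a point
    outside both sets. *)
Lemma Y1_irreducible : irreducible_set k Y1.
Proof.
split.
  by have [p [Yp _ _ _ pw]] := Ygen 0 (oner_neq0 C); exists p.
move=> F1 F2 [E1 ->] [E2 ->] cov; apply: contrapT => /not_orP[N1 N2].
have nz E : ~ Y1 `<=` [set p | points k p /\ forall f : A0, E f -> p f = 0] ->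
    exists f p, [/\ E f, Y1 p, p v != 0 & p f != 0].
  move=> N; apply: contrapT => K; apply: N => p Yp; split; first by apply: Ypt; case: Yp.
  move=> f Ef; apply/eqP; apply: contrapT => /negP pf; apply: K.
  by have [p' [Yp' pv pf']] := generic_nonzero Yp pf; exists f, p'.
have [f1 [p1 [Ef1 Yp1 pv1 pf1]]] := nz _ N1.
have [f2 [p2 [Ef2 Yp2 pv2 pf2]]] := nz _ N2.
have YY1 := proj1 Yp1; have YY2 := proj1 Yp2.
have [P1 PE1] := Yfun f1; have [P2 PE2] := Yfun f2.
(* The line is parametrised so that t = 0 gives p1 and t = 1 gives p2. *)
pose cx : {poly C} := (p1 e)%:P + 'X * (p2 e - p1 e)%:P.
pose cz : {poly C} := (p1 v)%:P + 'X * (p2 v - p1 v)%:P.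
pose c t := c4 cx.[t] (quartic cx.[t] / cz.[t]) cz.[t] (- 2 * D).
have rat P : ratl cz (fun t => P.@[c t]).
  apply: ratl_meval; case=> [[|[|[|[|//]]]] ?]; rewrite /c /c4.
  - exact: ratl_poly.
  - have [N [q E]] := ratl_div cz (quarticP \Po cx); exists N, q => t z0.
    by rewrite E // horner_comp quarticPE.
  - exact: ratl_poly.
  - have [N [q E]] := ratl_poly cz (- 2 * D)%:P; exists N, q => t z0.
    by rewrite E // hornerC.
have [M1 [q1 Q1]] := rat P1; have [M2 [q2 Q2]] := rat P2.
have ptE (p : pt) t : Y1 p -> p v != 0 -> cx.[t] = p e -> cz.[t] = p v -> co p =1 c t.
  move=> Yp pv xE zE i; rewrite /c xE zE (Y1_quartic Yp) mulfK // -(proj2 Yp).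
  by case: i => [[|[|[|[|//]]]] ?].
have z0 : cz.[0] = p1 v by rewrite /cz !hornerE.
have z1 : cz.[1] = p2 v by rewrite /cz hornerD hornerM !hornerC hornerX mul1r addrC subrK.
have cN : cz != 0 by apply: contraNneq pv1 => c0; rewrite -z0 c0 horner0.
have q1N : q1 != 0.
  apply: contraNneq pf1 => q0; have := Q1 0; rewrite z0 q0 horner0 => /(_ pv1) /esym /eqP.
  rewrite mulf_eq0 expf_eq0 (negPf pv1) andbF /= => /eqP.
  rewrite PE1 // => <-; apply/eqP; apply: meval_eq; apply: ptE => //.
  by rewrite /cx !hornerE.
have q2N : q2 != 0.
  apply: contraNneq pf2 => q0; have := Q2 1; rewrite z1 q0 horner0 => /(_ pv2) /esym /eqP.
  rewrite mulf_eq0 expf_eq0 (negPf pv2) andbF /= => /eqP.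
  rewrite PE2 // => E; rewrite -[X in _ == X]E; apply/eqP; apply: meval_eq; apply: ptE => //.
  by rewrite /cx hornerD hornerM !hornerC hornerX mul1r addrC subrK.
have [t] := exists_nonroot (mulf_neq0 cN (mulf_neq0 q1N q2N)).
rewrite !hornerM !mulf_eq0 !negb_or => /and3P[zt q1t q2t].
have [p [Yp pe pu pv pw]] := Ygen cx.[t] zt.
have Y1p : Y1 p by [].
have co_p : co p =1 c t by apply: ptE; rewrite ?pv.
have [[_ /(_ _ Ef1) pf]|[_ /(_ _ Ef2) pf]] := cov _ Y1p.
- case/negP: q1t; rewrite Q1 // -(meval_eq _ co_p) -PE1 // pf mulr0 //.
- case/negP: q2t; rewrite Q2 // -(meval_eq _ co_p) -PE2 // pf mulr0 //.
Qed.

(** The points with v = 0 are limits. Along a curve through (x, y, z) every function f becomes a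
    polynomial in t, and its value at t = 0 defines a ring morphism. *)
Lemma Y1_limit x y z : quartic x = y * z -> exists p : pt, [/\ Y1 p, p e = x, p u = y & p v = z].
Proof.
move=> F; have [cx [cy [cz [x0 y0 z0 cz0 G]]]] := curve_through F.
have /choice [PP PPE] := Yfun.
pose c : 'I_4 -> {poly C} := tnth [tuple cx; cy; cz; (-2 * D)%:P].
have /choice [q qE] : forall f, exists q : {poly C}, forall t, (PP f).@[fun i => (c i).[t]] = q.[t].
  by move=> f; exact: meval_curve.
have cE t i : (c i).[t] = c4 cx.[t] cy.[t] cz.[t] (- 2 * D) i.
  by case: i => [[|[|[|[|//]]]] ?]; rewrite /c /c4 !(tnth_nth 0) /= ?hornerC.
have pE t : cz.[t] != 0 -> exists p : pt,
    [/\ Y1 p, (forall f, p f = (q f).[t]), p e = cx.[t], p u = cy.[t] & p v = cz.[t]].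
  move=> zt; have [p [Yp pe pu pv pw]] := Ygen cx.[t] zt; exists p.
  have pu' : p u = cy.[t] by rewrite pu G mulfK.
  split=> // f; rewrite -qE PPE //; apply: meval_eq => i; rewrite cE -pe -pu' -pv -pw.
  by case: i => [[|[|[|[|//]]]] ?].
(* A polynomial identity that holds at the actual points, where cz is nonzero, holds identically and
   so also at t = 0. *)
have lim (s : {poly C}) : (forall t (p : pt), cz.[t] != 0 -> Y1 p -> (forall f, p f = (q f).[t]) ->
    p e = cx.[t] -> p u = cy.[t] -> p v = cz.[t] -> s.[t] = 0) -> s = 0.
  by move=> H; apply: (poly_vanish_dense cz0) => t zt; have [p [? ? ? ? ?]] := pE t zt; exact: (H t p).
have qB : zmod_morphism (fun f => (q f).[0]).
  move=> f g /=; have E : q (f - g) - (q f - q g) = 0.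
    by apply: lim => t p _ _ E _ _ _; rewrite !hornerE -!E rmorphB subrr.
  by rewrite (subr0_eq E) hornerD hornerN.
have qM : monoid_morphism (fun f => (q f).[0]).
  split=> [|f g] /=.
    have E : q 1 - 1 = 0 by apply: lim => t p _ _ E _ _ _; rewrite !hornerE -!E rmorph1 subrr.
    by rewrite (subr0_eq E) hornerC.
  have E : q (f * g) - q f * q g = 0.
    by apply: lim => t p _ _ E _ _ _; rewrite !hornerE -!E rmorphM subrr.
  by rewrite (subr0_eq E) hornerM.
have val f (s : {poly C}) : (forall t (p : pt), cz.[t] != 0 -> Y1 p -> (forall f, p f = (q f).[t]) ->
    p e = cx.[t] -> p u = cy.[t] -> p v = cz.[t] -> p f = s.[t]) -> (q f).[0] = s.[0].
  move=> H; congr _.[_]; apply/eqP; rewrite -subr_eq0; apply/eqP/lim => t p zt Yp E pe pu pv.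
  by rewrite !hornerE -E (H t p) // subrr.
exists (mk_rmorph qB qM); split.
- split; last first.
    have := val w (- 2 * D)%:P; rewrite hornerC; apply=> t p _ [_ pw] *; by rewrite hornerC.
  rewrite YE; split=> [c'|f Ef].
    have := val (k c') c'%:P; rewrite hornerC; apply=> t p _ [/Ypt pp _] *; rewrite hornerC; exact: pp.
  have := val f 0; rewrite horner0; apply=> t p _ [+ _] *; rewrite horner0 YE => -[_]; exact.
- by have := val e cx; rewrite x0; apply.
- by have := val u cy; rewrite y0; apply.
- by have := val v cz; rewrite z0; apply.
Qed.

Lemma Y1_identified : identified_via [tuple e; u; v] Y1
  [set t : 3.-tuple C | quartic t`_0 = t`_1 * t`_2].
Proof.
split.
  apply/seteqP; split=> [_ [p Yp <-]|t /Y1_limit [p [Yp pe pu pv]]] /=.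
    exact: Y1_quartic.
  exists p => //; apply: eq_from_tnth => i; rewrite tnth_map !(tnth_nth 0) /=.
  by case: i => [[|[|[|//]]] ?] /=.
move=> f; have [P PE] := Yfun f.
(* On [Y1] the fourth coordinate w is constant and can be replaced by its value. *)
pose s : 4.-tuple {mpoly C[3]} := [tuple 'X_0; 'X_1; 'X_(@Ordinal 3 2 isT); (- 2 * D)%:MP].
exists (P \mPo s) => p [Yp pw]; rewrite PE // comp_mpoly_meval; apply: meval_eq => i.
rewrite /co !(tnth_nth 0); case: i => [[|[|[|[|//]]]] ?] /=;
  by rewrite ?mevalXU ?mevalC // (tnth_nth 0).
Qed.

Lemma Y_eq_Y1 : a ^+ 2 = b ^+ 2 -> Y = Y1.
Proof.
move=> ab; apply/seteqP; split=> p; last by case.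
move=> Yp; split=> //; have [_ _ _ + _] := Yrel Yp; rewrite ab subrr !mulr0 subr0 addr0.
by move/eqP; rewrite mulf_eq0 orbb => /eqP.
Qed.

Section Isolated.
Variable z : pt.
Hypotheses (Yz : Y z) (ze : z e = 0) (zu : z u = 0) (zv : z v = 0) (zw : z w = 2 * D).
Hypothesis D0 : D != 0.

Let D4 : 2 * D + 2 * D != 0.
Proof. by rewrite -mulr2n mulrn_eq0 mulf_eq0 pnatr_eq0 (negPf D0). Qed.

Lemma Y_cases (p : pt) : Y p -> Y1 p \/ p = z.
Proof.
move=> Yp; have [Ee Eu Ev /eqP Ew _] := Yrel Yp.
have : (p w - 2 * D == 0) || (p w + 2 * D == 0) by rewrite -mulf_eq0.
rewrite subr_eq0 addr_eq0 => /orP[/eqP pw|/eqP pw]; last by left; split; rewrite ?pw ?mulNr.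
right; apply: Y_co_inj => // i.
have N (x : C) : x * (p w + 2 * D) = 0 -> x = 0.
  by move/eqP; rewrite pw mulf_eq0 (negPf D4) orbF => /eqP.
by case: i => [[|[|[|[|//]]]] ?]; rewrite /co !(tnth_nth 0) /= ?ze ?zu ?zv ?zw //; apply: N.
Qed.

Lemma z_notY1 : ~ Y1 z.
Proof. by case=> _; rewrite zw => /eqP; rewrite mulNr -addr_eq0 (negPf D4). Qed.

Lemma Y1_neq : Y1 <> [set z].
Proof. by move=> E; apply: z_notY1; rewrite E. Qed.

Lemma singleton_irreducible (p : pt) : irreducible_set k [set p].
Proof.
split=> [|F1 F2 _ _ /(_ p erefl) [] H]; first by exists p.
- by left=> _ ->.
- by right=> _ ->.
Qed.

Let FY1 : set pt := [set p | points k p /\ forall f, [set w + k (2 * D)] f -> p f = 0].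
Let Fz : set pt := [set p | points k p /\ forall f, [set w - k (2 * D)] f -> p f = 0].

Lemma FY1E (p : pt) : points k p -> FY1 p <-> p w = - 2 * D.
Proof.
move=> pp; split=> [[_ /(_ _ erefl)]|pw].
  by rewrite rmorphD pp => /eqP; rewrite addr_eq0 mulNr => /eqP.
by split=> // f ->; rewrite rmorphD pp pw mulNr addNr.
Qed.

Lemma FzE (p : pt) : points k p -> Fz p <-> p w = 2 * D.
Proof.
move=> pp; split=> [[_ /(_ _ erefl)]|pw].
  by rewrite rmorphB pp => /eqP; rewrite subr_eq0 => /eqP.
by split=> // f ->; rewrite rmorphB pp pw subrr.
Qed.

Lemma irr_sub X : X `<=` Y -> irreducible_set k X -> X `<=` Y1 \/ X `<=` [set z].
Proof.
move=> XY [_ Xirr].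
have cov : X `<=` FY1 `|` Fz.
  move=> p Xp; have [[_ pw]|pE] := Y_cases (XY _ Xp); [left|right].
    by apply/FY1E => //; exact: (Ypt (XY _ Xp)).
  by apply/FzE; [exact: (Ypt (XY _ Xp))|rewrite pE].
have [||H|H] := Xirr FY1 Fz _ _ cov; [by eexists|by eexists|left|right] => p Xp.
- by split; [exact: XY|apply/FY1E; [exact: (Ypt (XY _ Xp))|exact: H]].
- have [[_ pw]|->//] := Y_cases (XY _ Xp).
  have /FzE := H _ Xp; rewrite pw => /(_ (Ypt (XY _ Xp))) /eqP.
  by rewrite eq_sym mulNr -addr_eq0 (negPf D4).
Qed.

Lemma components X : irr_component k Y X <-> X = Y1 \/ X = [set z].
Proof.
have Y1Y : Y1 `<=` Y by move=> p [].
have zY : [set z] `<=` Y by move=> p ->.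
split=> [[XY Xirr Xmax]|[->|->]].
- have [XY1|Xz] := irr_sub XY Xirr; [left|right]; apply/esym/Xmax => //.
    exact: Y1_irreducible.
  exact: singleton_irreducible.
- split=> //; first exact: Y1_irreducible.
  move=> X' XY Xirr Y1X; have [XY1|Xz] := irr_sub XY Xirr; first by apply/seteqP.
  have [p [Yp _ _ _ pw]] := Ygen 0 (oner_neq0 C).
  by exfalso; apply: z_notY1; rewrite -(Xz p); [|apply: Y1X].
- split=> //; first exact: singleton_irreducible.
  move=> X' XY Xirr zX; have [XY1|Xz] := irr_sub XY Xirr; last by apply/seteqP.
  by case: z_notY1; apply: XY1; apply: zX.
Qed.

(** A point inside [Y1] is a chain of length one, and a single point admits none; this separates the
    two dimensions. *)
Lemma dims : dim_lt k [set z] Y1.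
Proof.
exists 1%N; last first.
  move=> [F [Fi Fs]]; have [[F0 _ F0E] [[p Fp] _]] := Fi 0%N isT.
  have [[F1 _ F1E] _] := Fi 1%N isT.
  have [F01 F10] := Fs 0%N isT.
  have pz : p = z by move: Fp; rewrite F0E => -[].
  apply: F10; rewrite F1E => q [-> _]; by rewrite -pz.
have [p [Yp pe pu pv pw]] := Ygen 0 (oner_neq0 C).
have [p' [Yp' pe' pu' pv' pw']] := Ygen 1 (oner_neq0 C).
exists (fun i => if i is 0%N then [set p] else Y1); split=> [[|[|//]] _|[|//] _] /=.
- split; last exact: singleton_irreducible.
  exists [set q | points k q /\ forall f, [set f | f = e - k (p e) \/ f = u - k (p u) \/ f = v - k (p v)] f -> q f = 0].
    by eexists.
  apply/seteqP; split=> [q ->|q [[Yq qw] [pq /= Eq]]].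
    do 2!split=> //; first exact: Ypt.
    by move=> f /= [->|[->|->]]; rewrite rmorphB (Ypt Yp) subrr.
  apply: Y_co_inj => // i.
  have K f : q (f - k (p f)) = 0 -> q f = p f by rewrite rmorphB pq => /subr0_eq.
  case: i => [[|[|[|[|//]]]] ?]; rewrite /co !(tnth_nth 0) /=.
  + by apply: K; apply: Eq; left.
  + by apply: K; apply: Eq; right; left.
  + by apply: K; apply: Eq; right; right.
  + by rewrite qw pw.
- split; last exact: Y1_irreducible.
  exists (points k); first by exists set0; apply/seteqP; split=> [q pq|q []] //; split.
  by apply/seteqP; split=> [q Yq|q []] //; split=> //; apply: Ypt; case: Yq.
- split=> [q ->//|/(_ p')] /=.
  move=> /(_ (conj Yp' pw')) E; have := oner_neq0 C.
  by rewrite -pe' E pe eqxx.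
Qed.

Lemma z_isolated : isolated_in k Y z.
Proof.
split=> //; exists FY1; first by eexists.
apply/seteqP; split=> p.
  move=> [Yp pz]; split=> //; apply/FY1E; first exact: Ypt.
  by have [[]|] := Y_cases Yp.
move=> [Yp /FY1E] /(_ (Ypt Yp)) pw; split=> // pz.
by apply: z_notY1; rewrite -pz.
Qed.

(** On Y every function is a polynomial in e, u, v, w. By induction on this polynomial, the function
    minus its value at z is a combination of the four generators, all of which vanish at z. *)
Lemma z_maxideal : maxideal_gen Y z [:: u; v; e; w - k (2 * D)].
Proof.
pose g := [:: u; v; e; w - k (2 * D)].
have zg (h : nat -> A0) : z (\sum_(i < size g) h i * g`_i) = 0.
  rewrite rmorph_sum big1 // => -[[|[|[|[|//]]]] ?] _; rewrite rmorphM /=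
    ?zu ?zv ?ze ?mulr0 // rmorphB (Ypt Yz) zw subrr mulr0 //.
move=> f; split=> [zf|[h /(_ z Yz) ->]]; last exact: zg.
have [P PE] := Yfun f.
suff [f' [h [Ef Eh]]] : exists f' (h : nat -> A0), (forall p : pt, Y p -> p f' = P.@[co p]) /\
    forall p : pt, Y p -> p f' - z f' = p (\sum_(i < size g) h i * g`_i).
  exists h => p Yp; rewrite -Eh // PE // Ef // Ef //.
  by rewrite -(PE _ Yz) zf subr0.
pose H f' := exists h : nat -> A0, forall p : pt, Y p -> p f' - z f' = p (\sum_(i < size g) h i * g`_i).
suff [f' [Ef [h Eh]]] : exists f', (forall p : pt, Y p -> p f' = P.@[co p]) /\ H f' by exists f', h.
have Hg i f' : (i < 4)%N -> (forall p : pt, Y p -> p f' - z f' = p g`_i) -> H f'.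
  move=> i4 E; exists (fun j => if j == i then 1 else 0) => p Yp; rewrite E // rmorph_sum.
  rewrite (bigD1 (Ordinal i4)) //= eqxx mul1r big1 ?addr0 // => j /negPf ji.
  by rewrite -[_ == i]/(j == Ordinal i4) ji mul0r rmorph0.
elim/mpoly_ring_ind: P {PE} => [c|i|P Q [f1 [E1 [h1 H1]]] [f2 [E2 [h2 H2]]]|P Q [f1 [E1 [h1 H1]]] [f2 [E2 [h2 H2]]]].
- exists (k c); split=> [p Yp|]; first by rewrite mevalC (Ypt Yp).
  exists (fun _ => 0) => p Yp; rewrite (Ypt Yp) (Ypt Yz) subrr big1 ?rmorph0 // => i _; exact: mul0r.
- exists (tnth [tuple e; u; v; w] i); split=> [p Yp|].
    by rewrite mevalXU /co; case: i => [[|[|[|[|//]]]] ?].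
  case: i => [[|[|[|[|//]]]] ?]; rewrite (tnth_nth 0) /=.
  + by apply: (Hg 2%N) => // p Yp /=; rewrite ze subr0.
  + by apply: (Hg 0%N) => // p Yp /=; rewrite zu subr0.
  + by apply: (Hg 1%N) => // p Yp /=; rewrite zv subr0.
  + by apply: (Hg 3%N) => // p Yp /=; rewrite zw rmorphB (Ypt Yp).
- exists (f1 + f2); split=> [p Yp|]; first by rewrite rmorphD mevalD E1 // E2.
  exists (fun i => h1 i + h2 i) => p Yp.
  rewrite !rmorphD opprD addrACA H1 // H2 // -rmorphD -big_split; congr (p _).
  by apply: eq_bigr => i _; rewrite mulrDl.
- exists (f1 * f2); split=> [p Yp|]; first by rewrite rmorphM mevalM E1 // E2.
  exists (fun i => f2 * h1 i + k (z f1) * h2 i) => p Yp.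
  transitivity (p f2 * (p f1 - z f1) + z f1 * (p f2 - z f2)); first by rewrite !rmorphM; ring.
  rewrite H1 // H2 // -(Ypt Yp (z f1)) -!rmorphM -rmorphD !mulr_sumr -big_split; congr (p _).
  by apply: eq_bigr => i _; rewrite mulrDl !mulrA (Ypt Yp).
Qed.

End Isolated.
End Geometry.

(** * The presentation *)

Section Presentation.
Variable C : numFieldType.
Local Notation S := {mpoly C[6]}.
Let A : S := 'X_(@Ordinal 6 0 isT).
Let B : S := 'X_(@Ordinal 6 1 isT).
Let r : S := 'X_(@Ordinal 6 2 isT).
Let R' : S := 'X_(@Ordinal 6 3 isT).
Let e : S := 'X_(@Ordinal 6 4 isT).
Let a : S := 'X_(@Ordinal 6 5 isT).
Let D := A ^+ 2 - B ^+ 2.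
Let F : S := (e - 2 * (A + B)) * (e + 2 * (A + B)) * (e - 2 * (A - B)) * (e + 2 * (A - B)).

Let eqX j (j6 j6' : (j < 6)%N) : 'X_(Ordinal j6) = 'X_(Ordinal j6') :> S.
Proof. by congr 'X_ _; apply: val_inj. Qed.

Definition relators : seq S :=
  [:: e * (a + 2 * D); r * (a + 2 * D); R' * (a + 2 * D);
      (a - 2 * D) * (a + 2 * D);
      (e - 2 * (A + B)) * (e + 2 * (A + B)) *
      (e - 2 * (A - B)) * (e + 2 * (A - B))
      - (r * R' + 4 * D * (a + 2 * D))].

Definition inI (P : S) : Prop :=
  exists Q : nat -> S, P = \sum_(i < size relators) Q i * relators`_i.

Lemma inI0 : inI 0.
Proof. by exists (fun _ => 0); rewrite big1 // => i _; rewrite mul0r. Qed.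
Lemma inI_D P P' : inI P -> inI P' -> inI (P + P').
Proof.
move=> [Q ->] [Q' ->]; exists (fun i => Q i + Q' i).
by rewrite -big_split; apply: eq_bigr => i _; rewrite mulrDl.
Qed.
Lemma inI_M c P : inI P -> inI (c * P).
Proof.
move=> [Q ->]; exists (fun i => c * Q i).
by rewrite mulr_sumr; apply: eq_bigr => i _; rewrite mulrA.
Qed.
Lemma inI_rel i c : (i < 5)%N -> inI (c * relators`_i).
Proof.
move=> i5; apply: inI_M; exists (fun j => if j == i then 1 else 0).
rewrite (bigD1 (Ordinal i5)) //= eqxx mul1r big1 ?addr0 // => j /negPf ji.
by rewrite -[_ == i]/(j == Ordinal i5) ji mul0r.
Qed.
Lemma inI_eq P P' : inI P -> P' = P -> inI P'. Proof. by move=> ? ->. Qed.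

(** Stands for membership in C[A, B, e]. The form through values is the one needed to pass between
    points with the same A, B and e. *)
Definition dependsABe (c : S) : Prop := forall s s' : 'I_6 -> C,
  A.@[s] = A.@[s'] -> B.@[s] = B.@[s'] -> e.@[s] = e.@[s'] -> c.@[s] = c.@[s'].
Definition dependsAB (c : S) : Prop := forall s s' : 'I_6 -> C,
  A.@[s] = A.@[s'] -> B.@[s] = B.@[s'] -> c.@[s] = c.@[s'].

Lemma dependsABe_D c c' : dependsABe c -> dependsABe c' -> dependsABe (c + c').
Proof. by move=> H H' s s' *; rewrite !mevalD (H s s') // (H' s s'). Qed.
Lemma dependsABe_M c c' : dependsABe c -> dependsABe c' -> dependsABe (c * c').
Proof. by move=> H H' s s' *; rewrite !mevalM (H s s') // (H' s s'). Qed.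
Lemma dependsABe_C k : dependsABe k%:MP.
Proof. by move=> s s' *; rewrite !mevalC. Qed.
Lemma dependsABe_disc : dependsABe D.
Proof. by move=> s s' EA EB _; rewrite /D !(mevalB, mevalM) EA EB. Qed.
Lemma dependsABe_F : dependsABe F.
Proof.
move=> s s' EA EB Ee; rewrite /F !(mevalM, mevalB, mevalD) EA EB Ee.
by rewrite !meval1.
Qed.

(** Against the factor a + 2D the relations make e, r and R' zero and a equal to 2D, so that only A
    and B survive. *)
Lemma reduceAB M : exists2 m, dependsAB m & inI ((a + 2 * D) * (M - m)).
Proof.
elim/mpoly_ring_ind: M => [c|i|P P' [m Am Im] [m' Am' Im']|P P' [m Am Im] [m' Am' Im']].
- by exists c%:MP; [move=> s s' *; rewrite !mevalC|rewrite subrr mulr0; exact: inI0].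
- have zero k : (k < 3)%N -> relators`_k = 'X_i * (a + 2 * D) ->
      exists2 m, dependsAB m & inI ((a + 2 * D) * ('X_i - m)).
    move=> k3 E; exists 0; first by move=> s s' *; rewrite !meval0.
    by rewrite subr0; apply: inI_eq (inI_rel 1 (leq_trans k3 _)) _; rewrite // E; ring.
  have self : dependsAB 'X_i -> exists2 m, dependsAB m & inI ((a + 2 * D) * ('X_i - m)).
    by move=> d; exists 'X_i => //; rewrite subrr mulr0; exact: inI0.
  case: i zero self => [[|[|[|[|[|[|//]]]]]] i6]; rewrite (eqX i6 isT) => zero self.
  + by apply: self => s s' + _.
  + by apply: self => s s' _ +.
  + exact: (zero 1%N).
  + exact: (zero 2%N).
  + exact: (zero 0%N).
  + exists (2 * D).
      move=> s s' EA EB; rewrite /D !(mevalM, mevalB) EA EB.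
      by rewrite !(mevalD, meval1).
    by apply: inI_eq (@inI_rel 3 1 _) _ => //=; rewrite -/a; ring.
- exists (m + m'); first by move=> s s' *; rewrite !mevalD (Am s s') // (Am' s s').
  by apply: inI_eq (inI_D Im Im') _; ring.
- exists (m * m'); first by move=> s s' *; rewrite !mevalM (Am s s') // (Am' s s').
  by apply: inI_eq (inI_D (inI_M P' Im) (inI_M m Im')) _; ring.
Qed.

(** The factor R' before g leaves the constant term to f alone. M is arbitrary here and is cut down
    to C[A, B] afterwards by [reduceAB]. *)
Definition normal (P : S) : Prop := exists (f g : {poly S}) (M : S),
  [/\ forall k, dependsABe f`_k, forall k, dependsABe g`_k &
      inI (P - (f.[r] + R' * g.[R'] + (a + 2 * D) * M))].

Lemma normal_D P P' : normal P -> normal P' -> normal (P + P').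
Proof.
move=> [f [g [M [df dg E]]]] [f' [g' [M' [df' dg' E']]]].
exists (f + f'), (g + g'), (M + M'); split=> [k|k|]; rewrite ?coefD.
- exact: dependsABe_D.
- exact: dependsABe_D.
- by apply: inI_eq (inI_D E E') _; rewrite !hornerD; ring.
Qed.

Lemma normal_eq P P' : normal P -> inI (P' - P) -> normal P'.
Proof.
move=> [f [g [M [df dg E]]]] E'; exists f, g, M; split=> //.
by apply: inI_eq (inI_D E' E) _; ring.
Qed.

Let d0 : dependsABe 0. Proof. by move=> s s' *; rewrite !meval0. Qed.

Lemma normal_a M : normal ((a + 2 * D) * M).
Proof.
exists 0, 0, M; split=> [k|k|]; rewrite ?coef0 // !horner0.
by apply: inI_eq inI0 _; ring.
Qed.

Lemma normal_r c k : dependsABe c -> normal (c * r ^+ k).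
Proof.
move=> dc; exists (c%:P * 'X^k), 0, 0; split=> [j|j|]; rewrite ?coef0 ?coefCM ?coefXn //.
  by apply: dependsABe_M => //; case: (j == k) => // s s' *; rewrite !meval1.
by apply: inI_eq inI0 _; rewrite !(hornerM, hornerC, hornerXn); ring.
Qed.

Lemma normal_R c k : dependsABe c -> normal (c * R' ^+ k).
Proof.
case: k => [|k] dc; first by rewrite expr0 -(expr0 r); exact: normal_r.
exists 0, (c%:P * 'X^k), 0; split=> [j|j|]; rewrite ?coef0 ?coefCM ?coefXn //.
  by apply: dependsABe_M => //; case: (j == k) => // s s' *; rewrite !meval1.
by apply: inI_eq inI0 _; rewrite !(hornerM, hornerC, hornerXn) exprS; ring.
Qed.

Lemma normal_sum I (s : seq I) (G : I -> S) : (forall i, normal (G i)) -> normal (\sum_(i <- s) G i).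
Proof.
move=> H; elim/big_ind: _ => [||i _]; [|exact: normal_D|exact: H].
by have := normal_r 0 d0; rewrite mul0r.
Qed.

Lemma normal_mul x P : (forall c k, dependsABe c -> normal (x * (c * r ^+ k))) ->
  (forall c k, dependsABe c -> normal (x * (c * R' ^+ k.+1))) -> normal P -> normal (x * P).
Proof.
move=> Hr HR [f [g [M [df dg E]]]].
apply: (@normal_eq (\sum_(i < size f) x * (f`_i * r ^+ i) + \sum_(i < size g) x * (g`_i * R' ^+ i.+1)
   + (a + 2 * D) * (x * M))).
  by apply: normal_D; [apply: normal_D; apply: normal_sum => i; [exact: Hr|exact: HR]|exact: normal_a].
apply: inI_eq (inI_M x E) _; rewrite !horner_coef -!mulr_sumr.
have -> : \sum_(i < size g) g`_i * R' ^+ i.+1 = R' * \sum_(i < size g) g`_i * R' ^+ i.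
  by rewrite mulr_sumr; apply: eq_bigr => i _; rewrite exprS; ring.
by ring.
Qed.

(** The last relation trades r R' for F, which involves only A, B and e, up to a multiple of a +
    2D. *)
Lemma normal_rR x c : normal (F * c * x) -> normal (r * R' * (c * x)).
Proof.
move=> H; apply: normal_eq (normal_D H (normal_a (- (4 * D * c * x)))) _.
by apply: inI_eq (@inI_rel 4 (- (c * x)) _) _ => //=; rewrite /F; ring.
Qed.

Lemma normal_mulABe x P : dependsABe x -> normal P -> normal (x * P).
Proof.
move=> dx; apply: normal_mul => c k dc; rewrite mulrA; [apply: normal_r|apply: normal_R];
  exact: dependsABe_M.
Qed.

(** The induction on P is made for multiplication by P on normal forms, which reduces it to the six
    variables. Only r against powers of R' and R' against powers of r call for a relation; a is
    split as (a + 2D) - 2D. *)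
Lemma normal_all P : normal P.
Proof.
suff H : forall Q, normal Q -> normal (P * Q).
  by rewrite -[P]mulr1; apply: H; have := normal_r 0 (dependsABe_C 1); rewrite mulr1 mpolyC1.
elim/mpoly_ring_ind: P => [c|i|P P' IH IH'|P P' IH IH'] Q nQ.
- by apply: normal_mulABe nQ; exact: dependsABe_C.
- case: i => [[|[|[|[|[|[|//]]]]]] i6]; rewrite (eqX i6 isT).
  + by apply: normal_mulABe nQ => s s'.
  + by apply: normal_mulABe nQ => s s'.
  + apply: normal_mul nQ => c k dc.
      by rewrite mulrCA -exprS; exact: normal_r.
    rewrite exprS (mulrCA c) (mulrA _ R'); apply: normal_rR; apply: normal_R.
    by apply: dependsABe_M => //; exact: dependsABe_F.
  + apply: normal_mul nQ => c k dc; last by rewrite mulrCA -exprS; exact: normal_R.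
    case: k => [|k]; first by have := normal_R 1 dc; rewrite expr0 mulr1 expr1 mulrC.
    rewrite exprS (mulrCA c) (mulrA _ r) (mulrC _ r); apply: normal_rR; apply: normal_r.
    by apply: dependsABe_M => //; exact: dependsABe_F.
  + by apply: normal_mulABe nQ => s s'.
  + have K x c : dependsABe c -> (forall c', dependsABe c' -> normal (c' * x)) -> normal (a * (c * x)).
      move=> dc H; apply: normal_eq (normal_D (normal_a (c * x)) (H (- (2 * D) * c) _)) _.
        apply: dependsABe_M => //; rewrite -mulNr -mpolyC_nat -mpolyCN.
        by apply: dependsABe_M; [exact: dependsABe_C|exact: dependsABe_disc].
      by apply: inI_eq inI0 _; rewrite -/a; ring.
    by apply: normal_mul nQ => c k dc; apply: K => // c' dc'; [exact: normal_r|exact: normal_R].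
- by rewrite mulrDl; apply: normal_D; [exact: IH|exact: IH'].
- by rewrite -mulrA; apply/IH/IH'.
Qed.

Section Points.
Variable T : set ('I_6 -> C).
Hypothesis Trel : forall s, T s -> forall i, (i < 5)%N -> (relators`_i).@[s] = 0.
Hypothesis Tgen : forall a0 b0 x z, z != 0 -> exists s : 'I_6 -> C,
  [/\ T s, A.@[s] = a0, B.@[s] = b0, e.@[s] = x &
   [/\ r.@[s] = quartic a0 b0 x / z, R'.@[s] = z & a.@[s] = - 2 * (a0 ^+ 2 - b0 ^+ 2)]].
Hypothesis Tiso : forall a0 b0, a0 ^+ 2 - b0 ^+ 2 != 0 -> exists s : 'I_6 -> C,
  [/\ T s, A.@[s] = a0, B.@[s] = b0, e.@[s] = 0 &
   [/\ r.@[s] = 0, R'.@[s] = 0 & a.@[s] = 2 * (a0 ^+ 2 - b0 ^+ 2)]].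

Let mevalDE s : D.@[s] = A.@[s] ^+ 2 - B.@[s] ^+ 2.
Proof. by rewrite /D !(mevalM, mevalB). Qed.
Let mevalFE s : F.@[s] = quartic A.@[s] B.@[s] e.@[s].
Proof. by rewrite /F !(mevalM, mevalB, mevalD) !meval1. Qed.

Lemma inI_vanish P s : inI P -> T s -> P.@[s] = 0.
Proof.
move=> [Q ->] Ts; rewrite raddf_sum big1 // => -[i i5] _; rewrite /= mevalM Trel ?mulr0 //.
Qed.

(** In f(F0 / z) the exponents of z are at most 0, in z g(z) they are positive, so the two parts
    vanish separately. For F0 = 0 only the constant term of f is visible. *)
Lemma laurent_vanish (f g : {poly C}) (F0 : C) :
  (forall z, z != 0 -> f.[F0 / z] + z * g.[z] = 0) -> (F0 != 0 -> f = 0) /\ g = 0.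
Proof.
move=> H; pose n := size f.
(* With n the size of f, X f0 is z^n f(F0 / z), of exponents 1 to n, while z^(n+1) g starts at
   exponent n + 1. *)
pose f0 := \poly_(j < n) (f`_(n.-1 - j) * F0 ^+ (n.-1 - j)).
have E : 'X * f0 + 'X^(n.+1) * g = 0.
  have X0 : 'X != 0 :> {poly C} by rewrite polyX_eq0.
  apply: (poly_vanish_dense X0) => z; rewrite hornerX => z0.
  have -> : ('X * f0 + 'X^(n.+1) * g).[z] = z ^+ n * (f.[F0 / z] + z * g.[z]).
    rewrite hornerD !hornerM hornerX hornerXn mulrDr !mulrA -exprSr; congr (_ + _).
    rewrite horner_poly horner_coef !mulr_sumr (reindex_inj rev_ord_inj) /=.
    apply: eq_bigr => i _; have lt := ltn_ord i.
    have -> : (n.-1 - (n - i.+1) = i)%N by rewrite /n in lt *; lia.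
    have -> : z ^+ n = z * z ^+ (n - i.+1) * z ^+ i.
      by rewrite -exprS -exprD; congr (_ ^+ _); rewrite /n in lt *; lia.
    rewrite exprMn exprVn; field.
    by rewrite expf_neq0.
  by rewrite H ?mulr0.
have cE j := congr1 (fun p : {poly C} => p`_j) E.
split.
  move=> F00; apply/polyP => k; rewrite coef0; have [lt|ge] := ltnP k n; last by rewrite nth_default.
  have := cE (n - k)%N; rewrite coefD coefXM coefXnM coef0.
  have -> : (n - k < n.+1)%N by lia.
  have -> : (n - k == 0)%N = false by lia.
  rewrite addr0 coef_poly.
  have -> : ((n - k).-1 < n)%N by lia.
  have -> : (n.-1 - (n - k).-1 = k)%N by lia.
  by move/eqP; rewrite mulf_eq0 expf_eq0 (negPf F00) andbF orbF => /eqP.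
apply/polyP => k; have := cE (n.+1 + k)%N; rewrite coefD coefXM coefXnM !coef0.
have -> : (n.+1 + k < n.+1)%N = false by lia.
have -> : (n.+1 + k == 0)%N = false by lia.
rewrite coef_poly.
have -> : ((n.+1 + k).-1 < n)%N = false by lia.
by rewrite add0r addKn.
Qed.

Lemma presentation P : (forall s, T s -> P.@[s] = 0) <-> inI P.
Proof.
split=> [PT|PI s Ts]; last exact: inI_vanish.
have [f [g [M [df dg E]]]] := normal_all P; have [m dm Em] := reduceAB M.
have {}E : inI (P - (f.[r] + R' * g.[R'] + (a + 2 * D) * m)).
  by apply: inI_eq (inI_D E Em) _; ring.
pose Q := f.[r] + R' * g.[R'] + (a + 2 * D) * m.
have QT s : T s -> Q.@[s] = 0.
  by move=> Ts; have := inI_vanish E Ts; rewrite mevalB PT // sub0r => /eqP; rewrite oppr_eq0 => /eqP.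
pose ev (s : 'I_6 -> C) (p : {poly S}) : {poly C} := map_poly (meval s) p.
have evE s p x : (p.[x]).@[s] = (ev s p).[x.@[s]] by rewrite -horner_map.
have same (s s' : 'I_6 -> C) (p : {poly S}) : (forall k, dependsABe p`_k) -> A.@[s] = A.@[s'] -> B.@[s] = B.@[s'] ->
    e.@[s] = e.@[s'] -> ev s p = ev s' p.
  by move=> dp EA EB Ee; apply/polyP => k; rewrite !coef_map /=; apply: dp.
(* At the points of [Tgen] the factor a + 2D vanishes and r = F / R', so the normal form becomes a
   Laurent polynomial in R' made of f and g. *)
have lau s : (F.@[s] != 0 -> ev s f = 0) /\ ev s g = 0.
  rewrite mevalFE; apply: laurent_vanish => z z0.
  have [s' [Ts EA EB Ee [Er ER Ea]]] := Tgen A.@[s] B.@[s] e.@[s] z0.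
  rewrite (same s s') // (same s s' g) //.
  have := QT _ Ts; rewrite /Q /D !(mevalD, mevalN, mevalM, meval1) !evE Er ER Ea EA EB.
  by rewrite mulNr addNr mul0r addr0.
have FN : F != 0.
  apply/eqP => F0; have := mevalFE (fun i => (i == 4%N :> nat)%:R).
  rewrite F0 meval0 !mevalXU /quartic /= => /eqP.
  by rewrite addr0 subr0 !mulr0 !(addr0, subr0) !mulr1 eq_sym oner_eq0.
have f0 : f = 0.
  apply/polyP => k; rewrite coef0; apply: (mpoly_vanish_dense FN) => s /(proj1 (lau s)) fs.
  by have := congr1 (fun p : {poly C} => p`_k) fs; rewrite coef0 coef_map.
have g0 : g = 0.
  apply/polyP => k; rewrite coef0; apply: mpoly_vanish => s; have gs := proj2 (lau s).
  by have := congr1 (fun p : {poly C} => p`_k) gs; rewrite coef0 coef_map.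
have DN : D != 0.
  apply/eqP => D0; have := mevalDE (fun i => (i == 0%N :> nat)%:R).
  by rewrite D0 meval0 !mevalXU /= expr1n expr0n subr0 => /eqP; rewrite eq_sym oner_eq0.
(* Once f and g are gone, the isolated points detect m: there a + 2D takes the nonzero value 4D. *)
have m0 : m = 0.
  apply: (mpoly_vanish_dense DN) => s; rewrite mevalDE => Ds.
  have [s' [Ts EA EB Ee [Er ER Ea]]] := Tiso Ds.
  rewrite (dm s s') //; have := QT _ Ts.
  rewrite /Q f0 g0 !horner0 mulr0 !add0r /D !(mevalD, mevalN, mevalM, meval1) Ea EA EB => /eqP.
  by rewrite -mulr2n mulf_eq0 mulrn_eq0 mulf_eq0 pnatr_eq0 (negPf Ds) => /eqP.
by apply: inI_eq E _; rewrite f0 g0 m0 !horner0 !mulr0 !addr0 subr0.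
Qed.

End Points.
End Presentation.

(** * Baby Verma modules *)

Section ConstantTerm.
Variables (C : numFieldType) (zeta : C).
Hypothesis zetaP : 4.-primitive_root zeta.
Variables (H : pzRingType) (sc : {rmorphism C -> H}) (h : 'I_6 -> H) (T : W -> H).
Hypothesis spec : cherednik_spec zeta sc h T.
Variable P : pt C -> {rmorphism H -> 'M[C]_8}.
Hypothesis PP : forall v, dunkl_spec zeta sc h T v (P v).
Variables (a b : C) (n : nat) (rho : W -> 'M[C]_n).
Hypothesis rhoM : forall g g', rho (mulW g g') = rho g *m rho g'.
Hypothesis rho1 : rho w1 = 1%:M.

Local Notation A := (h iA).
Local Notation B := (h iB).
Local Notation X := (h iX).
Local Notation Y := (h iY).
Local Notation x := (h ix).
Local Notation y := (h iy).
Local Notation pbwA := (pbw_sum sc h T).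
Local Notation mono := (mono h T).

Definition specval : 'I_6 -> C := fun i => if i == iA then a else if i == iB then b else 0.

(* The action of z on E_rho inside the Verma module, followed by the projection
   onto the component of degree 0 in X and Y. *)
Definition pi0 (z : H) : 'M[C]_n :=
  \sum_w ((xget [ffun => 0] [set q | pbwA q = z]) w).@[specval] *: rho w.

Lemma pi0_pbw q : pi0 (pbwA q) = \sum_w (q w).@[specval] *: rho w.
Proof. by rewrite /pi0; case: xgetP => [q' _ /= /(pbw_inj zetaP PP) -> //|/(_ q)]; case. Qed.

Lemma pi0_D z z' : pi0 (z + z') = pi0 z + pi0 z'.
Proof.
have [q ->] := pbw_surj zetaP spec z; have [q' ->] := pbw_surj zetaP spec z'.
rewrite -pbw_additive !pi0_pbw -big_split; apply: eq_bigr => w _.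
by rewrite ffunE mevalD scalerDl.
Qed.

Lemma pi0_0 : pi0 0 = 0.
Proof. by rewrite -(pbw0 sc h T) pi0_pbw big1 // => w _; rewrite ffunE meval0 scale0r. Qed.

Lemma pi0_N z : pi0 (- z) = - pi0 z.
Proof. by apply/eqP; rewrite -addr_eq0 -pi0_D addNr pi0_0. Qed.
Lemma pi0_B z z' : pi0 (z - z') = pi0 z - pi0 z'.
Proof. by rewrite pi0_D pi0_N. Qed.

Lemma pi0_sum I (r : seq I) (F : I -> H) : pi0 (\sum_(i <- r) F i) = \sum_(i <- r) pi0 (F i).
Proof. by elim: r => [|i r IH]; rewrite ?big_nil ?pi0_0 // !big_cons pi0_D IH. Qed.

Lemma pi0_mono c i j k l p q w :
  pi0 (sc c * (A ^+ i * B ^+ j * (X ^+ k * Y ^+ l) * T w * (x ^+ p * y ^+ q))) =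
  (c * a ^+ i * b ^+ j * [&& k == 0, l == 0, p == 0 & q == 0]%N%:R) *: rho w.
Proof.
rewrite -mono_mn -pbw_mono pi0_pbw (bigD1 w) //= ffunE eqxx big1 ?addr0 => [|w' /negPf ww].
  congr (_ *: _); rewrite mevalZ mevalX !big_ord_recl big_ord0 !mnmE /= /specval /= mulr1 !mulrA.
  by case: k l p q => [|k] [|l] [|p] [|q] /=;
    rewrite ?expr0 ?exprS ?(mul0r, mulr0, mulr1).
by rewrite ffunE ww meval0 scale0r.
Qed.

Lemma mono_ind (Q : H -> Prop) : Q 0 -> (forall z z', Q z -> Q z' -> Q (z + z')) ->
  (forall c i j k l p q w, Q (sc c * (A ^+ i * B ^+ j * (X ^+ k * Y ^+ l) * T w * (x ^+ p * y ^+ q)))) ->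
  forall z, Q z.
Proof.
move=> Q0 QD QM z; have [q ->] := pbw_surj zetaP spec z.
apply: (big_ind Q) => // w _; apply: (big_ind Q) => // m _; rewrite (mn_eta m) mono_mn; exact: QM.
Qed.

Let scZ c z z' : z * (sc c * z') = sc c * (z * z'). Proof. exact: spec_scZ spec c z z'. Qed.

Let expC (u v : H) k : u * v = v * u -> u ^+ k * v = v * u ^+ k.
Proof. by move=> E; have := @commrX _ v u k (esym E). Qed.

Lemma pi0_x z : pi0 (z * x) = 0.
Proof.
elim/mono_ind: z => [|z z' IH IH'|c i j k l p q w]; first by rewrite mul0r pi0_0.
  by rewrite mulrDl pi0_D IH IH' addr0.
have := pi0_mono c i j k l p.+1 q w; rewrite /= !andbF mulr0 scale0r => <-; congr pi0.
by rewrite -!mulrA; do 6!congr (_ * _); rewrite exprSr -mulrA; congr (_ * _); apply: expC; rewrite (xyC spec).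
Qed.

Lemma pi0_y z : pi0 (z * y) = 0.
Proof.
elim/mono_ind: z => [|z z' IH IH'|c i j k l p q w]; first by rewrite mul0r pi0_0.
  by rewrite mulrDl pi0_D IH IH' addr0.
have := pi0_mono c i j k l p q.+1 w; rewrite /= !andbF mulr0 scale0r => <-; congr pi0.
by rewrite -!mulrA; do 7!congr (_ * _); rewrite exprSr.
Qed.

Let pullAB z c i j t : z * (sc c * (A ^+ i * B ^+ j * t)) = sc c * (A ^+ i * B ^+ j * (z * t)).
Proof.
rewrite scZ; congr (_ * _); rewrite mulrA.
have -> : z * (A ^+ i * B ^+ j) = A ^+ i * B ^+ j * z.
  rewrite mulrA -(expC _ (spec_A spec z)) -!mulrA; congr (_ * _).
  by rewrite (expC _ (spec_B spec z)).
by rewrite mulrA.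
Qed.

Lemma pi0_X z : pi0 (X * z) = 0.
Proof.
elim/mono_ind: z => [|z z' IH IH'|c i j k l p q w]; first by rewrite mulr0 pi0_0.
  by rewrite mulrDr pi0_D IH IH' addr0.
have := pi0_mono c i j k.+1 l p q w; rewrite /= mulr0 scale0r => <-; congr pi0.
by rewrite -!(mulrA (A ^+ i * B ^+ j)) pullAB exprS !mulrA.
Qed.

Lemma pi0_Y z : pi0 (Y * z) = 0.
Proof.
elim/mono_ind: z => [|z z' IH IH'|c i j k l p q w]; first by rewrite mulr0 pi0_0.
  by rewrite mulrDr pi0_D IH IH' addr0.
have := pi0_mono c i j k l.+1 p q w; rewrite /= !andbF mulr0 scale0r => <-; congr pi0.
rewrite -!(mulrA (A ^+ i * B ^+ j)) pullAB exprS (mulrA (X ^+ k) Y) (expC k (XYC spec)).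
by rewrite !mulrA.
Qed.

Lemma pi0_sc c z : pi0 (sc c * z) = c *: pi0 z.
Proof.
elim/mono_ind: z => [|z z' IH IH'|d i j k l p q w]; first by rewrite mulr0 pi0_0 scaler0.
  by rewrite mulrDr !pi0_D IH IH' scalerDr.
by rewrite mulrA -rmorphM !pi0_mono scalerA !mulrA.
Qed.

Lemma pi0_parA z : pi0 (A * z) = a *: pi0 z.
Proof.
elim/mono_ind: z => [|z z' IH IH'|c i j k l p q w]; first by rewrite mulr0 pi0_0 scaler0.
  by rewrite mulrDr !pi0_D IH IH' scalerDr.
rewrite pi0_mono scalerA.
have := pi0_mono c i.+1 j k l p q w; rewrite !exprS scZ !mulrA => ->.
by congr (_ *: _); ring.
Qed.

Lemma pi0_parB z : pi0 (B * z) = b *: pi0 z.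
Proof.
elim/mono_ind: z => [|z z' IH IH'|c i j k l p q w]; first by rewrite mulr0 pi0_0 scaler0.
  by rewrite mulrDr !pi0_D IH IH' scalerDr.
rewrite pi0_mono scalerA.
have := pi0_mono c i j.+1 k l p q w.
rewrite !exprS scZ (mulrA (A ^+ i) B) (expC i (spec_A spec B)) !mulrA => ->.
by congr (_ *: _); ring.
Qed.

Lemma pi0_AB i j z : pi0 (A ^+ i * B ^+ j * z) = (a ^+ i * b ^+ j) *: pi0 z.
Proof.
rewrite -mulrA; elim: i => [|i IH]; last by rewrite !exprS -mulrA pi0_parA IH scalerA mulrA.
rewrite !expr0 !mul1r; elim: j => [|j IH]; first by rewrite !expr0 mul1r scale1r.
by rewrite !exprS -mulrA pi0_parB IH scalerA.
Qed.

Lemma pi0_T w : pi0 (T w) = rho w.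
Proof.
have := pi0_mono 1 0 0 0 0 0 0 w; rewrite /= !expr0 rmorph1 !mul1r !mulr1 => ->.
by rewrite scale1r.
Qed.

Lemma pi0_zT z w : pi0 (z * T w) = pi0 z *m rho w.
Proof.
have [xy dxy] := doublet_xy zetaP spec.
elim/mono_ind: z => [|z z' IH IH'|c i j k l p q w']; first by rewrite mul0r pi0_0 mul0mx.
  by rewrite mulrDl !pi0_D IH IH' mulmxDl.
have [Ex Ey] := dxy w.
rewrite pi0_mono; case: q => [|q].
  case: p => [|p].
    rewrite expr0 !mulr1 -!mulrA (spec_TM spec); have := pi0_mono c i j k l 0 0 (mulW w' w).
    by rewrite expr0 !mulr1 -!mulrA => ->; rewrite rhoM -scalemxAl !mulrA.
  rewrite expr0 mulr1 exprSr !mulrA -(mulrA _ x (T w)) Ex /= !andbF !mulr0 scale0r mul0mx.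
  by rewrite scZ pi0_sc mulrA; case: ifP => _; rewrite ?pi0_x ?pi0_y scaler0.
rewrite !exprSr !mulrA -(mulrA _ y (T w)) Ey /= !andbF !mulr0 scale0r mul0mx.
by rewrite scZ pi0_sc mulrA; case: ifP => _; rewrite ?pi0_x ?pi0_y scaler0.
Qed.

Lemma pi0_Tz z w : pi0 (T w * z) = rho w *m pi0 z.
Proof.
elim/mono_ind: z => [|z z' IH IH'|c i j k l p q w']; first by rewrite mulr0 pi0_0 mulmx0.
  by rewrite mulrDr !pi0_D IH IH' mulmxDr.
rewrite pi0_mono; case: k => [|k].
  case: l => [|l].
    have := pi0_mono c i j 0 0 p q (mulW w w').
    rewrite !expr0 !mulr1 -!(mulrA (A ^+ i * _)) pullAB (mulrA (T w)) (spec_TM spec) => ->.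
    by rewrite rhoM -scalemxAr.
  rewrite expr0 mul1r exprS -!(mulrA (A ^+ i * _)) pullAB pi0_sc pi0_AB -!(mulrA Y) (mulrA (T w)).
  rewrite (T_Y zetaP spec) /= !mulr0 scale0r mulmx0.
  by case: ifP => _; rewrite -!mulrA pi0_sc ?pi0_X ?pi0_Y !scaler0.
rewrite exprS -!(mulrA (A ^+ i * _)) pullAB pi0_sc pi0_AB -!(mulrA X) (mulrA (T w)).
rewrite (T_X zetaP spec) /= !mulr0 scale0r mulmx0.
by case: ifP => _; rewrite -!mulrA pi0_sc ?pi0_X ?pi0_Y !scaler0.
Qed.

(** On a monomial u, both sides vanish if it ends in x or y, and also if it begins with X or Y,
    because the central z can be moved behind these. The remaining case is that of the T w. *)
Lemma pi0_central z u : z \in @central H -> pi0 (z * u) = pi0 z *m pi0 u.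
Proof.
move=> /centralP zC.
elim/mono_ind: u => [|u u' IH IH'|c i j k l p q w]; first by rewrite mulr0 pi0_0 mulmx0.
  by rewrite mulrDr !pi0_D IH IH' mulmxDr.
rewrite pi0_mono; case: q => [|q]; last first.
  by rewrite exprSr !mulrA pi0_y /= !andbF mulr0 scale0r mulmx0.
case: p => [|p]; last first.
  by rewrite expr0 mulr1 exprSr !mulrA pi0_x /= !andbF mulr0 scale0r mulmx0.
rewrite !expr0 !mulr1 -!(mulrA (A ^+ i * _)) pullAB pi0_sc pi0_AB.
case: k => [|k]; last first.
  by rewrite exprS -!(mulrA X) mulrA zC -mulrA pi0_X /= mulr0 !scaler0 scale0r mulmx0.
case: l => [|l]; last first.
  by rewrite expr0 mul1r exprS -!(mulrA Y) mulrA zC -mulrA pi0_Y /= mulr0 !scaler0 scale0r mulmx0.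
by rewrite !expr0 !mul1r pi0_zT /= mulr1 -scalemxAr !scalerA mulrA.
Qed.

Lemma pi0_cs c : pi0 (sc c) = c%:M.
Proof. by rewrite -[sc c]mulr1 -(spec_T1 spec) pi0_sc pi0_T rho1 scalemx1. Qed.

End ConstantTerm.

Section CentralClosure.
Variable H : pzRingType.
Implicit Types z u : H.

Lemma centralD z u : z \in @central H -> u \in @central H -> z + u \in @central H.
Proof.
move=> /centralP zC /centralP uC; apply/centralP => t.
by rewrite mulrDl mulrDr zC uC.
Qed.
Lemma centralM z u : z \in @central H -> u \in @central H -> z * u \in @central H.
Proof. by have [_ _ M] := @central_subring H; exact: M. Qed.
Lemma centralB z u : z \in @central H -> u \in @central H -> z - u \in @central H.
Proof. by have [_ M _] := @central_subring H; exact: M. Qed.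
Lemma central1 : 1 \in @central H.
Proof. by have [M _ _] := @central_subring H; exact: M. Qed.
Lemma central0 : 0 \in @central H.
Proof. by apply/centralP => t; rewrite mul0r mulr0. Qed.
Lemma centralX z n : z \in @central H -> z ^+ n \in @central H.
Proof. by move=> zC; elim: n => [|n IH]; rewrite ?expr0 ?central1 // exprS centralM. Qed.
Lemma central_sum I (r : seq I) (F : I -> H) :
  (forall i, F i \in @central H) -> \sum_(i <- r) F i \in @central H.
Proof. by move=> FC; elim/big_ind: _ => [||i _]; [exact: central0|exact: centralD|exact: FC]. Qed.
End CentralClosure.

(** * Centrality of invariant polynomials *)

Section InvariantPolynomials.
Variables (C : numFieldType) (zeta : C).
Hypothesis zetaP : 4.-primitive_root zeta.

Definition mk2 (i j : nat) : 'X_{1..2} := [multinom nth 0%N [:: i; j] n | n < 2].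
Lemma mk2_eta (m : 'X_{1..2}) : m = mk2 (m ord0) (m ord_max).
Proof.
by apply/mnmP => n; rewrite mnmE; case: n => [[|[|//]] ?] /=; congr (m _); apply: val_inj.
Qed.
Lemma mk2_0 i j : mk2 i j ord0 = i. Proof. by rewrite mnmE. Qed.
Lemma mk2_1 i j : mk2 i j ord_max = j. Proof. by rewrite mnmE. Qed.

Lemma mevalX2 (v : 'I_2 -> C) i j : ('X_[mk2 i j] : {mpoly C[2]}).@[v] = v ord0 ^+ i * v ord_max ^+ j.
Proof.
rewrite mevalX big_ord_recl big_ord1 !mnmE /=; congr (_ * v _ ^+ _); exact: val_inj.
Qed.

(** Polynomials with the same values have the same coefficients, so invariance under a substitution
    that permutes monomials up to scalars can be read coefficientwise. *)
Lemma mcoeff_transform (p : {mpoly C[2]}) (phi : 'X_{1..2} -> 'X_{1..2}) (c : 'X_{1..2} -> C)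
    (t : ('I_2 -> C) -> 'I_2 -> C) :
  injective phi -> (forall m v, ('X_[m] : {mpoly C[2]}).@[t v] = c m * ('X_[phi m] : {mpoly C[2]}).@[v]) ->
  (forall v, p.@[t v] = p.@[v]) -> forall m, p@_(phi m) = p@_m * c m.
Proof.
move=> phi_inj tE pt m.
pose q : {mpoly C[2]} := \sum_(m <- mpoly.msupp p) (p@_m * c m) *: 'X_[phi m].
have pq : p = q.
  apply/eqP; rewrite -subr_eq0; apply/eqP/mpoly_vanish => v.
  rewrite mevalB; apply/eqP; rewrite subr_eq0; apply/eqP.
  rewrite -(pt v) [in LHS](mpolyE p) !raddf_sum; apply: eq_bigr => m' _ /=.
  by rewrite !mevalZ tE mulrA.
have -> : p@_(phi m) = \sum_(m' <- mpoly.msupp p) p@_m' * c m' * (m' == m)%:R.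
  rewrite {1}pq raddf_sum; apply: eq_bigr => m' _ /=.
  by rewrite mcoeffZ mcoeffX (inj_eq phi_inj).
have [mp|mp] := boolP (m \in mpoly.msupp p).
  rewrite (bigD1_seq m) ?mpoly.msupp_uniq //= eqxx mulr1 big1 ?addr0 // => m' /negPf ->; exact: mulr0.
rewrite (memN_msupp_eq0 mp) mul0r big_seq big1 // => m' m'p.
by case: eqP => [E|_]; rewrite ?mulr0 //; rewrite -E m'p in mp.
Qed.

Section Central.
Variables (H : pzRingType) (sc : {rmorphism C -> H}) (Q R : H).
Hypothesis scC : forall c z, sc c * z = z * sc c.
Hypothesis QR : Q * R = R * Q.
Hypothesis QRc : Q * R \in @central H.
Hypothesis Q4c : Q ^+ 4 + R ^+ 4 \in @central H.

Definition incl2 (p : {mpoly C[2]}) : H :=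
  \sum_(m <- mpoly.msupp p) sc p@_m * (Q ^+ m ord0 * R ^+ m ord_max).

(** Newton's recursion for u = Q^4 and v = R^4, whose sum and product are central. *)
Lemma power_sum_central k : Q ^+ (4 * k) + R ^+ (4 * k) \in @central H.
Proof.
rewrite !exprM; set u := Q ^+ 4; set v := R ^+ 4.
have uv : u * v = v * u by apply: commrX; apply/esym/commrX; exact/esym.
have uvC : u * v \in @central H.
  rewrite /u /v -exprMn_comm //; exact: centralX.
suff [] : u ^+ k + v ^+ k \in @central H /\ u ^+ k.+1 + v ^+ k.+1 \in @central H by [].
elim: k => [|k [IH IH']]; first by rewrite !expr0 !expr1; split=> //; apply: centralD; exact: central1.
split=> //.
have -> : u ^+ k.+2 + v ^+ k.+2 = (u + v) * (u ^+ k.+1 + v ^+ k.+1) - u * v * (u ^+ k + v ^+ k).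
  rewrite mulrDl !mulrDr -!exprS -(mulrA u v (v ^+ k)) -exprS.
  have -> : u * v * u ^+ k = v * u ^+ k.+1 by rewrite uv -mulrA -exprS.
  move: (u ^+ k.+2) (v ^+ k.+2) (v * _) (u * _) => t1 t2 t3 t4.
  by rewrite (addrC t3 t2) addrACA (addrC t3) addrK.
by apply: centralB; apply: centralM.
Qed.

Lemma symmetric_central i j : (i = j %[mod 4])%N -> Q ^+ i * R ^+ j + Q ^+ j * R ^+ i \in @central H.
Proof.
have QRX i' j' : Q ^+ i' * R ^+ j' = R ^+ j' * Q ^+ i'.
  by apply: commrX; apply/esym/commrX; exact/esym.
have main i' k : Q ^+ (i' + 4 * k) * R ^+ i' + Q ^+ i' * R ^+ (i' + 4 * k) \in @central H.
  have -> : Q ^+ (i' + 4 * k) * R ^+ i' + Q ^+ i' * R ^+ (i' + 4 * k) =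
      (Q * R) ^+ i' * (Q ^+ (4 * k) + R ^+ (4 * k)).
    rewrite exprMn_comm // mulrDr (exprD Q) (exprD R); congr (_ + _); last by rewrite mulrA.
    by rewrite -!mulrA QRX.
  by apply: centralM; [exact: centralX|exact: power_sum_central].
move=> ij; have [le|/ltnW le] := leqP j i.
  have -> : (i = j + 4 * ((i - j) %/ 4))%N by lia.
  exact: main.
have -> : (j = i + 4 * ((j - i) %/ 4))%N by lia.
by rewrite addrC; exact: main.
Qed.

Lemma incl2_bound p K : (forall m, m \in mpoly.msupp p -> m ord0 < K /\ m ord_max < K)%N ->
  incl2 p = \sum_(i < K) \sum_(j < K) sc p@_(mk2 i j) * (Q ^+ i * R ^+ j).
Proof.
move=> pK; rewrite pair_bigA /=.
pose F (m : 'X_{1..2}) := sc p@_m * (Q ^+ m ord0 * R ^+ m ord_max).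
pose L : seq 'X_{1..2} := [seq mk2 u.1 u.2 | u : 'I_K * 'I_K].
have -> : \sum_(u : 'I_K * 'I_K) sc p@_(mk2 u.1 u.2) * (Q ^+ u.1 * R ^+ u.2) = \sum_(m <- L) F m.
  by rewrite /L big_map big_enum /=; apply: eq_bigr => u _; rewrite /F mk2_0 mk2_1.
have L_uniq : uniq L.
  rewrite map_inj_uniq ?enum_uniq // => [[i j] [i' j']] /= E.
  have := congr1 (fun m : 'X_{1..2} => m ord0) E; have := congr1 (fun m : 'X_{1..2} => m ord_max) E.
  by rewrite !mk2_0 !mk2_1 => /val_inj -> /val_inj ->.
rewrite [RHS](bigID (mem (mpoly.msupp p))) /= [X in _ + X]big1 ?addr0; last first.
  by move=> m mp; rewrite /F (memN_msupp_eq0 mp) rmorph0 mul0r.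
rewrite -big_filter; apply: perm_big; apply: uniq_perm; rewrite ?filter_uniq ?mpoly.msupp_uniq //.
move=> m; rewrite mem_filter /=; case: (boolP (m \in _)) => //= mp.
have [i0 i1] := pK _ mp; apply/esym/mapP; exists (Ordinal i0, Ordinal i1); first exact: mem_enum.
exact: mk2_eta.
Qed.

Lemma incl2_central (p : {mpoly C[2]}) : (forall i j, p@_(mk2 i j) = p@_(mk2 j i)) ->
  (forall i j, p@_(mk2 i j) != 0 -> (i = j %[mod 4])%N) -> incl2 p \in @central H.
Proof.
move=> psym pmod.
have pK m : m \in mpoly.msupp p -> (m ord0 < msize p /\ m ord_max < msize p)%N.
  by move=> /mpoly.msize_mdeg_lt lt; split; apply: leq_ltn_trans lt; rewrite mdegE;
    [rewrite (bigD1 ord0)|rewrite (bigD1 ord_max)] => //=; rewrite leq_addr.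
have E := incl2_bound pK; set K := msize p in E.
have E2 : incl2 p = sc 2^-1 * (\sum_(i < K) \sum_(j < K) sc p@_(mk2 i j) * (Q ^+ i * R ^+ j + Q ^+ j * R ^+ i)).
  have -> : \sum_(i < K) \sum_(j < K) sc p@_(mk2 i j) * (Q ^+ i * R ^+ j + Q ^+ j * R ^+ i) = incl2 p + incl2 p.
    rewrite {1}E E [X in _ + X]exchange_big -big_split; apply: eq_bigr => i _.
    rewrite -big_split; apply: eq_bigr => j _; rewrite mulrDr psym //.
  rewrite -[incl2 p + _]mulr2n -[incl2 p *+ 2]mulr_natl mulrA -(rmorph_nat sc) -rmorphM mulVf ?pnatr_eq0 //.
  by rewrite rmorph1 mul1r.
rewrite E2; apply: centralM; first by apply/centralP => u; exact: scC.
apply: central_sum => i; apply: central_sum => j.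
have [->|nz] := eqVneq p@_(mk2 i j) 0; first by rewrite rmorph0 mul0r central0.
apply: centralM; first by apply/centralP => u; exact: scC.
exact/symmetric_central/pmod.
Qed.
End Central.

(** The swap gives the symmetry of the coefficients, the rotation diag(ζ, ζ^-1) the congruence. *)
Lemma invariant_coeffs (p : {mpoly C[2]}) :
  (forall v : 'I_2 -> C, p.@[fun i => if i == ord0 then zeta * v ord0 else zeta^-1 * v ord_max] = p.@[v]) ->
  (forall v : 'I_2 -> C, p.@[fun i => if i == ord0 then v ord_max else v ord0] = p.@[v]) ->
  (forall i j, p@_(mk2 i j) = p@_(mk2 j i)) /\
  (forall i j, p@_(mk2 i j) != 0 -> (i = j %[mod 4])%N).
Proof.
move=> rot swap; split=> i j.
  have := @mcoeff_transform p (fun m => mk2 (m ord_max) (m ord0)) (fun _ => 1) _ _ _ swap (mk2 j i).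
  rewrite mk2_0 mk2_1 mulr1; apply.
    move=> m m' E; rewrite (mk2_eta m) (mk2_eta m').
    have := congr1 (fun m : 'X_{1..2} => m ord0) E; have := congr1 (fun m : 'X_{1..2} => m ord_max) E.
    by rewrite !mk2_0 !mk2_1 => -> ->.
  by move=> m v; rewrite {1}(mk2_eta m) !mevalX2 /= mul1r mulrC.
have := @mcoeff_transform p id (fun m => zeta ^+ m ord0 * zeta^-1 ^+ m ord_max) _ _ _ rot (mk2 i j).
rewrite mk2_0 mk2_1 => E p0.
have {}E : p@_(mk2 i j) = p@_(mk2 i j) * (zeta ^+ i * zeta^-1 ^+ j).
  apply: E => // m v; rewrite [in LHS](mk2_eta m) [in RHS](mk2_eta m) !mevalX2 /= mk2_0 mk2_1 !exprMn.
  by rewrite mulrACA.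
have {}E : zeta ^+ i * zeta ^- j = 1.
  by apply: (mulfI p0); rewrite mulr1 -exprVn.
have zi : zeta ^+ j != 0 by rewrite expf_neq0 // (zeta_neq0 zetaP).
have : zeta ^+ i == zeta ^+ j by rewrite -[X in X == _](divfK zi) E mul1r.
by rewrite (eq_prim_root_expr zetaP) => /eqP.
Qed.

End InvariantPolynomials.

(** * The unique maximal submodule of a baby Verma module *)

Section BabyVermaModule.
Variables (C : numFieldType) (zeta : C).
Hypothesis zetaP : 4.-primitive_root zeta.
Variables (H : pzRingType) (sc : {rmorphism C -> H}) (h : 'I_6 -> H) (T : W -> H).
Hypothesis spec : cherednik_spec zeta sc h T.
Variable P : pt C -> {rmorphism H -> 'M[C]_8}.
Hypothesis PP : forall v, dunkl_spec zeta sc h T v (P v).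
Variables (a b : C) (n : nat) (rho : W -> 'M[C]_n).
Hypothesis rhoM : forall g g', rho (mulW g g') = rho g *m rho g'.
Hypothesis rho1 : rho w1 = 1%:M.
Hypothesis n_gt0 : (0 < n)%N.
Hypothesis rho_irr : forall G : set 'cV[C]_n,
  (forall u v, G u -> G v -> G (u + v)) -> (forall c u, G u -> G (c *: u)) ->
  (forall w u, G u -> G (rho w *m u)) -> (exists2 u, G u & u <> 0) -> forall u, G u.

Local Notation A := (h iA).
Local Notation B := (h iB).
Local Notation X := (h iX).
Local Notation Y := (h iY).
Local Notation x := (h ix).
Local Notation y := (h iy).
Local Notation pi0 := (pi0 sc h T a b rho).

Variables (Hb : pzRingType) (pi : {rmorphism H -> Hb}) (psi : Hb -> 'M[C]_n).
Hypothesis pi_surj : forall t, exists z, t = pi z.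
Hypothesis pi_A : pi A = pi (sc a).
Hypothesis pi_B : pi B = pi (sc b).
Hypothesis pi_YX : pi (Y * X) = 0.
Hypothesis pi_R : pi (X ^+ 4 + Y ^+ 4) = 0.
Hypothesis psiE : forall z, psi (pi z) = pi0 z.

Local Notation M := 'rV[Hb]_n.
Let e (j : 'I_n) : M := delta_mx 0 j.

Definition submod (N : set M) : Prop :=
  [/\ N 0, (forall u v, N u -> N v -> N (u + v)) & forall t u, N u -> N (t *: u)].

Definition vrel : set M :=
  [set u | exists j, [\/ u = pi x *: e j, u = pi y *: e j |
     exists w, u = pi (T w) *: e j - \sum_i pi (sc (rho w i j)) *: e i]].

Let psi_D s t : psi (s + t) = psi s + psi t.
Proof.
have [z ->] := pi_surj s; have [z' ->] := pi_surj t.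
by rewrite -rmorphD !psiE (pi0_D zetaP spec PP).
Qed.

(** The component of degree 0 in E_rho of the element of the Verma module represented by u; [psi] is
    [pi0] on the quotient ring. *)
Definition top (u : M) : 'cV[C]_n := \sum_j col j (psi (u 0 j)).

Lemma top_D u v : top (u + v) = top u + top v.
Proof.
rewrite -big_split; apply: eq_bigr => j _; rewrite mxE psi_D.
by apply/matrixP => i k; rewrite !mxE.
Qed.
Lemma top_0 : top 0 = 0.
Proof. by have := top_D 0 0; rewrite addr0 => /esym/eqP; rewrite -subr_eq0 addrK => /eqP. Qed.
Lemma top_N u : top (- u) = - top u.
Proof. by apply/eqP; rewrite -addr_eq0 -top_D addNr top_0. Qed.
Lemma top_sum I (r : seq I) (F : I -> M) : top (\sum_(i <- r) F i) = \sum_(i <- r) top (F i).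
Proof. by elim: r => [|i r IH]; rewrite ?big_nil ?top_0 // !big_cons top_D IH. Qed.

Lemma top_scale z Mz v : (forall g, pi0 (z * g) = Mz *m pi0 g) -> top (pi z *: v) = Mz *m top v.
Proof.
move=> E; rewrite mulmx_sumr; apply: eq_bigr => j _; rewrite mxE.
have [g ->] := pi_surj (v 0 j); rewrite -rmorphM !psiE E.
by rewrite !colE mulmxA.
Qed.

Lemma top_e z j : top (pi z *: e j) = col j (pi0 z).
Proof.
rewrite /top (bigD1 j) //= big1 ?addr0 => [|i /negPf ij].
  by rewrite !mxE !eqxx /= mulr1 psiE.
rewrite !mxE ij /= mulr0 -(rmorph0 pi) psiE (pi0_0 zetaP PP).
by apply/matrixP => k l; rewrite !mxE.
Qed.

Lemma row_decomp (u : M) : u = \sum_j u 0 j *: e j.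
Proof. exact: row_sum_delta. Qed.

(** The largest submodule in which every element has zero component of degree 0. *)
Definition N0 : set M := [set u | forall t, top (t *: u) = 0].

Lemma N0_submod : submod N0.
Proof.
split=> [t|u v Nu Nv t|s u Nu t]; first by rewrite scaler0 top_0.
  by rewrite scalerDr top_D Nu Nv addr0.
by rewrite scalerA Nu.
Qed.

Lemma vrel_N0 : vrel `<=` N0.
Proof.
have c0 j : col j (0 : 'M[C]_n) = 0 by apply/matrixP => k l; rewrite !mxE.
move=> u [j [->|->|[w ->]]] t; have [z ->] := pi_surj t.
- by rewrite scalerA -rmorphM top_e (pi0_x zetaP spec PP) c0.
- by rewrite scalerA -rmorphM top_e (pi0_y zetaP spec PP) c0.
rewrite scalerBr top_D top_N scalerA -rmorphM top_e (pi0_zT zetaP spec PP) // scaler_sumr top_sum.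
apply/eqP; rewrite subr_eq0; apply/eqP.
rewrite (eq_bigr (fun i => rho w i j *: col i (pi0 z))) => [|i _]; last first.
  rewrite scalerA -rmorphM top_e -(spec_sc spec) (pi0_sc zetaP spec PP).
  by apply/matrixP => k l; rewrite !mxE.
apply/matrixP => k l; rewrite !mxE summxE; apply: eq_bigr => i _.
by rewrite !mxE mulrC.
Qed.

Lemma N0_proper : N0 <> setT.
Proof.
move=> E; have : N0 (e (Ordinal n_gt0)) by rewrite E.
move/(_ 1); rewrite -(rmorph1 pi) top_e => /matrixP/(_ (Ordinal n_gt0) 0).
have -> : 1 = sc 1 :> H by rewrite rmorph1.
by rewrite (pi0_cs zetaP spec PP) // !mxE eqxx => /eqP; rewrite oner_eq0.
Qed.

Inductive posdeg : M -> Prop :=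
| posdeg0 : posdeg 0
| posdegD u v : posdeg u -> posdeg v -> posdeg (u + v)
| posdeg_gen i k c j : (0 < i + k)%N -> posdeg (pi (sc c * (X ^+ i * Y ^+ k)) *: e j).

Lemma posdeg_sum I (r : seq I) (F : I -> M) :
  (forall i, posdeg (F i)) -> posdeg (\sum_(i <- r) F i).
Proof. by move=> H'; elim/big_ind: _ => [||i _]; [exact: posdeg0|exact: posdegD|exact: H']. Qed.

Section Submodule.
Variable N : set M.
Hypotheses (N_submod : submod N) (N_vrel : vrel `<=` N).

Let N_0 : N 0. Proof. by case: N_submod. Qed.
Let N_D u v : N u -> N v -> N (u + v). Proof. by case: N_submod => _ + _; apply. Qed.
Let N_Z t u : N u -> N (t *: u). Proof. by case: N_submod => _ _; apply. Qed.
Let N_N u : N u -> N (- u). Proof. by rewrite -scaleN1r; apply: N_Z. Qed.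
Let N_B u v : N u -> N v -> N (u - v). Proof. by move=> Nu /N_N; apply: N_D. Qed.
Let N_sum I (r : seq I) (F : I -> M) : (forall i, N (F i)) -> N (\sum_(i <- r) F i).
Proof. by move=> HF; elim/big_ind: _ => [||i _]; [exact: N_0|exact: N_D|exact: HF]. Qed.

(** Modulo the relations of the Verma module x and y kill the e_j and T w acts by [rho]. What
    remains of the PBW form is a constant part, given by [pi0], and terms of positive degree in X
    and Y. *)
Lemma decomp_gen z j : exists2 f, posdeg f &
  N (pi z *: e j - (\sum_i pi (sc (pi0 z i j)) *: e i + f)).
Proof.
elim/(mono_ind zetaP spec): z => [|z z' [f Ff Nf] [f' Ff' Nf']|c i k p q p' q' w].
- exists 0; first exact: posdeg0.
  rewrite rmorph0 scale0r addr0 big1 ?subrr // => i _.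
  by rewrite (pi0_0 zetaP PP) mxE !rmorph0 scale0r.
- exists (f + f'); first exact: posdegD.
  have -> : pi (z + z') *: e j - (\sum_i pi (sc (pi0 (z + z') i j)) *: e i + (f + f')) =
    (pi z *: e j - (\sum_i pi (sc (pi0 z i j)) *: e i + f)) +
    (pi z' *: e j - (\sum_i pi (sc (pi0 z' i j)) *: e i + f')); last exact: N_D.
  rewrite addrACA -opprD addrACA -big_split rmorphD scalerDl; congr (_ - (_ + _)).
  by apply: eq_bigr => i _; rewrite (pi0_D zetaP spec PP) mxE !rmorphD scalerDl.
- rewrite (pi0_mono zetaP PP).
  have zero (u : M) : N u -> exists2 f, posdeg f & N (u - (\sum_i pi (sc ((0 : 'M[C]_n) i j)) *: e i + f)).
    move=> Nu; exists 0; first exact: posdeg0.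
    rewrite addr0 big1 ?subr0 // => l _; by rewrite mxE !rmorph0 scale0r.
  case: q' => [|q']; last first.
    rewrite /= !andbF mulr0 scale0r; apply: zero.
    rewrite exprSr !mulrA rmorphM -scalerA; apply/N_Z/N_vrel; exists j; exact: Or32.
  case: p' => [|p']; last first.
    rewrite /= !andbF mulr0 scale0r; apply: zero.
    rewrite expr0 mulr1 exprSr !mulrA rmorphM -scalerA; apply/N_Z/N_vrel; exists j; exact: Or31.
  rewrite !expr0 !mulr1 !mulrA rmorphM -scalerA.
  set t := sc c * _ * _ * _ * _.
  have tE d : pi t * pi (sc d) = pi (sc (c * a ^+ i * b ^+ k * d) * (X ^+ p * Y ^+ q)).
    rewrite -rmorphM -(spec_sc spec) (mulrC _ d) /t.
    by rewrite !rmorphM !rmorphXn /= pi_A pi_B !mulrA.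
  have Nt : N (pi t *: (pi (T w) *: e j) - \sum_l pi (sc (c * a ^+ i * b ^+ k * rho w l j) * (X ^+ p * Y ^+ q)) *: e l).
    have : N (pi (T w) *: e j - \sum_i pi (sc (rho w i j)) *: e i).
      by apply: N_vrel; exists j; apply: Or33; exists w.
    move=> /(N_Z (pi t)); rewrite scalerBr scaler_sumr; congr (N (_ - _)).
    by apply: eq_bigr => l _; rewrite scalerA tE.
  case: (posnP (p + q)%N) => [|pq].
    move/eqP; rewrite addn_eq0 => /andP[/eqP p0 /eqP q0]; exists 0; first exact: posdeg0.
    rewrite addr0; congr (N (_ - _)): Nt; apply: eq_bigr => l _.
    by rewrite p0 q0 !expr0 !mulr1 mxE.
  exists (\sum_l pi (sc (c * a ^+ i * b ^+ k * rho w l j) * (X ^+ p * Y ^+ q)) *: e l).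
    by apply: posdeg_sum => l; apply: posdeg_gen.
  rewrite big1 ?add0r // => l _.
  have -> : [&& p == 0, q == 0, 0%N == 0 & 0%N == 0]%N = false.
    by apply/negP => /and4P[/eqP p0 /eqP q0 _ _]; rewrite p0 q0 in pq.
  by rewrite mulr0 scale0r mxE !rmorph0 scale0r.
Qed.

Lemma decomp u : exists2 f, posdeg f & N (u - (\sum_i pi (sc (top u i 0)) *: e i + f)).
Proof.
have /choice [g gE] : forall j, exists z, u 0 j = pi z by move=> j; exact: pi_surj.
have /choice [f fE] : forall j, exists f, posdeg f /\
    N (pi (g j) *: e j - (\sum_i pi (sc (pi0 (g j) i j)) *: e i + f)).
  by move=> j; have [f] := decomp_gen (g j) j; exists f.
exists (\sum_j f j); first by apply: posdeg_sum => j; case: (fE j).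
have -> : u - (\sum_i pi (sc (top u i 0)) *: e i + \sum_j f j) =
    \sum_j (pi (g j) *: e j - (\sum_i pi (sc (pi0 (g j) i j)) *: e i + f j)).
  rewrite sumrB big_split {1}(row_decomp u) exchange_big /=; congr (_ - (_ + _)).
    by apply: eq_bigr => j _; rewrite gE.
  apply: eq_bigr => i _; rewrite -scaler_suml; congr (_ *: _).
  rewrite /top summxE !rmorph_sum; apply: eq_bigr => j _ /=.
  by rewrite mxE gE psiE.
by apply: N_sum => j; case: (fE j).
Qed.

Let XYp i k i' k' : X ^+ i * Y ^+ k * (X ^+ i' * Y ^+ k') = X ^+ (i + i') * Y ^+ (k + k').
Proof.
have E : Y ^+ k * X ^+ i' = X ^+ i' * Y ^+ k.
  by apply: commrX; apply/esym/commrX; exact: XYC spec.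
by rewrite !exprD -!mulrA (mulrA (Y ^+ k)) E !mulrA.
Qed.

(** In the quotient XY = 0 and X^4 + Y^4 = 0, hence X^5 = X (X^4 + Y^4) - (XY) Y^3 = 0, and likewise
    Y^5 = 0. *)
Lemma top_degree_vanish i k : (5 <= i + k)%N -> pi (X ^+ i * Y ^+ k) = 0.
Proof.
have XY0 : pi (X * Y) = 0 by rewrite (XYC spec).
case: k => [|k].
  rewrite addn0 => i5; rewrite expr0 mulr1 -(subnK i5) exprD rmorphM.
  have : pi (X * (X ^+ 4 + Y ^+ 4)) = 0 by rewrite rmorphM pi_R mulr0.
  rewrite mulrDr -exprS (exprS Y 3) mulrA rmorphD (rmorphM pi (X * Y)) XY0 mul0r addr0 => ->.
  by rewrite mulr0.
case: i => [|i].
  rewrite add0n => i5; rewrite expr0 mul1r -(subnK i5) exprD rmorphM.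
  have : pi (Y * (X ^+ 4 + Y ^+ 4)) = 0 by rewrite rmorphM pi_R mulr0.
  rewrite mulrDr -exprS (exprS X 3) mulrA rmorphD (rmorphM pi (Y * X)) pi_YX mul0r add0r => ->.
  by rewrite mulr0.
by rewrite exprSr exprS -mulrA (mulrA X) !rmorphM -rmorphM XY0 mul0r mulr0.
Qed.

(** By irreducibility of [rho] the map [top] sends N onto E_rho, so N contains each e_j up to terms
    of positive degree. These are absorbed because positive degree is nilpotent. *)
Lemma nakayama u : N u -> top u <> 0 -> N = setT.
Proof.
move=> Nu u0.
have full g : exists2 v, N v & top v = g.
  have := @rho_irr [set g | exists2 v, N v & top v = g]; apply=> [_ _ [v Nv <-] [v' Nv' <-]|c _ [v Nv <-]|w _ [v Nv <-]|].
  - by exists (v + v'); [exact: N_D|rewrite top_D].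
  - exists (pi (sc c) *: v); first exact: N_Z.
    by rewrite (@top_scale _ (c%:M)) ?mul_scalar_mx // => z; rewrite (pi0_sc zetaP spec PP) mul_scalar_mx.
  - exists (pi (T w) *: v); first exact: N_Z.
    by rewrite (@top_scale _ (rho w)) // => z; rewrite (pi0_Tz zetaP spec PP).
  - by exists (top u) => //; exists u.
have lead j : exists2 f, posdeg f & N (e j + f).
  have [v Nv vE] := full (delta_mx j 0); have [f Ff Nf] := decomp v; exists f => //.
  have -> : e j + f = v - (v - (\sum_i pi (sc (top v i 0)) *: e i + f)).
    rewrite subKr; congr (_ + _).
    rewrite (bigD1 j) //= vE mxE !eqxx !rmorph1 scale1r big1 ?addr0 // => i /negPf ij.
    by rewrite mxE ij !rmorph0 scale0r.
  exact: N_B.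
(* Descending induction on the degree: m bounds its distance to 5, from where on everything
   vanishes. *)
have main m : forall i k j, (5 <= m + (i + k))%N -> N (pi (X ^+ i * Y ^+ k) *: e j).
  elim: m => [|m IH] i k j; first by move=> ik; rewrite top_degree_vanish // scale0r.
  move=> ik; have [f Ff Nf] := lead j.
  suff Nf' : N (pi (X ^+ i * Y ^+ k) *: f).
    have := N_B (N_Z (pi (X ^+ i * Y ^+ k)) Nf) Nf'.
    by rewrite scalerDr addrK.
  elim: Ff => [|f1 f2 _ N1 _ N2|i' k' c j' ik']; first by rewrite scaler0.
    by rewrite scalerDr; apply: N_D.
  rewrite scalerA -rmorphM (spec_scZ spec) XYp rmorphM -scalerA; apply/N_Z/IH.
  by move: ik ik'; lia.
apply/seteqP; split=> // v _; rewrite (row_decomp v); apply: N_sum => j; apply: N_Z.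
by have := main 5%N 0%N 0%N j isT; rewrite !expr0 mulr1 rmorph1 scale1r.
Qed.

Lemma sub_N0 : N <> setT -> N `<=` N0.
Proof.
move=> NT u Nu t; apply: contrapT => tu; apply: NT.
by apply: nakayama tu; apply: N_Z.
Qed.

End Submodule.

Definition maximal_submod (N : set M) : Prop :=
  [/\ submod N, vrel `<=` N, N <> setT &
      forall N', submod N' -> N `<=` N' -> N' = N \/ N' = setT].

Lemma N0_maximal : maximal_submod N0.
Proof.
split; [exact: N0_submod|exact: vrel_N0|exact: N0_proper|move=> N' sN' NN'].
have [->|NT] := pselect (N' = setT); [by right|left].
apply/seteqP; split=> //; apply: sub_N0 => //.
exact: subset_trans vrel_N0 NN'.
Qed.

Lemma maximal_unique N : maximal_submod N -> N = N0.
Proof.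
move=> [sN vN NT max]; have [//|E] := max _ N0_submod (sub_N0 sN vN NT).
by have := N0_proper.
Qed.

Lemma central_scalar z c u : z \in @central H -> pi0 z = c%:M ->
  N0 (pi z *: u - pi (sc c) *: u).
Proof.
move=> zC zc t; have [g ->] := pi_surj t.
rewrite scalerBr top_D top_N !scalerA -!rmorphM.
rewrite -(centralP _ zC) -(spec_sc spec) !rmorphM -!scalerA.
rewrite (@top_scale z (c%:M)) => [|s]; last by rewrite (pi0_central zetaP spec PP) // zc.
rewrite (@top_scale (sc c) (c%:M)) ?subrr // => s.
by rewrite (pi0_sc zetaP spec PP) mul_scalar_mx.
Qed.

End BabyVermaModule.

(** * Relations at a point, and central characters of baby Verma modules *)

Section PointRelations.
Variables (C : numFieldType) (zeta : C).
Hypothesis zetaP : 4.-primitive_root zeta.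
Variables (H : pzRingType) (sc : {rmorphism C -> H}) (h : 'I_6 -> H) (T : W -> H).
Hypothesis spec : cherednik_spec zeta sc h T.
Variable P : pt C -> {rmorphism H -> 'M[C]_8}.
Hypothesis PP : forall v, dunkl_spec zeta sc h T v (P v).
Local Notation Z := (centre H).
Variable p : {rmorphism Z -> C}.
Let e := p (ceu zeta sc h T).
Let q := p (cq h).
Let Q := p (cQ h).
Let u := p (cr h).
Let v := p (cR h).
Let a1 := p (ca1 sc h).
Let w := p (ca2 zeta sc h T).
Let a3 := p (ca3 sc h).
Let a := p (cA h).
Let b := p (cB h).
Local Notation D := (a ^+ 2 - b ^+ 2).

Lemma point_relations :
  [/\ e * (w + 2 * D) = Q * a1 + q * a3,
      u * (w + 2 * D) = a1 ^+ 2 + q ^+ 2 * e ^+ 2 - 4 * q ^+ 3 * Q - 8 * q ^+ 2 * (a ^+ 2 + b ^+ 2),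
      v * (w + 2 * D) = a3 ^+ 2 + Q ^+ 2 * e ^+ 2 - 4 * Q ^+ 3 * q - 8 * Q ^+ 2 * (a ^+ 2 + b ^+ 2),
      (w - 2 * D) * (w + 2 * D) =
        a1 * a3 - q * Q * e ^+ 2 + 4 * q ^+ 2 * Q ^+ 2 + 8 * q * Q * (a ^+ 2 + b ^+ 2) &
      quartic a b e - (u * v + 4 * D * (w + 2 * D)) =
        - (a1 * a3) + 5 * q * Q * e ^+ 2 - 4 * q ^+ 2 * Q ^+ 2 - 8 * q * Q * (a ^+ 2 + b ^+ 2)].
Proof.
rewrite /quartic /e /q /Q /u /v /a1 /w /a3 /a /b.
have [] := relations zetaP spec PP; rewrite /cD /cS.
move: (ceu zeta sc h T) (cq h) (cQ h) (cr h) (cR h) (ca1 sc h) (ca2 zeta sc h T) (ca3 sc h) (cA h) (cB h).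
move=> ze zq zQ zr zR z1 z2 z3 zA zB.
move=> E1 E2 E3 E4 E5; split; [move: E1|move: E2|move: E3|move: E4|move: E5];
  move=> /(congr1 (p : Z -> C)); rewrite !(rmorphM, rmorphB, rmorphD, rmorphXn, rmorphN) rmorph1; exact.
Qed.

Hypotheses (q0 : q = 0) (Q0 : Q = 0).

(* The relations reduce to a1^2 = a3^2 = 0. *)
Lemma vanishing_odd : u = 0 -> v = 0 -> a1 = 0 /\ a3 = 0.
Proof.
move=> u0 v0; have [_ Eu Ev _ _] := point_relations; move: Eu Ev.
rewrite u0 v0 q0 Q0 !mul0r !expr0n /= !(mulr0, mul0r) !subr0 !addr0.
by move=> /esym/eqP + /esym/eqP; rewrite !expf_eq0 /= => /eqP -> /eqP ->.
Qed.

Lemma fixed_relations : a1 = 0 -> a3 = 0 ->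
  [/\ e * (w + 2 * D) = 0, u * (w + 2 * D) = 0, v * (w + 2 * D) = 0,
      (w - 2 * D) * (w + 2 * D) = 0 & quartic a b e = u * v + 4 * D * (w + 2 * D)].
Proof.
move=> a10 a30; have [-> -> -> ->] := point_relations.
rewrite q0 Q0 a10 a30 => /eqP; rewrite subr_eq => /eqP ->.
by rewrite !expr0n /= !(mulr0, mul0r) !subr0 !addr0 oppr0 !add0r.
Qed.
End PointRelations.

Section CentralCharacter.
Variables (C : numFieldType) (zeta : C).
Hypothesis zetaP : 4.-primitive_root zeta.
Variables (H : pzRingType) (sc : {rmorphism C -> H}) (h : 'I_6 -> H) (T : W -> H).
Hypothesis spec : cherednik_spec zeta sc h T.
Variable P : pt C -> {rmorphism H -> 'M[C]_8}.
Hypothesis PP : forall v, dunkl_spec zeta sc h T v (P v).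
Variables (a b : C) (n : nat) (rho : W -> 'M[C]_n).
Hypothesis rhoM : forall g g', rho (mulW g g') = rho g *m rho g'.
Hypothesis rho1 : rho w1 = 1%:M.
Variable i0 : 'I_n.
Hypothesis schur : forall M : 'M[C]_n,
  (forall w, M *m rho w = rho w *m M) -> M = (M i0 i0)%:M.

Local Notation A := (h iA).
Local Notation B := (h iB).
Local Notation X := (h iX).
Local Notation Y := (h iY).
Local Notation x := (h ix).
Local Notation y := (h iy).
Local Notation pi0 := (pi0 sc h T a b rho).
Local Notation Z := (centre H).

Definition lam (z : Z) : C := pi0 (val z) i0 i0.

(** For central z, multiplying by T w on either side shows that [pi0] of z commutes with [rho];
    Schur's lemma makes it a scalar. *)
Lemma lamE z : pi0 (val z) = (lam z)%:M.
Proof.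
apply: schur => w; have /centralP zC := valP z.
by rewrite -(pi0_zT zetaP spec PP) // zC (pi0_Tz zetaP spec PP).
Qed.

Lemma lam_zmod : zmod_morphism lam.
Proof. by move=> z z'; rewrite /lam cvalB (pi0_B zetaP spec PP) !mxE. Qed.
Lemma lam_monoid : monoid_morphism lam.
Proof.
split=> [|z z'].
  have := pi0_cs zetaP spec PP a b rho1 1; rewrite rmorph1 /lam cval1 => ->.
  by rewrite mxE eqxx.
by rewrite {1}/lam cvalM (pi0_central zetaP spec PP) ?(valP z) // !lamE -scalar_mxM mxE eqxx.
Qed.
Definition lamR : {rmorphism Z -> C} := mk_rmorph lam_zmod lam_monoid.

Let lam_to z c : z \in @central H -> pi0 z = c%:M -> lam (toZ z) = c.
Proof. by move=> zC E; rewrite /lam toZE // E mxE eqxx. Qed.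

Lemma lam_cs c : lam (cs sc c) = c.
Proof. by apply: lam_to; [exact: (sc_central spec)|exact: (pi0_cs zetaP spec PP)]. Qed.
Lemma lam_A : lam (cA h) = a.
Proof.
apply: lam_to; first exact: (A_central spec).
have := pi0_parA zetaP spec PP a b rho 1; rewrite mulr1 -(rmorph1 sc) (pi0_cs zetaP spec PP) // => ->.
by rewrite scalemx1.
Qed.
Lemma lam_B : lam (cB h) = b.
Proof.
apply: lam_to; first exact: (B_central spec).
have := pi0_parB zetaP spec PP a b rho 1; rewrite mulr1 -(rmorph1 sc) (pi0_cs zetaP spec PP) // => ->.
by rewrite scalemx1.
Qed.
Lemma lam_q : lam (cq h) = 0.
Proof.
by apply: lam_to; [exact: (xy_central zetaP spec)|rewrite (pi0_y zetaP spec PP) raddf0].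
Qed.
Lemma lam_Q : lam (cQ h) = 0.
Proof.
by apply: lam_to; [case: (YX_comm zetaP spec)|rewrite (pi0_Y zetaP spec PP) raddf0].
Qed.
Lemma lam_R : lam (cR h) = 0.
Proof.
apply: lam_to; first exact: (R_central zetaP spec).
by rewrite !exprS (pi0_D zetaP spec PP) (pi0_X zetaP spec PP) (pi0_Y zetaP spec PP) addr0 raddf0.
Qed.
Lemma lam_r : lam (cr h) = 0.
Proof.
rewrite -(crl0 sc); apply: lam_to; first exact: (rl_central zetaP spec).
by rewrite /rl rmorph0 !mul0r !addr0 !exprSr (pi0_D zetaP spec PP) (pi0_x zetaP spec PP) (pi0_y zetaP spec PP) addr0 raddf0.
Qed.

Let pS k : pi0 (refl_sum zeta sc h T k) = \sum_(i < 4) (zeta ^- (k * i) * if odd i then b else a) *: rho (reflW i).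
Proof.
rewrite (pi0_sum zetaP spec PP); apply: eq_bigr => i _; rewrite (pi0_sc zetaP spec PP) -scalerA; congr (_ *: _).
by rewrite /hpar; case: ifP => _; rewrite ?(pi0_parA zetaP spec PP) ?(pi0_parB zetaP spec PP) (pi0_T zetaP PP).
Qed.

Lemma lam_eu : (lam (ceu zeta sc h T))%:M = - \sum_(i < 4) (if odd i then b else a) *: rho (reflW i).
Proof.
rewrite -lamE toZE ?(euH_central zetaP spec PP) // /euH.
rewrite (pi0_B zetaP spec PP) (pi0_D zetaP spec PP) (pi0_x zetaP spec PP) (pi0_y zetaP spec PP).
rewrite pS addr0 sub0r; congr (- _); apply: eq_bigr => i _.
by rewrite mul0n expr0 invr1 mul1r.
Qed.

Lemma lam_a2 k : rho (el 2 false) = k%:M -> lam (ca2 zeta sc h T) = - (2 * (a ^+ 2 - b ^+ 2) * k).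
Proof.
move=> rk; apply: lam_to; first exact: (a2H_central zetaP spec PP).
rewrite /a2H (pi0_B zetaP spec PP) !(pi0_D zetaP spec PP) !expr2 !mulrA.
rewrite !(pi0_x zetaP spec PP) !(pi0_y zetaP spec PP) !addr0 sub0r raddfN; congr (- _).
rewrite -(rmorph_nat sc) -!mulrA (pi0_sc zetaP spec PP) mulrBl (pi0_B zetaP spec PP) -!mulrA.
rewrite !(pi0_parA zetaP spec PP) !(pi0_parB zetaP spec PP) (pi0_T zetaP PP) rk !scale_scalar_mx -raddfB.
by rewrite scale_scalar_mx; congr _%:M; ring.
Qed.

End CentralCharacter.

(** * The irreducible representations of W *)

Section Representations.
Variables (C : numFieldType) (zeta : C).
Hypothesis zetaP : 4.-primitive_root zeta.
Local Notation wmat := (wmat zeta).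
Let z2 : zeta ^+ 2 = -1 := zeta2 zetaP.

Lemma linrep_schur (chi : W -> C) (M : 'M[C]_1) :
  (forall w, M *m linrep chi w = linrep chi w *m M) -> M = (M 0 0)%:M.
Proof. by move=> _; exact: mx11_scalar. Qed.

Lemma linrep_irr (chi : W -> C) (G : set 'cV[C]_1) :
  (forall u v, G u -> G v -> G (u + v)) -> (forall c u, G u -> G (c *: u)) ->
  (forall w u, G u -> G (linrep chi w *m u)) -> (exists2 u, G u & u <> 0) -> forall u, G u.
Proof.
move=> _ GZ _ [u Gu u0] v.
have u00 : u 0 0 != 0 by apply: contra_notN u0 => /eqP E; rewrite (mx11_scalar u) E raddf0.
have -> : v = (v 0 0 / u 0 0) *: u; last exact: GZ.
by apply/matrixP => i j; rewrite !ord1 mxE divfK.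
Qed.

Lemma linrepM (chi : W -> C) : (forall g g', chi (mulW g g') = chi g * chi g') ->
  forall g g', linrep chi (mulW g g') = linrep chi g *m linrep chi g'.
Proof. by move=> M g g'; rewrite /linrep M scalar_mxM. Qed.

Let wrot : wmat (el 1 false) = \matrix_(j, k) (if j != k then 0 else if j == 0 then zeta else - zeta).
Proof.
apply/matrixP => j k; rewrite !mxE /= ; case: ifP => // _; case: ifP => _; rewrite expr1 //.
by rewrite (zetaV zetaP).
Qed.
Let wswap : wmat (el 0 true) = \matrix_(j, k) (j != k)%:R.
Proof.
by apply/matrixP => j k; rewrite !mxE /=; case: ifP => // _; case: ifP => _; rewrite expr0 ?invr1.
Qed.

(** Commutation with diag(ζ, -ζ) kills an off-diagonal entry, and commutation with the swap
    identifies the two off-diagonal and the two diagonal entries. *)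
Lemma wmat_schur (M : 'M[C]_2) : (forall w, M *m wmat w = wmat w *m M) -> M = (M 0 0)%:M.
Proof.
move=> comm; have /matrixP R := comm (el 1 false); have /matrixP S := comm (el 0 true).
have zN : zeta + zeta != 0.
  by rewrite -mulr2n mulrn_eq0 /= (zeta_neq0 zetaP).
have M01 : M 0 1 = 0.
  have := R 0 1; rewrite wrot !mxE !big_ord_recl !big_ord0 !mxE /= (_ : lift ord0 ord0 = 1); last exact: val_inj.
  move=> E; apply: (mulfI zN); rewrite mulr0.
  by rewrite !(mulr0, mul0r, addr0, add0r) in E; rewrite mulrDl -{1}E; ring.
have M10 : M 1 0 = 0.
  have := S 0 0; rewrite wswap !mxE !big_ord_recl !big_ord0 !mxE /= (_ : lift ord0 ord0 = 1); last exact: val_inj.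
  by rewrite !(mulr0, mul0r, addr0, add0r) mulr1 mul1r M01 => <-.
have M11 : M 1 1 = M 0 0.
  have := S 0 1; rewrite wswap !mxE !big_ord_recl !big_ord0 !mxE /= (_ : lift ord0 ord0 = 1); last exact: val_inj.
  by rewrite !(mulr0, mul0r, addr0, add0r) mulr1 mul1r => <-.
apply/matrixP => i j; rewrite mxE.
case: i => [[|[|//]] i2]; case: j => [[|[|//]] j2]; rewrite /= ?mulr1n ?mulr0n.
- by congr (M _ _); apply: val_inj.
- by rewrite -M01; congr (M _ _); apply: val_inj.
- by rewrite -M10; congr (M _ _); apply: val_inj.
- by rewrite -M11; congr (M _ _); apply: val_inj.
Qed.

Lemma wmat_irr (G : set 'cV[C]_2) :
  (forall u v, G u -> G v -> G (u + v)) -> (forall c u, G u -> G (c *: u)) ->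
  (forall w u, G u -> G (wmat w *m u)) -> (exists2 u, G u & u <> 0) -> forall u, G u.
Proof.
move=> GD GZ GW [u Gu u0].
have zN : zeta + zeta != 0 by rewrite -mulr2n mulrn_eq0 /= (zeta_neq0 zetaP).
have rotE c d : wmat (el 1 false) *m cV2 c d = cV2 (zeta * c) (- zeta * d).
  rewrite wrot; apply/matrixP => i j; rewrite !mxE !big_ord_recl big_ord0 !mxE /=.
  by case: i => [[|[|//]] i2] /=; rewrite ?(mul0r, addr0, add0r).
have swapE c d : wmat (el 0 true) *m cV2 c d = cV2 d c.
  rewrite wswap; apply/matrixP => i j; rewrite !mxE !big_ord_recl big_ord0 !mxE /=.
  by case: i => [[|[|//]] i2] /=; rewrite ?(mul0r, mul1r, addr0, add0r).
have eta (v : 'cV[C]_2) : v = cV2 (v 0 0) (v 1 0).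
  apply/matrixP => i j; rewrite mxE (ord1 j); case: i => [[|[|//]] i2] /=; congr (v _ _); exact: val_inj.
have scE c d k : k *: cV2 c d = cV2 (k * c) (k * d).
  by apply/matrixP => i j; rewrite !mxE; case: ifP.
have adE c d c' d' : cV2 c d + cV2 c' d' = cV2 (c + c') (d + d').
  by apply/matrixP => i j; rewrite !mxE; case: ifP.
(* From (c, d) with c nonzero, the sum of its image under diag(ζ, -ζ) and of its multiple by ζ is
   (2ζc, 0); the swap then gives the other basis vector. *)
suff [c [d [c0 Gc]]] : exists c d, c != 0 /\ G (cV2 c d).
  have G1 : G (cV2 1 0).
    have := GD _ _ (GW (el 1 false) _ Gc) (GZ zeta _ Gc); rewrite rotE scE adE mulNr addNr.
    move/(GZ ((zeta + zeta) * c)^-1); rewrite scE mulr0 -mulrDl mulVf //.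
    by rewrite mulf_neq0.
  have G2 : G (cV2 0 1) by have := GW (el 0 true) _ G1; rewrite swapE.
  move=> v; have := GD _ _ (GZ (v 0 0) _ G1) (GZ (v 1 0) _ G2).
  by rewrite !scE adE !(mulr0, mulr1, addr0, add0r) -eta.
have [u00|u00] := eqVneq (u 0 0) 0; last by exists (u 0 0), (u 1 0); rewrite -eta.
exists (u 1 0), (u 0 0); split; last by have := GW (el 0 true) _ Gu; rewrite {1}(eta u) swapE.
apply: contra_notN u0 => /eqP u10; rewrite (eta u) u00 u10.
by apply/matrixP => i j; rewrite !mxE; case: ifP.
Qed.

Lemma wmat_rot2 : wmat (el 2 false) = (-1)%:M.
Proof.
apply/matrixP => j k; rewrite !mxE /=; have [->|] := eqVneq j k; rewrite /= ?mulr1n ?mulr0n //.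
by case: ifP => _; rewrite z2 ?invrN1.
Qed.

(** As matrices s_(i+2) = -s_i, and both carry the same parameter. *)
Lemma wmat_refl_sum a b : \sum_(i < 4) (if odd i then b else a) *: wmat (reflW i) = 0.
Proof.
apply/matrixP => j k; rewrite summxE big_ord4 !mxE /=.
case: ifP => _; first by rewrite !mulr0 !addr0.
have z3 : zeta ^+ 3 = - zeta by rewrite exprS z2 mulrN1.
by case: ifP => _; rewrite ?expr0 ?expr1 ?z2 ?z3 ?invr1 ?invrN1 ?invrN; ring.
Qed.

(** The element -1 of W acts trivially in the linear characters and by -1 in the reflection
    representation; through [lam_a2] this sign separates the two possible values of [a2]. *)
Lemma linear_values chi : [\/ chi = char1, chi = eps zeta, chi = eps_s | chi = eps_t] ->
  [/\ (forall g g', chi (mulW g g') = chi g * chi g'), chi w1 = 1 & chi (el 2 false) = 1].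
Proof.
case=> ->.
- by split=> [g g'||]; rewrite /char1 ?mul1r.
- split=> [g g'||]; rewrite /eps ?(wmatM zetaP) ?det_mulmx //; first by rewrite wmat1 ?det1.
  by rewrite wmat_rot2 det_scalar sqrrN expr1n.
- split; first by have [_ _ M] := @eps_sE C.
    by rewrite /eps_s /= expr0.
  by rewrite /eps_s /= addn0 sqrrN expr1n.
- split; first by have [_ _ M] := @eps_tE C.
    by rewrite /eps_t /= expr0.
  by rewrite /eps_t /= sqrrN expr1n.
Qed.

End Representations.

(** * Points of the fixed locus *)

Section GenericCharacter.
Variables (C : numClosedFieldType) (zeta : C).
Hypothesis zetaP : 4.-primitive_root zeta.
Variables (H : pzRingType) (sc : {rmorphism C -> H}) (h : 'I_6 -> H) (T : W -> H).
Hypothesis spec : cherednik_spec zeta sc h T.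
Variable P : pt C -> {rmorphism H -> 'M[C]_8}.
Hypothesis PP : forall v, dunkl_spec zeta sc h T v (P v).

Lemma generic_character (a b x z : C) : z != 0 -> exists p : {rmorphism centre H -> C},
  [/\ forall c, p (cs sc c) = c,
      [/\ p (cq h) = 0, p (cQ h) = 0, p (ca1 sc h) = 0 & p (ca3 sc h) = 0],
      [/\ p (cA h) = a, p (cB h) = b & p (ceu zeta sc h T) = x] &
      [/\ p (cr h) = quartic a b x / z, p (cR h) = z &
          p (ca2 zeta sc h T) = - 2 * (a ^+ 2 - b ^+ 2)]].
Proof.
move=> z0; pose X0 := 4.-root z; have X4 : X0 ^+ 4 = z by rewrite rootCK.
have X00 : X0 != 0 by apply: contraNneq z0 => E; rewrite -X4 E expr0n.
(* With Y = y = 0 the values of [cq], [cQ], [ca1] and [ca3] vanish, that of [cR] is X0^4 and that of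
   [ceu] is X0 times x. The parameters are divided by X0^2 because [parA] and [parB] multiply them
   by it. *)
pose v := Pt (a / X0 ^+ 2) (b / X0 ^+ 2) X0 0 (x / X0) 0.
have rv : regular v by rewrite /regular /= X4 expr0n.
exists (evR zetaP PP rv).
have E z' : evR zetaP PP rv z' = ev P v z' by [].
rewrite !E (ev_A zetaP spec PP rv) (ev_B zetaP spec PP rv) (ev_eu zetaP spec PP rv).
rewrite (ev_r zetaP spec PP rv) (ev_R zetaP spec PP rv) (ev_a2 zetaP spec PP rv).
rewrite (ev_q zetaP spec PP rv) (ev_Q zetaP spec PP rv) (ev_a1 zetaP spec PP rv) (ev_a3 zetaP spec PP rv).
split.
- by move=> c; rewrite E (ev_cs zetaP spec PP rv).
- by rewrite /kappa1 /=; split; rewrite ?expr0n /= ?(mulr0, mul0r, addr0, subr0).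
- rewrite /parA /parB /= expr0n subr0 addr0; split; by rewrite ?(mulr0, addr0) divfK ?expf_neq0.
- split.
  + rewrite /rho /v /quartic -X4; field; by rewrite X00.
  + by rewrite /= expr0n addr0.
  + rewrite /kappa /v; field; by rewrite X00.
Qed.
End GenericCharacter.

Section Concrete.
Variables (C : numClosedFieldType) (zeta : C).
Hypothesis zetaP : 4.-primitive_root zeta.
Local Notation H := (cherednik zeta).
Local Notation Z := (centre H).
Local Notation sc := (scR zeta).
Local Notation h := (h_ zeta).
Local Notation T := (T_ zeta).
Let spec : cherednik_spec zeta sc h T := cherednikP zetaP.
Let PP := PhiP zetaP.

Lemma scRE c : scR zeta c = scalH zeta c. Proof. by []. Qed.

Lemma pbwE q : pbw zeta q = pbw_sum sc h T q.
Proof.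
apply: eq_bigr => w _; apply: eq_bigr => m _.
rewrite -scRE /mono; reflexivity.
Qed.

Lemma TruncE z : Trunc z = TruncA sc h T z.
Proof.
rewrite /Trunc /TruncA.
by have -> : pbw zeta = pbw_sum sc h T by apply/funext => q; exact: pbwE.
Qed.

Lemma TruncInvE p : TruncInv zeta p = TruncInvA sc h T p.
Proof.
rewrite /TruncInv /TruncInvA.
by have -> : @Trunc C zeta = TruncA sc h T by apply/funext => q; exact: TruncE.
Qed.

Lemma euE : eu zeta = ceu zeta sc h T.
Proof.
rewrite /eu TruncInvE -(TruncA_euH zetaP spec PP).
exact: (TruncInvAE zetaP spec PP (euH_central zetaP spec PP)).
Qed.
Lemma a2E : a2 zeta = ca2 zeta sc h T.
Proof.
rewrite /a2 TruncInvE -(TruncA_a2H zetaP spec PP).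
exact: (TruncInvAE zetaP spec PP (a2H_central zetaP spec PP)).
Qed.

Section OneTorus.
Variable xi : C.
Hypothesis xi0 : xi != 0.
Let torus_rm : {rmorphism freealg C -> H} := [the {rmorphism freealg C -> H} of piH zeta \o torusF xi].
Lemma torus_kills f : cherednik_rel zeta f -> torus_rm f = 0.
Proof. exact: torusF_rel. Qed.
Definition tau : {rmorphism H -> H} := qliftR torus_kills.
Lemma tau_piH f : tau (piH zeta f) = piH zeta (torusF xi f). Proof. exact: torusE. Qed.

Lemma tauP : torus_spec sc h T xi tau.
Proof.
split=> [c|i|w].
- apply: etrans (tau_piH _) _; congr (piH zeta _).
  by apply: etrans (torusF_Z _ _ _) _; congr (_ *: _); exact: rmorph1.
- apply: etrans (tau_piH _) _; apply: etrans (congr1 (piH zeta) (torusF_gen xi (inl i))) _.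
  exact: piHZ.
- by apply: etrans (tau_piH _) _; congr (piH zeta _); exact: torusF_T.
Qed.
End OneTorus.

(** A single test element, ξ = ζ with ζ^2 = -1, forces the four vanishing conditions. *)
Lemma muFixP (p : {rmorphism Z -> C}) : muFix zeta 4 p <->
  (forall c, p (cs sc c) = c) /\
  [/\ p (cq h) = 0, p (cQ h) = 0, p (ca1 sc h) = 0 & p (ca3 sc h) = 0].
Proof.
have z0 := zeta_neq0 zetaP; have zV : zeta^-1 != 0 by rewrite invr_eq0.
split=> [[pk pf]|[pk [q0 Q0 a10 a30]]].
  have {}pk : forall c, p (cs sc c) = c by [].
  split=> //.
  apply: (vanishing_of_fixed zetaP spec z0 (tauP z0) (tauP zV) (zeta4 zetaP) pk (zeta2 zetaP)).
  by move=> z; have := pf zeta (zeta4 zetaP) z.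
split=> // xi xi4 z; have xi0 : xi != 0.
  by apply: contra_eq_neq xi4 => ->; rewrite expr0n /= eq_sym oner_neq0.
have xiV : xi^-1 != 0 by rewrite invr_eq0.
exact: (fixed_of_vanishing zetaP spec PP xi0 (tauP xi0) (tauP xiV) xi4 q0 Q0 a10 a30).
Qed.

Definition gens : 6.-tuple Z := [tuple zA zeta; zB zeta; zr zeta; zR zeta; eu zeta; a2 zeta].

Lemma generation (f : Z) : exists P : {mpoly C[6]},
  forall p, muFix zeta 4 p -> p f = P.@[tnth (coords gens p)].
Proof.
have genX i z : nth 0 gens i = z -> (i < 6)%N -> exists P : {mpoly C[6]},
    forall p, muFix zeta 4 p -> p z = P.@[tnth (coords gens p)].
  move=> <- i6; exists 'X_(Ordinal i6) => p _.
  by rewrite mevalXU tnth_map (tnth_nth 0).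
have gen0 (z : Z) : (forall p, muFix zeta 4 p -> p z = 0) -> exists P : {mpoly C[6]},
    forall p, muFix zeta 4 p -> p z = P.@[tnth (coords gens p)].
  by move=> z0; exists 0 => p pF; rewrite meval0 z0.
have := Gen_all zetaP spec PP f.
elim=> [c||||||||||| z1 z2 _ [P1 E1] _ [P2 E2]| z1 z2 _ [P1 E1] _ [P2 E2]].
- by exists c%:MP => p /muFixP[pk _]; rewrite mevalC pk.
- exact: (genX 0%N _ erefl isT).
- exact: (genX 1%N _ erefl isT).
- apply: gen0 => p /muFixP[_ [E _ _ _]]; exact: E.
- apply: gen0 => p /muFixP[_ [_ E _ _]]; exact: E.
- exact: (genX 2%N _ erefl isT).
- exact: (genX 3%N _ erefl isT).
- rewrite -euE; exact: (genX 4%N _ erefl isT).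
- apply: gen0 => p /muFixP[_ [_ _ E _]]; exact: E.
- rewrite -a2E; exact: (genX 5%N _ erefl isT).
- apply: gen0 => p /muFixP[_ [_ _ _ E]]; exact: E.
- by exists (P1 + P2) => p pF; rewrite rmorphD mevalD E1 // E2.
- by exists (P1 * P2) => p pF; rewrite rmorphM mevalM E1 // E2.
Qed.

Lemma fix_relations (p : {rmorphism Z -> C}) : muFix zeta 4 p ->
  let a := p (zA zeta) in let b := p (zB zeta) in
  let e := p (eu zeta) in let u := p (zr zeta) in let v := p (zR zeta) in let w := p (a2 zeta) in
  [/\ e * (w + 2 * (a ^+ 2 - b ^+ 2)) = 0, u * (w + 2 * (a ^+ 2 - b ^+ 2)) = 0,
      v * (w + 2 * (a ^+ 2 - b ^+ 2)) = 0,
      (w - 2 * (a ^+ 2 - b ^+ 2)) * (w + 2 * (a ^+ 2 - b ^+ 2)) = 0 &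
      quartic a b e = u * v + 4 * (a ^+ 2 - b ^+ 2) * (w + 2 * (a ^+ 2 - b ^+ 2))].
Proof.
move=> /muFixP[_ [q0 Q0 a10 a30]]; rewrite euE a2E.
exact: (fixed_relations zetaP spec PP q0 Q0 a10 a30).
Qed.

Lemma generic_point (a b x z : C) : z != 0 -> exists p : {rmorphism Z -> C},
  [/\ muFix zeta 4 p, p (zA zeta) = a, p (zB zeta) = b, p (eu zeta) = x &
   [/\ p (zr zeta) = quartic a b x / z, p (zR zeta) = z & p (a2 zeta) = - 2 * (a ^+ 2 - b ^+ 2)]].
Proof.
move=> z0; have [p [pk pO [pA pB pe] [pr pR pa]]] := generic_character zetaP spec PP a b x z0.
exists p; rewrite euE a2E; split; [by apply/muFixP|exact: pA|exact: pB|exact: pe|].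
by split; [exact: pr|exact: pR|exact: pa].
Qed.

End Concrete.

(** * The degree 0 component on the restricted Cherednik algebra *)

Section QuotientKernel.
Variables (C : numFieldType) (zeta : C).
Hypothesis zetaP : 4.-primitive_root zeta.
Variables (H : pzRingType) (sc : {rmorphism C -> H}) (h : 'I_6 -> H) (T : W -> H).
Hypothesis spec : cherednik_spec zeta sc h T.
Variable P : pt C -> {rmorphism H -> 'M[C]_8}.
Hypothesis PP : forall v, dunkl_spec zeta sc h T v (P v).
Variables (a b : C) (n : nat) (rho : W -> 'M[C]_n).

Local Notation A := (h iA).
Local Notation B := (h iB).
Local Notation X := (h iX).
Local Notation Y := (h iY).
Local Notation x := (h ix).
Local Notation y := (h iy).
Local Notation pi0 := (pi0 sc h T a b rho).

Lemma pi0_parameters u v s : s = A - sc a \/ s = B - sc b -> pi0 (u * s * v) = 0.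
Proof.
have E t : t \in @central H -> u * t * v = t * (u * v).
  by move=> /centralP tC; rewrite -tC mulrA.
by case=> ->; rewrite E ?centralB ?(sc_central spec) ?(A_central spec) ?(B_central spec) //;
  rewrite mulrBl (pi0_B zetaP spec PP) ?(pi0_parA zetaP spec PP) ?(pi0_parB zetaP spec PP)
    (pi0_sc zetaP spec PP) subrr.
Qed.

Lemma incl2_central_XY (p : {mpoly C[2]}) :
  (forall v : 'I_2 -> C, p.@[fun i => if i == ord0 then zeta * v ord0 else zeta^-1 * v ord_max] = p.@[v]) ->
  (forall v : 'I_2 -> C, p.@[fun i => if i == ord0 then v ord_max else v ord0] = p.@[v]) ->
  incl2 sc X Y p \in @central H.
Proof.
move=> rot swap; have [psym pmod] := invariant_coeffs zetaP rot swap.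
have [YXc _] := YX_comm zetaP spec.
by apply: (incl2_central zetaP (spec_sc spec) (XYC spec) _ _ psym pmod); [rewrite (XYC spec)|exact: (R_central zetaP spec)].
Qed.

Lemma incl2_central_xy (p : {mpoly C[2]}) :
  (forall v : 'I_2 -> C, p.@[fun i => if i == ord0 then zeta * v ord0 else zeta^-1 * v ord_max] = p.@[v]) ->
  (forall v : 'I_2 -> C, p.@[fun i => if i == ord0 then v ord_max else v ord0] = p.@[v]) ->
  incl2 sc x y p \in @central H.
Proof.
move=> rot swap; have [psym pmod] := invariant_coeffs zetaP rot swap.
apply: (incl2_central zetaP (spec_sc spec) (xyC spec) _ _ psym pmod); first exact: (xy_central zetaP spec).
by have := rl_central zetaP spec 0; rewrite /rl rmorph0 !mul0r !addr0.
Qed.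

Let supp_pos (p : {mpoly C[2]}) m : p@_0%MM = 0 -> m \in mpoly.msupp p -> (0 < m ord0 + m ord_max)%N.
Proof.
move=> p0; rewrite lt0n addn_eq0 mcoeff_msupp; apply: contraNN => /andP[/eqP m0 /eqP m1].
rewrite -p0; apply/eqP; congr (_@__); apply/mnmP => i; rewrite mnmE.
by case: i => [[|[|//]] i2]; [rewrite -[RHS]m0|rewrite -[RHS]m1]; congr (m _); apply: val_inj.
Qed.

(** Inside a two-sided product, a central polynomial in X, Y can be moved to the left end, where
    [pi0] kills it; one in x, y is moved to the right end in the next lemma. The vanishing constant
    term guarantees a positive exponent. *)
Lemma pi0_incl_XY (p : {mpoly C[2]}) u v : p@_0%MM = 0 -> incl2 sc X Y p \in @central H ->
  pi0 (u * incl2 sc X Y p * v) = 0.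
Proof.
move=> p0 /centralP pC; rewrite -pC -mulrA mulr_suml (pi0_sum zetaP spec PP) big_seq big1 // => m mp.
rewrite -!mulrA (pi0_sc zetaP spec PP); have := supp_pos p0 mp.
case: (m ord0) => [|k]; last by rewrite exprS -mulrA (pi0_X zetaP spec PP) scaler0.
case: (m ord_max) => [//|k] _; by rewrite expr0 mul1r exprS -mulrA (pi0_Y zetaP spec PP) scaler0.
Qed.

Lemma pi0_incl_xy (p : {mpoly C[2]}) u v : p@_0%MM = 0 -> incl2 sc x y p \in @central H ->
  pi0 (u * incl2 sc x y p * v) = 0.
Proof.
move=> p0 /centralP pC; rewrite -mulrA pC mulrA mulr_sumr (pi0_sum zetaP spec PP) big_seq big1 // => m mp.
rewrite (spec_scZ spec) (pi0_sc zetaP spec PP); have := supp_pos p0 mp.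
case: (m ord_max) => [|k]; last by rewrite exprSr !mulrA (pi0_y zetaP spec PP) scaler0.
case: (m ord0) => [//|k] _; by rewrite expr0 mulr1 exprSr !mulrA (pi0_x zetaP spec PP) scaler0.
Qed.

End QuotientKernel.

Section InclPolynomials.
Variables (C : numFieldType) (H : pzRingType) (sc : {rmorphism C -> H}) (Q R : H).

Lemma incl2_D (p q : {mpoly C[2]}) : incl2 sc Q R (p + q) = incl2 sc Q R p + incl2 sc Q R q.
Proof.
pose K := maxn (msize p) (maxn (msize q) (msize (p + q))).
have bound (s : {mpoly C[2]}) : (msize s <= K)%N ->
    forall m, m \in mpoly.msupp s -> (m ord0 < K /\ m ord_max < K)%N.
  move=> sK m /mpoly.msize_mdeg_lt lt.
  by split; apply: leq_ltn_trans (leq_trans lt sK); rewrite mdegE;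
    [rewrite (bigD1 ord0)|rewrite (bigD1 ord_max)] => //=; rewrite leq_addr.
rewrite !(@incl2_bound _ _ _ _ _ _ K); try (apply: bound; rewrite !leq_max leqnn ?orbT //).
rewrite -big_split; apply: eq_bigr => i _; rewrite -big_split; apply: eq_bigr => j _ /=.
by rewrite mcoeffD rmorphD mulrDl.
Qed.

Lemma incl2_X i j : incl2 sc Q R 'X_[mk2 i j] = Q ^+ i * R ^+ j.
Proof. by rewrite /incl2 msuppX big_seq1 mcoeffX eqxx rmorph1 mul1r mk2_0 mk2_1. Qed.

End InclPolynomials.

Section InvariantConditions.
Variables (C : numFieldType) (zeta : C).
Hypothesis zetaP : 4.-primitive_root zeta.
Local Notation wmat := (wmat zeta).

Lemma wmat_colE g (v : 'cV[C]_2) : wmat g *m v =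
  \col_i (if g.2 then (if i == ord0 then zeta ^+ g.1 * v 1 0 else zeta ^- g.1 * v 0 0)
          else (if i == ord0 then zeta ^+ g.1 * v 0 0 else zeta ^- g.1 * v 1 0)).
Proof.
apply/matrixP => i j; rewrite !mxE !big_ord_recl big_ord0 /Defs.wmat (ord1 j).
rewrite (_ : lift ord0 ord0 = 1); last exact: val_inj.
by case: g => k []; case: i => [[|[|//]] i2]; rewrite /= !mxE /= ?(mul0r, add0r, addr0).
Qed.

Lemma wmat_rowE g (v : 'rV[C]_2) : v *m wmat g =
  \row_i (if g.2 then (if i == ord0 then zeta ^- g.1 * v 0 1 else zeta ^+ g.1 * v 0 0)
          else (if i == ord0 then zeta ^+ g.1 * v 0 0 else zeta ^- g.1 * v 0 1)).
Proof.
apply/matrixP => i j; rewrite !mxE !big_ord_recl big_ord0 /Defs.wmat (ord1 i).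
rewrite (_ : lift ord0 ord0 = 1); last exact: val_inj.
by case: g => k []; case: j => [[|[|//]] i2]; rewrite /= !mxE /= ?(mulr0, add0r, addr0) // mulrC.
Qed.

Let ord1E : ord_max = 1 :> 'I_2. Proof. exact: val_inj. Qed.

Lemma invV_sub (p : {mpoly C[2]}) : invV zeta p ->
  (forall v : 'I_2 -> C, p.@[fun i => if i == ord0 then zeta * v ord0 else zeta^-1 * v ord_max] = p.@[v]) /\
  (forall v : 'I_2 -> C, p.@[fun i => if i == ord0 then v ord_max else v ord0] = p.@[v]).
Proof.
move=> inv; split=> v; have := inv _ (\col_i v i).
  move/(_ (el 1 false)); rewrite wmat_colE => E.
  transitivity (p.@[fun i => (\col_i v i) i 0]); last by apply: meval_eq => i; rewrite mxE.
  by rewrite -E; apply: meval_eq => i; rewrite !mxE /= expr1 ord1E.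
move/(_ (el 0 true)); rewrite wmat_colE => E.
transitivity (p.@[fun i => (\col_i v i) i 0]); last by apply: meval_eq => i; rewrite mxE.
by rewrite -E; apply: meval_eq => i; rewrite !mxE /= expr0 invr1 !mul1r ord1E.
Qed.

Lemma invVd_sub (p : {mpoly C[2]}) : invVd zeta p ->
  (forall v : 'I_2 -> C, p.@[fun i => if i == ord0 then zeta * v ord0 else zeta^-1 * v ord_max] = p.@[v]) /\
  (forall v : 'I_2 -> C, p.@[fun i => if i == ord0 then v ord_max else v ord0] = p.@[v]).
Proof.
move=> inv; split=> v; have := inv _ (\row_i v i).
  move/(_ (el 1 false)); rewrite wmat_rowE => E.
  transitivity (p.@[fun i => (\row_i v i) 0 i]); last by apply: meval_eq => i; rewrite mxE.
  by rewrite -E; apply: meval_eq => i; rewrite !mxE /= expr1 ord1E.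
move/(_ (el 0 true)); rewrite wmat_rowE => E.
transitivity (p.@[fun i => (\row_i v i) 0 i]); last by apply: meval_eq => i; rewrite mxE.
by rewrite -E; apply: meval_eq => i; rewrite !mxE /= expr0 invr1 !mul1r ord1E.
Qed.

Lemma XY_invV : invV zeta 'X_[mk2 1 1].
Proof.
move=> g v; rewrite wmat_colE !mevalX2 !mxE ord1E /=.
have zg : zeta ^+ g.1 != 0 by rewrite expf_neq0 // (zeta_neq0 zetaP).
by rewrite !expr1; case: g.2; rewrite mulrACA mulfV // mul1r // mulrC.
Qed.

Lemma X4Y4_invV : invV zeta ('X_[mk2 4 0] + 'X_[mk2 0 4]).
Proof.
move=> g v; rewrite wmat_colE !mevalD !mevalX2 !mxE ord1E /=.
have z4 k : (zeta ^+ k) ^+ 4 = 1 by rewrite exprAC (zeta4 zetaP) expr1n.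
by rewrite !expr0 !mul1r !mulr1; case: g.2; rewrite !exprMn exprVn !z4 invr1 !mul1r // addrC.
Qed.

End InvariantConditions.

Section AdditiveOnQuotient.
Variables (R : pzRingType) (S : set R) (M : zmodType) (f : R -> M).
Hypothesis fB : forall u v, f (u - v) = f u - f v.
Hypothesis fS : forall u s v, S s -> f (u * s * v) = 0.

(** The map f kills the two-sided ideal generated by S, so its value does not depend on the
    representative of a class. *)
Lemma additive_qrepr z : f (qrepr (qpi S z)) = f z.
Proof.
have f0 : f 0 = 0 by have := fB 0 0; rewrite !subrr.
have fD u v : f (u + v) = f u + f v by rewrite -{1}(opprK v) fB -(sub0r v) fB f0 sub0r opprK.
apply: subr0_eq; rewrite -fB -[X in f X]mul1r -[X in f X]mulr1.
apply: (@qrepr_pi R S z [set d | forall u v, f (u * d * v) = 0]) => [|s Ss u v] /=; last exact: fS.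
split=> [u v|d1 d2 H1 H2 u v|u' d v' Hd u v] /=.
- by rewrite mulr0 mul0r.
- by rewrite mulrDr mulrDl fD H1 H2 addr0.
- by rewrite !mulrA -(mulrA _ v' v) Hd.
Qed.
End AdditiveOnQuotient.

Section ConcreteVerma.
Variables (C : numClosedFieldType) (zeta : C).
Hypothesis zetaP : 4.-primitive_root zeta.
Local Notation H := (cherednik zeta).
Local Notation sc := (scR zeta).
Local Notation h := (h_ zeta).
Local Notation T := (T_ zeta).
Let spec : cherednik_spec zeta sc h T := cherednikP zetaP.
Let PP := PhiP zetaP.
Variables (a b : C) (n : nat) (rho : W -> 'M[C]_n).
Local Notation Hc := (Hc zeta a b).
Local Notation Hb := (Hbar zeta a b).
Local Notation pi0 := (pi0 sc h T a b rho).

Lemma inclVE p : inclV zeta p = incl2 sc (h iX) (h iY) p. Proof. by []. Qed.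

Definition piHcR : {rmorphism H -> Hc} := qpi (@Hc_rel C zeta a b).
Definition piHbR : {rmorphism Hc -> Hb} := qpi (@Hbar_rel C zeta a b).
Definition piHbarR : {rmorphism H -> Hb} := [the {rmorphism H -> Hb} of piHbR \o piHcR].

Lemma piHbar_surj (t : Hb) : exists z, t = piHbarR z.
Proof.
exists (qrepr (qrepr t : Hc)); symmetry.
by apply: etrans (congr1 piHbR (qreprK _)) _; exact: qreprK.
Qed.

Let piHbar_eq z z' : piHcR z = piHcR z' -> piHbarR z = piHbarR z'.
Proof. by move=> E; exact: (congr1 piHbR E). Qed.

Lemma piHbar_A : piHbarR (h iA) = piHbarR (sc a).
Proof.
apply: piHbar_eq; apply: subr0_eq; apply: etrans (esym (rmorphB piHcR _ _)) _.
by apply: qpi_eq0; left.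
Qed.
Lemma piHbar_B : piHbarR (h iB) = piHbarR (sc b).
Proof.
apply: piHbar_eq; apply: subr0_eq; apply: etrans (esym (rmorphB piHcR _ _)) _.
by apply: qpi_eq0; right.
Qed.
Lemma piHbar_inclV p : invV zeta p -> p@_0%MM = 0 -> piHbarR (inclV zeta p) = 0.
Proof. by move=> pI p0; apply: qpi_eq0; exists p => //; left. Qed.

Lemma piHbar_YX : piHbarR (h iY * h iX) = 0.
Proof.
rewrite -(XYC spec) -[h iX * h iY]/(h iX ^+ 1 * h iY ^+ 1) -(incl2_X sc) -inclVE.
apply: piHbar_inclV; first exact: (XY_invV zetaP).
rewrite mcoeffX; case: eqP => // /(congr1 (fun m : 'X_{1..2} => m ord0)).
by rewrite mk2_0 mnmE.
Qed.
Lemma piHbar_R : piHbarR (h iX ^+ 4 + h iY ^+ 4) = 0.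
Proof.
have -> : h iX ^+ 4 + h iY ^+ 4 = inclV zeta ('X_[mk2 4 0] + 'X_[mk2 0 4]).
  by rewrite inclVE incl2_D !incl2_X !expr0 mulr1 mul1r.
apply: piHbar_inclV; first exact: (X4Y4_invV zetaP).
rewrite mcoeffD !mcoeffX.
case: eqP => [/(congr1 (fun m : 'X_{1..2} => m ord0))|_]; first by rewrite mk2_0 mnmE.
case: eqP => [/(congr1 (fun m : 'X_{1..2} => m ord_max))|_]; first by rewrite mk2_1 mnmE.
by rewrite addr0.
Qed.

Let kills_Hc u s v : @Hc_rel C zeta a b s -> pi0 (u * s * v) = 0.
Proof. by move=> [->|->]; apply: (pi0_parameters zetaP spec PP); [left|right]. Qed.

Definition pi0c (t : Hc) : 'M[C]_n := pi0 (qrepr t).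
Lemma pi0cE z : pi0c (piHcR z) = pi0 z.
Proof. exact: (additive_qrepr (pi0_B zetaP spec PP a b rho) kills_Hc). Qed.

Let Hc_surj (t : Hc) : exists z, t = piHcR z.
Proof. by exists (qrepr t); symmetry; exact: qreprK. Qed.

Lemma pi0c_B t t' : pi0c (t - t') = pi0c t - pi0c t'.
Proof.
have [z ->] := Hc_surj t; have [z' ->] := Hc_surj t'.
by rewrite -(rmorphB piHcR) !pi0cE (pi0_B zetaP spec PP).
Qed.

Let kills_Hbar u s v : @Hbar_rel C zeta a b s -> pi0c (u * s * v) = 0.
Proof.
have [u' ->] := Hc_surj u; have [v' ->] := Hc_surj v.
move=> [p p0 [[pI ->]|[pI ->]]].
  have [rot swap] := invV_sub pI.
  have E : piHcR u' * piHc a b (inclV zeta p) * piHcR v' = piHcR (u' * inclV zeta p * v').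
    by apply: esym; apply: etrans (rmorphM piHcR _ _) (congr1 (fun t => t * piHcR v') (rmorphM piHcR _ _)).
  apply: etrans (congr1 pi0c E) _; apply: etrans (pi0cE _) _.
  apply: (pi0_incl_XY zetaP spec PP a b rho u' v' p0).
  exact: (incl2_central_XY zetaP spec).
have [rot swap] := invVd_sub pI.
have E : piHcR u' * piHc a b (inclVd zeta p) * piHcR v' = piHcR (u' * inclVd zeta p * v').
  by apply: esym; apply: etrans (rmorphM piHcR _ _) (congr1 (fun t => t * piHcR v') (rmorphM piHcR _ _)).
apply: etrans (congr1 pi0c E) _; apply: etrans (pi0cE _) _.
  apply: (pi0_incl_xy zetaP spec PP a b rho u' v' p0).
exact: (incl2_central_xy zetaP spec).
Qed.

Definition psi (t : Hb) : 'M[C]_n := pi0c (qrepr t).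
Lemma psiE z : psi (piHbarR z) = pi0 z.
Proof. by rewrite -pi0cE; exact: (additive_qrepr pi0c_B kills_Hbar). Qed.

End ConcreteVerma.

(** * Points of the specialised centre *)

Section PointsOfZc.
Variables (C : numClosedFieldType) (zeta : C).
Hypothesis zetaP : 4.-primitive_root zeta.
Local Notation H := (cherednik zeta).
Local Notation Z := (centre H).
Local Notation sc := (scR zeta).
Local Notation h := (h_ zeta).
Local Notation T := (T_ zeta).
Let spec : cherednik_spec zeta sc h T := cherednikP zetaP.
Let PP := PhiP zetaP.
Variables a b : C.
Local Notation Zc := (Zc zeta a b).

Definition piZcR : {rmorphism Z -> Zc} := qpi (@Zc_rel C zeta a b).
Lemma Zc_surj (f : Zc) : exists z, f = piZcR z.
Proof. by exists (qrepr f); symmetry; exact: qreprK. Qed.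

Definition pullZ (p : {rmorphism Zc -> C}) : {rmorphism Z -> C} := [the {rmorphism Z -> C} of p \o piZcR].

Let piZc_A : piZcR (zA zeta) = piZcR (scalZ zeta a).
Proof.
apply: subr0_eq; apply: etrans (esym (rmorphB piZcR _ _)) _.
by apply: qpi_eq0; left.
Qed.
Let piZc_B : piZcR (zB zeta) = piZcR (scalZ zeta b).
Proof.
apply: subr0_eq; apply: etrans (esym (rmorphB piZcR _ _)) _.
by apply: qpi_eq0; right.
Qed.

Lemma pullZ_AB p : points (scalZc zeta a b) p -> pullZ p (zA zeta) = a /\ pullZ p (zB zeta) = b.
Proof.
move=> pk; split.
  exact: etrans (congr1 p piZc_A) (pk a).
exact: etrans (congr1 p piZc_B) (pk b).
Qed.

Lemma pushZ (q : {rmorphism Z -> C}) : (forall c, q (scalZ zeta c) = c) ->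
  q (zA zeta) = a -> q (zB zeta) = b -> exists p : {rmorphism Zc -> C},
  points (scalZc zeta a b) p /\ forall z, p (piZc a b z) = q z.
Proof.
move=> qk qA qB; have qS s : @Zc_rel C zeta a b s -> q s = 0.
  move=> [->|->]; apply: etrans (rmorphB q _ _) _.
    exact: etrans (congr2 (fun u v => u - v) qA (qk a)) (subrr a).
  exact: etrans (congr2 (fun u v => u - v) qB (qk b)) (subrr b).
exists (qliftR qS); have E z : qliftR qS (piZc a b z) = q z by exact: qliftRE.
split; [move=> c; exact: (etrans (E (scalZ zeta c)) (qk c))|exact: E].
Qed.

Lemma muFixcP (p : {rmorphism Zc -> C}) : muFixc zeta a b 4 p <-> muFix zeta 4 (pullZ p).
Proof. by split=> -[pk pf]; split; [exact: pk|exact: pf|exact: pk|exact: pf]. Qed.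

Section Character.
Variables (n : nat) (rho : W -> 'M[C]_n).
Hypothesis rhoM : forall g g', rho (mulW g g') = rho g *m rho g'.
Hypothesis rho1 : rho w1 = 1%:M.
Variable i0 : 'I_n.
Hypothesis schur : forall M : 'M[C]_n,
  (forall w, M *m rho w = rho w *m M) -> M = (M i0 i0)%:M.
Hypothesis rho_irr : forall G : set 'cV[C]_n,
  (forall u v, G u -> G v -> G (u + v)) -> (forall c u, G u -> G (c *: u)) ->
  (forall w u, G u -> G (rho w *m u)) -> (exists2 u, G u & u <> 0) -> forall u, G u.
Local Notation lam := (lam sc h T a b rho i0).

Let n_gt0 : (0 < n)%N. Proof. exact: leq_ltn_trans (leq0n i0) (ltn_ord i0). Qed.
Let N := N0 (@psi C zeta a b n rho).

(** The character [lam] takes the values a, b on A, B, so it factors through [Zc]. A central z minus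
    [lam z] maps the whole module into [N0], the unique maximal submodule. *)
Lemma zchi_exists : exists p : {rmorphism Zc -> C},
  is_zchi zeta a b rho p /\ forall z, p (piZc a b z) = lam z.
Proof.
have [|||p [pk pE]] := @pushZ (lamR zetaP spec PP a b rhoM rho1 schur).
- exact: (lam_cs zetaP spec PP a b rho1 i0).
- exact: (lam_A zetaP spec PP a b rho1 i0).
- exact: (lam_B zetaP spec PP a b rho1 i0).
exists p; split; last exact: pE.
split; first exact: pk.
exists N; split.
- exact: (N0_maximal zetaP spec PP rhoM rho1 n_gt0 rho_irr (@piHbar_surj C zeta a b)
    (piHbar_A zeta a b) (piHbar_B zeta a b) (piHbar_YX zetaP a b) (piHbar_R zetaP a b) (psiE zetaP a b rho)).
- exact: (maximal_unique zetaP spec PP rhoM rho1 n_gt0 rho_irr (@piHbar_surj C zeta a b)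
    (piHbar_A zeta a b) (piHbar_B zeta a b) (piHbar_YX zetaP a b) (piHbar_R zetaP a b) (psiE zetaP a b rho)).
- move=> z u; rewrite pE.
  exact: (central_scalar zetaP spec PP rhoM (@piHbar_surj C zeta a b) (psiE zetaP a b rho) u (valP z)
    (lamE zetaP spec PP a b rhoM schur z)).
Qed.

End Character.
End PointsOfZc.

Lemma fix_relations_at (C : numClosedFieldType) (zeta : C) (zetaP : 4.-primitive_root zeta)
    (p : {rmorphism centre (cherednik zeta) -> C}) (a b : C) :
  muFix zeta 4 p -> p (zA zeta) = a -> p (zB zeta) = b ->
  let e := p (eu zeta) in let u := p (zr zeta) in let v := p (zR zeta) in let w := p (a2 zeta) in
  [/\ e * (w + 2 * (a ^+ 2 - b ^+ 2)) = 0, u * (w + 2 * (a ^+ 2 - b ^+ 2)) = 0,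
      v * (w + 2 * (a ^+ 2 - b ^+ 2)) = 0,
      (w - 2 * (a ^+ 2 - b ^+ 2)) * (w + 2 * (a ^+ 2 - b ^+ 2)) = 0 &
      quartic a b e = u * v + 4 * (a ^+ 2 - b ^+ 2) * (w + 2 * (a ^+ 2 - b ^+ 2))].
Proof. move=> pF <- <-. exact (fix_relations zetaP pF). Qed.

Section FixedLocus.
Variables (C : numClosedFieldType) (zeta : C).
Hypothesis zetaP : 4.-primitive_root zeta.
Local Notation Z := (centre (cherednik zeta)).
Local Notation sc := (scR zeta).
Local Notation h := (h_ zeta).
Local Notation T := (T_ zeta).
Let spec : cherednik_spec zeta sc h T := cherednikP zetaP.
Let PP := PhiP zetaP.
Variables a b : C.
Local Notation Zc := (Zc zeta a b).
Local Notation Y := (muFixc zeta a b 4).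
Local Notation k := (scalZc zeta a b).
Local Notation e := (piZc a b (eu zeta)).
Local Notation u := (piZc a b (zr zeta)).
Local Notation v := (piZc a b (zR zeta)).
Local Notation w := (piZc a b (a2 zeta)).

(** The images of the generators of the centre on which ζ in C^* acts by -1. *)
Definition odd_elements : set Zc := [set f | [\/ f = piZc a b (cq h), f = piZc a b (cQ h),
  f = piZc a b (ca1 sc h) | f = piZc a b (ca3 sc h)]].

Lemma YE : Y = [set p : {rmorphism Zc -> C} | points k p /\ forall f, odd_elements f -> p f = 0].
Proof.
apply/seteqP; split=> p.
  move=> Yp; split; first by case: Yp.
  have [_ [q0 Q0 a10 a30]] := iffLR (muFixP zetaP _) (iffLR (muFixcP p) Yp).
  by move=> f [->|->|->|->]; [exact: q0|exact: Q0|exact: a10|exact: a30].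
move=> [pk pO]; apply/muFixcP/(muFixP zetaP); split; first exact: pk.
by split; apply: pO; [apply: Or41|apply: Or42|apply: Or43|apply: Or44].
Qed.

Lemma Y_fix (p : {rmorphism Zc -> C}) : Y p ->
  [/\ muFix zeta 4 (pullZ p), pullZ p (zA zeta) = a & pullZ p (zB zeta) = b].
Proof.
move=> Yp; have [pk _] := Yp; have [pA pB] := pullZ_AB pk.
by split; [exact: (iffLR (muFixcP p) Yp)|exact: pA|exact: pB].
Qed.

Lemma Yfun (f : Zc) : exists P : {mpoly C[4]}, forall p : {rmorphism Zc -> C}, Y p ->
  p f = P.@[co e u v w p].
Proof.
have [z ->] := Zc_surj f; have [P PE] := generation zetaP z.
pose s : 6.-tuple {mpoly C[4]} := [tuple a%:MP; b%:MP; 'X_(@Ordinal 4 1 isT);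
  'X_(@Ordinal 4 2 isT); 'X_(@Ordinal 4 0 isT); 'X_(@Ordinal 4 3 isT)].
exists (P \mPo s) => p Yp; have [pF pA pB] := Y_fix Yp.
apply: etrans (PE _ pF) _; rewrite comp_mpoly_meval; apply: meval_eq => i.
rewrite tnth_map !(tnth_nth 0).
case: i => [[|[|[|[|[|[|//]]]]]] i6].
- by apply: etrans pA _; rewrite /s /= mevalC.
- by apply: etrans pB _; rewrite /s /= mevalC.
- by rewrite /s /= mevalXU /co (tnth_nth 0).
- by rewrite /s /= mevalXU /co (tnth_nth 0).
- by rewrite /s /= mevalXU /co (tnth_nth 0).
- by rewrite /s /= mevalXU /co (tnth_nth 0).
Qed.

Lemma Yrel (p : {rmorphism Zc -> C}) : Y p ->
  [/\ p e * (p w + 2 * (a ^+ 2 - b ^+ 2)) = 0, p u * (p w + 2 * (a ^+ 2 - b ^+ 2)) = 0,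
      p v * (p w + 2 * (a ^+ 2 - b ^+ 2)) = 0,
      (p w - 2 * (a ^+ 2 - b ^+ 2)) * (p w + 2 * (a ^+ 2 - b ^+ 2)) = 0 &
      quartic a b (p e) = p u * p v + 4 * (a ^+ 2 - b ^+ 2) * (p w + 2 * (a ^+ 2 - b ^+ 2))].
Proof.
by move=> /Y_fix[pF pA pB]; exact: (fix_relations_at zetaP pF pA pB).
Qed.

Lemma Ygen x z : z != 0 -> exists p : {rmorphism Zc -> C},
  [/\ Y p, p e = x, p u = quartic a b x / z, p v = z & p w = - 2 * (a ^+ 2 - b ^+ 2)].
Proof.
move=> z0; have [q [qF qA qB qe [qr qR qa]]] := generic_point zetaP a b x z0.
have [p [pk pE]] := pushZ (proj1 qF) qA qB.
exists p; split; [|by rewrite pE|by rewrite pE|by rewrite pE|by rewrite pE].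
apply/muFixcP/(muFixP zetaP); split; first exact: pk.
have [_ [q0 Q0 a10 a30]] := iffLR (muFixP zetaP _) qF.
by split; [exact: etrans (pE _) q0|exact: etrans (pE _) Q0|exact: etrans (pE _) a10|exact: etrans (pE _) a30].
Qed.

(** [pi0] kills products that end in x or y or begin with X or Y, so [cq], [cQ], [cr] and [cR]
    vanish at the point; the relations then force [ca1] and [ca3] to vanish too, and the point is
    fixed. *)
Lemma zchi_fixed n (rho : W -> 'M[C]_n) (i0 : 'I_n) (p : {rmorphism Zc -> C}) :
  (forall g g', rho (mulW g g') = rho g *m rho g') -> rho w1 = 1%:M ->
  (forall M : 'M[C]_n, (forall g, M *m rho g = rho g *m M) -> M = (M i0 i0)%:M) ->
  points k p -> (forall z, p (piZc a b z) = lam sc h T a b rho i0 z) ->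
  [/\ Y p, p u = 0, p v = 0,
      (p e)%:M = - \sum_(i < 4) (if odd i then b else a) *: rho (reflW i) &
      forall c, rho (el 2 false) = c%:M -> p w = - (2 * (a ^+ 2 - b ^+ 2) * c)].
Proof.
move=> rhoM rho1 schur pk pE.
have q0 : pullZ p (cq h) = 0 by apply: etrans (pE _) _; exact: (lam_q zetaP spec PP).
have Q0 : pullZ p (cQ h) = 0 by apply: etrans (pE _) _; exact: (lam_Q zetaP spec PP).
have r0 : pullZ p (cr h) = 0 by apply: etrans (pE _) _; exact: (lam_r zetaP spec PP).
have R0 : pullZ p (cR h) = 0 by apply: etrans (pE _) _; exact: (lam_R zetaP spec PP).
have [a10 a30] := vanishing_odd zetaP spec PP q0 Q0 r0 R0.
split; [|exact: r0|exact: R0| |].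
- apply/muFixcP/(muFixP zetaP); split; [exact: pk|].
  by split; [exact: q0|exact: Q0|exact: a10|exact: a30].
- rewrite pE (euE zetaP); exact: (lam_eu zetaP spec PP a b rhoM schur).
- move=> c rc; rewrite pE (a2E zetaP); exact: (lam_a2 zetaP spec PP a b i0 rc).
Qed.

Definition mainY : set {rmorphism Zc -> C} := Y1 Y a b w.

Lemma linear_point chi : [\/ chi = char1, chi = eps zeta, chi = eps_s | chi = eps_t] ->
  exists2 z, is_zchi zeta a b (linrep chi) z & mainY z.
Proof.
move=> /(linear_values zetaP)[chiM chi1 chi2].
have rhoM := linrepM chiM; have rho1 : linrep chi w1 = 1%:M by rewrite /linrep chi1.
have [p [pz pE]] := zchi_exists zetaP a b rhoM rho1 (linrep_schur (chi:=chi)) (linrep_irr (chi:=chi)).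
have [Yp _ _ _ pw] := zchi_fixed rhoM rho1 (linrep_schur (chi:=chi)) (proj1 pz) pE.
exists p; first exact: pz.
by split; [exact: Yp|rewrite (pw 1) ?mulr1 ?mulNr // /linrep chi2].
Qed.

Lemma reflection_point : exists z, is_zchi zeta a b (wmat zeta) z /\
  [/\ Y z, z e = 0, z u = 0, z v = 0 & z w = 2 * (a ^+ 2 - b ^+ 2)].
Proof.
have [p [pz pE]] := zchi_exists zetaP a b (wmatM zetaP) (wmat1 zeta) (wmat_schur zetaP) (wmat_irr zetaP).
have [Yp pu pv pe pw] := zchi_fixed (wmatM zetaP) (wmat1 zeta) (wmat_schur zetaP) (proj1 pz) pE.
exists p; split; first exact: pz.
split; [exact: Yp| |exact: pu|exact: pv|].
  move: pe; rewrite (wmat_refl_sum zetaP) oppr0 => /matrixP/(_ 0 0).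
  by rewrite !mxE eqxx mulr1n.
by rewrite (pw _ (wmat_rot2 zetaP)) mulrN1 opprK.
Qed.

End FixedLocus.

Section Presents.
Variables (C : numClosedFieldType) (zeta : C).
Hypothesis zetaP : 4.-primitive_root zeta.

Lemma coordsE (p : {rmorphism centre (cherednik zeta) -> C}) (s : 'I_6 -> C) : s = tnth (coords (gens zeta) p) ->
  [/\ ('X_(@Ordinal 6 0 isT) : {mpoly C[6]}).@[s] = p (zA zeta),
      ('X_(@Ordinal 6 1 isT) : {mpoly C[6]}).@[s] = p (zB zeta),
      ('X_(@Ordinal 6 4 isT) : {mpoly C[6]}).@[s] = p (eu zeta) &
    [/\ ('X_(@Ordinal 6 2 isT) : {mpoly C[6]}).@[s] = p (zr zeta),
      ('X_(@Ordinal 6 3 isT) : {mpoly C[6]}).@[s] = p (zR zeta) &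
      ('X_(@Ordinal 6 5 isT) : {mpoly C[6]}).@[s] = p (a2 zeta)]].
Proof. by move=> ->; split; rewrite ?mevalXU ?tnth_map ?(tnth_nth 0) //; split; rewrite mevalXU tnth_map (tnth_nth 0). Qed.

Lemma presents_fixed : presents (gens zeta) (relators C) (muFix zeta 4).
Proof.
split; first exact: generation.
move=> P; pose S : set ('I_6 -> C) := [set s | exists2 p, muFix zeta 4 p & s = tnth (coords (gens zeta) p)].
have : (forall s, S s -> P.@[s] = 0) <-> inI P.
  apply: presentation.
  - move=> s [p pF /coordsE[EA EB Ee [Er ER Ea]]].
    have [R1 R2 R3 R4 R5] := fix_relations_at zetaP pF erefl erefl.
    case=> [|[|[|[|[|//]]]]] _ /=; rewrite !(mevalM, mevalB, mevalD, meval1) EA EB ?Ee ?Er ?ER ?Ea.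
    + exact: R1.
    + exact: R2.
    + exact: R3.
    + exact: R4.
    + by move/eqP: R5; rewrite -subr_eq0 => /eqP.
  - move=> a0 b0 x z z0; have [p [pF pA pB pe [pr pR pa]]] := generic_point zetaP a0 b0 x z0.
    exists (tnth (coords (gens zeta) p)); have [EA EB Ee [Er ER Ea]] := coordsE (erefl (tnth (coords (gens zeta) p))).
    split; [by exists p|exact: etrans EA pA|exact: etrans EB pB|exact: etrans Ee pe|].
    by split; [exact: etrans Er pr|exact: etrans ER pR|exact: etrans Ea pa].
  (* For all values of the parameters, the point required by [Tiso] is that of the reflection
     representation, pulled back from [Zc] to the centre. *)
  - move=> a0 b0 _; have [q [_ [Yq qe qu qv qw]]] := reflection_point zetaP a0 b0.
    have [pF pA pB] := Y_fix Yq.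
    exists (tnth (coords (gens zeta) (pullZ q))); have [EA EB Ee [Er ER Ea]] := coordsE (erefl (tnth (coords (gens zeta) (pullZ q)))).
    split; [by exists (pullZ q)|exact: etrans EA pA|exact: etrans EB pB|exact: etrans Ee qe|].
    by split; [exact: etrans Er qu|exact: etrans ER qv|exact: etrans Ea qw].
move=> H'; split=> [HP|/H' HP p pF]; last by apply: HP; exists p.
by apply/H' => s [p pF ->]; exact: HP.
Qed.

End Presents.

Local Open Scope complex_scope.
Local Open Scope classical_set_scope.

Theorem proposition8p8 (R : realType) (zeta : R[i])
    (zetaP : 4.-primitive_root zeta) :
  (let A : {mpoly R[i][6]} := 'X_(@Ordinal 6 0 isT) in
   let B : {mpoly R[i][6]} := 'X_(@Ordinal 6 1 isT) in
   let r : {mpoly R[i][6]} := 'X_(@Ordinal 6 2 isT) in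
   let R' : {mpoly R[i][6]} := 'X_(@Ordinal 6 3 isT) in
   let e : {mpoly R[i][6]} := 'X_(@Ordinal 6 4 isT) in
   let a : {mpoly R[i][6]} := 'X_(@Ordinal 6 5 isT) in
   let D := A ^+ 2 - B ^+ 2 in
   presents
     [tuple zA zeta; zB zeta; zr zeta; zR zeta; eu zeta; a2 zeta]
     [:: e * (a + 2 * D); r * (a + 2 * D); R' * (a + 2 * D);
         (a - 2 * D) * (a + 2 * D);
         (e - 2 * (A + B)) * (e + 2 * (A + B)) *
         (e - 2 * (A - B)) * (e + 2 * (A - B))
         - (r * R' + 4 * D * (a + 2 * D))]
     (muFix zeta 4))
  /\
  forall a b : R[i],
    let q := @piZc _ zeta a b in
    let k := scalZc zeta a b in
    let Y := muFixc zeta a b 4 in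
    let g := [tuple q (eu zeta); q (zr zeta); q (zR zeta)] in
    (a ^+ 2 = b ^+ 2 ->
       irreducible_set k Y /\
       identified_via g Y
         [set t : 3.-tuple R[i] |
           let e := t`_0 in let u := t`_1 in let v := t`_2 in
           (e - 4 * a) * (e + 4 * a) * e ^+ 2 = u * v])
    /\
    (a ^+ 2 <> b ^+ 2 ->
       exists Y1 Y2,
         [/\ Y1 <> Y2,
             (forall X, irr_component k Y X <-> X = Y1 \/ X = Y2),
             dim_lt k Y2 Y1,
             identified_via g Y1
               [set t : 3.-tuple R[i] |
                 let e := t`_0 in let u := t`_1 in let v := t`_2 in
                 (e - 2 * (a + b)) * (e + 2 * (a + b)) *
                 (e - 2 * (a - b)) * (e + 2 * (a - b)) = u * v] &
             [/\ (forall chi, [\/ chi = char1, chi = eps zeta,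
                                  chi = eps_s | chi = eps_t] ->
                    exists2 z, is_zchi zeta a b (linrep chi) z & Y1 z) &
                 exists z,
                   [/\ is_zchi zeta a b (wmat zeta) z,
                       Y2 = [set z],
                       isolated_in k Y z &
                       maxideal_gen Y z
                         [:: q (zr zeta); q (zR zeta); q (eu zeta);
                             q (a2 zeta) - k (2 * (a ^+ 2 - b ^+ 2))]]]]).
Proof.
split; first exact: presents_fixed.
move=> a b q k Y g; split=> [ab|ab].
  have YY1 := Y_eq_Y1 (Yrel zetaP (b := b)) ab.
  split.
    by rewrite /Y YY1; apply: (Y1_irreducible (YE zetaP a b) (Yfun zetaP (b := b)) (Yrel zetaP (b := b)) (Ygen zetaP a b)).
  have -> : [set t : 3.-tuple R[i] | let e := t`_0 in let u := t`_1 in let v := t`_2 in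
      (e - 4 * a) * (e + 4 * a) * e ^+ 2 = u * v] = [set t : 3.-tuple R[i] | quartic a b t`_0 = t`_1 * t`_2].
    (* The quartic is (x^2 - 4 (a + b)^2)(x^2 - 4 (a - b)^2), which differs from x^2 (x^2 - 16 a^2)
       by multiples of a^2 - b^2. *)
    apply/seteqP; split=> t /=; move: (t`_0) (t`_1 * t`_2) => x y; have -> : quartic a b x = (x - 4 * a) * (x + 4 * a) * x ^+ 2 + 16 * (a ^+ 2 - b ^+ 2) ^+ 2 + 8 * (a ^+ 2 - b ^+ 2) * x ^+ 2 by rewrite /quartic; ring.
      by rewrite ab subrr expr0n /= !mulr0 mul0r !addr0.
    by rewrite ab subrr expr0n /= !mulr0 mul0r !addr0.
  rewrite /Y YY1; apply: (Y1_identified (YE zetaP a b) (Yfun zetaP (b := b)) (Yrel zetaP (b := b)) (Ygen zetaP a b)).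
have D0 : a ^+ 2 - b ^+ 2 != 0 by rewrite subr_eq0; apply/eqP.
have [z [zz [Yz ze zu zv zw]]] := reflection_point zetaP a b.
exists (@mainY _ zeta a b), [set z]; split.
- exact: (Y1_neq zw D0).
- move=> X; exact: (components (YE zetaP a b) (Yfun zetaP (b := b)) (Yrel zetaP (b := b)) (Ygen zetaP a b) Yz ze zu zv zw D0 X).
- exact: (dims (YE zetaP a b) (Yfun zetaP (b := b)) (Yrel zetaP (b := b)) (Ygen zetaP a b) z).
- exact: (Y1_identified (YE zetaP a b) (Yfun zetaP (b := b)) (Yrel zetaP (b := b)) (Ygen zetaP a b)).
- split; first exact: linear_point.
  exists z; split; [exact: zz|reflexivity| |].
    exact: (z_isolated (YE zetaP a b) (Yfun zetaP (b := b)) (Yrel zetaP (b := b)) Yz ze zu zv zw D0).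
  exact: (z_maxideal (YE zetaP a b) (Yfun zetaP (b := b)) Yz ze zu zv zw).
Qed.
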